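(* Let $0\le\beta<1$ and let $K_i$ be a closed cone in $\mathbb R^{d_i}$, $i=1,2$. Every separately continuous bilinear form $w$ on $S^\beta(K_1)\times S^\beta(K_2)$ is uniquely representable as $$w(f,g)=(v,f\otimes g),$$ where $v$ is a continuous linear functional on $S^\beta(K_1,K_2)$.
   Context: Put $p=1/(1-\beta)$. A cone in $\mathbb R^d$ is a nonempty set invariant under multiplication by positive numbers (so a closed cone contains $0$; $\{0\}$ is a closed cone, called degenerate). For cones $V_1,V_2$, the notation $V_1\Subset V_2$ means $\bar V_1\setminus\{0\}\subset V_2$. $|\cdot|$ is a fixed norm on $\mathbb R^d$ and $d(x,U)=\inf_{\xi\in U}|x-\xi|$. For an open cone $U\subset\mathbb R^d$, $B>0$ and $N=0,1,2,\dots$, let $H^{\beta,B}_N(U)$ be the Hilbert space of entire functions on $\mathbb C^d$ with finite norm for the inner product $$\langle f,g\rangle_{U,B,N}=\int_{\mathbb C^d}\overline{f(z)}\,g(z)\prod_{j=1}^d(1+|x_j|)^{2N}\exp\{-2d(Bx,U)^{p}-2|By|^{p}\}\,d\lambda,\qquad z=x+iy,$$ where $d\lambda=dx\,dy$ is Lebesgue measure. For $b>0$, $S^{\beta,b}(U)=\bigcap_{B>b,\,N\ge0}H^{\beta,B}_N(U)$ with the projective limit topology (a Fréchet space), and $S^\beta(U)=\bigcup_{b>0}S^{\beta,b}(U)$ with the locally convex inductive limit topology (independent of the choice of norm). $S^\beta(\{0\})$ is defined by the same formulas with $U=\{0\}$, $d(x,\{0\})=|x|$. For a closed cone $K\ne\{0\}$,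 $S^\beta(K)$ is the union of the spaces $S^\beta(U)$ over all open cones $U$ with $K\Subset U$, with the locally convex inductive limit topology. $S^\beta(K_1,K_2)=\varinjlim_{U_1,U_2}S^\beta(U_1\times U_2)$, where $U_i$ ranges over the open cones in $\mathbb R^{d_i}$ with $K_i\Subset U_i$; all these spaces are subspaces of $S^\beta(\{0\})$ over $\mathbb R^{d_1+d_2}$, and the inductive limit is their linear span with the finest locally convex topology making all the inclusions continuous. (If $K_i=\{0\}$, one obtains the same space with the same topology by also allowing $U_i=\{0\}$, with $S^\beta(U_1\times U_2)$ defined by the same formulas; the family is then directed.) Here $(f\otimes g)(z_1,z_2)=f(z_1)g(z_2)$. *)

(* Defs.v *)
From HB Require Import structures.
From mathcomp Require Import all_boot all_order all_algebra.
From mathcomp Require Import complex.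
From mathcomp Require Import all_classical all_reals all_analysis.

Set Implicit Arguments.
Unset Strict Implicit.
Unset Printing Implicit Defensive.

Import Order.TTheory GRing.Theory Num.Theory.
Import numFieldNormedType.Exports.

Local Open Scope classical_set_scope.
Local Open Scope ring_scope.
Local Open Scope complex_scope.

(* A subset [car] of an ambient type together with a family of subsets of it.
   All function spaces below live in one ambient space of functions, so that
   an inclusion between two of them is the identity map. *)
Record tspace (V : Type) := TSpace { car : set V; opens : set (set V) }.

Definition is_topology (V : Type) (E : set V) (T : set (set V)) : Prop :=
  [/\ T `<=` [set A | A `<=` E],
      T E,
      (forall A B, T A -> T B -> T (A `&` B)) &
      (forall F : set (set V), F `<=` T -> T (\bigcup_(A in F) A))].

Definition generated_topology (V : Type) (E : set V) (S : set (set V)) :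
    set (set V) :=
  [set A | forall T, is_topology E T -> S `<=` T -> T A].

Definition continuous_inclusion (V : Type) (X Y : tspace V) : Prop :=
  car X `<=` car Y /\ forall A, opens Y A -> opens X (A `&` car X).

(* The coarsest topology on [E] making the inclusions into the members of [F]
   continuous. *)
Definition projlim (V : Type) (E : set V) (F : set (tspace V)) : tspace V :=
  TSpace E (generated_topology E
    [set A `&` E | A in \bigcup_(X in F) opens X]).

Section LocallyConvex.
Context {K : numFieldType} {V : lmodType K}.

Definition linspan (A : set V) : set V :=
  [set f | exists n (a : 'I_n -> K) (g : 'I_n -> V),
     (forall i, A (g i)) /\ f = \sum_(i < n) a i *: g i].

Definition is_lc_topology (E : set V) (T : set (set V)) : Prop :=
  [/\ is_topology E T,
      (forall W f g, T W -> E f -> E g -> W (f + g) ->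
        exists A B, [/\ T A, T B, A f, B g &
          forall u v, A u -> B v -> W (u + v)]),
      (forall W (a : K) f, T W -> E f -> W (a *: f) ->
        exists (e : K) A, [/\ 0 < e, T A, A f &
          forall (b : K) u, `|b - a| < e -> A u -> W (b *: u)]) &
      (forall W f, T W -> W f ->
        exists A : set V, [/\ T A, A f, A `<=` W & convex_set A])].

(* The finest locally convex topology on [E] making the inclusions of the
   members of [F] continuous: the supremum of all such topologies, which is
   itself one of them as soon as [E] is a subspace containing these members. *)
Definition indlim (E : set V) (F : set (tspace V)) : tspace V :=
  TSpace E (generated_topology E
    (\bigcup_(T in [set T | is_lc_topology E T /\
       forall X, F X -> continuous_inclusion X (TSpace E T)]) T)).

(* Functionals on a subspace are represented by functions on the ambient
   space; only their values on the subspace matter. *)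
Definition linear_on (E : set V) (v : V -> K) : Prop :=
  forall a f g, E f -> E g -> v (a *: f + g) = a * v f + v g.

Definition continuous_on (X : tspace V) (v : V -> K) : Prop :=
  forall O : set K^o, open O -> opens X (v @^-1` O `&` car X).

End LocallyConvex.

Definition bilinear_on (K : numFieldType) (V1 V2 : lmodType K)
    (E1 : set V1) (E2 : set V2) (w : V1 -> V2 -> K) : Prop :=
  (forall f, E1 f -> linear_on E2 (w f)) /\
  (forall g, E2 g -> linear_on E1 (w ^~ g)).

Definition separately_continuous (K : numFieldType) (V1 V2 : lmodType K)
    (X1 : tspace V1) (X2 : tspace V2) (w : V1 -> V2 -> K) : Prop :=
  (forall f, car X1 f -> continuous_on X2 (w f)) /\
  (forall g, car X2 g -> continuous_on X1 (w ^~ g)).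

Section LebesgueMeasure.
Context {R : realType}.
Local Notation mR := (measurableTypeR R).

Definition tuple_cons (n : nat) (u : mR * n.-tuple mR) : n.+1.-tuple mR :=
  [tuple of u.1 :: u.2].

Lemma measurable_tuple_cons n : measurable_fun setT (@tuple_cons n).
Proof. by apply: measurable_cons; [exact: measurable_fst|exact: measurable_snd]. Qed.


Section step.
Context {n : nat} (m : {sigma_finite_measure set (n.-tuple mR) -> \bar R}).

Definition lebesgue_cons : set (n.+1.-tuple mR) -> \bar R :=
  pushforward (lebesgue_measure \x m)%E (@tuple_cons n).

Let mpush : {measure set (n.+1.-tuple mR) -> \bar R} :=
  measure_function_pushforward__canonical__measure_function_Measure
    (product_measure1 lebesgue_measure m) (@measurable_tuple_cons n).

Let cons0 : lebesgue_cons set0 = 0%E.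
Proof. exact: (measure0 mpush). Qed.

Let cons_ge0 A : (0 <= lebesgue_cons A)%E.
Proof. exact: (measure_ge0 mpush). Qed.

Let cons_semi_sigma_additive : semi_sigma_additive lebesgue_cons.
Proof. exact: (@measure_semi_sigma_additive _ _ _ mpush). Qed.

HB.instance Definition _ := isMeasure.Build _ _ _ lebesgue_cons
  cons0 cons_ge0 cons_semi_sigma_additive.

Let cons_sigma_finite : sigma_finite setT lebesgue_cons.
Proof.
have /sigma_finiteP[F [FT ndF Ffin]] := sigma_finiteT (@lebesgue_measure R).
have /sigma_finiteP[G [GT ndG Gfin]] := sigma_finiteT m.
pose uncons (t : n.+1.-tuple mR) : (mR * n.-tuple mR)%type :=
  (thead t, [tuple of behead t]).
have unconsK : cancel uncons (@tuple_cons n).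
  by move=> t; rewrite /tuple_cons /=; apply/esym/tuple_eta.
have consK : cancel (@tuple_cons n) uncons.
  by case=> x t; rewrite /uncons /tuple_cons theadE; congr pair; exact/val_inj.
have muncons : measurable_fun setT uncons.
  by apply: measurable_fun_pair; [exact: measurable_tnth|exact: measurable_behead].
exists (fun i => uncons @^-1` (F i `*` G i)).
  apply/seteqP; split=> // t _.
  have [i _ Fi] : (\bigcup_i F i) (uncons t).1 by rewrite -FT.
  have [j _ Gj] : (\bigcup_i G i) (uncons t).2 by rewrite -GT.
  exists (maxn i j) => //; split.
    by move: Fi; exact/subsetPset/ndF/leq_maxl.
  by move: Gj; exact/subsetPset/ndG/leq_maxr.
move=> i; have [mF Fi] := Ffin i; have [mG Gi] := Gfin i; split.
  by rewrite -[X in measurable X]setTI; apply: muncons => //; exact: measurableX.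
rewrite /lebesgue_cons /pushforward.
rewrite (_ : @tuple_cons n @^-1` _ = F i `*` G i); last first.
  by apply/funext => u; rewrite -{2}[u]consK.
by rewrite product_measure1E// lte_mul_pinfty// ge0_fin_numE.
Qed.

HB.instance Definition _ :=
  Measure_isSigmaFinite.Build _ _ _ lebesgue_cons cons_sigma_finite.

End step.

(* Lebesgue measure on R^n, points being encoded as tuples, obtained by
   iterating the product with the Lebesgue measure of the line. *)
Fixpoint lebesgue_tuple (n : nat) :
    {sigma_finite_measure set (n.-tuple mR) -> \bar R} :=
  match n with
  | 0 => dirac ([tuple] : 0.-tuple mR)
  | n.+1 => lebesgue_cons (lebesgue_tuple n)
  end.

End LebesgueMeasure.

(* The ambient space: all functions from C^d to C, with pointwise operations. *)
Notation cfun R d := ('rV[R[i]]_d -> R[i]^o).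

Section Spaces.
Context {R : realType}.
Local Notation C := R[i].

(* In what follows beta is the index of the space and [N] is the norm fixed on
   the real space; it need not be the library's (sup) norm of row vectors. *)
Definition is_norm (d : nat) (N : 'rV[R]_d -> R) : Prop :=
  [/\ forall x y, N (x + y) <= N x + N y,
      forall (a : R) x, N (a *: x) = `|a| * N x &
      forall x, N x = 0 -> x = 0].

Definition dist_set (d : nat) (N : 'rV[R]_d -> R) (x : 'rV[R]_d)
    (U : set 'rV[R]_d) : R :=
  inf [set N (x - xi) | xi in U].

Definition cone (d : nat) (U : set 'rV[R]_d) : Prop :=
  U !=set0 /\ forall (t : R) x, 0 < t -> U x -> U (t *: x).

Definition open_cone (d : nat) (U : set 'rV[R]_d) : Prop := cone U /\ open U.

Definition closed_cone (d : nat) (U : set 'rV[R]_d) : Prop :=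
  cone U /\ closed U.

(* V1 is compactly included in V2, in the sense of cones. *)
Definition cone_compact_in (d : nat) (V1 V2 : set 'rV[R]_d) : Prop :=
  closure V1 `\` [set 0] `<=` V2.

Definition cone_prod (d1 d2 : nat) (U1 : set 'rV[R]_d1) (U2 : set 'rV[R]_d2) :
    set 'rV[R]_(d1 + d2) :=
  [set x | U1 (lsubmx x) /\ U2 (rsubmx x)].

(* Frechet differentiability over the field C, that is, holomorphy on C^d. *)
Definition entire (d : nat) (f : cfun R d) : Prop :=
  forall z, differentiable f z.

Definition real_point (d : nat) (t : d.-tuple (measurableTypeR R)) : 'rV[R]_d :=
  \row_j (tnth t j : R).

Definition complex_point (d : nat) (x y : 'rV[R]_d) : 'rV[C]_d :=
  \row_j (x 0 j +i* y 0 j).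

Definition weight (beta : R) (d : nat) (N : 'rV[R]_d -> R) (U : set 'rV[R]_d)
    (B : R) (n : nat) (x y : 'rV[R]_d) : R :=
  let p := (1 - beta)^-1 in
  (\prod_(j < d) (1 + `|x 0 j|) ^+ (2 * n)) *
  expR (- 2 * dist_set N (B *: x) U `^ p - 2 * N (B *: y) `^ p).

(* The inner product <f, f>_{U,B,n}, equal to +oo when the integral diverges.
   The pair t = (t.1, t.2) of tuples encodes the point x + iy. *)
Definition Hsqnorm (beta : R) (d : nat) (N : 'rV[R]_d -> R)
    (U : set 'rV[R]_d) (B : R) (n : nat) (f : cfun R d) : \bar R :=
  (\int[lebesgue_tuple d \x lebesgue_tuple d]_t
     (let x := real_point t.1 in let y := real_point t.2 in
      ((Normc.normc (f (complex_point x y))) ^+ 2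
         * weight beta N U B n x y)%:E))%E.

Definition Hnorm (beta : R) (d : nat) (N : 'rV[R]_d -> R)
    (U : set 'rV[R]_d) (B : R) (n : nat) (f : cfun R d) : R :=
  Num.sqrt (fine (Hsqnorm beta N U B n f)).

Definition Hspace (beta : R) (d : nat) (N : 'rV[R]_d -> R) (U : set 'rV[R]_d)
    (B : R) (n : nat) : tspace (cfun R d) :=
  let E := [set f : cfun R d |
    entire f /\ (Hsqnorm beta N U B n f < +oo)%E] in
  TSpace E [set A | A `<=` E /\ forall f, A f -> exists2 e : R, 0 < e &
    forall g, E g -> Hnorm beta N U B n (g - f) < e -> A g].

Definition Sopen_type (beta : R) (d : nat) (N : 'rV[R]_d -> R) (U : set 'rV[R]_d)
    (b : R) : tspace (cfun R d) :=
  let F := [set X | exists (B : R) (n : nat), b < B /\ X = Hspace beta N U B n] in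
  projlim (\bigcap_(X in F) car X) F.

(* Meant for U an open cone or the degenerate cone {0}. *)
Definition Sopen (beta : R) (d : nat) (N : 'rV[R]_d -> R) (U : set 'rV[R]_d) :
    tspace (cfun R d) :=
  let F := [set Sopen_type beta N U b | b in [set b : R | 0 < b]] in
  indlim (\bigcup_(X in F) car X) F.

Definition Scone (beta : R) (d : nat) (N : 'rV[R]_d -> R) (K : set 'rV[R]_d) :
    tspace (cfun R d) :=
  let F := [set Sopen beta N U |
    U in [set U | open_cone U /\ cone_compact_in K U]] in
  if pselect (K = [set 0]) then Sopen beta N [set 0]
  else indlim (\bigcup_(X in F) car X) F.

Definition Sconepair (beta : R) (d1 d2 : nat) (N : 'rV[R]_(d1 + d2) -> R)
    (K1 : set 'rV[R]_d1) (K2 : set 'rV[R]_d2) : tspace (cfun R (d1 + d2)) :=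
  let F := [set X | exists (U1 : set 'rV[R]_d1) (U2 : set 'rV[R]_d2),
    [/\ open_cone U1, cone_compact_in K1 U1, open_cone U2,
        cone_compact_in K2 U2 & X = Sopen beta N (cone_prod U1 U2)]] in
  indlim (linspan (\bigcup_(X in F) car X)) F.

Definition tensor (d1 d2 : nat) (f : cfun R d1) (g : cfun R d2) : cfun R (d1 + d2) :=
  fun z => f (lsubmx z) * g (rsubmx z).

End Spaces.

(* Main.v *)
From HB Require Import structures.
Require Import Defs.
From mathcomp Require Import all_boot all_order all_algebra.
From mathcomp Require Import complex.
From mathcomp Require Import all_classical all_reals all_analysis.
From mathcomp Require Import measurable_realfun gauss_integral ring lra.

(** The theorem is a kernel theorem for spaces defined by Hilbert norms whose
connecting maps are Hilbert-Schmidt.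

Fix cones [U1], [U2] and a scale [b]. The Hilbert norm of an entire function controls
its pointwise values (a sub-mean-value estimate, [point_bound] and [H_point]), and the
loss of a little scale and of one power of the polynomial weights leaves room for an
integrable factor. Three consequences follow. The spaces of scale [b] are complete
([Sb_complete]), so that a separately continuous form is bounded by a product of two
norms ([banach_steinhaus]). Evaluating the point estimate on an orthonormal sequence
bounds its diagonal, so a weaker norm is Hilbert-Schmidt for a stronger one; choosing
each vector greedily gives an orthonormal sequence [e k] along which orthogonal
expansions converge in the weaker norm ([good_system]). Finally, if [lam (e k) h] is the
coefficient of the slices [h (z1, .)] along [e k], then
[v h = \sum_k w (lam (e k) h, e k)] converges absolutely, is bounded and extends [w]
([local_functional]); and since [h] is the limit of the finite sums of the tensors
[lam (e k) h (x) e k], a bounded functional is determined by its values on tensors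
([local_uniqueness]). Each comparison of the weight of a product with the product of the
weights costs a factor [kap] in the scale ([wt_product]), which is harmless in the
inductive limit.

Uniqueness makes the functionals attached to different pairs of cones and scales agree,
so they glue to a linear form on the span of all the spaces ([glued]). A linear form on
a locally convex inductive limit is continuous as soon as its restrictions are
([continuous_indlim]), because the topology it induces is locally convex. In the other
direction, continuity of [w] on the inductive limits restricts to the steps
([Scone_bounded]).

One point remains. When a cone [K_i] degenerates to {0}, the space of the cone is given
by [U = {0}], whereas the space of the pair is spanned by functions living on products
of open cones. So a function of the degenerate space must be a finite sum of functions
living on open cones, here orthants ([splits_norm]). The variables are treated one at a
time. A function of the degenerate space grows like [exp (A |z| ^ p)]; it is expanded in
powers of the chosen variable, and each power is split as
[z ^ n = z ^ n chi_n(z) + z ^ n (1 - chi_n(z))], where [chi_n] is a smoothed indicator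
function of a half-plane, the integral over a half-line of a kernel that decays faster
than any power on the real axis, is nonnegative there, and has a growth in the imaginary
direction adapted to [n] ([monomial_split]). The estimates of the Taylor coefficients make both series
converge, one to a function decaying as [Re z] tends to +oo, the other as it tends to
-oo ([dclass_split]).

The complex analysis needed for this is developed from Goursat's theorem: Cauchy's
formula is written in the coordinate [log z], where circles become vertical segments,
and used through Taylor expansions with explicit remainders ([taylor]). *)

Set Implicit Arguments.
Unset Strict Implicit.
Unset Printing Implicit Defensive.

Import Order.TTheory GRing.Theory Num.Theory.
Import numFieldNormedType.Exports.

Local Open Scope classical_set_scope.
Local Open Scope ring_scope.
Local Open Scope complex_scope.

Notation nc := Normc.normc.
Notation Re := complex.Re.
Notation Im := complex.Im.
Arguments Normc.normc : simpl never.

(** * Complex numbers and complex-valued integrals *)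

Section Modulus.
Context {R : realType}.
Implicit Types z w : R[i].

Lemma ncE z : `|z| = (nc z)%:C.
Proof. by []. Qed.

Lemma nc_ge0 z : 0 <= nc z.
Proof. by case: z => a b; exact: sqrtr_ge0. Qed.

Lemma ncD z w : nc (z + w) <= nc z + nc w.
Proof. exact: le_normcD. Qed.

Lemma ncM z w : nc (z * w) = nc z * nc w.
Proof. exact: Normc.normcM. Qed.

Lemma ncN z : nc (- z) = nc z.
Proof. exact: normcN. Qed.

Lemma ncB z w : nc (z - w) <= nc z + nc w.
Proof. by rewrite -(ncN w) ncD. Qed.

Lemma nc_distC z w : nc (z - w) = nc (w - z).
Proof. by rewrite -ncN opprB. Qed.

Lemma nc0 : nc (0 : R[i]) = 0.
Proof. exact: Normc.normc0. Qed.

Lemma nc1 : nc (1 : R[i]) = 1.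
Proof. exact: Normc.normc1. Qed.

Lemma nc_eq0 z : (nc z == 0) = (z == 0).
Proof. by apply/eqP/eqP => [/Normc.eq0_normc //|->]; exact: nc0. Qed.

Lemma nc_gt0 z : (0 < nc z) = (z != 0).
Proof. by rewrite lt0r nc_eq0 nc_ge0 andbT. Qed.

Lemma ncV z : nc z^-1 = (nc z)^-1.
Proof. exact: Normc.normcV. Qed.

Lemma ncX z n : nc (z ^+ n) = nc z ^+ n.
Proof. by elim: n => [|n ih]; rewrite ?expr0 ?nc1// !exprS ncM ih. Qed.

Lemma ncR (x : R) : nc x%:C = `|x|.
Proof. by rewrite /nc /= expr0n /= addr0 sqrtr_sqr. Qed.

Lemma nci : nc ('i : R[i]) = 1.
Proof. by rewrite /nc /= expr0n expr1n add0r sqrtr1. Qed.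

Lemma Re_le_nc z : `|Re z| <= nc z.
Proof. by rewrite -lecR; exact: normc_ge_Re. Qed.

Lemma nc_sqr z : nc z ^+ 2 = Re z ^+ 2 + Im z ^+ 2.
Proof. by case: z => a b; rewrite /nc /= sqr_sqrtr// addr_ge0 ?sqr_ge0. Qed.

Lemma Im_le_nc z : `|Im z| <= nc z.
Proof.
by rewrite -(@ler_pXn2r _ 2) ?nnegrE ?nc_ge0// nc_sqr real_normK ?num_real// lerDr sqr_ge0.
Qed.

Lemma nc_le_ReIm z : nc z <= `|Re z| + `|Im z|.
Proof.
rewrite -(@ler_pXn2r _ 2) ?nnegrE ?nc_ge0 ?addr_ge0//.
rewrite nc_sqr sqrrD !real_normK ?num_real// lerD2r lerDl.
by rewrite mulrn_wge0 // mulr_ge0.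
Qed.

Lemma ncJ z : nc z^* = nc z.
Proof. by case: z => a b; rewrite /nc /= sqrrN. Qed.

Lemma mulJ_nc z : z^* * z = (nc z ^+ 2)%:C.
Proof.
case: z => a b; rewrite nc_sqr /=; apply/eqP.
by rewrite eq_complex /=; apply/andP; split; apply/eqP; ring.
Qed.

Lemma nc_sum (I : Type) (r : seq I) (P : pred I) (F : I -> R[i]) :
  nc (\sum_(i <- r | P i) F i) <= \sum_(i <- r | P i) nc (F i).
Proof.
elim/big_rec2 : _ => [|i y1 y2 _ h]; first by rewrite nc0.
by apply: (le_trans (ncD _ _)); rewrite lerD2l.
Qed.

Lemma nc_le_dist z w : nc z <= nc w + nc (z - w).
Proof. by have := ncD w (z - w); rewrite addrC subrK. Qed.

Lemma ReD z w : Re (z + w) = Re z + Re w.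
Proof. by case: z; case: w. Qed.
Lemma ImD z w : Im (z + w) = Im z + Im w.
Proof. by case: z; case: w. Qed.
Lemma ReN z : Re (- z) = - Re z. Proof. by case: z. Qed.
Lemma ImN z : Im (- z) = - Im z. Proof. by case: z. Qed.
Lemma ReM z w : Re (z * w) = Re z * Re w - Im z * Im w.
Proof. by case: z; case: w. Qed.
Lemma ImM z w : Im (z * w) = Re z * Im w + Im z * Re w.
Proof. by case: z => a b; case: w => c d /=. Qed.
Lemma complexP z w : Re z = Re w -> Im z = Im w -> z = w.
Proof. by case: z => a b; case: w => c d /= -> ->. Qed.

End Modulus.

Definition ReIm := (@ReD, @ImD, @ReN, @ImN, @ReM, @ImM).

Section ComplexIntegral.
Context d (T : measurableType d) {R : realType}.
Variable mu : {measure set T -> \bar R}.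
Implicit Types (D : set T) (f g : T -> R[i]).

Definition cmeas D f := measurable_fun D (fun t => Re (f t)) /\
  measurable_fun D (fun t => Im (f t)).

Definition cint D f : R[i] :=
  (\int[mu]_(t in D) Re (f t)) +i* (\int[mu]_(t in D) Im (f t)).

Definition cintegrable D f := mu.-integrable D (fun t => (Re (f t))%:E) /\
  mu.-integrable D (fun t => (Im (f t))%:E).

Lemma cmeasM D f g : cmeas D f -> cmeas D g -> cmeas D (fun t => f t * g t).
Proof.
move=> [f1 f2] [g1 g2]; split.
- by under eq_fun do rewrite ReM; apply: measurable_funB; exact: measurable_funM.
- by under eq_fun do rewrite ImM; apply: measurable_funD; exact: measurable_funM.
Qed.

Lemma cmeasJ D f : cmeas D f -> cmeas D (fun t => (f t)^*).
Proof.
move=> [f1 f2]; split.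
- rewrite (_ : (fun t => _) = (fun t => Re (f t)))//; apply/funext => t.
  by case: (f t).
- rewrite (_ : (fun t => _) = (fun t => - Im (f t))); last first.
    by apply/funext => t; case: (f t).
  exact: measurableT_comp.
Qed.

Lemma cmeas_real D (u : T -> R) : measurable_fun D u -> cmeas D (fun t => (u t)%:C).
Proof. by move=> mu'; split => //=; exact: measurable_cst. Qed.

Lemma measurable_nc_sqr D f : cmeas D f -> measurable_fun D (fun t => nc (f t) ^+ 2).
Proof.
move=> [f1 f2]; under eq_fun do rewrite nc_sqr.
by apply: measurable_funD; apply: measurable_funX.
Qed.

Lemma cintegrable_le D f (M : T -> R) : measurable D -> cmeas D f ->
  mu.-integrable D (EFin \o M) -> (forall t, D t -> nc (f t) <= M t) ->
  cintegrable D f.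
Proof.
move=> mD [f1 f2] iM fM; split.
- apply: (le_integrable mD _ _ iM); first exact/measurable_EFinP.
  move=> t Dt /=; rewrite lee_fin (le_trans (Re_le_nc _))// (le_trans (fM _ Dt))//.
  exact: ler_norm.
- apply: (le_integrable mD _ _ iM); first exact/measurable_EFinP.
  move=> t Dt /=; rewrite lee_fin (le_trans (Im_le_nc _))// (le_trans (fM _ Dt))//.
  exact: ler_norm.
Qed.

Lemma cintegrable_meas D f : cintegrable D f -> cmeas D f.
Proof. by move=> [/measurable_int/measurable_EFinP ? /measurable_int/measurable_EFinP ?]. Qed.

Lemma eq_cint D f g : (forall t, D t -> f t = g t) -> cint D f = cint D g.
Proof.
move=> fg; rewrite /cint; congr (_ +i* _);
  by apply: eq_Rintegral => t /set_mem Dt; rewrite fg.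
Qed.

Lemma cintD D f g : measurable D -> cintegrable D f -> cintegrable D g ->
  cint D (fun t => f t + g t) = cint D f + cint D g.
Proof.
move=> mD [f1 f2] [g1 g2]; rewrite /cint.
under [X in X +i* _]eq_Rintegral do rewrite ReD.
under [X in _ +i* X = _]eq_Rintegral do rewrite ImD.
by rewrite !RintegralD.
Qed.

Lemma cintegrableD D f g : measurable D -> cintegrable D f -> cintegrable D g ->
  cintegrable D (fun t => f t + g t).
Proof.
move=> mD [f1 f2] [g1 g2]; split.
- under eq_fun do rewrite ReD EFinD; exact: (integrableD mD f1 g1).
- under eq_fun do rewrite ImD EFinD; exact: (integrableD mD f2 g2).
Qed.

Lemma cintegrableZ D (c : R[i]) f : measurable D -> cintegrable D f ->
  cintegrable D (fun t => c * f t).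
Proof.
move=> mD [f1 f2]; case: c => a b.
have Z (u : T -> R) (r : R) : mu.-integrable D (fun t => (u t)%:E) ->
   mu.-integrable D (fun t => (r * u t)%:E).
  by move=> iu; under eq_fun do rewrite EFinM; exact: integrableZl.
split.
- rewrite (_ : (fun t => _) = (fun t => (a * Re (f t))%:E) \- (fun t => (b * Im (f t))%:E))%E.
    by apply: integrableB => //; exact: Z.
  by apply/funext => t /=; rewrite ReM /= EFinB.
- rewrite (_ : (fun t => _) = (fun t => (a * Im (f t))%:E) \+ (fun t => (b * Re (f t))%:E))%E.
    by apply: integrableD => //; exact: Z.
  by apply/funext => t /=; rewrite ImM /= EFinD.
Qed.

Lemma cintZ D (c : R[i]) f : measurable D -> cintegrable D f ->
  cint D (fun t => c * f t) = c * cint D f.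
Proof.
move=> mD [f1 f2]; case: c => a b; rewrite /cint /=.
have Z (u : T -> R) (r : R) : mu.-integrable D (fun t => (u t)%:E) ->
   mu.-integrable D (fun t => (r * u t)%:E).
  by move=> iu; under eq_fun do rewrite EFinM; exact: integrableZl.
under [X in X +i* _]eq_Rintegral do rewrite ReM /=.
under [X in _ +i* X = _]eq_Rintegral do rewrite ImM /=.
rewrite RintegralB//; [|exact: Z|exact: Z].
rewrite RintegralD//; [|exact: Z|exact: Z].
by rewrite !RintegralZl.
Qed.

Lemma cintegrableN D f : measurable D -> cintegrable D f ->
  cintegrable D (fun t => - f t).
Proof.
by move=> mD intf; under eq_fun do rewrite -mulN1r; exact: cintegrableZ.
Qed.

Lemma cintN D f : measurable D -> cintegrable D f ->
  cint D (fun t => - f t) = - cint D f.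
Proof.
move=> mD intf; rewrite -mulN1r -cintZ//.
by congr cint; apply/funext => t; rewrite mulN1r.
Qed.

Lemma cintegrableB D f g : measurable D -> cintegrable D f -> cintegrable D g ->
  cintegrable D (fun t => f t - g t).
Proof. by move=> mD intf intg; apply: cintegrableD => //; exact: cintegrableN. Qed.

Lemma cintB D f g : measurable D -> cintegrable D f -> cintegrable D g ->
  cint D (fun t => f t - g t) = cint D f - cint D g.
Proof. by move=> mD intf intg; rewrite cintD ?cintN//; exact: cintegrableN. Qed.

Lemma cint0 D : cint D (fun=> 0) = 0.
Proof.
rewrite /cint /=; have -> : \int[mu]_(t in D) (0 : R) = 0; last by [].
by rewrite /Rintegral integral0.
Qed.

Lemma cintegrable0 D : cintegrable D (fun=> 0).
Proof. by split; exact: integrable0. Qed.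

Lemma cintegrable_sum D n (F : nat -> T -> R[i]) : measurable D ->
  (forall k, cintegrable D (F k)) -> cintegrable D (fun t => \sum_(k < n) F k t).
Proof.
move=> mD iF; elim: n => [|n ih].
  by under eq_fun do rewrite big_ord0; exact: cintegrable0.
by under eq_fun do rewrite big_ord_recr /=; exact: cintegrableD.
Qed.

Lemma cint_sum D n (F : nat -> T -> R[i]) : measurable D ->
  (forall k, cintegrable D (F k)) ->
  cint D (fun t => \sum_(k < n) F k t) = \sum_(k < n) cint D (F k).
Proof.
move=> mD iF; elim: n => [|n ih].
  by rewrite big_ord0; under eq_cint do rewrite big_ord0; rewrite cint0.
rewrite big_ord_recr /= -ih -cintD//; last exact: cintegrable_sum.
by congr cint; apply/funext => t; rewrite big_ord_recr.
Qed.

(** The factor 2 comes from estimating the real and the imaginary part separately. *)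
Lemma cint_le D f (M : T -> R) : measurable D -> cintegrable D f ->
  mu.-integrable D (EFin \o M) -> (forall t, D t -> nc (f t) <= M t) ->
  nc (cint D f) <= 2 * \int[mu]_(t in D) M t.
Proof.
move=> mD [f1 f2] iM fM; rewrite mulr_natl mulr2n.
apply: (le_trans (nc_le_ReIm _)); rewrite /cint /=; apply: lerD.
- apply: (le_trans (le_normr_Rintegral _ _)) => //.
  apply: le_Rintegral => //; first exact: integrable_norm.
  by move=> t Dt; rewrite (le_trans (Re_le_nc _))// fM.
- apply: (le_trans (le_normr_Rintegral _ _)) => //.
  apply: le_Rintegral => //; first exact: integrable_norm.
  by move=> t Dt; rewrite (le_trans (Im_le_nc _))// fM.
Qed.

End ComplexIntegral.

(** * Goursat's theorem on rectangles *)

Section SegmentIntegral.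
Context {R : realType}.
Notation C := R[i].
Notation leb := (@lebesgue_measure R).

Definition ccat (u : R -> C) (x : R) :=
  {for x, continuous (fun t => Re (u t) : R)} /\ {for x, continuous (fun t => Im (u t) : R)}.

Definition cI (a b : R) (u : R -> C) : C := cint leb `[a, b] u.

Lemma ccatP (u : R -> C) x :
  (forall e, 0 < e -> exists2 r, 0 < r & forall t, `|t - x| <= r -> nc (u t - u x) <= e) ->
  ccat u x.
Proof.
move=> h; split; apply/cvgrPdist_le => e e0; have [r r0 hr] := h _ e0.
- near=> t; apply: (le_trans _ (hr t _)).
    by rewrite distrC -ReN -ReD; exact: Re_le_nc.
  by near: t; apply/nbhs_ballP; exists r => //= y /ltW; rewrite distrC.
- near=> t; apply: (le_trans _ (hr t _)).
    by rewrite distrC -ImN -ImD; exact: Im_le_nc.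
  by near: t; apply/nbhs_ballP; exists r => //= y /ltW; rewrite distrC.
Unshelve. all: by end_near. Qed.

Lemma cI_integrable (a b : R) u : (forall x, a <= x <= b -> ccat u x) ->
  cintegrable leb `[a, b] u.
Proof.
move=> h; split; apply: continuous_compact_integrable; try exact: segment_compact.
- apply: continuous_in_subspaceT => x /set_mem /=; rewrite in_itv /= => /h[]; exact.
- apply: continuous_in_subspaceT => x /set_mem /=; rewrite in_itv /= => /h[_]; exact.
Qed.

Lemma cI_split (a b c : R) u : a <= b -> b <= c ->
  cintegrable leb `[a, c] u -> cI a c u = cI a b u + cI b c u.
Proof.
move=> ab bc [u1 u2].
have S (v : R -> R) : leb.-integrable `[a, c] (EFin \o v) ->
    \int[leb]_(t in `[a, c]) v t = \int[leb]_(t in `[a, b]) v t + \int[leb]_(t in `[b, c]) v t.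
  move=> iv; apply/eqP; rewrite addrC -subr_eq; apply/eqP.
  rewrite (@Rintegral_itvB _ v (BLeft a) (BRight c) b iv) ?bnd_simp//.
  rewrite Rintegral_itv_obnd_cbnd//; apply: integrableS iv => //.
  by apply: subset_itvr; rewrite bnd_simp.
by rewrite /cI /cint (S _ u1) (S _ u2).
Qed.

Lemma Rint_cst (a b M : R) : a <= b -> \int[leb]_(t in `[a, b]) M = M * (b - a).
Proof.
move=> ab; rewrite Rintegral_cst//; congr (_ * _).
transitivity (fine (lebesgue_measure ([set` `[a, b]] : set R))); first by [].
rewrite lebesgue_measure_itv /= lte_fin.
case: ltP => // ba; rewrite (_ : b = a) ?subrr//.
by apply/eqP; rewrite eq_le ab ba.
Qed.

Lemma cI_cst (a b : R) (c : C) : a <= b -> cI a b (fun=> c) = (b - a)%:C * c.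
Proof.
move=> ab; rewrite /cI /cint !Rint_cst//.
by case: c => x y; apply: complexP; rewrite ReIm/=; ring.
Qed.

Lemma cst_integrable (a b M : R) : leb.-integrable `[a, b] (EFin \o fun=> M).
Proof.
by apply: continuous_compact_integrable;
  [exact: segment_compact|exact: continuous_subspaceT (@cst_continuous _ _ M)].
Qed.

Lemma cI_le (a b M : R) u : a <= b -> cintegrable leb `[a, b] u ->
  (forall x, a <= x <= b -> nc (u x) <= M) -> nc (cI a b u) <= 2 * M * (b - a).
Proof.
move=> ab iu h; rewrite /cI -mulrA.
have -> : M * (b - a) = \int[leb]_(t in `[a, b]) M.
  by rewrite Rint_cst.
by apply: cint_le => //; exact: cst_integrable.
Qed.

End SegmentIntegral.

Section Goursat.
Context {R : realType}.
Notation C := R[i].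
Notation leb := (@lebesgue_measure R).
Implicit Types g : C -> C.

Definition ccont g (w : C) := forall e, 0 < e ->
  exists2 r, 0 < r & forall h, nc h <= r -> nc (g (w + h) - g w) <= e.

(** Complex differentiability, with real moduli as in all the estimates; [cdiffP]
relates it to the Frechet derivative. *)
Definition cdiff g (w : C) := exists a : C, forall e, 0 < e ->
  exists2 r, 0 < r & forall h, nc h <= r -> nc (g (w + h) - g w - a * h) <= e * nc h.

Lemma cdiff_ccont g w : cdiff g w -> ccont g w.
Proof.
move=> [a ha] e e0; have [r r0 hr] := ha 1 ltr01.
have d0 : 0 < nc a + 1 by rewrite ltr_pwDr// nc_ge0.
exists (Num.min r (e / (nc a + 1))).
  by rewrite lt_min r0 divr_gt0.
move=> h; rewrite le_min => /andP[hr' he].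
rewrite -(subrK (a * h) (g (w + h) - g w)); apply: (le_trans (ncD _ _)).
rewrite ncM; apply: (le_trans (lerD (hr _ hr') (lexx _))).
by rewrite -mulrDl addrC mulrC -ler_pdivlMr.
Qed.

Definition rect (a b c d : R) g := cI a b (fun x => g (x +i* c) - g (x +i* d)) +
  'i * cI c d (fun y => g (b +i* y) - g (a +i* y)).

Definition cont_on (a b c d : R) g :=
  forall x y, a <= x <= b -> c <= y <= d -> ccont g (x +i* y).

Lemma ccat_h g x y : ccont g (x +i* y) -> ccat (fun t => g (t +i* y)) x.
Proof.
move=> h; apply: ccatP => e /h[r r0 hr]; exists r => // t tr.
have := hr ((t - x)%:C); rewrite ncR => /(_ tr).
suff -> : (x +i* y) + (t - x)%:C = t +i* y by [].
by apply: complexP; rewrite ReIm /=; ring.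
Qed.

Lemma ccat_v g x y : ccont g (x +i* y) -> ccat (fun t => g (x +i* t)) y.
Proof.
move=> h; apply: ccatP => e /h[r r0 hr]; exists r => // t tr.
have := hr ('i * (t - y)%:C); rewrite ncM nci mul1r ncR => /(_ tr).
suff -> : (x +i* y) + 'i * (t - y)%:C = x +i* t by [].
by apply: complexP; rewrite !ReIm /=; ring.
Qed.

Lemma integ_h a b c d g y : cont_on a b c d g -> c <= y <= d ->
  cintegrable leb `[a, b] (fun x => g (x +i* y)).
Proof. by move=> h yd; apply: cI_integrable => x xab; apply: ccat_h; exact: h. Qed.

Lemma integ_v a b c d g x : cont_on a b c d g -> a <= x <= b ->
  cintegrable leb `[c, d] (fun y => g (x +i* y)).
Proof. by move=> h xd; apply: cI_integrable => y yab; apply: ccat_v; exact: h. Qed.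

Lemma cont_onW a b c d a' b' c' d' g : a <= a' -> b' <= b -> c <= c' -> d' <= d ->
  cont_on a b c d g -> cont_on a' b' c' d' g.
Proof.
move=> aa bb cc dd h x y /andP[x1 x2] /andP[y1 y2]; apply: h.
- by rewrite (le_trans aa x1) (le_trans x2 bb).
- by rewrite (le_trans cc y1) (le_trans y2 dd).
Qed.

Lemma rect_split_h a m b c d g : a <= m -> m <= b -> c <= d -> cont_on a b c d g ->
  rect a b c d g = rect a m c d g + rect m b c d g.
Proof.
move=> am mb cd h; rewrite /rect.
have ab := le_trans am mb.
rewrite (cI_split am mb); last first.
  by apply: cintegrableB => //; apply: (integ_h h); rewrite ?lexx ?cd.
rewrite addrACA; congr (_ + _); rewrite -mulrDr; congr (_ * _).
rewrite -cintD//; first by congr cint; apply/funext => y; ring.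
all: by apply: cintegrableB => //; apply: (integ_v h); rewrite ?lexx ?am ?mb ?ab.
Qed.

Lemma rect_split_v a b c m d g : a <= b -> c <= m -> m <= d -> cont_on a b c d g ->
  rect a b c d g = rect a b c m g + rect a b m d g.
Proof.
move=> ab cm md h; rewrite /rect.
have cd := le_trans cm md.
rewrite (cI_split cm md); last first.
  by apply: cintegrableB => //; apply: (integ_v h); rewrite ?lexx ?ab.
rewrite mulrDr addrACA; congr (_ + _).
rewrite -cintD//; first by congr cint; apply/funext => y; ring.
all: by apply: cintegrableB => //; apply: (integ_h h); rewrite ?lexx ?cm ?md ?cd.
Qed.

Lemma rectB a b c d g k : a <= b -> c <= d -> cont_on a b c d g -> cont_on a b c d k ->
  rect a b c d (fun w => g w - k w) = rect a b c d g - rect a b c d k.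
Proof.
move=> ab cd hg hk; rewrite /rect opprD addrACA -mulrBr.
congr (_ + _); last congr (_ * _); rewrite -cintB//.
- by congr cint; apply/funext => x; ring.
1,2: by apply: cintegrableB => //; apply: integ_h; eauto; rewrite ?lexx ?cd.
- by congr cint; apply/funext => x; ring.
all: by apply: cintegrableB => //; apply: integ_v; eauto; rewrite ?lexx ?ab.
Qed.

Lemma ccont_affine (p q : C) w : ccont (fun w => p + q * w) w.
Proof.
move=> e e0; have d0 : 0 < nc q + 1 by rewrite ltr_pwDr// nc_ge0.
exists (e / (nc q + 1)); first exact: divr_gt0.
move=> h; rewrite ler_pdivlMr// => hh.
rewrite (_ : _ - _ = q * h); last by ring.
by rewrite ncM (le_trans _ hh)// mulrC ler_wpM2l ?nc_ge0// lerDl.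
Qed.

Lemma rect_affine a b c d (p q : C) : a <= b -> c <= d ->
  rect a b c d (fun w => p + q * w) = 0.
Proof.
move=> ab cd; rewrite /rect.
rewrite (_ : (fun x => _) = fun=> q * (0 +i* (c - d))); last first.
  apply/funext => x.
  have -> : 0 +i* (c - d) = (x +i* c) - (x +i* d); last by ring.
  by apply: complexP; rewrite !ReIm /=; ring.
rewrite (_ : (fun y => p + q * (b +i* y) - _) = fun=> q * ((b - a) +i* 0)); last first.
  apply/funext => x.
  have -> : (b - a) +i* 0 = (b +i* x) - (a +i* x); last by ring.
  by apply: complexP; rewrite !ReIm /=; ring.
rewrite !cI_cst//.
case: q => u v; by apply: complexP; rewrite !ReIm /=; ring.
Qed.

Lemma rect_le a b c d g M : a <= b -> c <= d -> cont_on a b c d g ->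
  (forall x y, a <= x <= b -> c <= y <= d -> nc (g (x +i* y)) <= M) ->
  nc (rect a b c d g) <= 4 * M * ((b - a) + (d - c)).
Proof.
move=> ab cd h hM; rewrite /rect mulrDr; apply: (le_trans (ncD _ _)); rewrite ncM nci mul1r.
have E : 4 * M = 2 * (M + M) by ring.
rewrite E; apply: lerD; apply: cI_le => //.
- by apply: cintegrableB => //; apply: (integ_h h); rewrite ?lexx ?cd.
- by move=> x xab; apply: (le_trans (ncB _ _)); apply: lerD; apply: hM; rewrite ?lexx ?cd.
- by apply: cintegrableB => //; apply: (integ_v h); rewrite ?lexx ?ab.
- by move=> x xab; apply: (le_trans (ncB _ _)); apply: lerD; apply: hM; rewrite ?lexx ?ab.
Qed.

Lemma half_pow_small (K r : R) : 0 < r -> exists n : nat, K * 2^-1 ^+ n <= r.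
Proof.
move=> r0; have [K0|K0] := leP K 0.
  by exists 0%N; rewrite expr0 mulr1 (le_trans K0)// ltW.
have [n hn] : exists n : nat, K / r < n%:R.
  by exists (Num.truncn (K / r)).+1; exact: truncnS_gt.
exists n; rewrite exprVn ler_pdivrMr ?exprn_gt0//.
have : n%:R <= 2 ^+ n :> R by rewrite -natrX ler_nat ltnW// ltn_expl.
move=> n2; rewrite mulrC -ler_pdivrMr// (le_trans (ltW hn))//.
Qed.

(** Repeated quartering yields nested rectangles on which the boundary integral remains
above a fixed multiple of the squared side; at their common point, the affine
approximation of [g] makes it smaller than any such multiple. *)
Theorem goursat a b c d g : a <= b -> c <= d ->
  (forall x y, a <= x <= b -> c <= y <= d -> cdiff g (x +i* y)) ->
  rect a b c d g = 0.
Proof.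
move=> ab cd hd.
have hc : cont_on a b c d g by move=> x y xab ycd; apply: cdiff_ccont; exact: hd.
pose al := b - a; pose be := d - c.
have al0 : 0 <= al by rewrite subr_ge0.
have be0 : 0 <= be by rewrite subr_ge0.
pose h n : R := 2^-1 ^+ n.
have h0 n : 0 <= h n by rewrite exprn_ge0// invr_ge0.
have hS n : h n = h n.+1 + h n.+1 by rewrite /h exprS; field.
pose J0 := nc (rect a b c d g).
pose P n (q : R * R) := [/\ a <= q.1, q.1 + al * h n <= b, c <= q.2, q.2 + be * h n <= d &
   J0 * (h n) ^+ 2 <= nc (rect q.1 (q.1 + al * h n) q.2 (q.2 + be * h n) g)].
have step (nq : nat * (R * R)) : exists q' : R * R, P nq.1 nq.2 ->
   [/\ P nq.1.+1 q', nq.2.1 <= q'.1, q'.1 + al * h nq.1.+1 <= nq.2.1 + al * h nq.1,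
     nq.2.2 <= q'.2 & q'.2 + be * h nq.1.+1 <= nq.2.2 + be * h nq.1].
  case: nq => n [x y] /=.
  have [[/= q1 q2 q3 q4 q5]|nP] := pselect (P n (x, y)); last by exists (x, y).
  set X := al * h n.+1; set Y := be * h n.+1.
  have X0 : 0 <= X by rewrite mulr_ge0.
  have Y0 : 0 <= Y by rewrite mulr_ge0.
  have EX : al * h n = X + X by rewrite /X -mulrDr -hS.
  have EY : be * h n = Y + Y by rewrite /Y -mulrDr -hS.
  move: q2 q4 q5; rewrite EX EY => q2 q4 q5.
  have hc' : cont_on x (x + (X + X)) y (y + (Y + Y)) g by exact: cont_onW hc.
  have E : rect x (x + (X + X)) y (y + (Y + Y)) g =
     (rect x (x + X) y (y + Y) g + rect x (x + X) (y + Y) (y + Y + Y) g) +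
     (rect (x + X) (x + X + X) y (y + Y) g + rect (x + X) (x + X + X) (y + Y) (y + Y + Y) g).
    have xX : x <= x + X by lra.
    have xXX : x + X <= x + (X + X) by lra.
    have yY : y <= y + Y by lra.
    have yYY : y + Y <= y + (Y + Y) by lra.
    have yy := le_trans yY yYY; have xx := le_trans xX xXX.
    rewrite (rect_split_h xX xXX yy hc') (rect_split_v xX yY yYY).
      rewrite (rect_split_v xXX yY yYY) ?addrA//.
      by apply: cont_onW hc' => //; lra.
    by apply: cont_onW hc' => //; lra.
  (* One of the four quarters carries at least a quarter of the integral. *)
  have F : J0 * h n.+1 ^+ 2 <= nc (rect x (x + X) y (y + Y) g) \/
     J0 * h n.+1 ^+ 2 <= nc (rect x (x + X) (y + Y) (y + Y + Y) g) \/
     J0 * h n.+1 ^+ 2 <= nc (rect (x + X) (x + X + X) y (y + Y) g) \/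
     J0 * h n.+1 ^+ 2 <= nc (rect (x + X) (x + X + X) (y + Y) (y + Y + Y) g).
    apply: contrapT => /not_orP[/negP F1 /not_orP[/negP F2 /not_orP[/negP F3 /negP F4]]].
    move: F1 F2 F3 F4; rewrite -!ltNge => F1 F2 F3 F4.
    move: q5; rewrite E; apply/negP; rewrite -ltNge.
    apply: (le_lt_trans (ncD _ _)).
    apply: (le_lt_trans (lerD (ncD _ _) (ncD _ _))).
    have -> : J0 * h n ^+ 2 = 4 * (J0 * h n.+1 ^+ 2) by rewrite (hS n); ring.
    lra.
  case: F => [F|[F|[F|F]]].
  - exists (x, y) => _ /=; split; rewrite -?/X -?/Y; try lra; split => /=; rewrite -?/X -?/Y//; lra.
  - exists (x, y + Y) => _ /=; split; rewrite -?/X -?/Y; try lra; split => /=; rewrite -?/X -?/Y//; lra.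
  - exists (x + X, y) => _ /=; split; rewrite -?/X -?/Y; try lra; split => /=; rewrite -?/X -?/Y//; lra.
  - exists (x + X, y + Y) => _ /=; split; rewrite -?/X -?/Y; try lra; split => /=; rewrite -?/X -?/Y//; lra.
have [F HF] := choice step.
pose fix sq n := if n is m.+1 then F (m, sq m) else (a, c).
have Psq n : P n (sq n).
  elim: n => [|n ih] /=; last by have [] := HF (n, sq n) ih.
  have Eal : a + al = b by rewrite /al; ring.
  have Ebe : c + be = d by rewrite /be; ring.
  by split; rewrite /= /h ?expr0 ?expr1n ?mulr1 ?Eal ?Ebe//.
have lo m n : (m <= n)%N -> [/\ (sq m).1 <= (sq n).1, (sq n).1 + al * h n <= (sq m).1 + al * h m,
    (sq m).2 <= (sq n).2 & (sq n).2 + be * h n <= (sq m).2 + be * h m].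
  elim: n => [|n ih]; first by rewrite leqn0 => /eqP ->.
  rewrite leq_eqVlt => /predU1P[->//|]; rewrite ltnS => /ih[i1 i2 i3 i4].
  have [_ j1 j2 j3 j4] := HF (n, sq n) (Psq n).
  by split; [exact: le_trans j1|exact: le_trans i2|exact: le_trans j3|exact: le_trans i4].
have sup_in (u : nat -> R) (l : R) : 0 <= l ->
    (forall m n, (m <= n)%N -> u m <= u n /\ u n + l * h n <= u m + l * h m) ->
    exists A, forall n, u n <= A <= u n + l * h n.
  move=> l0 hu; have ubm m n : u n <= u m + l * h m.
    have [mn|nm] := leqP m n.
      by have [_] := hu _ _ mn; apply: le_trans; rewrite lerDl mulr_ge0.
    have [h1 _] := hu _ _ (ltnW nm); apply: (le_trans h1).
    by rewrite lerDl mulr_ge0.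
  have hs : has_sup (range u).
    split; first by exists (u 0%N); exists 0%N.
    by exists (u 0%N + l * h 0%N) => _ [n _ <-]; exact: ubm.
  exists (sup (range u)) => n; apply/andP; split.
    by apply: ub_le_sup; [case: hs|exists n].
  by apply: ge_sup; [case: hs|move=> _ [k _ <-]; exact: ubm].
have [A hA] := sup_in (fun n => (sq n).1) al al0 (fun m n mn => let: And4 x y _ _ := lo m n mn in conj x y).
have [B hB] := sup_in (fun n => (sq n).2) be be0 (fun m n mn => let: And4 _ _ x y := lo m n mn in conj x y).
have Aab : a <= A <= b.
  have /andP[A1 A2] := hA 0%N; have [/= P1 P2 _ _ _] := Psq 0%N.
  by move: A1 A2 P2; rewrite /= => A1 A2 P2; rewrite A1 (le_trans A2 P2).
have Bcd : c <= B <= d.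
  have /andP[A1 A2] := hB 0%N; have [/= _ _ P1 P2 _] := Psq 0%N.
  by move: A1 A2 P2; rewrite /= => A1 A2 P2; rewrite A1 (le_trans A2 P2).
have [k hk] := hd A B Aab Bcd.
have key e : 0 < e -> J0 <= 4 * e * (al + be) ^+ 2.
  move=> e0; have [r r0 hr] := hk e e0.
  have [n hn] := half_pow_small (al + be) r0.
  have [/= p1 p2 p3 p4 p5] := Psq n.
  have /andP[A1 A2] := hA n; have /andP[B1 B2] := hB n.
  set x := (sq n).1 in p1 p2 p3 p4 p5 A1 A2 B1 B2 *.
  set y := (sq n).2 in p1 p2 p3 p4 p5 A1 A2 B1 B2 *.
  have X0 : 0 <= al * h n by rewrite mulr_ge0.
  have Y0 : 0 <= be * h n by rewrite mulr_ge0.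
  pose w0 := A +i* B; pose p := g w0 - k * w0.
  have hc' : cont_on x (x + al * h n) y (y + be * h n) g by exact: cont_onW hc.
  have hp : cont_on x (x + al * h n) y (y + be * h n) (fun w => p + k * w).
    by move=> ? ? _ _; exact: ccont_affine.
  have E : rect x (x + al * h n) y (y + be * h n) g =
     rect x (x + al * h n) y (y + be * h n) (fun w => g w - (p + k * w)).
    by rewrite rectB ?rect_affine ?subr0//; rewrite lerDl.
  have hgp : cont_on x (x + al * h n) y (y + be * h n) (fun w => g w - (p + k * w)).
    move=> u v hu hv e' e'0; have e'2 : 0 < e' / 2 by rewrite divr_gt0.
    have [r1 r10 h1] := hc' u v hu hv _ e'2.
    have [r2 r20 h2] := hp u v hu hv _ e'2.
    exists (Num.min r1 r2); first by rewrite lt_min r10.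
    move=> t; rewrite le_min => /andP[t1 t2].
    rewrite (_ : _ - _ = (g (u +i* v + t) - g (u +i* v)) - (p + k * (u +i* v + t) - (p + k * (u +i* v)))); last by ring.
    by apply: (le_trans (ncB _ _)); rewrite [e']splitr; apply: lerD; [exact: h1|exact: h2].
  have := rect_le (M := e * ((al + be) * h n)) _ _ hgp; rewrite -E !lerDl => /(_ X0 Y0) bnd.
  have {bnd} : nc (rect x (x + al * h n) y (y + be * h n) g) <=
      4 * (e * ((al + be) * h n)) * (x + al * h n - x + (y + be * h n - y)).
    apply: bnd => u v hu hv.
    pose t := (u - A) +i* (v - B).
    have tle : nc t <= (al + be) * h n.
      apply: (le_trans (nc_le_ReIm _)); rewrite mulrDl /=; apply: lerD; rewrite ler_norml; lra.
    have Et : u +i* v = w0 + t by apply: complexP; rewrite !ReIm /=; ring.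
    rewrite Et (_ : _ - _ = g (w0 + t) - g w0 - k * t); last by rewrite /p; ring.
    apply: (le_trans (hr _ (le_trans tle hn))).
    by rewrite ler_wpM2l// ltW.
  move=> bnd; have := le_trans p5 bnd.
  rewrite (_ : _ * (_ - _ + _) = 4 * e * (al + be) ^+ 2 * h n ^+ 2); last by ring.
  by rewrite ler_pM2r// exprn_gt0// exprn_gt0.
apply/eqP; rewrite -nc_eq0 -/J0; apply/eqP/le_anti; rewrite nc_ge0 andbT.
have K0 : 0 < 4 * (al + be) ^+ 2 + 1 by rewrite ltr_pwDr// mulr_ge0// sqr_ge0.
apply/ler_addgt0Pr => e e0; rewrite add0r.
have := key (e / (4 * (al + be) ^+ 2 + 1)) (divr_gt0 e0 K0).
move/le_trans; apply.
rewrite (_ : 4 * _ * _ = e * ((4 * (al + be) ^+ 2) / (4 * (al + be) ^+ 2 + 1))); last by ring.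
rewrite -[leRHS]mulr1 ler_wpM2l ?(ltW e0)//.
by rewrite ler_pdivrMr// mul1r lerDl.
Qed.

End Goursat.

(** * Complex differentiability in one variable *)

Section DifferentiableEps.
Context {K : numFieldType} {V W : normedModType K}.

Lemma diff_epsP (f : V -> W) (x : V) : differentiable f x <->
  exists2 L : {linear V -> W}, continuous L &
    forall e : K, 0 < e -> \forall h \near 0, `|f (h + x) - f x - L h| <= e * `|h|.
Proof.
split=> [df|[L cL hL]].
  exists (diff (Phantom _ (nbhs x)) f : {linear V -> W}); first exact: diff_continuous.
  have := diff_locally df.
  move=> /eqaddoP h e e0; have := h e e0; apply: filterS => t /=.
  by rewrite !fctE /= opprD addrA.
have E : f \o shift x = cst (f x) + L +o_ 0 id.
  apply/eqaddoP => e e0; apply: filterS (hL e e0) => t /=.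
  by rewrite !fctE /= opprD addrA.
have D := diff_unique cL E.
by apply/diff_locallyP; rewrite D; split.
Qed.

End DifferentiableEps.

Section ComplexDerivative.
Context {R : realType}.
Notation C := R[i].

Lemma nbhsC_le (x : C) (P : set C) : nbhs (x : C^o) (P : set C^o) <->
  exists2 r : R, 0 < r & forall y, nc (y - x) <= r -> P y.
Proof.
split.
  move=> /nbhs_ballP[e /= e0 he].
  have e0' : 0 < Re e by move: e0; rewrite ltcE => /andP[].
  have Ee : e = (Re e)%:C by rewrite RRe_real// gtr0_real.
  exists (Re e / 2); first by rewrite divr_gt0.
  move=> y hy; apply: he; rewrite -ball_normE /= ncE Ee ltcR /=.
  rewrite -ncN opprB (le_lt_trans hy)//; lra.
move=> [r r0 hr]; apply/nbhs_ballP; exists r%:C => /=; first by rewrite ltcR.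
move=> y; rewrite -ball_normE /= ncE ltcR => hy; apply: hr.
by rewrite -ncN opprB ltW.
Qed.

Lemma posC (e : C) : 0 < e -> 0 < Re e /\ e = (Re e)%:C.
Proof. by move=> e0; split; [move: e0; rewrite ltcE => /andP[]|rewrite RRe_real// gtr0_real]. Qed.

Lemma ccontP (g : C -> C) (w : C) : ccont g w <-> {for (w : C^o), continuous (g : C^o -> C^o)}.
Proof.
have F : Filter (nbhs (w : C^o)) by exact: nbhs_filter.
have P := @cvgrPdist_le C C^o C^o (nbhs (w : C^o)) F (g : C^o -> C^o) (g w).
split=> [h|].
  apply/P => e /posC[e0 ->]; have [r r0 hr] := h _ e0.
  apply/nbhsC_le; exists r => // y hy; rewrite ncE lecR -ncN opprB.
  by have := hr (y - w) hy; rewrite (addrC w) subrK.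
move=> /P h e e0; have e0' : 0 < e%:C by rewrite ltcR.
have /nbhsC_le[r r0 hr] := h _ e0'; exists r => // t ht.
have := hr (w + t); rewrite {1}(addrC w) addrK => /(_ ht).
by rewrite ncE lecR -ncN opprB.
Qed.

Lemma cdiffP (g : C -> C) (w : C) : cdiff g w <-> differentiable (g : C^o -> C^o) (w : C^o).
Proof.
split=> [[a ha]|/diff_epsP[L cL hL]].
  apply/diff_epsP.
  have linL : linear (fun h : C^o => a * h : C^o).
    by move=> k u v /=; rewrite mulrDr; congr (_ + _); rewrite /GRing.scale /= mulrCA.
  pose Lm := GRing.isLinear.Build _ _ _ _ _ linL.
  pose L : {linear C^o -> C^o} := HB.pack (fun h : C^o => a * h : C^o) Lm.
  exists L.
    move=> t; apply/(ccontP (fun h => a * h)) => e e0.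
    have [r r0 hr] := @ccont_affine _ 0 a t e e0; exists r => // h /hr.
    by rewrite !add0r.
  move=> e /posC[e0 ->]; have [r r0 hr] := ha _ e0.
  apply/nbhsC_le; exists r => // h; rewrite subr0 => hh.
  rewrite !ncE -rmorphM /= lecR (addrC h w); exact: hr.
exists (L 1) => e e0.
have e0' : 0 < e%:C by rewrite ltcR.
have /nbhsC_le[r r0 hr] := hL _ e0'; exists r => // h hh.
have := hr h; rewrite subr0 => /(_ hh); rewrite !ncE -rmorphM /= lecR (addrC h w).
have -> : L h = L 1 * h; last by [].
by rewrite mulrC -[in LHS](mulr1 h) -[h * 1]/(h *: (1 : C^o)) linearZ.
Qed.

Lemma cdiffD (f g : C -> C) w : cdiff f w -> cdiff g w -> cdiff (fun z => f z + g z) w.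
Proof. by move=> /cdiffP hf /cdiffP hg; apply/cdiffP; exact: (differentiableD hf hg). Qed.

Lemma cdiffN (f : C -> C) w : cdiff f w -> cdiff (fun z => - f z) w.
Proof. by move=> /cdiffP hf; apply/cdiffP; exact: (differentiableN hf). Qed.

Lemma cdiffB (f g : C -> C) w : cdiff f w -> cdiff g w -> cdiff (fun z => f z - g z) w.
Proof. by move=> hf hg; apply: cdiffD => //; exact: cdiffN. Qed.

Lemma cdiffM (f g : C -> C) w : cdiff f w -> cdiff g w -> cdiff (fun z => f z * g z) w.
Proof. by move=> /cdiffP hf /cdiffP hg; apply/cdiffP; exact: (differentiableM hf hg). Qed.

Lemma cdiffV (f : C -> C) w : cdiff f w -> f w != 0 -> cdiff (fun z => (f z)^-1) w.
Proof. by move=> /cdiffP hf h0; apply/cdiffP; exact: (differentiableV hf h0). Qed.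

Lemma cdiff_comp (f g : C -> C) w : cdiff f w -> cdiff g (f w) -> cdiff (fun z => g (f z)) w.
Proof. by move=> /cdiffP hf /cdiffP hg; apply/cdiffP; exact: (differentiable_comp hf hg). Qed.

Lemma cdiff_cst (c w : C) : cdiff (fun=> c) w.
Proof.
exists 0 => e e0; exists 1 => // h _.
by rewrite subrr mul0r subr0 nc0 mulr_ge0 ?nc_ge0// ltW.
Qed.

Lemma cdiff_id (w : C) : cdiff (fun z => z) w.
Proof.
exists 1 => e e0; exists 1 => // h _.
by rewrite (addrC w) addrK mul1r subrr nc0 mulr_ge0 ?nc_ge0// ltW.
Qed.

Lemma cdiffX (f : C -> C) n w : cdiff f w -> cdiff (fun z => f z ^+ n) w.
Proof.
move=> hf; elim: n => [|n ih].
  rewrite (_ : (fun z => _) = fun=> 1); first exact: cdiff_cst.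
  by apply/funext => z; rewrite expr0.
rewrite (_ : (fun z => _) = fun z => f z * f z ^+ n); first exact: cdiffM.
by apply/funext => z; rewrite exprS.
Qed.

Lemma cdiff_sum n (f : nat -> C -> C) w : (forall k, cdiff (f k) w) ->
  cdiff (fun z => \sum_(k < n) f k z) w.
Proof.
move=> hf; elim: n => [|n ih].
  rewrite (_ : (fun z => _) = fun=> 0); first exact: cdiff_cst.
  by apply/funext => z; rewrite big_ord0.
rewrite (_ : (fun z => _) = fun z => \sum_(k < n) f k z + f n z); first exact: cdiffD.
by apply/funext => z; rewrite big_ord_recr.
Qed.

Lemma cdiff_prod n (f : nat -> C -> C) w : (forall k, cdiff (f k) w) ->
  cdiff (fun z => \prod_(k < n) f k z) w.
Proof.
move=> hf; elim: n => [|n ih].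
  rewrite (_ : (fun z => _) = fun=> 1); first exact: cdiff_cst.
  by apply/funext => z; rewrite big_ord0.
rewrite (_ : (fun z => _) = fun z => (\prod_(k < n) f k z) * f n z); first exact: cdiffM.
by apply/funext => z; rewrite big_ord_recr.
Qed.

Lemma ccontM (f g : C -> C) w : ccont f w -> ccont g w -> ccont (fun z => f z * g z) w.
Proof. by move=> /ccontP hf /ccontP hg; apply/ccontP; exact: (continuousM hf hg). Qed.

Lemma ccont_comp (f g : C -> C) w : ccont f w -> ccont g (f w) -> ccont (fun z => g (f z)) w.
Proof. by move=> /ccontP hf /ccontP hg; apply/ccontP; exact: (continuous_comp hf hg). Qed.

Definition cexp (w : C) : C := (expR (Re w) * cos (Im w)) +i* (expR (Re w) * sin (Im w)).

Lemma cexpD z w : cexp (z + w) = cexp z * cexp w.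
Proof.
by rewrite /cexp ReD ImD expRD cosD sinD; apply: complexP; rewrite !ReIm /=; ring.
Qed.

Lemma nc_cexp w : nc (cexp w) = expR (Re w).
Proof.
apply/eqP; rewrite -(@eqrXn2 _ 2) ?nc_ge0 ?expR_ge0// nc_sqr /= !exprMn -mulrDr.
by rewrite cos2Dsin2 mulr1.
Qed.

Lemma cexp_neq0 w : cexp w != 0.
Proof. by rewrite -nc_gt0 nc_cexp expR_gt0. Qed.

Lemma cexp_pi x : cexp (x +i* (- pi)) = cexp (x +i* pi).
Proof. by rewrite /cexp /= cosN sinN sinpi oppr0. Qed.

Lemma real_diff_eps (f : R -> R) (x a : R) : is_derive x 1 f a ->
  forall e, 0 < e -> exists2 r, 0 < r & forall h, `|h| <= r -> `|f (x + h) - f x - a * h| <= e * `|h|.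
Proof.
move=> [df fa] e e0; move: df => /derivable1_diffP.
move=> /[dup] /diff_locallyxP[_ _] /diff_epsP[L cL hL].
have La : L 1 = a.
  rewrite -fa deriveE//.
    have E : f \o shift x = cst (f x) + L +o_ 0 id.
      apply/eqaddoP => e' e'0; apply: filterS (hL e' e'0) => t /=.
      by rewrite !fctE /= opprD addrA.
    by rewrite (diff_unique cL E).
  apply/diff_epsP; by exists L.
have /nbhs_ballP[r /= r0 hr] := hL e e0.
exists (r / 2); first by rewrite divr_gt0.
move=> h hh; have := hr h; rewrite -ball_normE /= sub0r normrN.
have hlt : `|h| < r by rewrite (le_lt_trans hh)//; lra.
move=> /(_ hlt); rewrite (addrC h).
have -> : L h = a * h; last by [].
by rewrite -La mulrC -[in LHS](mulr1 h) -[h * 1]/(h *: (1 : R^o)) linearZ.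
Qed.

Lemma cdiff_cexp w : cdiff cexp w.
Proof.
exists (cexp w) => e e0; pose d := e / (8 * nc (cexp w)).
have w0 : 0 < nc (cexp w) by rewrite nc_cexp expR_gt0.
have d0 : 0 < d by rewrite divr_gt0// mulr_gt0.
have [r1 r10 h1] := real_diff_eps (is_derive_expR 0) d0.
have [r2 r20 h2] := real_diff_eps (is_derive_cos 0) d0.
have [r3 r30 h3] := real_diff_eps (is_derive_sin 0) d0.
have [r4 r40 h4] := real_diff_eps (is_derive_expR 0) ltr01.
pose r := Num.min (Num.min r1 r2) (Num.min (Num.min r3 r4) (Num.min (d / 2) 1)).
exists r; first by rewrite !lt_min r10 r20 r30 r40 divr_gt0//=.
move=> h; rewrite !le_min => /andP[/andP[t1 t2] /andP[/andP[t3 t4] /andP[t5 t6]]].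
have rh := Re_le_nc h; have ih := Im_le_nc h; have h0 := nc_ge0 h.
move: (h1 (Re h) (le_trans rh t1)); rewrite add0r expR0 mul1r => {}h1.
move: (h2 (Im h) (le_trans ih t2)); rewrite add0r cos0 sin0 oppr0 mul0r subr0 => {}h2.
move: (h3 (Im h) (le_trans ih t3)); rewrite add0r sin0 cos0 subr0 mul1r => {}h3.
move: (h4 (Re h) (le_trans rh t4)); rewrite add0r expR0 !mul1r => {}h4.
have d0' := ltW d0.
have h1' : `|expR (Re h) - 1 - Re h| <= d * nc h.
  by apply: (le_trans h1); rewrite ler_wpM2l.
have h2' : `|cos (Im h) - 1| <= d * nc h.
  by apply: (le_trans h2); rewrite ler_wpM2l.
have h3' : `|sin (Im h) - Im h| <= d * nc h.
  by apply: (le_trans h3); rewrite ler_wpM2l.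
have E1 : `|expR (Re h) - 1| <= 2 * nc h.
  rewrite -(subrK (Re h) (expR (Re h) - 1)).
  by apply: (le_trans (ler_normD _ _)); lra.
have E3 : `|expR (Re h)| <= 3.
  rewrite -(subrK 1 (expR (Re h))); apply: (le_trans (ler_normD _ _)).
  rewrite normr1; lra.
rewrite cexpD (_ : _ - _ - _ = cexp w * (cexp h - 1 - h)); last by ring.
rewrite ncM; suff : nc (cexp h - 1 - h) <= 8 * d * nc h.
  move=> hh; apply: (le_trans (ler_wpM2l (ltW w0) hh)).
  rewrite /d; rewrite le_eqVlt; apply/orP; left; apply/eqP; field.
  by rewrite gt_eqF.
apply: (le_trans (nc_le_ReIm _)).
have -> : Re (cexp h - 1 - h) = (expR (Re h) - 1 - Re h) + expR (Re h) * (cos (Im h) - 1).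
  by rewrite !ReIm /=; ring.
have -> : Im (cexp h - 1 - h) = expR (Re h) * (sin (Im h) - Im h) + (expR (Re h) - 1) * Im h.
  by rewrite !ReIm /=; ring.
have F1 : `|expR (Re h) * (cos (Im h) - 1)| <= 3 * (d * nc h).
  by rewrite normrM ler_pM.
have F2 : `|expR (Re h) * (sin (Im h) - Im h)| <= 3 * (d * nc h).
  by rewrite normrM ler_pM.
have F3 : `|(expR (Re h) - 1) * Im h| <= d * nc h.
  rewrite normrM ler_pM//; apply: (le_trans E1); lra.
apply: (le_trans (lerD (ler_normD _ _) (ler_normD _ _))); lra.
Qed.

Definition ent1 (f : C -> C) := forall w, cdiff f w.

End ComplexDerivative.

(** * Circle means, Cauchy's formula and Taylor expansions *)

Section CircleMeans.
Context {R : realType}.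
Notation C := R[i].
Notation leb := (@lebesgue_measure R).
Implicit Types (G f : C -> C) (s : R).

(** For G = f o exp, this is 2 pi times the mean of f over the circle of radius exp s:
the exponential replaces polar coordinates, and a change of radius becomes Goursat's
theorem on a rectangle. *)
Definition vint G s : C := cI (- pi) pi (fun t => G (s +i* t)).

Lemma pi_itv : - pi <= pi :> R.
Proof. by have := pi_ge0 R; lra. Qed.

Lemma lineint G s : (forall t, ccont G (s +i* t)) ->
  cintegrable leb `[(- pi)%R, pi] (fun t => G (s +i* t)).
Proof. by move=> h; apply: cI_integrable => t _; exact: ccat_v. Qed.

Lemma vintB G H s : (forall t, ccont G (s +i* t)) -> (forall t, ccont H (s +i* t)) ->
  vint (fun w => G w - H w) s = vint G s - vint H s.
Proof. by move=> hG hH; rewrite /vint /cI cintB//; exact: lineint. Qed.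

Lemma vintD G H s : (forall t, ccont G (s +i* t)) -> (forall t, ccont H (s +i* t)) ->
  vint (fun w => G w + H w) s = vint G s + vint H s.
Proof. by move=> hG hH; rewrite /vint /cI cintD//; exact: lineint. Qed.

Lemma vintZ (c : C) G s : (forall t, ccont G (s +i* t)) ->
  vint (fun w => c * G w) s = c * vint G s.
Proof. by move=> hG; rewrite /vint /cI cintZ//; exact: lineint. Qed.

Lemma vint_sum n (F : nat -> C -> C) s : (forall k t, ccont (F k) (s +i* t)) ->
  vint (fun w => \sum_(k < n) F k w) s = \sum_(k < n) vint (F k) s.
Proof.
move=> hF; apply: (@cint_sum _ _ _ leb `[(- pi)%R, pi] n (fun k t => F k (s +i* t))) => // k.
exact: lineint.
Qed.

Lemma vint_cst (c : C) s : vint (fun=> c) s = (2 * pi)%:C * c.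
Proof. by rewrite /vint cI_cst ?pi_itv//; congr (_%:C * _); ring. Qed.

Lemma vint_le G s M : (forall t, ccont G (s +i* t)) ->
  (forall t, nc (G (s +i* t)) <= M) -> nc (vint G s) <= 4 * M * pi.
Proof.
move=> hG hM; apply: (le_trans (cI_le pi_itv (lineint hG) (fun x _ => hM x))).
by rewrite le_eqVlt; apply/orP; left; apply/eqP; ring.
Qed.

Lemma eq_vint G H s : (forall t, G (s +i* t) = H (s +i* t)) -> vint G s = vint H s.
Proof. by move=> E; rewrite /vint; congr cI; apply/funext. Qed.

(** The horizontal sides of the rectangle cancel by periodicity. *)
Lemma vint_const_le G s1 s2 : s1 <= s2 ->
  (forall x y, s1 <= x <= s2 -> cdiff G (x +i* y)) ->
  (forall x, G (x +i* (- pi)) = G (x +i* pi)) -> vint G s1 = vint G s2.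
Proof.
move=> s12 hd hp.
have := goursat s12 pi_itv (fun x y hx _ => hd x y hx).
rewrite /rect (_ : (fun x => G (x +i* _) - _) = fun=> 0); last first.
  by apply/funext => x; rewrite hp subrr.
rewrite {1}/cI cint0 add0r => /eqP; rewrite mulf_eq0 => /orP[/eqP i0|/eqP h].
  by move: i0 => /(congr1 (@nc R)); rewrite nci nc0 => /eqP; rewrite oner_eq0.
apply/esym/subr0_eq; rewrite -h /vint /cI cintB//; apply: lineint => t; apply: cdiff_ccont; apply: hd;
  by rewrite ?lexx ?s12.
Qed.

Lemma unif_line G s0 (a b : R) : (forall t, ccont G (s0 +i* t)) -> forall e, 0 < e ->
  exists2 r, 0 < r & forall s t, `|s - s0| <= r -> a <= t <= b ->
    nc (G (s +i* t) - G (s0 +i* t)) <= e.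
Proof.
move=> hG e e0.
have := @segment_compact R a b => /compact_near_coveringP.
move=> /(_ R (0^'+) (fun r t => forall s, `|s - s0| <= r -> nc (G (s +i* t) - G (s0 +i* t)) <= e) _).
case.
  move=> t _; have e2 : 0 < e / 2 by rewrite divr_gt0.
  have [r r0 hr] := hG t _ e2.
  have r2 : 0 < r / 2 by rewrite divr_gt0.
  exists (ball t (r / 2), [set q : R | q <= r / 2]) => /=.
    split; first exact: nbhsx_ballx.
    near=> q; near: q; exact: nbhs_right_le.
  move=> [t' q] /= []; rewrite /ball /= => tt' qr s ss.
  have F u : `|u| <= r / 2 -> nc (G ((s0 + u) +i* t') - G (s0 +i* t)) <= e / 2.
    move=> hu; have := hr (u +i* (t' - t)).
    have -> : (s0 +i* t) + (u +i* (t' - t)) = (s0 + u) +i* t'.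
      by apply: complexP; rewrite !ReIm /=; ring.
    apply; apply: (le_trans (nc_le_ReIm _)) => /=.
    by move: tt'; rewrite distrC => /ltW tt'; lra.
  have F1 := F 0; rewrite normr0 addr0 in F1.
  have F2 := F (s - s0) (le_trans ss qr); rewrite (addrC s0) subrK in F2.
  rewrite -[X in nc X](subrKA (G (s0 +i* t))); apply: (le_trans (ncD _ _)).
  rewrite [e]splitr lerD// nc_distC; apply: F1; exact: ltW.
move=> r /= r0 hr; exists (r / 2); first by rewrite divr_gt0.
move=> s t ss tab; apply: (hr (r / 2)) => //=.
- by rewrite sub0r normrN gtr0_norm ?divr_gt0//; lra.
- by rewrite divr_gt0.
Unshelve. all: end_near. Qed.

(** By continuity the means cross the vertical line on which differentiability is not
known. This is what removes the singularity of difference quotients below. *)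
Lemma vint_const G s0 : (forall w, ccont G w) ->
  (forall x y, x != s0 -> cdiff G (x +i* y)) ->
  (forall x, G (x +i* (- pi)) = G (x +i* pi)) -> forall s1 s2, vint G s1 = vint G s2.
Proof.
move=> hc hd hp.
suff H s : vint G s = vint G s0 by move=> s1 s2; rewrite (H s1) (H s2).
apply/subr0_eq/eqP; rewrite -nc_eq0; apply/eqP/le_anti; rewrite nc_ge0 andbT.
apply/ler_addgt0Pr => e e0; rewrite add0r.
have p0 := pi_gt0 R.
have [r r0 hr] := unif_line (- pi) pi (fun t => hc (s0 +i* t)) (divr_gt0 e0 (mulr_gt0 (ltr0n _ 4) p0)).
have K s' : `|s' - s0| <= r -> nc (vint G s' - vint G s0) <= e.
  move=> hs; rewrite /vint /cI -cintB//; try exact: lineint.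
  have := @cI_le _ (- pi) pi (e / (4 * pi)) (fun t => G (s' +i* t) - G (s0 +i* t)) pi_itv.
  move=> /(_ _ (fun t => hr s' t hs)) h; apply: (le_trans (h _)).
    by apply: cintegrableB => //; exact: lineint.
  have -> : 2 * (e / (4 * pi)) * (pi - - pi) = e; last by [].
  by move: (pi) p0 => q q0; field; exact: lt0r_neq0.
have [ss|ss|->] := ltgtP s s0; last by rewrite subrr nc0 ltW.
- have [m1 m2] : s <= Num.max s (s0 - r) /\ Num.max s (s0 - r) < s0.
    by rewrite le_max lexx /= gt_max ss /= gtrDl oppr_lt0.
  rewrite (vint_const_le m1 _ hp).
    apply: K; rewrite ltr0_norm ?subr_lt0// opprB lerBlDr -lerBlDl le_max lexx orbT//.
  by move=> x y /andP[_ x2]; apply: hd; rewrite lt_eqF// (le_lt_trans x2).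
- have [m1 m2] : Num.min s (s0 + r) <= s /\ s0 < Num.min s (s0 + r).
    by rewrite ge_min lexx /= lt_min ss /= ltrDl.
  rewrite -(vint_const_le m1 _ hp).
    apply: K; rewrite gtr0_norm ?subr_gt0// lerBlDl ge_min lexx orbT//.
  by move=> x y /andP[x2 _]; apply: hd; rewrite gt_eqF// (lt_le_trans m2).
Qed.

Lemma bound_disc f : (forall w, ccont f w) -> forall rho, exists M, forall w, nc w <= rho -> nc (f w) <= M.
Proof.
move=> hf rho.
have K : compact ([set` `[(- rho)%R, rho]] `*` [set` `[(- rho)%R, rho]] : set (R * R)%type).
  by apply: compact_setX; exact: segment_compact.
move: K => /compact_near_coveringP/(_ R (+oo_R) (fun M q => nc (f (q.1 +i* q.2)) <= M) _).
case.
  move=> [x y] _; have [r r0 hr] := hf (x +i* y) _ (@ltr01 R).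
  have r2 : 0 < r / 2 by rewrite divr_gt0.
  exists (ball (x, y) (r / 2), [set M : R | nc (f (x +i* y)) + 1 <= M]) => /=.
    split; first exact: nbhsx_ballx.
    by apply: nbhs_pinfty_ge; exact: num_real.
  move=> [[x' y'] M] /= [[/= bx by']]; move=> hM.
  apply: (le_trans _ hM); apply: (le_trans (nc_le_dist _ (f (x +i* y)))).
  rewrite lerD2l; have := hr ((x' - x) +i* (y' - y)).
  have -> : (x +i* y) + ((x' - x) +i* (y' - y)) = x' +i* y'.
    by apply: complexP; rewrite !ReIm /=; ring.
  apply; apply: (le_trans (nc_le_ReIm _)) => /=.
  by move: bx by'; rewrite /ball /= (distrC x) (distrC y) => /ltW ? /ltW ?; lra.
move=> M [_ hM]; exists (M + 1) => w hw.
have := hM (M + 1); rewrite ltrDl => /(_ ltr01) /(_ (Re w, Im w)) /=.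
have -> : Re w +i* Im w = w by case: (w).
apply; split; rewrite /= in_itv /= -ler_norml (le_trans _ hw)//; [exact: Re_le_nc|exact: Im_le_nc].
Qed.

(** The k-th Taylor coefficient at 0, as a Cauchy integral over the unit circle. *)
Definition acoef f k : C := ((2 * pi)^-1)%:C * vint (fun w => f (cexp w) * (cexp w)^-1 ^+ k) 0.

Lemma cdiff_near f g w r : 0 < r -> (forall h, nc h <= r -> f (w + h) = g (w + h)) ->
  cdiff f w -> cdiff g w.
Proof.
move=> r0 E [a ha]; exists a => e /ha[r' r'0 hr].
exists (Num.min r r'); first by rewrite lt_min r0.
move=> h; rewrite le_min => /andP[h1 h2].
have E0 : f w = g w by rewrite -[w]addr0 E// nc0 ltW.
by rewrite -E// -E0; exact: hr.
Qed.

Lemma cdiff_cexpV w : cdiff (fun w : C => (cexp w)^-1) w.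
Proof. by apply: cdiffV; [exact: cdiff_cexp|exact: cexp_neq0]. Qed.

Lemma cdiff_fexp f k w : ent1 f -> cdiff (fun w => f (cexp w) * (cexp w)^-1 ^+ k) w.
Proof.
move=> hf; apply: cdiffM; first by apply: cdiff_comp (hf _); exact: cdiff_cexp.
by apply: cdiffX; exact: cdiff_cexpV.
Qed.

Lemma acoefE f k s : ent1 f ->
  (2 * pi)%:C * acoef f k = vint (fun w => f (cexp w) * (cexp w)^-1 ^+ k) s.
Proof.
move=> hf; rewrite /acoef mulrA -rmorphM /= mulfV ?mul1r; last first.
  by rewrite mulf_neq0// gt_eqF// pi_gt0.
apply: (@vint_const _ 0).
- by move=> w; apply: cdiff_ccont; exact: cdiff_fexp.
- by move=> x y _; exact: cdiff_fexp.
- by move=> x; rewrite cexp_pi.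
Qed.

Lemma exprVn_nc (w : C) k : nc ((cexp w)^-1 ^+ k) = (expR (Re w) ^+ k)^-1.
Proof. by rewrite ncX ncV nc_cexp exprVn. Qed.

Lemma twopi_gt0 : 0 < 2 * pi :> R.
Proof. by rewrite mulr_gt0// pi_gt0. Qed.

Lemma acoef_le f k r M : ent1 f -> 0 < r -> (forall z, nc z = r -> nc (f z) <= M) ->
  nc (acoef f k) <= 2 * M / r ^+ k.
Proof.
move=> hf r0 hM; rewrite -(ler_pM2l twopi_gt0).
have -> : 2 * pi * nc (acoef f k) = nc ((2 * pi)%:C * acoef f k).
  by rewrite ncM ncR ger0_norm// ltW// twopi_gt0.
rewrite (acoefE _ (ln r))//.
have rE : expR (ln r) = r by rewrite lnK.
apply: (le_trans (vint_le (M := M / r ^+ k) _ _)).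
- by move=> t; apply: cdiff_ccont; exact: cdiff_fexp.
- move=> t; rewrite ncM exprVn_nc /= rE ler_wpM2r ?invr_ge0 ?exprn_ge0 ?(ltW r0)//.
  by apply: hM; rewrite nc_cexp.
by move: (pi : R) => q; rewrite le_eqVlt; apply/orP; left; apply/eqP; ring.
Qed.

(** The difference quotient extends continuously to the pole, so its circle means do not
depend on the radius; they tend to 0 with it. *)
Lemma cauchy_quotient f z s : ent1 f -> nc z != expR s ->
  vint (fun w => (f (cexp w) - f z) * (cexp w / (cexp w - z))) s = 0.
Proof.
move=> hf zs; have [a ha] := hf z.
pose q (u : C) := if u == z then a else (f u - f z) / (u - z).
have qdiff u : u != z -> cdiff q u.
  move=> uz; have n0 : 0 < nc (u - z) by rewrite nc_gt0 subr_eq0.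
  apply: (@cdiff_near (fun u => (f u - f z) / (u - z)) _ _ (nc (u - z) / 2)).
  - by rewrite divr_gt0.
  - move=> h hh; rewrite /q; case: eqP => // E; exfalso.
    have : nc (u - z) = nc h by rewrite -E opprD addNKr ncN.
    by move: hh n0; lra.
  - apply: cdiffM; first by apply: cdiffB; [exact: hf|exact: cdiff_cst].
    apply: cdiffV; first by apply: cdiffB; [exact: cdiff_id|exact: cdiff_cst].
    by rewrite subr_eq0.
have qcont u : ccont q u.
  have [->|uz] := eqVneq u z; last by apply: cdiff_ccont; exact: qdiff.
  move=> e e0; have [r r0 hr] := ha e e0; exists r => // h hh; rewrite /q eqxx.
  case: eqP => [_|/eqP hz]; first by rewrite subrr nc0 ltW.
  have h0 : h != 0 by apply: contraNneq hz => ->; rewrite addr0.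
  rewrite (addrC z) addrK -[X in _ - X](mulfK h0) -mulrBl ncM ncV.
  by rewrite ler_pdivrMr ?nc_gt0// (addrC h) hr.
pose G (w : C) := q (cexp w) * cexp w.
have GE s' : vint G s' = vint G s.
  apply: (@vint_const _ (ln (nc z))).
  - move=> w; apply: ccontM; last by apply: cdiff_ccont; exact: cdiff_cexp.
    by apply: ccont_comp; [apply: cdiff_ccont; exact: cdiff_cexp|exact: qcont].
  - move=> x y hx; apply: cdiffM; last exact: cdiff_cexp.
    apply: cdiff_comp; first exact: cdiff_cexp.
    apply: qdiff; apply: contraNneq hx => <-.
    by rewrite nc_cexp expRK.
  - by move=> x; rewrite /G cexp_pi.
transitivity (vint G s).
  apply: eq_vint => t; rewrite /G /q; case: eqP => [E|_].
    by move: zs; rewrite -E nc_cexp eqxx.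
  by rewrite mulrAC mulrA.
apply/eqP; rewrite -nc_eq0; apply/eqP/le_anti; rewrite nc_ge0 andbT.
apply/ler_addgt0Pr => e e0; rewrite add0r.
have [M hM] := bound_disc qcont 1.
have M0 : 0 <= M by apply: le_trans (hM 0 _); rewrite ?nc_ge0 ?nc0.
have p0 := pi_gt0 R.
pose u := e / (4 * (M + 1) * pi).
have u0 : 0 < u by rewrite divr_gt0// !mulr_gt0// ltr_wpDl.
pose s' := Num.min 0 (ln u).
rewrite -(GE s'); apply: (le_trans (vint_le (M := M * expR s') _ _)).
- move=> t; apply: ccontM; last by apply: cdiff_ccont; exact: cdiff_cexp.
  by apply: ccont_comp; [apply: cdiff_ccont; exact: cdiff_cexp|exact: qcont].
- move=> t; rewrite ncM nc_cexp /= ler_wpM2r ?expR_ge0//; apply: hM.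
  by rewrite nc_cexp /= -expR0 ler_expR ge_min lexx.
have hs' : expR s' <= u by rewrite -[leRHS]lnK// ler_expR ge_min lexx orbT.
apply: (@le_trans _ _ (4 * ((M + 1) * u) * pi)).
  apply: ler_wpM2r; first exact: ltW.
  apply: ler_wpM2l => //; apply: ler_pM; rewrite ?expR_ge0//.
  by rewrite lerDl.
rewrite /u; move: (pi : R) p0 => p p0.
rewrite le_eqVlt; apply/orP; left; apply/eqP; field.
by rewrite !gt_eqF//=; lra.
Qed.

(** The Cauchy kernel, with the boundary point written as an exponential. *)
Definition kern (z w : C) := cexp w / (cexp w - z).

Lemma kern_geo z w n : nc z < expR (Re w) -> kern z w =
  \sum_(k < n) z ^+ k * (cexp w)^-1 ^+ k + z ^+ n * ((cexp w)^-1 ^+ n * kern z w).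
Proof.
move=> zw; have w0 := cexp_neq0 w.
have wz : cexp w - z != 0.
  by rewrite subr_eq0; apply: contraTneq zw => <-; rewrite nc_cexp ltxx.
pose x := z / cexp w.
under eq_bigr do rewrite -exprMn -/x.
rewrite mulrA -exprMn -/x.
have E : kern z w = (1 - x)^-1 by rewrite /kern /x; field; rewrite w0.
have x1 : 1 - x != 0.
  by apply: contraNneq wz => h; rewrite -[z](divfK w0) -/x -[X in X - _]mul1r -mulrBl h mul0r.
rewrite E; apply: (mulIf x1); rewrite mulVf// mulrDl -mulrA mulVf// mulr1.
have := subrX1 x n; rewrite -(opprB 1 x) mulNr => /eqP; rewrite -eqr_oppLR opprB => /eqP.
by rewrite mulrC => <-; rewrite subrK.
Qed.

Lemma cdiff_kern z w : nc z < expR (Re w) -> cdiff (kern z) w.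
Proof.
move=> zw; apply: cdiffM; first exact: cdiff_cexp.
apply: cdiffV; first by apply: cdiffB; [exact: cdiff_cexp|exact: cdiff_cst].
by rewrite subr_eq0; apply: contraTneq zw => <-; rewrite nc_cexp ltxx.
Qed.

Lemma kern_le z s t : nc z <= expR s / 2 -> nc (kern z (s +i* t)) <= 2.
Proof.
move=> zs; rewrite /kern ncM ncV nc_cexp /=.
have e0 := expR_gt0 s.
have h : expR s / 2 <= nc (cexp (s +i* t) - z).
  have := nc_le_dist (cexp (s +i* t)) z; rewrite nc_cexp /=; lra.
rewrite ler_pdivrMr; first by lra.
by apply: lt_le_trans h; rewrite divr_gt0.
Qed.

Section Kernel.
Variables (z : C) (s : R).
Hypothesis zs : nc z <= expR s / 2.

Let zs' : nc z < expR s.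
Proof. by have := expR_gt0 s; move: zs; lra. Qed.

Lemma vint_kern_geo f n : ent1 f ->
  vint (fun w => f (cexp w) * kern z w) s =
  (2 * pi)%:C * (\sum_(k < n) acoef f k * z ^+ k) +
  z ^+ n * vint (fun w => f (cexp w) * (cexp w)^-1 ^+ n * kern z w) s.
Proof.
move=> hf; rewrite mulr_sumr.
transitivity (vint (fun w => \sum_(k < n) (z ^+ k * (f (cexp w) * (cexp w)^-1 ^+ k)) +
   z ^+ n * (f (cexp w) * (cexp w)^-1 ^+ n * kern z w)) s).
  apply: eq_vint => t; rewrite {1}(kern_geo n) //= mulrDr mulr_sumr; congr (_ + _).
    by apply: eq_bigr => k _; ring.
  by ring.
have c1 k t : ccont (fun w => f (cexp w) * (cexp w)^-1 ^+ k) (s +i* t).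
  by apply: cdiff_ccont; exact: cdiff_fexp.
have c2 k t : ccont (fun w => f (cexp w) * (cexp w)^-1 ^+ k * kern z w) (s +i* t).
  apply: ccontM => //; apply: cdiff_ccont; exact: cdiff_kern.
have cZ (c : C) (g : C -> C) t : ccont g (s +i* t) -> ccont (fun w => c * g w) (s +i* t).
  by move=> hg; apply: ccontM => //; apply: cdiff_ccont; exact: cdiff_cst.
rewrite vintD; last 2 first.
- move=> t; apply: cdiff_ccont; apply: (@cdiff_sum _ n (fun k w => z ^+ k * (f (cexp w) * (cexp w)^-1 ^+ k))).
  by move=> k; apply: cdiffM; [exact: cdiff_cst|exact: cdiff_fexp].
- by move=> t; exact: cZ.
rewrite (@vint_sum n (fun k w => z ^+ k * (f (cexp w) * (cexp w)^-1 ^+ k))); last first.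
  by move=> k t; exact: cZ.
rewrite vintZ//; congr (_ + _).
apply: eq_bigr => k _; rewrite vintZ//.
by rewrite -(acoefE _ s)//; ring.
Qed.

Lemma vint_kern_rem f M n : ent1 f -> (forall t, nc (f (cexp (s +i* t))) <= M) ->
  nc (z ^+ n * vint (fun w => f (cexp w) * (cexp w)^-1 ^+ n * kern z w) s) <=
  2 * pi * (4 * M * (nc z / expR s) ^+ n).
Proof.
move=> hf hM.
have := @vint_le (fun w => f (cexp w) * (cexp w)^-1 ^+ n * kern z w) s (M * (expR s ^+ n)^-1 * 2).
move=> h; rewrite ncM ncX; apply: (le_trans (ler_wpM2l _ (h _ _))).
- by rewrite exprn_ge0// nc_ge0.
- move=> t; apply: ccontM; apply: cdiff_ccont; first exact: cdiff_fexp.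
  exact: cdiff_kern.
- move=> t; rewrite ncM; apply: ler_pM; rewrite ?nc_ge0//; last exact: kern_le.
  by rewrite ncM exprVn_nc /= ler_wpM2r// invr_ge0 exprn_ge0// expR_ge0.
rewrite exprMn exprVn; move: (pi : R) => p.
by rewrite le_eqVlt; apply/orP; left; apply/eqP; ring.
Qed.

Lemma vint_kern : vint (kern z) s = (2 * pi)%:C.
Proof.
have ent_1 : ent1 (fun=> 1 : C) by move=> w; exact: cdiff_cst.
have a0 : acoef (fun=> 1) 0 = 1.
  apply: (@mulfI _ (2 * pi)%:C); first by rewrite -nc_gt0 ncR normr_gt0 gt_eqF// twopi_gt0.
  by rewrite (acoefE _ 0)// -[RHS](vint_cst _ 0); apply: eq_vint => t; rewrite expr0 mulr1.
have ak k : acoef (fun=> 1) k.+1 = 0.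
  apply/eqP; rewrite -nc_eq0; apply/eqP/le_anti; rewrite nc_ge0 andbT.
  apply/ler_addgt0Pr => e e0; rewrite add0r.
  have r0 : 0 < 1 + 2 / e by rewrite ltr_wpDr// divr_ge0// ltW.
  apply: (le_trans (acoef_le k.+1 (M := 1) ent_1 r0 _)) => [z' _|]; first by rewrite nc1.
  rewrite mulr1 ler_pdivrMr ?exprn_gt0//.
  apply: (@le_trans _ _ (e * (1 + 2 / e))).
    by rewrite mulrDr mulr1 mulrCA mulfV ?gt_eqF// mulr1 lerDr ltW.
  rewrite ler_pM2l// exprS ler_peMr ?(ltW r0)//; apply: exprn_ege1.
  by rewrite lerDl divr_ge0// ltW.
apply/subr0_eq/eqP; rewrite -nc_eq0; apply/eqP/le_anti; rewrite nc_ge0 andbT.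
apply/ler_addgt0Pr => e e0; rewrite add0r.
have [n hn] := half_pow_small (8 * pi) e0.
have E := vint_kern_geo n.+1 ent_1.
have F := @vint_kern_rem (fun=> 1) 1 n.+1 ent_1 (fun _ => etrans (congr1 (fun x => x <= 1) (@nc1 R)) (lexx 1)).
move: E; rewrite (_ : vint (fun w => 1 * kern z w) s = vint (kern z) s); last first.
  by apply: eq_vint => t; rewrite mul1r.
rewrite big_ord_recl a0 expr0 mulr1 big1 ?addr0 ?mulr1; last by move=> k _; rewrite ak mul0r.
move=> ->; rewrite addrAC subrr add0r; apply: (le_trans F).
apply: le_trans hn; rewrite mulr1.
rewrite (_ : 2 * pi * _ = 8 * pi * (nc z / expR s) ^+ n.+1); last first.
  by move: (pi : R) => p; ring.
rewrite ler_wpM2l//; first by have := pi_gt0 R; lra.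
have q2 : nc z / expR s <= 2^-1 by rewrite ler_pdivrMr ?expR_gt0// mulrC.
have q0 : 0 <= nc z / expR s by rewrite divr_ge0 ?nc_ge0 ?expR_ge0.
apply: (@le_trans _ _ (2^-1 ^+ n.+1)); first by rewrite lerXn2r// nnegrE invr_ge0.
by rewrite exprS ler_piMl ?exprn_ge0 ?invr_ge0// invf_le1// ler1n.
Qed.

Lemma cauchy_formula f : ent1 f ->
  vint (fun w => f (cexp w) * kern z w) s = (2 * pi)%:C * f z.
Proof.
move=> hf; have zs2 : nc z != expR s by rewrite lt_eqF.
have := cauchy_quotient hf zs2.
rewrite (_ : vint _ s = vint (fun w => f (cexp w) * kern z w - f z * kern z w) s); last first.
  by apply: eq_vint => t; rewrite /kern mulrBl.
have ck t : ccont (kern z) (s +i* t) by apply: cdiff_ccont; exact: cdiff_kern.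
rewrite vintB; last 2 first.
- move=> t; apply: ccontM => //; apply: cdiff_ccont.
  by apply: cdiff_comp; [exact: cdiff_cexp|exact: hf].
- by move=> t; apply: ccontM => //; apply: cdiff_ccont; exact: cdiff_cst.
by rewrite vintZ// vint_kern => /subr0_eq ->; rewrite mulrC.
Qed.

End Kernel.

(** The geometric expansion of the Cauchy kernel, truncated. Power series are used in
this form, with a finite sum and an explicit remainder. *)
Theorem taylor f z r M n : ent1 f -> 0 < r -> nc z <= r / 2 ->
  (forall u, nc u = r -> nc (f u) <= M) ->
  nc (f z - \sum_(k < n) acoef f k * z ^+ k) <= 4 * M * (nc z / r) ^+ n.
Proof.
move=> hf r0 zr hM; rewrite -(ler_pM2l twopi_gt0).
have rE : expR (ln r) = r by rewrite lnK.
rewrite -rE in zr.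
have -> x : 2 * pi * nc x = nc ((2 * pi)%:C * x) :> R.
  by rewrite ncM ncR ger0_norm// ltW// twopi_gt0.
rewrite mulrBr -(cauchy_formula zr hf) (vint_kern_geo zr n hf) addrAC subrr add0r.
have := @vint_kern_rem z (ln r) zr f M n hf; rewrite rE; apply.
by move=> t; apply: hM; rewrite nc_cexp /= rE.
Qed.

Lemma acoef0 f : ent1 f -> acoef f 0 = f 0.
Proof.
move=> hf; have [M hM] := bound_disc (fun w => cdiff_ccont (hf w)) 1.
have := @taylor f 0 1 M 1 hf ltr01; rewrite nc0 mul0r expr1 mulr0.
move=> /(_ (ltW _)) h; apply/esym/subr0_eq/eqP; rewrite -nc_eq0.
apply/eqP/le_anti; rewrite nc_ge0 andbT.
have := h _; rewrite big_ord_recl big_ord0 expr0 mulr1 addr0; apply.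
- by rewrite divr_gt0.
- by move=> u hu; apply: hM; rewrite hu.
Qed.

End CircleMeans.

(** * Limits and parameter integrals of entire functions *)

Section Consequences.
Context {R : realType}.
Notation C := R[i].
Implicit Types (f g : C -> C).

Lemma ent1_shift f w : ent1 f -> ent1 (fun h => f (w + h)).
Proof.
move=> hf u; apply: cdiff_comp (hf _).
by apply: cdiffD; [exact: cdiff_cst|exact: cdiff_id].
Qed.

Lemma ent1_lip f w r M h : ent1 f -> 0 < r -> nc h <= r / 2 ->
  (forall u, nc u = r -> nc (f (w + u)) <= M) ->
  nc (f (w + h) - f w) <= 4 * M / r * nc h.
Proof.
move=> hf r0 hr hM; have hf' := ent1_shift w hf.
have := taylor 1 hf' r0 hr hM.
rewrite big_ord_recl big_ord0 expr0 mulr1 addr0 acoef0// addr0 expr1.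
by move/le_trans; apply; rewrite le_eqVlt; apply/orP; left; apply/eqP; ring.
Qed.

Lemma ent1_second f w r M h : ent1 f -> 0 < r -> nc h <= r / 2 ->
  (forall u, nc u = r -> nc (f (w + u)) <= M) ->
  nc (f (w + h) - f w - acoef (fun u => f (w + u)) 1 * h) <= 4 * M / r ^+ 2 * nc h ^+ 2.
Proof.
move=> hf r0 hr hM; have hf' := ent1_shift w hf.
have := taylor 2 hf' r0 hr hM.
rewrite !big_ord_recl big_ord0 expr0 mulr1 addr0 acoef0// addr0 expr1 opprD addrA.
move/le_trans; apply; rewrite le_eqVlt; apply/orP; left; apply/eqP.
by rewrite expr_div_n; ring.
Qed.

Lemma ent1_quot f w r M h h' : ent1 f -> 0 < r ->
  (forall u, nc u = r -> nc (f (w + u)) <= M) ->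
  h != 0 -> h' != 0 -> nc h <= r / 2 -> nc h' <= r / 2 ->
  nc ((f (w + h) - f w) / h - (f (w + h') - f w) / h') <= 4 * M / r ^+ 2 * (nc h + nc h').
Proof.
move=> hf r0 hM h0 h'0 hr hr'; pose a := acoef (fun u => f (w + u)) 1.
have K k : k != 0 -> nc k <= r / 2 -> nc ((f (w + k) - f w) / k - a) <= 4 * M / r ^+ 2 * nc k.
  move=> k0 kr; rewrite -[X in _ - X](mulfK k0) -mulrBl ncM ncV.
  have kp : 0 < nc k by rewrite nc_gt0.
  rewrite ler_pdivrMr// -[leRHS]mulrA -[nc k * nc k]expr2; exact: ent1_second.
rewrite -(subrKA a) mulrDr; apply: (le_trans (ncD _ _)).
by apply: lerD; [exact: K|rewrite nc_distC; exact: K].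
Qed.

(** The limit is the supremum of the lower bounds [u i - d i]. No order on the index
type is involved, so the lemma also serves for limits at a point. *)
Lemma real_net (A : Type) (u d : A -> R) (i0 : A) :
  (forall i j, `|u i - u j| <= d i + d j) -> exists l, forall i, `|u i - l| <= d i.
Proof.
move=> h; pose S := range (fun i => u i - d i).
have ub j : ubound S (u j + d j).
  by move=> _ [i _ <-]; have := h i j; rewrite ler_norml; lra.
have hs : has_sup S by split; [exists (u i0 - d i0); exists i0|exists (u i0 + d i0); exact: ub].
exists (sup S) => i; rewrite ler_norml.
have h1 : u i - d i <= sup S by apply: ub_le_sup; [case: hs|exists i].
have h2 : sup S <= u i + d i by apply: ge_sup; [case: hs|exact: ub].
lra.
Qed.

Lemma complex_net (A : Type) (u : A -> C) (d : A -> R) (i0 : A) :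
  (forall i j, nc (u i - u j) <= d i + d j) -> exists l, forall i, nc (u i - l) <= 2 * d i.
Proof.
move=> h.
have [a ha] : exists l, forall i, `|Re (u i) - l| <= d i.
  apply: real_net => // i j; apply: le_trans (h i j).
  by rewrite -ReN -ReD; exact: Re_le_nc.
have [b hb] : exists l, forall i, `|Im (u i) - l| <= d i.
  apply: real_net => // i j; apply: le_trans (h i j).
  by rewrite -ImN -ImD; exact: Im_le_nc.
exists (a +i* b) => i; apply: (le_trans (nc_le_ReIm _)).
by rewrite !ReIm /= mulr_natl mulr2n; apply: lerD.
Qed.

(** Difference quotients that are Cauchy at a linear rate converge; this turns complex
differentiability into a condition that survives limits and integration. *)
Lemma cdiff_quot g w M r : 0 < r ->
  (forall h h', h != 0 -> h' != 0 -> nc h <= r -> nc h' <= r ->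
    nc ((g (w + h) - g w) / h - (g (w + h') - g w) / h') <= M * (nc h + nc h')) ->
  cdiff g w.
Proof.
move=> r0 H.
pose A := {h : C | h != 0 /\ nc h <= r}.
have i0 : A.
  exists r%:C; rewrite -nc_gt0 ncR gtr0_norm//.
have [a ha] : exists a, forall i : A, nc ((g (w + sval i) - g w) / sval i - a) <= 2 * (M * nc (sval i)).
  apply: (complex_net (u := fun i : A => (g (w + sval i) - g w) / sval i)) => //.
  move=> [h [h0 hr]] [h' [h'0 hr']] /=; rewrite -mulrDr; exact: H.
exists a => e e0.
have d0 : 0 < 2 * `|M| + 1 by rewrite ltr_wpDl// mulr_ge0.
exists (Num.min r (e / (2 * `|M| + 1))); first by rewrite lt_min r0 divr_gt0.
move=> h; rewrite le_min => /andP[hr he].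
have [->|h0] := eqVneq h 0; first by rewrite addr0 subrr mulr0 subrr nc0 mulr0.
have := ha (exist _ h (conj h0 hr)) => /= K.
rewrite (_ : _ - _ - _ = ((g (w + h) - g w) / h - a) * h); last first.
  by rewrite mulrBl divfK.
rewrite ncM ler_wpM2r ?nc_ge0//; apply: (le_trans K).
move: he; rewrite ler_pdivlMr// => he; apply: le_trans he.
have := nc_ge0 h; have := ler_norm M; nra.
Qed.

(** By the second-order bounds, which are uniform in [n], the difference quotients of
the limit are Cauchy at a linear rate. *)
Lemma ent1_lim (F : nat -> C -> C) g : (forall n, ent1 (F n)) ->
  (forall w e, 0 < e -> exists N, forall n, (N <= n)%N -> nc (F n w - g w) <= e) ->
  (forall rho, exists M, forall n w, nc w <= rho -> nc (F n w) <= M) -> ent1 g.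
Proof.
move=> hF hlim hM w.
have [M {}hM] := hM (nc w + 2).
apply: (@cdiff_quot _ _ (4 * M / 2 ^+ 2) 1) => // h h' h0 h'0 hr hr'.
apply/ler_addgt0Pr => e e0.
have hp : 0 < nc h by rewrite nc_gt0.
have hp' : 0 < nc h' by rewrite nc_gt0.
pose e1 := e / 4 * nc h; pose e2 := e / 4 * nc h'.
have e10 : 0 < e1 by rewrite mulr_gt0// divr_gt0.
have e20 : 0 < e2 by rewrite mulr_gt0// divr_gt0.
have [N1 L1] := hlim (w + h) _ e10.
have [N2 L2] := hlim w _ e10.
have [N3 L3] := hlim (w + h') _ e20.
have [N4 L4] := hlim w _ e20.
pose n := (N1 + N2 + N3 + N4)%N.
have n1 : (N1 <= n)%N by rewrite /n -!addnA leq_addr.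
have n2 : (N2 <= n)%N by rewrite /n addnAC -!addnA addnCA leq_addr.
have n3 : (N3 <= n)%N by rewrite /n addnAC leq_addl.
have n4 : (N4 <= n)%N by rewrite /n leq_addl.
have Q := @ent1_quot (F n) w 2 M h h' (hF n) (ltr0n _ 2).
have {}Q : nc ((F n (w + h) - F n w) / h - (F n (w + h') - F n w) / h') <= 4 * M / 2 ^+ 2 * (nc h + nc h').
  apply: Q => //; last 2 first.
  - by rewrite divff.
  - by rewrite divff.
  by move=> u hu; apply: hM; apply: (le_trans (ncD _ _)); rewrite hu.
have D (k : C) (E : R) (a b c d : C) : k != 0 -> nc (a - b) <= E * nc k -> nc (c - d) <= E * nc k ->
   nc ((b - d) / k - (a - c) / k) <= 2 * E.
  move=> k0 h1 h2; have kp : 0 < nc k by rewrite nc_gt0.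
  rewrite -mulrBl ncM ncV ler_pdivrMr//.
  rewrite (_ : _ - _ = (c - d) - (a - b)); last by ring.
  apply: (le_trans (ncB _ _)); lra.
have D1 := D h _ _ _ _ _ h0 (L1 n n1) (L2 n n2).
have D2 := D h' _ _ _ _ _ h'0 (L3 n n3) (L4 n n4).
set A := _ / h in D1 *; set A' := _ / h' in D2 *.
set B := _ / h in D1 Q; set B' := _ / h' in D2 Q.
have -> : A - A' = (B - B') + (A - B) - (A' - B') by ring.
apply: (le_trans (ncB _ _)).
have := ncD (B - B') (A - B); lra.
Qed.

Section ParameterIntegral.
Context d (T : measurableType d) (mu : {measure set T -> \bar R}).

(** The linear Cauchy rate of the difference quotients is integrable in the
parameter. *)
Lemma ent1_cint (D : set T) (phi : C -> T -> C) : measurable D ->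
  (forall t, D t -> ent1 (phi ^~ t)) ->
  (forall w, cmeas D (phi w)) ->
  (forall rho, exists M : T -> R, mu.-integrable D (EFin \o M) /\
     forall w t, nc w <= rho -> D t -> nc (phi w t) <= M t) ->
  ent1 (fun w => cint mu D (phi w)).
Proof.
move=> mD hphi hm hM w.
have intg u : cintegrable mu D (phi u).
  have [M [iM bM]] := hM (nc u); apply: (cintegrable_le mD (hm u) iM) => t Dt.
  exact: bM.
have [M [iM bM]] := hM (nc w + 2).
apply: (@cdiff_quot _ _ (2 * \int[mu]_(t in D) M t) 1) => // h h' h0 h'0 hr hr'.
rewrite -!cintB//.
have E (k : C) : cint mu D (fun t => phi (w + k) t - phi w t) / k =
    cint mu D (fun t => k^-1 * (phi (w + k) t - phi w t)).
  by rewrite cintZ 1?mulrC//; exact: cintegrableB.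
have iE (k : C) : cintegrable mu D (fun t => k^-1 * (phi (w + k) t - phi w t)).
  by apply: cintegrableZ => //; exact: cintegrableB.
rewrite !E -cintB//.
have iM' : mu.-integrable D (EFin \o (fun t => (nc h + nc h') * M t)).
  rewrite (_ : _ \o _ = fun t => ((nc h + nc h')%:E * (M t)%:E)%E) ?integrableZl//.
apply: (le_trans (cint_le (M := fun t => (nc h + nc h') * M t) mD _ iM' _)).
- exact: cintegrableB.
- move=> t Dt.
  have := @ent1_quot (phi ^~ t) w 2 (M t) h h' (hphi t Dt) (ltr0n _ 2).
  rewrite divff// (_ : 4 * M t / 2 ^+ 2 = M t); last by field.
  move=> Q; rewrite ![_^-1 * _]mulrC (mulrC (nc h + nc h')); apply: Q => //.
  by move=> u hu; apply: bM => //; apply: (le_trans (ncD _ _)); rewrite hu.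
rewrite RintegralZl//.
by rewrite le_eqVlt; apply/orP; left; apply/eqP; ring.
Qed.

End ParameterIntegral.

End Consequences.

(** * Entire functions of several variables *)

Section SeveralVariables.
Context {R : realType} {d : nat}.
Notation C := R[i].
Notation V := 'rV[C]_d.
Implicit Types (f : cfun R d) (z h : V).

Let VN : normedModType C := 'rV[C]_d.

Definition cn z : R := \big[Order.max/0]_(j < d) nc (z 0 j).

Lemma cn_ge0 z : 0 <= cn z.
Proof. by rewrite /cn; elim/big_ind : _ => // [x y hx hy|i _]; rewrite ?le_max ?hx ?nc_ge0. Qed.

Lemma le_cn z j : nc (z 0 j) <= cn z.
Proof. exact: le_bigmax. Qed.

Lemma cn_leP z M : 0 <= M -> (forall j, nc (z 0 j) <= M) -> cn z <= M.
Proof. by move=> M0 hM; apply: bigmax_le. Qed.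

Lemma cn_ltP z M : 0 < M -> (forall j, nc (z 0 j) < M) -> cn z < M.
Proof. by move=> M0 hM; apply: bigmax_lt. Qed.

Lemma cn0 : cn 0 = 0.
Proof. by apply/le_anti; rewrite cn_ge0 andbT cn_leP// => j; rewrite mxE nc0. Qed.

Lemma cnD z h : cn (z + h) <= cn z + cn h.
Proof.
apply: cn_leP; first by rewrite addr_ge0 ?cn_ge0.
by move=> j; rewrite mxE (le_trans (ncD _ _))// lerD ?le_cn.
Qed.

Lemma cnZ (c : C) z : cn (c *: z) <= nc c * cn z.
Proof.
apply: cn_leP; first by rewrite mulr_ge0 ?cn_ge0 ?nc_ge0.
by move=> j; rewrite mxE ncM ler_wpM2l ?nc_ge0 ?le_cn.
Qed.

Lemma cn_gt0 z : z != 0 -> 0 < cn z.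
Proof.
move=> z0; rewrite lt_neqAle cn_ge0 andbT eq_sym; apply: contraNneq z0 => h.
apply/eqP/rowP => j; rewrite mxE; apply/eqP; rewrite -nc_eq0; apply/eqP/le_anti.
by rewrite nc_ge0 -h le_cn.
Qed.

Lemma norm_cn (h : V) : `|h| = (cn h)%:C.
Proof.
have r : `|h| = (Re `|h|)%:C by rewrite RRe_real// ger0_real.
rewrite r; congr (_%:C).
have K e : 0 < e -> (Re `|h| < e) = (cn h < e).
  move=> e0; have e0' : 0 < e%:C by rewrite ltcR.
  have <- : (`|h| < e%:C) = (Re `|h| < e) by rewrite {1}r ltcR.
  have := congr1 (fun b => b (0 : V) e%:C h) (@mx_norm_ball C 1 d).
  rewrite /ball_ /= sub0r normrN => E; apply/idP/idP.
    rewrite -E => -[_ hb]; apply: cn_ltP => // j.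
    by have := hb 0 j; rewrite /ball /= mxE sub0r normrN ncE ltcR.
  move=> hc; rewrite -E; split => // i j; rewrite ord1 /ball /= mxE sub0r normrN ncE ltcR.
  exact: le_lt_trans (le_cn _ _) hc.
have a0 : 0 <= Re `|h| by rewrite -ler0c -r.
apply/le_anti/andP; split; apply/ler_addgt0Pr => e e0; apply: ltW.
  by rewrite K; [rewrite ltrDl|rewrite ltr_wpDl ?cn_ge0].
by rewrite -K; [rewrite ltrDl|rewrite ltr_wpDl].
Qed.

Lemma nbhsV_le (P : set VN) : nbhs (0 : VN) P <->
  exists2 r : R, 0 < r & forall y, cn y <= r -> P y.
Proof.
split.
  move=> /nbhs_ballP[e /= /posC[e0 ->] he].
  exists (Re e / 2); first by rewrite divr_gt0.
  move=> y hy; apply: he; rewrite -ball_normE /= sub0r normrN norm_cn ltcR.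
  by lra.
move=> [r r0 hr]; apply/nbhs_ballP; exists r%:C => /=; first by rewrite ltcR.
move=> y; rewrite -ball_normE /= sub0r normrN norm_cn ltcR => hy; apply: hr.
exact: ltW.
Qed.

(** Holomorphy on complex lines together with local boundedness: the form in which
entire functions are constructed and used. *)
Definition holo f := (forall z v, ent1 (fun s : C => f (z + s *: v))) /\
  (forall z, exists r M, 0 < r /\ forall h, cn h <= r -> nc (f (z + h)) <= M).

Lemma entire_holo f : entire f -> holo f.
Proof.
move=> hf; split.
  move=> z v w; apply/cdiffP.
  have E : differentiable (fun s : C^o => z + s *: v : V) (w : C^o).
    apply: differentiableD; first exact: differentiable_cst.
    exact: differentiableZl.
  exact: (differentiable_comp E (hf _)).
move=> z.
have := diff_epsP f z => -[/(_ (hf z)) [L cL hL] _].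
have /nbhsV_le[r1 r10 h1] := hL 1 ltr01.
have F0 : Filter (nbhs (0 : VN)) by exact: nbhs_filter.
have := cL 0; rewrite /continuous_at => /(@cvgrPdist_le C C^o VN (nbhs (0 : VN)) F0 (L : VN -> C^o) (L 0)).
move=> /(_ 1 ltr01) /nbhsV_le[r2 r20 h2].
exists (Num.min r1 r2), (nc (f z) + 1 + r1); split; first by rewrite lt_min r10.
move=> h; rewrite le_min => /andP[hr1 hr2].
have := h1 h hr1; rewrite mul1r norm_cn ncE lecR (addrC h) => k1.
have := h2 h hr2; rewrite linear0 sub0r normrN ncE => k2.
have {}k2 : nc (L h) <= 1 by rewrite -lecR.
rewrite (_ : f (z + h) = f z + L h + (f (z + h) - f z - L h)); last by ring.
apply: (le_trans (ncD _ _)); apply: lerD; last by apply: le_trans hr1.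
by apply: (le_trans (ncD _ _)); rewrite lerD2l.
Qed.

Lemma holo_lip f z r M p a : holo f -> 0 < r ->
  (forall h, cn h <= r -> nc (f (z + h)) <= M) -> cn p <= r / 2 -> cn a <= r / 4 ->
  nc (f (z + p + a) - f (z + p)) <= 8 * M / r * cn a.
Proof.
move=> [hl _] r0 hM hp ha.
have [->|a0] := eqVneq a 0; first by rewrite addr0 subrr nc0 cn0 mulr0.
have ap := cn_gt0 a0.
pose rho := r / 2 / cn a.
have rho0 : 0 < rho by rewrite !divr_gt0.
have := @ent1_lip R _ 0 rho M 1 (hl (z + p) a) rho0.
rewrite nc1 scale0r addr0 add0r scale1r mulr1 => H.
have {}H : nc (f (z + p + a) - f (z + p)) <= 4 * M / rho.
  apply: H.
  - by rewrite ler_pdivlMr// mul1r ler_pdivlMr//; lra.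
  - move=> u hu; rewrite add0r -addrA; apply: hM; apply: (le_trans (cnD _ _)).
    have := cnZ u a; rewrite hu /rho divfK ?gt_eqF//; lra.
apply: (le_trans H); rewrite le_eqVlt; apply/orP; left; apply/eqP.
by rewrite /rho; field; rewrite !gt_eqF.
Qed.

(** The one-variable Lipschitz estimate, applied once in each direction. *)
Lemma holo_mixed f z r M a b : holo f -> 0 < r ->
  (forall h, cn h <= r -> nc (f (z + h)) <= M) -> cn a <= r / 4 -> cn b <= r / 4 ->
  nc (f (z + b + a) - f (z + b) - (f (z + a) - f z)) <= 64 * M / r ^+ 2 * (cn a * cn b).
Proof.
move=> hf r0 hM ha hb; have [hl _] := hf.
have [->|b0] := eqVneq b 0; first by rewrite addr0 subrr nc0 cn0 !mulr0.
have bp := cn_gt0 b0.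
pose rho := r / 2 / cn b.
have rho0 : 0 < rho by rewrite !divr_gt0.
have hg : ent1 (fun s : C => f (z + a + s *: b) - f (z + s *: b)).
  by move=> w; apply: cdiffB; apply: hl.
have := @ent1_lip R _ 0 rho (8 * M / r * cn a) 1 hg rho0.
rewrite nc1 scale0r !addr0 add0r scale1r mulr1 => H.
rewrite (addrAC z b a).
have {}H : nc (f (z + a + b) - f (z + b) - (f (z + a) - f z)) <= 4 * (8 * M / r * cn a) / rho.
  apply: H.
  - by rewrite ler_pdivlMr// mul1r ler_pdivlMr//; lra.
  - move=> u hu; rewrite add0r (addrAC z); apply: holo_lip => //.
    by have := cnZ u b; rewrite hu /rho divfK ?gt_eqF.
apply: (le_trans H); rewrite le_eqVlt; apply/orP; left; apply/eqP.
by rewrite /rho; field; rewrite !gt_eqF.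
Qed.

Lemma small_quadratic (c : C) (K r : R) : 0 < r ->
  (forall s : C, nc s <= r -> nc (s * c) <= K * nc s ^+ 2) -> c = 0.
Proof.
move=> r0 h; apply/eqP; rewrite -nc_eq0; apply/eqP/le_anti; rewrite nc_ge0 andbT.
apply/ler_addgt0Pr => e e0; rewrite add0r.
have K0 : 0 < `|K| + 1 by rewrite ltr_wpDl.
pose s := Num.min r (e / (`|K| + 1)).
have s0 : 0 < s by rewrite lt_min r0 divr_gt0.
have := h s%:C; rewrite ncM ncR gtr0_norm// => /(_ _)/wrap[]; first by rewrite ge_min lexx.
rewrite expr2 mulrA [_ * nc c]mulrC ler_pM2r// => hc; apply: (le_trans hc).
have : s * (`|K| + 1) <= e by rewrite -ler_pdivlMr// ge_min lexx orbT.
have := ler_norm K; nra.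
Qed.

(** The derivatives along lines form a linear map because second differences are
quadratically small, by [holo_mixed]. *)
Lemma holo_entire f : holo f -> entire f.
Proof.
move=> hf z; have [hl hb] := hf; have [r [M [r0 hM]]] := hb z.
have M0 : 0 <= M by apply: le_trans (hM 0 _); rewrite ?nc_ge0// cn0 ltW.
pose D v := acoef (fun s : C => f (z + s *: v)) 1.
have E0 h : (fun u : C => f (z + (0 + u) *: h)) = (fun u : C => f (z + u *: h)).
  by apply/funext => u; rewrite add0r.
have D0 : D 0 = 0.
  apply: (@small_quadratic _ (4 * nc (f z)) (1 / 2)); first by rewrite divr_gt0.
  move=> s hs; have := @ent1_second R (fun s : C => f (z + s *: 0)) 0 1 (nc (f z)) s (hl z 0) ltr01 hs.
  rewrite E0 !scaler0 subrr sub0r ncN => H.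
  rewrite mulrC; apply: (le_trans (H _)); first by move=> u _; rewrite scaler0 addr0.
  by rewrite expr1n divr1.
have Dle h : nc (D h) <= 2 * M / r * cn h.
  have [->|h0] := eqVneq h 0; first by rewrite D0 nc0 cn0 mulr0.
  have hp := cn_gt0 h0; pose rho := r / cn h.
  have rho0 : 0 < rho by rewrite divr_gt0.
  have H := @acoef_le R _ 1 rho M (hl z h) rho0.
  apply: (le_trans (H _)).
    move=> u hu; apply: hM; apply: (le_trans (cnZ _ _)).
    by rewrite hu /rho divfK ?gt_eqF.
  have -> : 2 * M / rho ^+ 1 = 2 * M / r * cn h; last by [].
  by rewrite /rho; field; rewrite !gt_eqF.
have Ds (s : C) h : nc s * cn h <= r / 2 ->
    nc (f (z + s *: h) - f z - s * D h) <= 4 * M / r ^+ 2 * (nc s * cn h) ^+ 2.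
  move=> hs; have [->|h0] := eqVneq h 0.
    by rewrite scaler0 addr0 subrr D0 mulr0 subr0 nc0 cn0 mulr0 expr0n mulr0.
  have hp := cn_gt0 h0; pose rho := r / cn h.
  have rho0 : 0 < rho by rewrite divr_gt0.
  have H := @ent1_second R _ 0 rho M s (hl z h) rho0.
  rewrite E0 scale0r addr0 add0r in H.
  have {}H : nc (f (z + s *: h) - f z - D h * s) <= 4 * M / rho ^+ 2 * nc s ^+ 2.
    apply: H.
    - by rewrite /rho mulrAC ler_pdivlMr.
    - move=> u hu; rewrite add0r; apply: hM; apply: (le_trans (cnZ _ _)).
      by rewrite hu /rho divfK ?gt_eqF.
  rewrite (mulrC s); apply: (le_trans H).
  have -> : 4 * M / rho ^+ 2 * nc s ^+ 2 = 4 * M / r ^+ 2 * (nc s * cn h) ^+ 2; last by [].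
  by rewrite /rho; field; rewrite !gt_eqF.
have second h : cn h <= r / 2 -> nc (f (z + h) - f z - D h) <= 4 * M / r ^+ 2 * cn h ^+ 2.
  by have := Ds 1 h; rewrite nc1 !mul1r scale1r.
pose K := 4 * M / r ^+ 2.
have K0 : 0 <= K by rewrite /K divr_ge0 ?mulr_ge0 ?exprn_ge0 ?(ltW r0).
(* Both sides are first-order parts of the same increments: their difference is
quadratic in s, hence zero. The same holds for additivity below. *)
have DZ (c : C) h : D (c *: h) = c * D h.
  apply/subr0_eq.
  have n1 : 0 < 2 * ((nc c + 1) * (cn h + 1)) by rewrite !mulr_gt0// ltr_wpDl ?nc_ge0 ?cn_ge0.
  apply: (@small_quadratic _ (2 * K * ((nc c + 1) * (cn h + 1)) ^+ 2) (r / (2 * ((nc c + 1) * (cn h + 1))))).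
    by rewrite divr_gt0.
  move=> s; rewrite ler_pdivlMr// => hs.
  have c0 := nc_ge0 c; have h0 := cn_ge0 h; have s0 := nc_ge0 s.
  have B1 : nc s * cn (c *: h) <= nc s * ((nc c + 1) * (cn h + 1)).
    by rewrite ler_wpM2l// (le_trans (cnZ _ _))//; nra.
  have B2 : nc (s * c) * cn h <= nc s * ((nc c + 1) * (cn h + 1)).
    by rewrite ncM -mulrA ler_wpM2l//; nra.
  have E1 := Ds s (c *: h) (le_trans B1 _).
  have E2 := Ds (s * c) h (le_trans B2 _).
  have Q : nc s * ((nc c + 1) * (cn h + 1)) <= r / 2 by lra.
  move: (E1 Q) (E2 Q); rewrite scalerA -/K => {}E1 {}E2.
  have RG (a b e g : C) : s * (e - c * g) = (a - b - s * c * g) - (a - b - s * e) by ring.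
  rewrite (RG (f (z + (s * c) *: h)) (f z)).
  apply: (le_trans (ncB _ _)).
  have S1 : (nc s * cn (c *: h)) ^+ 2 <= (nc s * ((nc c + 1) * (cn h + 1))) ^+ 2.
    by rewrite lerXn2r// nnegrE ?mulr_ge0 ?cn_ge0 ?addr_ge0.
  have S2 : (nc (s * c) * cn h) ^+ 2 <= (nc s * ((nc c + 1) * (cn h + 1))) ^+ 2.
    by rewrite lerXn2r// nnegrE ?mulr_ge0 ?nc_ge0 ?addr_ge0.
  apply: (le_trans (lerD (le_trans E2 (ler_wpM2l K0 S2)) (le_trans E1 (ler_wpM2l K0 S1)))).
  by rewrite le_eqVlt; apply/orP; left; apply/eqP; ring.
have DD u v : D (u + v) = D u + D v.
  apply/subr0_eq.
  have u0 := cn_ge0 u; have v0 := cn_ge0 v.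
  pose N := cn u + cn v + 1.
  have n1 : 0 < 4 * N by rewrite /N; lra.
  apply: (@small_quadratic _ (19 * K * N ^+ 2) (r / (4 * N))).
    by rewrite divr_gt0.
  move=> s; rewrite ler_pdivlMr// => hs.
  have s0 := nc_ge0 s.
  have N0 : 0 <= N by rewrite /N; lra.
  have Bu : nc s * cn u <= nc s * N by rewrite ler_wpM2l// /N; lra.
  have Bv : nc s * cn v <= nc s * N by rewrite ler_wpM2l// /N; lra.
  have Buv : nc s * cn (u + v) <= nc s * N.
    by rewrite ler_wpM2l// (le_trans (cnD _ _))// /N; lra.
  have Q : nc s * N <= r / 4 by lra.
  have Q2 : nc s * N <= r / 2 by lra.
  have E1 := Ds s u (le_trans Bu Q2).
  have E2 := Ds s v (le_trans Bv Q2).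
  have E3 := Ds s (u + v) (le_trans Buv Q2).
  have cu : cn (s *: u) <= nc s * N := le_trans (cnZ _ _) Bu.
  have cv : cn (s *: v) <= nc s * N := le_trans (cnZ _ _) Bv.
  have E4 := holo_mixed hf r0 hM (le_trans cu Q) (le_trans cv Q).
  have T0 : 0 <= nc s * N by rewrite mulr_ge0.
  have sq x : 0 <= x -> x <= nc s * N -> x ^+ 2 <= (nc s * N) ^+ 2.
    by move=> x0 hx; rewrite lerXn2r// nnegrE.
  have S1 := ler_wpM2l K0 (sq _ (mulr_ge0 s0 u0) Bu).
  have S2 := ler_wpM2l K0 (sq _ (mulr_ge0 s0 v0) Bv).
  have S3 := ler_wpM2l K0 (sq _ (mulr_ge0 s0 (cn_ge0 _)) Buv).
  have S4 : 64 * M / r ^+ 2 * (cn (s *: u) * cn (s *: v)) <= 16 * (K * (nc s * N) ^+ 2).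
    rewrite (_ : 64 * M / r ^+ 2 = 16 * K); last by rewrite /K; ring.
    by rewrite -mulrA ler_wpM2l// ler_wpM2l// expr2 ler_pM ?cn_ge0.
  have Euv : z + s *: (u + v) = z + s *: v + s *: u by rewrite scalerDr addrA addrAC.
  have RG (x a b o e g k : C) : s * (e - (g + k)) =
      x - a - (b - o) - (x - o - s * e) + (b - o - s * g) + (a - o - s * k) by ring.
  rewrite (RG (f (z + s *: v + s *: u)) (f (z + s *: v)) (f (z + s *: u)) (f z)).
  rewrite Euv in E3.
  apply: (le_trans (ncD _ _)); apply: (le_trans (lerD (ncD _ _) (lexx _))).
  apply: (le_trans (lerD (lerD (ncB _ _) (lexx _)) (lexx _))).
  rewrite -/K in E1 E2 E3.
  apply: (le_trans (lerD (lerD (lerD (le_trans E4 S4) (le_trans E3 S3)) (le_trans E1 S1)) (le_trans E2 S2))).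
  by rewrite le_eqVlt; apply/orP; left; apply/eqP; ring.
have linD : linear (D : V -> C^o) by move=> c u v; rewrite DD DZ.
pose Lm := GRing.isLinear.Build _ _ _ _ _ linD.
pose L : {linear V -> C^o} := HB.pack (D : V -> C^o) Lm.
apply/diff_epsP; exists L.
  have F0 y : Filter (nbhs (y : VN)) by exact: nbhs_filter.
  apply: bounded_linear_continuous; apply/linear_boundedP.
  near=> k => v; rewrite norm_cn ncE.
  apply: (@le_trans _ _ ((2 * M / r)%:C * (cn v)%:C)); first by rewrite -rmorphM /= lecR.
  rewrite ler_wpM2r ?ler0c ?cn_ge0//.
  near: k; apply: nbhs_pinfty_ge; by apply/complex_realP; exists (2 * M / r).
move=> e /posC[e0 ->]; apply/nbhsV_le.
have K1 : 0 < K + 1 by rewrite ltr_wpDl.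
exists (Num.min (r / 2) (Re e / (K + 1))); first by rewrite lt_min !divr_gt0.
move=> h; rewrite le_min => /andP[hr he].
rewrite norm_cn ncE -rmorphM /= lecR (addrC h); apply: (le_trans (second h hr)).
rewrite -/K expr2 mulrA ler_wpM2r ?cn_ge0//.
move: he; rewrite ler_pdivlMr//; have := cn_ge0 h; nra.
Unshelve. all: by end_near. Qed.

Lemma entireP f : entire f <-> holo f.
Proof. by split; [exact: entire_holo|exact: holo_entire]. Qed.

Lemma entire_line f z v : entire f -> ent1 (fun s : C => f (z + s *: v)).
Proof. by move=> /entire_holo[+ _]; apply. Qed.

Lemma entire_bounded f : entire f -> forall rho, exists M, forall z, cn z <= rho -> nc (f z) <= M.
Proof.
move=> hf rho; have [_ hb] := entire_holo hf.
pose B := [set v : 'rV[R]_d | forall i, `[(- rho)%R, rho]%classic (v 0 i)].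
have cB : compact B by apply: (@rV_compact _ _ (fun=> `[(- rho)%R, rho]%classic)) => i; exact: segment_compact.
have := compact_setX cB cB => /compact_near_coveringP.
move=> /(_ R (+oo_R) (fun M q => nc (f (complex_point q.1 q.2)) <= M) _).
case.
  move=> [x y] _ /=; have [r [M [r0 hM]]] := hb (complex_point x y).
  have r2 : 0 < r / 2 by rewrite divr_gt0.
  exists (ball (x, y) (r / 2), [set M' : R | M <= M']) => /=.
    split; first exact: nbhsx_ballx.
    by apply: nbhs_pinfty_ge; exact: num_real.
  move=> [[x' y'] M'] /= [[[_ bx] [_ by']] hM']; apply: le_trans hM'.
  have -> : complex_point x' y' = complex_point x y + (complex_point x' y' - complex_point x y).
    by rewrite addrC subrK.
  apply: hM; apply: cn_leP => [|j]; first exact: ltW.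
  rewrite !mxE; apply: (le_trans (nc_le_ReIm _)); rewrite !ReIm /=.
  have := bx 0 j; have := by' 0 j; rewrite /ball /= (distrC (y 0 j)) (distrC (x 0 j)).
  by move=> /ltW ? /ltW ?; lra.
move=> M [_ hM]; exists (M + 1) => z hz.
have := hM (M + 1); rewrite ltrDl => /(_ ltr01) /(_ (\row_j Re (z 0 j), \row_j Im (z 0 j))) /=.
have -> : complex_point (\row_j Re (z 0 j)) (\row_j Im (z 0 j)) = z.
  by apply/rowP => j; rewrite !mxE; case: (z 0 j).
apply; split => i; rewrite /= mxE in_itv /= -ler_norml (le_trans _ (le_trans (le_cn z i) hz))//.
  exact: Re_le_nc.
exact: Im_le_nc.
Qed.

(** On each line this is the one-variable statement, and the limit is locally
bounded. *)
Lemma entire_lim (F : nat -> cfun R d) (g : cfun R d) : (forall n, entire (F n)) ->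
  (forall z e, 0 < e -> exists N, forall n, (N <= n)%N -> nc (F n z - g z) <= e) ->
  (forall rho, exists M, forall n z, cn z <= rho -> nc (F n z) <= M) -> entire g.
Proof.
move=> hF hlim hb; apply/entireP; split.
  move=> z v; apply: (@ent1_lim R (fun n s => F n (z + s *: v))).
  - by move=> n; exact: entire_line.
  - by move=> w e e0; exact: hlim.
  - move=> rho; have [M hM] := hb (cn z + rho * cn v).
    exists M => n w hw; apply: hM; apply: (le_trans (cnD _ _)); rewrite lerD2l.
    by apply: (le_trans (cnZ _ _)); apply: (ler_wpM2r (cn_ge0 v) hw).
move=> z; have [M hM] := hb (cn z + 1).
exists 1, (M + 1); split=> // h hh.
have [N /(_ N (leqnn N)) hN] := hlim (z + h) 1 ltr01.
apply: (le_trans (nc_le_dist _ (F N (z + h)))); rewrite nc_distC; apply: lerD => //.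
by apply: hM; apply: (le_trans (cnD _ _)); rewrite lerD2l.
Qed.

End SeveralVariables.

(** * Lebesgue measure on tuples and the point estimate *)

Section TupleMeasure.
Context {R : realType}.
Local Notation mR := (measurableTypeR R).
Notation C := R[i].
Notation leb := (@lebesgue_measure R).

Definition pts (d : nat) : Type := (d.-tuple mR * d.-tuple mR)%type.

Notation lebp d := (@lebesgue_tuple R d \x @lebesgue_tuple R d)%E.

Definition pt (d : nat) (t : d.-tuple mR * d.-tuple mR) : 'rV[C]_d :=
  complex_point (real_point t.1) (real_point t.2).

Lemma ptE d t j : @pt d t 0 j = (tnth t.1 j : R) +i* (tnth t.2 j : R).
Proof. by rewrite !mxE. Qed.

Definition mesh (n : nat) (x : R) : int := Num.floor (x * 2 ^+ n).

Lemma mesh_le n (x : R) : (mesh n x)%:~R / 2 ^+ n <= x < (mesh n x + 1)%:~R / 2 ^+ n.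
Proof.
rewrite ler_pdivrMr ?exprn_gt0// ltr_pdivlMr ?exprn_gt0//.
by rewrite floor_le_tmp floorD1_gt.
Qed.

Lemma measurable_mesh n (k : int) : measurable [set x : mR | mesh n x = k].
Proof.
rewrite (_ : [set _ | _] = `[(k%:~R / 2 ^+ n)%R, ((k + 1)%:~R / 2 ^+ n)%R[%classic); last first.
  apply/seteqP; split=> [x /= <-|x /=]; first by rewrite in_itv /= mesh_le.
  rewrite in_itv /= ler_pdivrMr ?exprn_gt0// ltr_pdivlMr ?exprn_gt0// => /andP[h1 h2].
  by apply/floor_def; rewrite h1.
exact: measurable_itv.
Qed.

Definition meshv (d n : nat) (t : d.-tuple mR * d.-tuple mR) : d.-tuple int * d.-tuple int :=
  (map_tuple (mesh n) t.1, map_tuple (mesh n) t.2).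

Definition meshp (d n : nat) (k : d.-tuple int * d.-tuple int) : 'rV[C]_d :=
  \row_j ((tnth k.1 j)%:~R / 2 ^+ n +i* ((tnth k.2 j)%:~R / 2 ^+ n)).

Lemma measurable_meshv d n k : measurable [set t | @meshv d n t = k].
Proof.
rewrite (_ : [set _ | _] =
  (\bigcap_(j in [set: 'I_d]) ((fun t : d.-tuple mR * d.-tuple mR => tnth t.1 j) @^-1` [set x : mR | mesh n x = tnth k.1 j])) `&`
  (\bigcap_(j in [set: 'I_d]) ((fun t : d.-tuple mR * d.-tuple mR => tnth t.2 j) @^-1` [set x : mR | mesh n x = tnth k.2 j]))).
  apply: measurableI; apply: fin_bigcap_measurable => [|j _]; try exact: finite_finset;
    rewrite -[X in measurable X]setTI.
  - have m1 : measurable_fun setT (fun t : d.-tuple mR * d.-tuple mR => tnth t.1 j).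
      by apply: (measurableT_comp (measurable_tnth j)); exact: measurable_fst.
    by apply: m1 => //; exact: measurable_mesh.
  - have m1 : measurable_fun setT (fun t : d.-tuple mR * d.-tuple mR => tnth t.2 j).
      by apply: (measurableT_comp (measurable_tnth j)); exact: measurable_snd.
    by apply: m1 => //; exact: measurable_mesh.
apply/seteqP; split=> t /=.
  by move=> <-; split=> j _ /=; rewrite tnth_map.
case: k => k1 k2 [h1 h2]; rewrite /meshv; congr pair; apply: eq_from_tnth => j; rewrite tnth_map.
  exact: (h1 j).
exact: (h2 j).
Qed.

Definition vcont (d : nat) (g : 'rV[C]_d -> R) := forall z e, 0 < e ->
  exists2 r, 0 < r & forall h, cn h <= r -> `|g (z + h) - g z| <= e.

(** A continuous function is a pointwise limit of functions of the mesh cell. *)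
Lemma measurable_vcont d (g : 'rV[C]_d -> R) : vcont g ->
  measurable_fun setT (fun t => g (@pt d t)).
Proof.
move=> hg.
apply: (@measurable_fun_cvg _ _ _ setT (fun n t => g (meshp n (meshv n t)))).
  move=> n _ B mB; rewrite setTI.
  rewrite (_ : _ @^-1` _ = \bigcup_(k in [set k | B (g (meshp n k))]) [set t | @meshv d n t = k]).
    rewrite bigcup_mkcond; apply: countable_bigcupT_measurable; first exact: countableP.
    by move=> k; case: ifP => _; [exact: measurable_meshv|exact: measurable0].
  apply/seteqP; split=> t /=; first by move=> h; exists (meshv n t).
  by move=> [k /= hk E]; rewrite E.
move=> t _; apply/cvgrPdist_le => e e0.
have [r r0 hr] := hg (pt t) e e0.
have [N hN] := half_pow_small 2 r0.
near=> n; rewrite distrC.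
have := hr (meshp n (meshv n t) - pt t); rewrite (addrC (pt t)) subrK; apply.
apply: cn_leP => [|j]; first exact: ltW.
apply: le_trans hN.
have nN : (2^-1 : R) ^+ n <= 2^-1 ^+ N.
  by rewrite ler_wiXn2l ?invr_ge0// ?invf_le1 ?ler1n//; near: n; exact: nbhs_infty_ge.
apply: (@le_trans _ _ (2 * 2^-1 ^+ n)); last by rewrite ler_wpM2l.
rewrite !mxE; apply: (le_trans (nc_le_ReIm _)); rewrite !ReIm /= !tnth_map.
rewrite mulr_natl mulr2n; apply: lerD.
- have /andP[h1 h2] := mesh_le n (tnth t.1 j).
  rewrite ler_norml; move: h1 h2; rewrite intrD mulrDl mul1r exprVn; lra.
- have /andP[h1 h2] := mesh_le n (tnth t.2 j).
  rewrite ler_norml; move: h1 h2; rewrite intrD mulrDl mul1r exprVn; lra.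
Unshelve. all: by end_near. Qed.

Lemma entire_vcont d (f : cfun R d) : entire f -> vcont (fun z => Re (f z)) /\ vcont (fun z => Im (f z)).
Proof.
move=> hf.
have K z e : 0 < e -> exists2 r, 0 < r & forall h, cn h <= r -> nc (f (z + h) - f z) <= e.
  move=> e0; have ho := entire_holo hf; have [_ hb] := ho.
  have [r [M [r0 hM]]] := hb z.
  have M0 : 0 <= M by apply: le_trans (hM 0 _); rewrite ?nc_ge0// cn0 ltW.
  pose L := 8 * M / r; have L0 : 0 <= L by rewrite /L divr_ge0 ?mulr_ge0// ltW.
  have L1 : 0 < L + 1 by lra.
  exists (Num.min (r / 4) (e / (L + 1))); first by rewrite lt_min !divr_gt0.
  move=> h; rewrite le_min => /andP[h1 h2].
  have := @holo_lip _ _ f z r M 0 h ho r0 hM; rewrite cn0 !addr0 => H.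
  apply: (le_trans (H _ h1)); first by rewrite divr_ge0// ltW.
  move: h2; rewrite ler_pdivlMr// -/L; have := cn_ge0 h; nra.
by split=> z e /(K z)[r r0 hr]; exists r => // h /hr; apply: le_trans;
  rewrite -?ReN -?ImN -?ReD -?ImD ?Re_le_nc ?Im_le_nc.
Qed.

Lemma entire_cmeas d (f : cfun R d) : entire f -> cmeas setT (fun t => f (@pt d t)).
Proof.
move=> /entire_vcont[h1 h2]; split.
  exact: (@measurable_vcont d (fun z => Re (f z)) h1).
exact: (@measurable_vcont d (fun z => Im (f z)) h2).
Qed.

Lemma fubini_prod d1 d2 (T1 : measurableType d1) (T2 : measurableType d2)
    (m1 : {sigma_finite_measure set T1 -> \bar R}) (m2 : {sigma_finite_measure set T2 -> \bar R})
    (u : T1 -> R) (v : T2 -> R) :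
  measurable_fun setT u -> measurable_fun setT v -> (forall x, 0 <= u x) -> (forall x, 0 <= v x) ->
  (\int[m1 \x m2]_t (u t.1 * v t.2)%:E = (\int[m1]_x (u x)%:E) * (\int[m2]_x (v x)%:E))%E.
Proof.
move=> mu mv u0 v0.
have mf : measurable_fun setT (fun t : T1 * T2 => (u t.1 * v t.2)%:E).
  apply/measurable_EFinP; apply: measurable_funM.
    by apply: (measurableT_comp mu); exact: measurable_fst.
  by apply: (measurableT_comp mv); exact: measurable_snd.
rewrite fubini_tonelli1//; last by move=> t; rewrite lee_fin mulr_ge0.
rewrite /fubini_F /=.
under eq_integral => x _.
  under eq_integral do rewrite EFinM.
  rewrite ge0_integralZl_EFin//; last 2 first.
  - by move=> y _; rewrite lee_fin.
  - exact/measurable_EFinP.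
  over.
rewrite ge0_integralZr//.
- exact/measurable_EFinP.
- by move=> x _; rewrite lee_fin.
- by apply: integral_ge0 => x _; rewrite lee_fin.
Qed.

(** The integrable majorant on the line; its products play this role on C^d. *)
Definition idec (x : R) : R := (1 + x ^+ 2)^-1.

Lemma idec_gt0 x : 0 < idec x.
Proof. by rewrite invr_gt0 ltr_pwDl// sqr_ge0. Qed.

Lemma idec_le1 x : idec x <= 1.
Proof. by rewrite invf_le1 ?lerDl ?sqr_ge0// ltr_pwDl// sqr_ge0. Qed.

Lemma measurable_idec : measurable_fun setT (idec : mR -> R).
Proof. by apply: continuous_measurable_fun; exact: continuous_oneDsqrV. Qed.

Lemma integral_idec : (\int[leb]_x (idec x)%:E < +oo)%E.
Proof.
rewrite ge0_symfun_integralT; last 3 first.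
- by move=> x; rewrite ltW// idec_gt0.
- exact: continuous_oneDsqrV.
- by move=> x; rewrite /idec /= sqrrN.
rewrite (_ : [set x | _] = `[0%R, +oo[%classic); last first.
  by apply/seteqP; split=> x /=; rewrite in_itv /= andbT.
have := @integral0y_oneDsqr R; rewrite /oneDsqr /idec => ->.
by rewrite -EFinM ltry.
Qed.

Definition tdec d (t : d.-tuple mR) : R := \prod_(j < d) idec (tnth t j).

Lemma tdec_gt0 d (t : d.-tuple mR) : 0 < tdec t.
Proof. by apply: prodr_gt0 => j _; exact: idec_gt0. Qed.

Lemma measurable_tdec d : measurable_fun setT (@tdec d).
Proof.
rewrite /tdec; elim: (index_enum _) => [|j s ih].
  by under eq_fun do rewrite big_nil; exact: measurable_cst.
under eq_fun do rewrite big_cons; apply: measurable_funM => //.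
by apply: (measurableT_comp measurable_idec); exact: measurable_tnth.
Qed.

Lemma tdec_cons d (u : mR * d.-tuple mR) : tdec (tuple_cons u) = idec u.1 * tdec u.2.
Proof.
rewrite /tdec big_ord_recl; congr (idec _ * _); apply: eq_bigr => j _.
by congr idec; rewrite /tuple_cons /= (tnth_nth (0 : R)) /= [RHS](tnth_nth (0 : R)).
Qed.

Lemma integral_lebesgue_cons d (F : d.+1.-tuple mR -> R) :
  measurable_fun setT F -> (forall t, 0 <= F t) ->
  (\int[@lebesgue_tuple R d.+1]_t (F t)%:E =
   \int[leb \x @lebesgue_tuple R d]_u (F (tuple_cons u))%:E)%E.
Proof.
move=> mF F0.
transitivity (\int[pushforward (leb \x @lebesgue_tuple R d)%E (@tuple_cons R d)]_t (F t)%:E)%E; first by [].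
rewrite (@ge0_integral_pushforward _ _ _ _ _ (@tuple_cons R d) (@measurable_tuple_cons R d)) //.
- exact/measurable_EFinP.
- by move=> t _; rewrite lee_fin.
Qed.

Lemma integral_tdec d : (\int[@lebesgue_tuple R d]_t (tdec t)%:E < +oo)%E.
Proof.
elim: d => [|d ih].
  rewrite /= integral_dirac//=; first by rewrite ltry.
  by apply/measurable_EFinP; exact: measurable_tdec.
rewrite integral_lebesgue_cons//; last 2 first.
- exact: measurable_tdec.
- by move=> t; exact/ltW/tdec_gt0.
under eq_integral do rewrite tdec_cons.
rewrite (fubini_prod leb (@lebesgue_tuple R d)) //; last 4 first.
- exact: measurable_idec.
- exact: measurable_tdec.
- by move=> x; exact/ltW/idec_gt0.
- by move=> x; exact/ltW/tdec_gt0.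
have I0 : (0 <= \int[leb]_x (idec x)%:E)%E.
  by apply: integral_ge0 => x _; rewrite lee_fin ltW// idec_gt0.
by apply: lte_mul_pinfty => //; rewrite ge0_fin_numE//; exact: integral_idec.
Qed.

Definition pdec d (t : d.-tuple mR * d.-tuple mR) : R := tdec t.1 * tdec t.2.

Lemma pdec_gt0 d (t : d.-tuple mR * d.-tuple mR) : 0 < pdec t.
Proof. by rewrite mulr_gt0// tdec_gt0. Qed.

Lemma measurable_pdec d : measurable_fun setT (@pdec d).
Proof.
apply: measurable_funM; apply: (measurableT_comp (@measurable_tdec d)).
- exact: measurable_fst.
- exact: measurable_snd.
Qed.

Lemma integrable_pdec d : (lebp d).-integrable setT (EFin \o @pdec d).
Proof.
apply/integrableP; split; first by apply/measurable_EFinP; exact: measurable_pdec.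
under eq_integral => t _ do rewrite /= ger0_norm ?(ltW (pdec_gt0 _))//.
rewrite /pdec fubini_prod; try exact: measurable_tdec; try by move=> x; exact/ltW/tdec_gt0.
have I0 : (0 <= \int[@lebesgue_tuple R d]_x (tdec x)%:E)%E.
  by apply: integral_ge0 => x _; rewrite lee_fin ltW// tdec_gt0.
by rewrite lte_mul_pinfty ?ge0_fin_numE ?integral_tdec.
Qed.

Definition tcube d (a : d.-tuple mR) (r : R) : set (d.-tuple mR) :=
  [set t | forall j, `|(tnth t j : R) - tnth a j| <= r].

Lemma measurable_tcube d (a : d.-tuple mR) r : measurable (tcube a r).
Proof.
rewrite (_ : tcube a r = \bigcap_(j in [set: 'I_d])
   ((fun t : d.-tuple mR => tnth t j) @^-1` `[(tnth a j - r : R)%R, (tnth a j + r)%R]%classic)).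
  apply: fin_bigcap_measurable => [|j _]; first exact: finite_finset.
  by rewrite -[X in measurable X]setTI; apply: measurable_tnth => //; exact: measurable_itv.
apply/seteqP; split=> t /= h j; first by move=> _ /=; rewrite in_itv /= -ler_distl.
by have := h j I; rewrite /= in_itv /= -ler_distl.
Qed.

Lemma lebesgue_tcube d (a : d.-tuple mR) r : 0 <= r ->
  @lebesgue_tuple R d (tcube a r) = ((2 * r) ^+ d)%:E.
Proof.
move=> r0; elim: d a => [|d ih] a.
  rewrite /= expr0 (_ : tcube a r = setT) ?diracT//.
  by apply/seteqP; split=> // t _ [].
transitivity ((leb \x @lebesgue_tuple R d)%E (@tuple_cons R d @^-1` (tcube a r))); first by [].
rewrite (_ : _ @^-1` _ = `[(thead a - r : R)%R, (thead a + r)%R]%classic `*` tcube [tuple of behead a] r).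
  rewrite product_measure1E//; last exact: measurable_tcube.
  rewrite ih exprS.
  transitivity ((lebesgue_measure ([set` `[(thead a - r : R)%R, (thead a + r)%R]] : set R)) * ((2 * r) ^+ d)%:E)%E; first by [].
  rewrite lebesgue_measure_itv /= lte_fin; case: ltP => h; first by rewrite -EFinM; congr (_ * _)%:E; ring.
  have -> : r = 0 by apply/le_anti; rewrite r0 andbT; lra.
  by rewrite mulr0 mul0r mul0e.
apply/seteqP; split=> -[x t] /=.
  move=> h; split; first by have := h ord0; rewrite in_itv /= -ler_distl.
  move=> j; have := h (lift ord0 j); rewrite /tuple_cons /= !(tnth_nth (0 : R)) /=.
  by rewrite nth_behead.
move=> [hx ht] j; case: (unliftP ord0 j) => [j' ->|->].
  have := ht j'; rewrite /tuple_cons /= !(tnth_nth (0 : R)) /=.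
  by rewrite nth_behead.
by move: hx; rewrite in_itv /= -ler_distl.
Qed.

Definition pcube d (a : d.-tuple mR * d.-tuple mR) r := tcube a.1 r `*` tcube a.2 r.

Lemma measurable_pcube d (a : d.-tuple mR * d.-tuple mR) r : measurable (pcube a r).
Proof. by apply: measurableX; exact: measurable_tcube. Qed.

Lemma lebp_pcube d (a : d.-tuple mR * d.-tuple mR) r : 0 <= r ->
  lebp d (pcube a r) = ((2 * r) ^+ (d + d))%:E.
Proof.
move=> r0; rewrite /pcube product_measure1E; try exact: measurable_tcube.
by rewrite exprD EFinM; congr (_ * _)%E; exact: lebesgue_tcube.
Qed.

Definition unpt d (z : 'rV[C]_d) : d.-tuple mR * d.-tuple mR :=
  ([tuple Re (z 0 j) | j < d], [tuple Im (z 0 j) | j < d]).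

Lemma unptK d (z : 'rV[C]_d) : pt (unpt z) = z.
Proof. by apply/rowP => j; rewrite ptE !tnth_mktuple; case: (z 0 j). Qed.

Lemma pcube_sub d (a b : d.-tuple mR * d.-tuple mR) r q : pcube a r b -> pcube b q `<=` pcube a (r + q).
Proof.
move=> [/= h1 h2] c [/= h3 h4]; split=> j /=.
  have := h1 j; have := h3 j; rewrite !ler_distl; lra.
have := h2 j; have := h4 j; rewrite !ler_distl; lra.
Qed.

Lemma pcubeW d (a b : d.-tuple mR * d.-tuple mR) r q : r <= q -> pcube a r b -> pcube a q b.
Proof. by move=> rq [/= h1 h2]; split=> j /=; [apply: le_trans (h1 j) rq|apply: le_trans (h2 j) rq]. Qed.

Lemma pcubexx d (a : d.-tuple mR * d.-tuple mR) r : 0 <= r -> pcube a r a.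
Proof. by move=> r0; split=> j /=; rewrite subrr normr0. Qed.

Lemma pcube_cn d (a b : d.-tuple mR * d.-tuple mR) r : 0 <= r -> pcube a r b -> cn (pt b - pt a) <= 2 * r.
Proof.
move=> r0 [/= h1 h2]; apply: cn_leP => [|j]; first by rewrite mulr_ge0.
rewrite [X in nc X]mxE [in X in _ + X]mxE !ptE; apply: (le_trans (nc_le_ReIm _)); rewrite !ReIm /=.
by rewrite mulr_natl mulr2n lerD.
Qed.

Lemma cn_pcube d (a : d.-tuple mR * d.-tuple mR) h r : cn h <= r -> pcube a r (unpt (pt a + h)).
Proof.
move=> hr; split=> j /=; rewrite tnth_mktuple mxE ptE !ReIm /= addrC addKr;
  apply: le_trans hr; apply: le_trans (le_cn h j); [exact: Re_le_nc|exact: Im_le_nc].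
Qed.

(** Maximising the modulus times a power of the distance to the boundary of the cube
yields a point around which the function cannot vary much, so that its square integral
over a comparable cube is bounded below. *)
Theorem point_bound d : exists2 K : R, 0 < K & forall (f : cfun R d) a, entire f ->
  ((nc (f (@pt d a)) ^+ 2)%:E <= K%:E * \int[lebp d]_(t in pcube a 1) (nc (f (pt t)) ^+ 2)%:E)%E.
Proof.
(* With this [eta], the Lipschitz constant of f near the nearly maximal point allows a
relative variation of at most 2 ^ (d + 6) * eta = 1 / 2 on a cube of half-side eta *
dl. *)
pose eta : R := (2 ^+ (d + 7))^-1.
have eta0 : 0 < eta by rewrite invr_gt0 exprn_gt0.
pose q := (2 * eta) ^+ (d + d).
have q0 : 0 < q by rewrite exprn_gt0 // mulr_gt0.
exists (16 / q); first by rewrite divr_gt0.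
move=> f a hf; have ho := entire_holo hf.
have I0 : (0 <= \int[lebp d]_(t in pcube a 1) (nc (f (pt t)) ^+ 2)%:E)%E.
  by apply: integral_ge0 => t _; rewrite lee_fin sqr_ge0.
have K0 : (0 <= (16 / q)%:E)%E by rewrite lee_fin divr_ge0 // ltW.
have [fa0|fa0] := eqVneq (nc (f (pt a))) 0; first by rewrite fa0 expr0n; exact: mule_ge0.
have {}fa0 : 0 < nc (f (pt a)) by rewrite lt_neqAle eq_sym fa0 nc_ge0.
(* Here ud.2 bounds the distance from the point ud.1 to the boundary of the cube; the
centre, with ud.2 = 1, contributes the value to be estimated. *)
pose S := [set nc (f (pt ud.1)) * ud.2 ^+ d | ud in
   [set ud : (d.-tuple mR * d.-tuple mR) * R | [/\ 0 < ud.2, ud.2 <= 1 & pcube a (1 - ud.2) ud.1]]].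
have Sa : S (nc (f (pt a))).
  exists (a, 1); rewrite /= ?expr1n ?mulr1//; split => //.
  by apply: pcubexx; rewrite subrr.
have [M hM] := entire_bounded hf (cn (pt a) + 2).
have hS : has_sup S.
  split; first by eexists; exact: Sa.
  exists M => _ [[u dl] /= [d0 d1 hu] <-].
  apply: (@le_trans _ _ (nc (f (pt u)))).
    by rewrite ler_piMr ?nc_ge0// exprn_ile1// ltW.
  apply: hM; rewrite -(subrK (pt a) (pt u)) addrC; apply: (le_trans (cnD _ _)); rewrite lerD2l.
  by apply: (le_trans (pcube_cn _ hu)); lra.
have supa : nc (f (pt a)) <= sup S by apply: ub_le_sup => //; case: hS.
have sup0 : 0 < sup S by apply: lt_le_trans supa.
have [_ [[u dl] /= [d0 d1 hu] <-] hs] := sup_adherent (divr_gt0 sup0 (ltr0n _ 2)) hS.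
set s := nc (f (pt u)) * dl ^+ d in hs.
have s2 : sup S <= 2 * s by lra.
have s0 : 0 < s by lra.
have fu0 : 0 < nc (f (pt u)).
  by move: s0; rewrite /s pmulr_lgt0// exprn_gt0.
have hmax v e : 0 < e -> e <= 1 -> pcube a (1 - e) v -> nc (f (pt v)) * e ^+ d <= 2 * s.
  move=> e0 e1 hv; apply: le_trans s2; apply: ub_le_sup; first by case: hS.
  by exists (v, e).
pose r := dl / 2; have r0 : 0 < r by rewrite divr_gt0.
have bnd h : cn h <= r -> nc (f (pt u + h)) <= 2 ^+ d.+1 * nc (f (pt u)).
  move=> hr; have := cn_pcube u hr; set v := unpt _ => hv.
  have := @hmax v r r0; rewrite unptK => H.
  have {}H : nc (f (pt u + h)) * r ^+ d <= 2 * s.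
    apply: H; first by rewrite /r; lra.
    by apply: pcubeW (pcube_sub hu hv); rewrite /r; lra.
  rewrite -(@ler_pM2r _ (r ^+ d)) ?exprn_gt0//; apply: (le_trans H).
  rewrite /s /r expr_div_n exprS.
  have -> : 2 * 2 ^+ d * nc (f (pt u)) * (dl ^+ d / 2 ^+ d) = 2 * (nc (f (pt u)) * dl ^+ d); last by [].
  by field; rewrite expf_neq0.
have low v : pcube u (eta * dl) v -> nc (f (pt u)) / 2 <= nc (f (pt v)).
  move=> hv.
  have e1 : 0 <= eta * dl by rewrite mulr_ge0 // ltW.
  have hc := pcube_cn e1 hv.
  have := @holo_lip _ _ f (pt u) r (2 ^+ d.+1 * nc (f (pt u))) 0 (pt v - pt u) ho r0 bnd.
  rewrite cn0 addr0 (addrC (pt u)) subrK => H.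
  have e8 : eta <= 2 ^- 7.
    by rewrite lef_pV2 ?posrE ?exprn_gt0// ler_weXn2l ?ler1n// leq_addl.
  have {}H : nc (f (pt v) - f (pt u)) <= 8 * (2 ^+ d.+1 * nc (f (pt u))) / r * cn (pt v - pt u).
    apply: H; first by rewrite /r; lra.
    apply: (le_trans hc); rewrite /r.
    have : 2 * (eta * dl) <= 2 * (2 ^- 7 * dl) by rewrite ler_wpM2l// ler_wpM2r// ltW.
    by move/le_trans; apply; rewrite (_ : 2 ^- 7 = 1 / 128); [lra|field].
  have H2 : nc (f (pt v) - f (pt u)) <= nc (f (pt u)) / 2.
    apply: (le_trans H).
    have X0 : 0 <= 8 * (2 ^+ d.+1 * nc (f (pt u))) / r.
      by rewrite divr_ge0 ?mulr_ge0 ?exprn_ge0 ?ltW.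
    apply: (le_trans (ler_wpM2l X0 hc)).
    rewrite /r /eta exprD exprS (_ : 2 ^+ 7 = 128); last by ring.
    rewrite le_eqVlt; apply/orP; left; apply/eqP; field.
    by rewrite expf_neq0//= gt_eqF.
  have := nc_le_dist (f (pt u)) (f (pt v)); rewrite nc_distC; lra.
have sub : pcube u (eta * dl) `<=` pcube a 1.
  move=> v hv; apply: pcubeW (pcube_sub hu hv).
  have e1 : eta <= 1 by rewrite invf_le1 ?exprn_gt0// exprn_ege1// ler1n.
  have : eta * dl <= 1 * dl by rewrite ler_wpM2r// ltW.
  lra.
have cont : measurable_fun setT (fun t : d.-tuple mR * d.-tuple mR => (nc (f (pt t)) ^+ 2)%:E).
  by apply/measurable_EFinP; apply: measurable_nc_sqr; exact: entire_cmeas.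
have B : (((nc (f (pt u)) / 2) ^+ 2 * (2 * (eta * dl)) ^+ (d + d))%:E <= \int[lebp d]_(t in pcube a 1) (nc (f (pt t)) ^+ 2)%:E)%E.
  apply: (@le_trans _ _ (\int[lebp d]_(t in pcube u (eta * dl)) (nc (f (pt t)) ^+ 2)%:E)%E).
    rewrite EFinM -(lebp_pcube u (r := eta * dl)); last by rewrite mulr_ge0// ltW.
    rewrite -(integral_cst (lebp d)); last exact: measurable_pcube.
    apply: ge0_le_integral => //.
    - exact: measurable_pcube.
    - by move=> t _; rewrite lee_fin sqr_ge0.
    - exact: measurable_funS cont.
    - move=> t ht; rewrite lee_fin lerXn2r ?nnegrE ?nc_ge0//; last exact: low.
      by rewrite divr_ge0// nc_ge0.
  apply: ge0_subset_integral => //; try exact: measurable_pcube.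
  - exact: measurable_funS cont.
  - by move=> t _; rewrite lee_fin sqr_ge0.
apply: le_trans (lee_wpmul2l K0 B); rewrite -EFinM lee_fin.
have -> : 16 / q * ((nc (f (pt u)) / 2) ^+ 2 * (2 * (eta * dl)) ^+ (d + d)) = (2 * s) ^+ 2.
  have -> : (2 * (eta * dl)) ^+ (d + d) = q * (dl ^+ d) ^+ 2.
    by rewrite mulrA exprMn -/q exprD -expr2.
  by rewrite /s; move: (dl ^+ d) => D; field; rewrite gt_eqF.
have s20 : 0 <= 2 * s by rewrite mulr_ge0 // ltW.
by apply: lerXn2r; rewrite ?nnegrE ?nc_ge0//; exact: le_trans supa s2.
Qed.

End TupleMeasure.

(** * Norms, distances to cones and real powers *)

Section Norms.
Context {R : realType} {d : nat}.
Variable N : 'rV[R]_d -> R.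
Hypothesis hN : is_norm N.
Implicit Types x y : 'rV[R]_d.

Definition rn x : R := \big[Order.max/0]_(j < d) `|x 0 j|.

Lemma rn_ge0 x : 0 <= rn x.
Proof. by rewrite /rn; elim/big_ind : _ => // a b ha hb; rewrite le_max ha. Qed.

Lemma le_rn x j : `|x 0 j| <= rn x.
Proof. exact: le_bigmax. Qed.

Lemma rn_leP x M : 0 <= M -> (forall j, `|x 0 j| <= M) -> rn x <= M.
Proof. by move=> M0 hM; apply: bigmax_le. Qed.

Lemma N0 : N 0 = 0.
Proof. by have [_ /(_ 0 0) + _] := hN; rewrite scale0r normr0 mul0r. Qed.

Lemma ND x y : N (x + y) <= N x + N y.
Proof. by case: hN. Qed.

Lemma NZ (a : R) x : N (a *: x) = `|a| * N x.
Proof. by case: hN. Qed.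

Lemma NN x : N (- x) = N x.
Proof. by rewrite -scaleN1r NZ normrN1 mul1r. Qed.

Lemma NB x y : N (x - y) = N (y - x).
Proof. by rewrite -NN opprB. Qed.

Lemma N_ge0 x : 0 <= N x.
Proof. by have := ND x (- x); rewrite subrr N0 NN; lra. Qed.

Lemma N_upper : exists2 K, 0 < K & forall x, N x <= K * rn x.
Proof.
exists (1 + \sum_(j < d) N (delta_mx 0 j)); first by rewrite ltr_pwDl// sumr_ge0// => j _; exact: N_ge0.
move=> x; rewrite {1}(row_sum_delta x).
apply: (@le_trans _ _ (\sum_(j < d) N (x 0 j *: delta_mx 0 j))).
  elim/big_rec2 : _ => [|j a b _ h]; first by rewrite N0.
  by apply: (le_trans (ND _ _)); rewrite lerD2l.
rewrite mulrDl mul1r mulr_suml; apply: (@le_trans _ _ (\sum_(j < d) N (delta_mx 0 j) * rn x)).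
  by apply: ler_sum => j _; rewrite NZ mulrC ler_wpM2l ?N_ge0 ?le_rn.
by rewrite lerDr rn_ge0.
Qed.

Lemma N_lip x y : `|N x - N y| <= N (x - y).
Proof.
rewrite ler_norml; have := ND (x - y) y; have := ND (y - x) x.
rewrite !subrK NB; lra.
Qed.

Lemma rnZ (a : R) x : rn (a *: x) <= `|a| * rn x.
Proof. by apply: rn_leP => [|j]; rewrite ?mulr_ge0 ?rn_ge0// mxE normrM ler_wpM2l ?le_rn. Qed.

Lemma rn_norm x : rn x = `|x|.
Proof.
apply/le_anti/andP; split.
  apply: rn_leP => // j; rewrite [leRHS]/Num.Def.normr /= mx_normrE.
  by apply/bigmax_geP; right => /=; exists (0, j).
rewrite [leLHS]/Num.Def.normr /= mx_normrE; apply: bigmax_le; first exact: rn_ge0.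
by move=> [i j] _ /=; rewrite ord1 le_rn.
Qed.

(** Compactness of the unit sphere of the sup norm, as for every comparison of norms. *)
Lemma N_lower : exists2 K, 0 < K & forall x, rn x <= K * N x.
Proof.
have [U U0 hU] := N_upper.
pose S := [set x : 'rV[R]_d | `|x| = 1].
have cS : compact S.
  apply: bounded_closed_compact.
    exists 1; split; first exact: num_real.
    by move=> M M1 x /= ->; exact: ltW.
  rewrite (_ : S = (fun x : 'rV[R]_d => `|x|) @^-1` [set 1]); last by [].
  by apply: closed_comp => [x _|]; [exact: norm_continuous|exact: closed_eq].
move: cS => /compact_near_coveringP/(_ R (0^'+) (fun c x => c <= N x) _).
case.
  move=> x /= x1.
  have Nx : 0 < N x.
    rewrite lt_neqAle N_ge0 andbT eq_sym; apply: contra_eq_neq x1 => h.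
    by case: hN => _ _ /(_ x h) ->; rewrite normr0 eq_sym oner_eq0.
  exists (ball x (N x / 2 / U), [set c : R | c <= N x / 2]) => /=.
    split; first by apply: nbhsx_ballx; rewrite !divr_gt0.
    near=> q; near: q; apply: nbhs_right_le; exact: divr_gt0.
  move=> [x' c] /= [hx hc]; apply: (le_trans hc).
  have xx : N (x - x') <= N x / 2.
    apply: (le_trans (hU _)); rewrite rn_norm mulrC -ler_pdivlMr//.
    by move: hx; rewrite -ball_normE /= => /ltW.
  by have := ND (x - x') x'; rewrite subrK; lra.
move=> c /= c0 hc.
exists (2 / c); first by rewrite divr_gt0.
move=> x; have [->|x0] := eqVneq x 0.
  by rewrite N0 mulr0 rn_norm normr0.
have n0 : 0 < `|x| by rewrite normr_gt0.
have c2 : 0 < c / 2 by rewrite divr_gt0.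
have cc : ball_ (fun x : R => `|x|) 0 c (c / 2).
  by rewrite /ball_ /= sub0r normrN gtr0_norm//; lra.
have H : c / 2 <= N (`|x|^-1 *: x).
  by apply: (hc _ cc c2) => /=; rewrite /S /= normrZ normfV normr_id mulVf ?gt_eqF.
move: H; rewrite NZ normfV normr_id [_ * N x]mulrC ler_pdivlMr// rn_norm => H.
rewrite mulrAC ler_pdivlMr//; lra.
Unshelve. all: end_near. Qed.

Section Distance.
Implicit Types U : set 'rV[R]_d.

Lemma dist_has_inf U x : U !=set0 -> has_inf [set N (x - xi) | xi in U].
Proof.
move=> [u Uu]; split; first by exists (N (x - u)); exists u.
by exists 0 => _ [v _ <-]; exact: N_ge0.
Qed.

Lemma dist_ge0 U x : U !=set0 -> 0 <= dist_set N x U.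
Proof.
move=> U0; apply: lb_le_inf; first by have [] := dist_has_inf x U0.
by move=> _ [v _ <-]; exact: N_ge0.
Qed.

Lemma dist_le U x xi : U xi -> dist_set N x U <= N (x - xi).
Proof.
move=> Uxi; apply: ge_inf; last by exists xi.
by have [] := dist_has_inf x (ex_intro _ _ Uxi).
Qed.

Lemma dist_approx U x e : U !=set0 -> 0 < e -> exists2 xi, U xi & N (x - xi) < dist_set N x U + e.
Proof.
move=> U0 e0; have [_ [xi Ux <-] h] := inf_adherent e0 (dist_has_inf x U0).
by exists xi.
Qed.

Lemma dist_leP U x r : U !=set0 -> (forall xi, U xi -> r <= N (x - xi)) -> r <= dist_set N x U.
Proof.
move=> U0 h; apply: lb_le_inf; first by have [] := dist_has_inf x U0.
by move=> _ [v Uv <-]; exact: h.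
Qed.

Lemma dist_lip U x y : U !=set0 -> dist_set N x U <= N (x - y) + dist_set N y U.
Proof.
move=> U0; rewrite -lerBlDl; apply: dist_leP => // xi Uxi.
rewrite lerBlDl; apply: (le_trans (dist_le x Uxi)).
by apply: le_trans (ND _ _); rewrite addrA subrK.
Qed.

Lemma dist_cone U x (t : R) : cone U -> 0 < t -> dist_set N (t *: x) U = t * dist_set N x U.
Proof.
move=> [U0 hU] t0.
have H s y : 0 < s -> s * dist_set N y U <= dist_set N (s *: y) U.
  move=> s0; apply: dist_leP => // xi Uxi.
  have Us : U (s^-1 *: xi) by apply: hU => //; rewrite invr_gt0.
  apply: (le_trans (ler_wpM2l (ltW s0) (dist_le y Us))).
  rewrite -{1}(gtr0_norm s0) -NZ scalerBr scalerA mulfV ?gt_eqF// scale1r.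
  exact: lexx.
apply/le_anti; rewrite H// andbT.
have := H t^-1 (t *: x); rewrite invr_gt0 => /(_ t0).
by rewrite scalerA mulVf ?gt_eqF// scale1r mulrC ler_pdivrMr// mulrC.
Qed.

Lemma dist_leN U x : cone U -> dist_set N x U <= N x.
Proof.
move=> [U0 hU]; apply/ler_addgt0Pr => e e0.
have [u Uu] := U0; pose t := e / (N u + 1).
have n1 : 0 < N u + 1 by rewrite ltr_wpDl// N_ge0.
have t0 : 0 < t by rewrite divr_gt0.
apply: (le_trans (dist_le x (hU t u t0 Uu))); apply: (le_trans (ND _ _)).
rewrite lerD2l NN NZ gtr0_norm// /t mulrAC ler_pdivrMr//.
by rewrite ler_wpM2l ?ltW// ltrDl.
Qed.

Lemma dist0 x : dist_set N x [set 0] = N x.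
Proof.
apply/le_anti; apply/andP; split; first by have := @dist_le [set 0] x 0 erefl; rewrite subr0.
by apply: dist_leP; [exists 0|move=> xi /= ->; rewrite subr0].
Qed.

End Distance.
End Norms.

Section PowerEstimates.
Context {R : realType}.
Implicit Types a b p : R.

Lemma powR_mono a b p : 0 <= p -> 0 <= a -> a <= b -> a `^ p <= b `^ p.
Proof. by move=> p0 a0 ab; rewrite ge0_ler_powR// nnegrE// (le_trans a0). Qed.

(** A bounded translation costs an arbitrarily small dilation and a constant; this is
where the strict inequalities between scales are spent. *)
Lemma powR_shift (k dl a p : R) : 1 < k -> 0 <= dl -> 0 <= p -> 0 <= a ->
  (a + dl) `^ p <= (k * a) `^ p + (dl * k / (k - 1)) `^ p.
Proof.
move=> k1 d0 p0 a0; have k10 : 0 < k - 1 by rewrite subr_gt0.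
have [h|h] := leP dl ((k - 1) * a).
  apply: (@le_trans _ _ ((k * a) `^ p)); last by rewrite lerDl powR_ge0.
  by apply: powR_mono; rewrite ?addr_ge0//; lra.
apply: (@le_trans _ _ ((dl * k / (k - 1)) `^ p)); last by rewrite lerDr powR_ge0.
apply: powR_mono; rewrite ?addr_ge0// ler_pdivlMr//.
by move: h; rewrite mulrC; nra.
Qed.

Lemma powR_ge_lin a p : 1 <= p -> 0 <= a -> a <= a `^ p + 1.
Proof.
move=> p1 a0; have [h|h] := leP 1 a; last by have := powR_ge0 a p; lra.
have : a `^ 1 <= a `^ p by rewrite ler_powR.
rewrite powRr1//; lra.
Qed.

Lemma exp_quad (t : R) : 0 <= t -> 1 + t ^+ 2 / 4 <= expR t.
Proof.
move=> t0.
have h := expR_ge1Dx (t / 2).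
have -> : expR t = expR (t / 2) ^+ 2 by rewrite expr2 -expRD; congr expR; field.
apply: (@le_trans _ _ ((1 + t / 2) ^+ 2)); first by rewrite sqrrD; nra.
by rewrite lerXn2r ?nnegrE ?expR_ge0//; lra.
Qed.

Lemma exp_idec (c y : R) : 0 < c -> expR (- (c * `|y|)) <= (1 + 4 / c ^+ 2) * idec y.
Proof.
move=> c0; rewrite expRN -[leLHS]mul1r ler_pdivrMr ?expR_gt0//.
have i0 : 0 < 1 + y ^+ 2 by rewrite ltr_pwDl// sqr_ge0.
rewrite mulrAC /idec ler_pdivlMr// mul1r.
have := exp_quad (mulr_ge0 (ltW c0) (normr_ge0 y)); rewrite exprMn real_normK ?num_real// => h.
apply: (@le_trans _ _ ((1 + 4 / c ^+ 2) * (1 + c ^+ 2 * y ^+ 2 / 4))); last first.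
  by rewrite ler_wpM2l// addr_ge0// divr_ge0// sqr_ge0.
have c2 : 0 < c ^+ 2 by rewrite exprn_gt0.
have -> : (1 + 4 / c ^+ 2) * (1 + c ^+ 2 * y ^+ 2 / 4) = 1 + c ^+ 2 * y ^+ 2 / 4 + 4 / c ^+ 2 + y ^+ 2.
  by field; rewrite gt_eqF.
have : 0 <= c ^+ 2 * y ^+ 2 / 4 by apply: divr_ge0 => //; apply: mulr_ge0; exact: sqr_ge0.
have : 0 <= 4 / c ^+ 2 by apply: divr_ge0 => //; exact: sqr_ge0.
lra.
Qed.

End PowerEstimates.

(** * The weights *)

Section Weights.
Context {R : realType} {d : nat}.
Local Notation mR := (measurableTypeR R).
Notation C := R[i].
Notation pts := (d.-tuple mR * d.-tuple mR)%type.
Variables (beta : R) (N : 'rV[R]_d -> R).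
Hypothesis hb0 : 0 <= beta.
Hypothesis hb1 : beta < 1.
Hypothesis hN : is_norm N.
Implicit Types (U : set 'rV[R]_d) (B : R) (n : nat) (t : pts) (f : cfun R d).

Let p := (1 - beta)^-1.

Lemma p_ge1 : 1 <= p.
Proof. by rewrite /p invf_ge1 ?subr_gt0// gerBl. Qed.

Let p_gt0 : 0 < p.
Proof. by apply: lt_le_trans p_ge1. Qed.

Definition wt U B n t : R := weight beta N U B n (real_point t.1) (real_point t.2).

Definition polyw n t : R := \prod_(j < d) (1 + `|tnth t.1 j : R|) ^+ (2 * n).

Lemma wtE U B n t : wt U B n t = polyw n t *
  expR (- 2 * dist_set N (B *: real_point t.1) U `^ p - 2 * N (B *: real_point t.2) `^ p).
Proof.
by rewrite /wt /weight; congr (_ * _); apply: eq_bigr => j _; rewrite mxE.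
Qed.

Lemma polyw_gt0 n t : 0 < polyw n t.
Proof. by apply: prodr_gt0 => j _; rewrite exprn_gt0// ltr_pwDl. Qed.

Lemma polyw_ge1 n t : 1 <= polyw n t.
Proof.
rewrite /polyw; elim/big_rec : _ => // j x _ hx.
by rewrite mulr_ege1// exprn_ege1// lerDl.
Qed.

Lemma wt_gt0 U B n t : 0 < wt U B n t.
Proof. by rewrite wtE mulr_gt0 ?polyw_gt0 ?expR_gt0. Qed.

Lemma vcont_lip (g : 'rV[C]_d -> R) (L : R) :
  (forall z h, `|g (z + h) - g z| <= L * cn h) -> vcont g.
Proof.
move=> hg z e e0; have L0 : 0 < `|L| + 1 by rewrite ltr_wpDl.
exists (e / (`|L| + 1)); first by rewrite divr_gt0.
move=> h; rewrite ler_pdivlMr// => hh; apply: (le_trans (hg z h)).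
have := cn_ge0 h; have := ler_norm L; nra.
Qed.

Let xr (z : 'rV[C]_d) : 'rV[R]_d := \row_j Re (z 0 j).
Let yr (z : 'rV[C]_d) : 'rV[R]_d := \row_j Im (z 0 j).

Lemma xr_pt t : xr (pt t) = real_point t.1.
Proof. by apply/rowP => j; rewrite !mxE. Qed.
Lemma yr_pt t : yr (pt t) = real_point t.2.
Proof. by apply/rowP => j; rewrite !mxE. Qed.

Lemma measurable_wt U B n : cone U -> measurable_fun setT (wt U B n).
Proof.
move=> [U0 _]; have [K K0 hK] := N_upper hN.
rewrite (_ : wt U B n = fun t => polyw n t *
  expR (- 2 * dist_set N (B *: real_point t.1) U `^ p - 2 * N (B *: real_point t.2) `^ p)); last first.
  by apply/funext => t; rewrite wtE.
apply: measurable_funM.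
  rewrite /polyw; elim: (index_enum _) => [|j s ih].
    by under eq_fun do rewrite big_nil; exact: measurable_cst.
  under eq_fun do rewrite big_cons; apply: measurable_funM => //.
  apply: measurable_funX; apply: measurable_funD; first exact: measurable_cst.
  apply: measurableT_comp => //.
  by apply: (measurableT_comp (measurable_tnth j)); exact: measurable_fst.
apply: measurableT_comp; first exact: measurable_expR.
apply: measurable_funB; apply: measurable_funM; try exact: measurable_cst.
- apply: (measurableT_comp (measurable_powR p)).
  rewrite (_ : (fun t => _) = fun t => dist_set N (B *: xr (pt t)) U); last first.
    by apply/funext => t; rewrite xr_pt.
  apply: (@measurable_vcont R d (fun z => dist_set N (B *: xr z) U)).
  apply: (@vcont_lip _ (`|B| * K)) => z h.
  have E : B *: xr (z + h) - B *: xr z = B *: xr h.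
    by rewrite -scalerBr; congr (_ *: _); apply/rowP => j; rewrite !mxE ReD; ring.
  have F : N (B *: xr h) <= `|B| * K * cn h.
    rewrite (NZ hN) -mulrA ler_wpM2l//; apply: (le_trans (hK _)); rewrite ler_wpM2l ?(ltW K0)//.
    by apply: rn_leP => [|j]; rewrite ?cn_ge0// mxE (le_trans (Re_le_nc _))// le_cn.
  rewrite ler_norml; have := dist_lip hN (B *: xr (z + h)) (B *: xr z) U0.
  have := dist_lip hN (B *: xr z) (B *: xr (z + h)) U0; rewrite (NB hN (B *: xr z)) E; lra.
- apply: (measurableT_comp (measurable_powR p)).
  rewrite (_ : (fun t => _) = fun t => N (B *: yr (pt t))); last first.
    by apply/funext => t; rewrite yr_pt.
  apply: (@measurable_vcont R d (fun z => N (B *: yr z))).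
  apply: (@vcont_lip _ (`|B| * K)) => z h.
  have E : B *: yr (z + h) - B *: yr z = B *: yr h.
    by rewrite -scalerBr; congr (_ *: _); apply/rowP => j; rewrite !mxE ImD; ring.
  have F : N (B *: yr h) <= `|B| * K * cn h.
    rewrite (NZ hN) -mulrA ler_wpM2l//; apply: (le_trans (hK _)); rewrite ler_wpM2l ?(ltW K0)//.
    by apply: rn_leP => [|j]; rewrite ?cn_ge0// mxE (le_trans (Im_le_nc _))// le_cn.
  apply: (le_trans (N_lip hN _ _)); rewrite E; exact: F.
Qed.

Lemma NZ_pos B x : 0 <= B -> N (B *: x) = B * N x.
Proof. by move=> B0; rewrite (NZ hN) ger0_norm. Qed.

Lemma wt_mono U B n B' n' t : cone U -> 0 < B -> B <= B' -> (n' <= n)%N -> wt U B' n' t <= wt U B n t.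
Proof.
move=> cU B0 BB nn; have B'0 : 0 < B' by apply: lt_le_trans BB.
rewrite !wtE; apply: ler_pM; [exact: (ltW (polyw_gt0 _ _))|exact: expR_ge0| |].
  by apply: ler_prod => j _; rewrite exprn_ge0 ?addr_ge0//= ler_weXn2l// ?leq_mul2l//= lerDl.
rewrite ler_expR !(dist_cone hN)// !NZ_pos ?(ltW B0) ?(ltW B'0)//.
set X := dist_set _ _ _; set Y := N _.
have X0 : 0 <= X by apply: dist_ge0 => //; case: cU.
have Y0 : 0 <= Y by exact: N_ge0.
have : (B * X) `^ p <= (B' * X) `^ p by apply: powR_mono; rewrite ?(ltW p_gt0) ?mulr_ge0 ?(ltW B0)// ler_wpM2r.
have : (B * Y) `^ p <= (B' * Y) `^ p by apply: powR_mono; rewrite ?(ltW p_gt0) ?mulr_ge0 ?(ltW B0)// ler_wpM2r.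
lra.
Qed.

(** Lowering the weight pays for integrability: one power of each 1 + |x_j| and a
fraction of the scale are traded for an integrable factor, uniformly over a unit
cube. *)
Lemma wt_compare B B' n n' : 0 < B -> B < B' -> (n'.+1 <= n)%N ->
  exists2 K, 0 < K & forall U t s, cone U -> pcube t 1 s -> wt U B' n' t <= K * pdec t * wt U B n s.
Proof.
move=> B0 BB nn; have B'0 : 0 < B' by apply: lt_trans BB.
have [KU KU0 hKU] := N_upper hN; have [KL KL0 hKL] := N_lower hN.
have p0 := ltW p_gt0.
pose B2 := (B + B') / 2.
have B20 : 0 < B2 by rewrite divr_gt0// addr_gt0.
pose dl := B * KU; have dl0 : 0 <= dl by rewrite mulr_ge0// ltW.
pose k1 := B' / B; pose k2 := B2 / B.
have k11 : 1 < k1 by rewrite ltr_pdivlMr// mul1r.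
have k21 : 1 < k2 by rewrite ltr_pdivlMr// mul1r /B2; lra.
pose C1 := (dl * k1 / (k1 - 1)) `^ p; pose C2 := (dl * k2 / (k2 - 1)) `^ p.
pose c := B' `^ p - B2 `^ p.
have c0 : 0 < c.
  by rewrite subr_gt0 gt0_ltr_powR ?p_gt0// ?nnegrE ?ltW// /B2; lra.
pose c' := 2 * c / (d%:R + 1) / KL.
have c'0 : 0 < c' by rewrite !divr_gt0 ?mulr_gt0// ltr_wpDl.
pose K1 := expR (2 * C1 + 2 * C2 + 2 * c).
pose K2 := (1 + 4 / c' ^+ 2) ^+ d.
pose K3 := (2 ^+ (2 * n)) ^+ d : R.
exists (K3 * (K1 * K2)).
  by rewrite !mulr_gt0 ?expR_gt0 ?exprn_gt0// ltr_pwDl// divr_ge0 ?sqr_ge0.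
move=> U t s cU [/= h1 h2].
have U0 : U !=set0 by case: cU.
rewrite !wtE /pdec.
have P1 : polyw n' t <= K3 * tdec t.1 * polyw n s.
  have -> : K3 = \prod_(j < d) 2 ^+ (2 * n) by rewrite prodr_const card_ord.
  rewrite /polyw /tdec -!big_split /=.
  apply: ler_prod => j _; rewrite exprn_ge0 ?addr_ge0//=.
  have hj := h1 j; set x := tnth t.1 j in hj *; set x' := tnth s.1 j in hj *.
  have a1 : 1 + `|x : R| <= 2 * (1 + `|x' : R|).
    have := ler_normB (x' : R) (x' - x); rewrite opprB addrC subrK => hx.
    have x'0 : 0 <= `|x' : R| by [].
    by apply: (le_trans (lerD (lexx 1) hx)); lra.
  have a2 : (1 + `|x : R|) ^+ (2 * n') * (1 + (x : R) ^+ 2) <= (1 + `|x : R|) ^+ (2 * n).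
    apply: (@le_trans _ _ ((1 + `|x : R|) ^+ (2 * n') * (1 + `|x : R|) ^+ 2)).
      rewrite ler_wpM2l ?exprn_ge0 ?addr_ge0// sqrrD expr1n real_normK ?num_real//.
      have := normr_ge0 (x : R); lra.
    by rewrite -exprD -mulnSr ler_weXn2l ?lerDl// leq_mul2l.
  have a3 : (1 + `|x : R|) ^+ (2 * n) <= 2 ^+ (2 * n) * (1 + `|x' : R|) ^+ (2 * n).
    by rewrite -exprMn lerXn2r// nnegrE ?mulr_ge0 ?addr_ge0.
  rewrite /idec mulrAC ler_pdivlMr ?ltr_pwDl ?sqr_ge0//.
  exact: le_trans a2 a3.
pose A := dist_set N (real_point t.1) U; pose A' := dist_set N (real_point s.1) U.
pose Y := N (real_point t.2); pose Y' := N (real_point s.2).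
have A0 : 0 <= A by exact: dist_ge0.
have A'0 : 0 <= A' by exact: dist_ge0.
have Y0 : 0 <= Y by exact: N_ge0.
have Y'0 : 0 <= Y' by exact: N_ge0.
have NK (u v : d.-tuple mR) : (forall j, `|(tnth v j : R) - tnth u j| <= 1) ->
    N (real_point v - real_point u) <= KU.
  move=> huv; apply: (le_trans (hKU _)); rewrite -[leRHS]mulr1 ler_wpM2l ?(ltW KU0)//.
  by apply: rn_leP => // j; rewrite !mxE; exact: huv.
have AA : B * A' <= B * A + dl.
  rewrite /dl -mulrDr ler_wpM2l ?(ltW B0)// addrC.
  by apply: (le_trans (dist_lip hN _ (real_point t.1) U0)); rewrite lerD2r; exact: NK.
have YY : B * Y' <= B * Y + dl.
  rewrite /dl -mulrDr ler_wpM2l ?(ltW B0)// addrC.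
  have := ND hN (real_point s.2 - real_point t.2) (real_point t.2); rewrite subrK => /le_trans; apply.
  by rewrite lerD2r; exact: NK.
have EA : (B * A') `^ p <= (B' * A) `^ p + C1.
  apply: (@le_trans _ _ ((B * A + dl) `^ p)).
    by apply: powR_mono => //; rewrite mulr_ge0// ltW.
  have := @powR_shift _ k1 dl (B * A) p k11 dl0 p0; rewrite mulrA divfK ?gt_eqF//; apply.
  by rewrite mulr_ge0// ltW.
have EY : (B * Y') `^ p <= (B2 * Y) `^ p + C2.
  apply: (@le_trans _ _ ((B * Y + dl) `^ p)).
    by apply: powR_mono => //; rewrite mulr_ge0// ltW.
  have := @powR_shift _ k2 dl (B * Y) p k21 dl0 p0; rewrite mulrA divfK ?gt_eqF//; apply.
  by rewrite mulr_ge0// ltW.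
have EB : (B' * Y) `^ p - (B2 * Y) `^ p = c * Y `^ p.
  by rewrite (powRM p (ltW B'0) Y0) (powRM p (ltW B20) Y0) /c mulrBl.
have Yp := powR_ge_lin p_ge1 Y0.
have Ysum : \sum_(j < d) `|tnth t.2 j : R| <= (d%:R + 1) * (KL * Y).
  have KY : 0 <= KL * Y by rewrite mulr_ge0// ltW.
  apply: (@le_trans _ _ (\sum_(j < d) (KL * Y))).
    apply: ler_sum => j _; apply: le_trans (hKL _).
    by have := le_rn (real_point t.2) j; rewrite mxE.
  by rewrite sumr_const card_ord -[leLHS]mulr_natl mulrDl mul1r lerDl.
have Z : expR (- (2 * c * Y)) <= K2 * tdec t.2.
  apply: (@le_trans _ _ (\prod_(j < d) expR (- (c' * `|tnth t.2 j : R|)))).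
    rewrite -expR_sum ler_expR sumrN lerN2 -mulr_sumr.
    apply: (le_trans (ler_wpM2l (ltW c'0) Ysum)).
    rewrite le_eqVlt; apply/orP; left; apply/eqP; rewrite /c'; field.
    by rewrite !gt_eqF//= ltr_wpDl.
  have -> : K2 = \prod_(j < d) (1 + 4 / c' ^+ 2) by rewrite prodr_const card_ord.
  rewrite /tdec -big_split /=.
  by apply: ler_prod => j _; rewrite expR_ge0 exp_idec.
have P2 : expR (- 2 * dist_set N (B' *: real_point t.1) U `^ p - 2 * N (B' *: real_point t.2) `^ p) <=
    K1 * K2 * tdec t.2 *
    expR (- 2 * dist_set N (B *: real_point s.1) U `^ p - 2 * N (B *: real_point s.2) `^ p).
  rewrite !(dist_cone hN)// !NZ_pos ?(ltW B0) ?(ltW B'0)// -/A -/A' -/Y -/Y'.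
  apply: (@le_trans _ _ (K1 * expR (- (2 * c * Y)) * expR (- 2 * (B * A') `^ p - 2 * (B * Y') `^ p))).
    rewrite /K1 -!expRD ler_expR.
    have : c * Y <= c * Y `^ p + c by rewrite -[X in _ + X]mulr1 -mulrDr ler_wpM2l// ltW.
    rewrite -EB -mulrA; move: EA EY.
    move: ((B * A') `^ p) ((B' * A) `^ p) ((B * Y') `^ p) ((B2 * Y) `^ p) ((B' * Y) `^ p) (c * Y).
    by move=> *; lra.
  by rewrite ler_wpM2r ?expR_ge0// -[leRHS]mulrA ler_wpM2l ?expR_ge0.
have T1 := tdec_gt0 t.1; have T2 := tdec_gt0 t.2.
apply: (le_trans (ler_pM (ltW (polyw_gt0 _ _)) (expR_ge0 _) P1 P2)).
by rewrite le_eqVlt; apply/orP; left; apply/eqP; ring.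
Qed.

End Weights.

(** * The weighted Hilbert norms *)

Section EntireOps.
Context {R : realType} {d : nat}.
Notation C := R[i].
Implicit Types f g : cfun R d.

Lemma entireD f g : entire f -> entire g -> entire (f + g).
Proof. by move=> hf hg z; apply: differentiableD. Qed.

Lemma entireZ (a : C) f : entire f -> entire (a *: f).
Proof. by move=> hf z; apply: differentiableZ. Qed.

Lemma entire0 : entire (0 : cfun R d).
Proof. by move=> z; exact: differentiable_cst. Qed.

Lemma entireN f : entire f -> entire (- f).
Proof. by rewrite -scaleN1r; exact: entireZ. Qed.

Lemma entireB f g : entire f -> entire g -> entire (f - g).
Proof. by move=> hf /entireN; exact: entireD. Qed.
End EntireOps.

Section HilbertNorms.
Context {R : realType} {d : nat}.
Local Notation mR := (measurableTypeR R).
Notation C := R[i].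
Notation pts := (d.-tuple mR * d.-tuple mR)%type.
Variables (beta : R) (N : 'rV[R]_d -> R).
Hypothesis hb0 : 0 <= beta.
Hypothesis hb1 : beta < 1.
Hypothesis hN : is_norm N.
Implicit Types (U : set 'rV[R]_d) (B : R) (n : nat) (t : pts) (f g : cfun R d).

Local Notation wt := (wt beta N).
Local Notation hn := (Hnorm beta N).
Local Notation hs := (Hsqnorm beta N).
Local Notation lebp d := (@lebesgue_tuple R d \x @lebesgue_tuple R d)%E.

Definition HE U B n f := entire f /\ (hs U B n f < +oo)%E.

Lemma HsE U B n f : hs U B n f = (\int[lebp d]_t (nc (f (pt t)) ^+ 2 * wt U B n t)%:E)%E.
Proof. by []. Qed.

Lemma wt_ge0 U B n t : 0 <= wt U B n t.
Proof. exact/ltW/wt_gt0. Qed.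

Lemma dens_ge0 U B n f t : (0 <= (nc (f (pt t)) ^+ 2 * wt U B n t)%:E)%E.
Proof. by rewrite lee_fin mulr_ge0 ?sqr_ge0 ?wt_ge0. Qed.

Lemma measurable_dens U B n f : cone U -> entire f ->
  measurable_fun setT (fun t => (nc (f (pt t)) ^+ 2 * wt U B n t)%:E).
Proof.
move=> cU ef; apply/measurable_EFinP; apply: measurable_funM; last exact: measurable_wt.
by apply: measurable_nc_sqr; exact: entire_cmeas.
Qed.

Lemma hs_ge0 U B n f : (0 <= hs U B n f)%E.
Proof. by apply: integral_ge0 => t _; exact: dens_ge0. Qed.

Lemma hn_ge0 U B n f : 0 <= hn U B n f.
Proof. exact: sqrtr_ge0. Qed.

Lemma hs_hn U B n f : HE U B n f -> hs U B n f = (hn U B n f ^+ 2)%:E.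
Proof.
move=> [_ h]; rewrite /Hnorm sqr_sqrtr ?fine_ge0 ?hs_ge0// fineK//.
by rewrite ge0_fin_numE ?hs_ge0.
Qed.

Lemma HE_le U B n f (M : R) : entire f -> 0 <= M -> (hs U B n f <= (M ^+ 2)%:E)%E ->
  HE U B n f /\ hn U B n f <= M.
Proof.
move=> ef M0 h; have hE : HE U B n f by split => //; apply: le_lt_trans h (ltry _).
split => //; move: h; rewrite hs_hn// lee_fin ler_sqr// ?nnegrE//; exact: hn_ge0.
Qed.

Definition pmass : R := fine (\int[lebp d]_t (pdec t)%:E)%E.

Lemma pmassE : (\int[lebp d]_t (pdec t)%:E = pmass%:E)%E.
Proof. by rewrite fineK// (integrable_fin_num _ (integrable_pdec d)). Qed.

Lemma pmass_ge0 : 0 <= pmass.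
Proof. by apply: fine_ge0; apply: integral_ge0 => t _; rewrite lee_fin ltW// pdec_gt0. Qed.

Lemma HE_dens U B n f (M : R) : cone U -> entire f -> 0 <= M ->
  (forall t, nc (f (pt t)) ^+ 2 * wt U B n t <= M * pdec t) ->
  HE U B n f /\ hn U B n f ^+ 2 <= M * pmass.
Proof.
move=> cU ef M0 hM.
have h : (hs U B n f <= (M * pmass)%:E)%E.
  rewrite HsE EFinM -pmassE -ge0_integralZl_EFin//; last 2 first.
  - by move=> t _; rewrite lee_fin ltW// pdec_gt0.
  - by apply/measurable_EFinP; exact: measurable_pdec.
  apply: ge0_le_integral => //.
  - by move=> t _; exact: dens_ge0.
  - exact: measurable_dens.
  - by apply: measurable_funeM; apply/measurable_EFinP; exact: measurable_pdec.
  - by move=> t _; rewrite -EFinM lee_fin.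
have hE : HE U B n f by split => //; apply: le_lt_trans h (ltry _).
by split => //; rewrite -lee_fin -hs_hn.
Qed.

Lemma HE_mono U U' B B' n n' f : cone U -> cone U' -> (forall t, wt U' B' n' t <= wt U B n t) ->
  HE U B n f -> HE U' B' n' f /\ hn U' B' n' f <= hn U B n f.
Proof.
move=> cU cU' hw hE; have [ef _] := hE.
apply: HE_le => //; first exact: hn_ge0.
rewrite -(hs_hn hE) !HsE; apply: ge0_le_integral.
- exact: measurableT.
- by move=> t _; exact: dens_ge0.
- exact: measurable_dens.
- exact: measurable_dens.
- by move=> t _; rewrite lee_fin ler_wpM2l ?sqr_ge0.
Qed.

Lemma hsZ U B n (a : C) f : cone U -> entire f -> (hs U B n (a *: f) = (nc a ^+ 2)%:E * hs U B n f)%E.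
Proof.
move=> cU ef; rewrite !HsE -ge0_integralZl_EFin ?sqr_ge0//.
- by apply: eq_integral => t _; rewrite -EFinM; congr EFin; rewrite [RHS]mulrA; congr (_ * _); rewrite -exprMn -ncM.
- by move=> t _; exact: dens_ge0.
- exact: measurable_dens.
Qed.

Lemma HEZ U B n (a : C) f : cone U -> HE U B n f ->
  HE U B n (a *: f) /\ hn U B n (a *: f) = nc a * hn U B n f.
Proof.
move=> cU hE; have [ef hf] := hE.
have h : HE U B n (a *: f).
  split; first exact: entireZ.
  by rewrite hsZ// hs_hn// -EFinM ltry.
split => //; apply: (@pexpIrn _ 2%N) => //; rewrite ?nnegrE ?mulr_ge0 ?nc_ge0 ?hn_ge0//.
apply: (can_inj (fun r : R => erefl (fine r%:E))).
by rewrite -hs_hn// hsZ// hs_hn// -EFinM exprMn.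
Qed.

Lemma sqr_ncD (a b : C) (s : R) : 0 < s ->
  nc (a + b) ^+ 2 <= (1 + s) * nc a ^+ 2 + (1 + s^-1) * nc b ^+ 2.
Proof.
move=> s0; apply: (@le_trans _ _ ((nc a + nc b) ^+ 2)).
  by rewrite lerXn2r ?nnegrE ?addr_ge0 ?nc_ge0// ncD.
set x := nc a; set y := nc b.
have h : 0 <= s * (x - s^-1 * y) ^+ 2 by rewrite mulr_ge0 ?sqr_ge0// ltW.
have e : s * (x - s^-1 * y) ^+ 2 = s * x ^+ 2 - 2 * (x * y) + s^-1 * y ^+ 2.
  by field; rewrite gt_eqF.
rewrite e in h; move: h; rewrite sqrrD; lra.
Qed.

Lemma HED U B n f g : cone U -> HE U B n f -> HE U B n g ->
  HE U B n (f + g) /\ hn U B n (f + g) <= hn U B n f + hn U B n g.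
Proof.
move=> cU hf hg; have [ef _] := hf; have [eg _] := hg.
set x := hn U B n f; set y := hn U B n g.
have x0 : 0 <= x by exact: hn_ge0.
have y0 : 0 <= y by exact: hn_ge0.
have key s : 0 < s -> (hs U B n (f + g)%R <= ((1 + s) * x ^+ 2 + (1 + s^-1) * y ^+ 2)%:E)%E.
  move=> s0; have s1 : 0 <= 1 + s by lra.
  have s2 : 0 <= 1 + s^-1 by rewrite addr_ge0// invr_ge0 ltW.
  rewrite EFinD (EFinM (1 + s)) (EFinM (1 + s^-1)) /x /y -!hs_hn// !HsE -!ge0_integralZl_EFin//; try by move=> t _; exact: dens_ge0.
  all: try exact: measurable_dens.
  rewrite -ge0_integralD//.
  all: try by apply: measurable_funeM; exact: measurable_dens.
  all: try by move=> t _; rewrite mule_ge0 ?dens_ge0// lee_fin.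
  apply: ge0_le_integral => //.
  - by move=> t _; exact: dens_ge0.
  - by apply: (measurable_dens _ _ cU); exact: entireD.
  - by apply: emeasurable_funD; apply: measurable_funeM; exact: measurable_dens.
  - move=> t _; rewrite -!EFinM -EFinD lee_fin.
    have := ler_wpM2r (wt_ge0 U B n t) (sqr_ncD (f (pt t)) (g (pt t)) s0).
    by rewrite mulrDl -(mulrA (1 + s)) -(mulrA (1 + s^-1)).
have hE : HE U B n (f + g).
  by split; [exact: entireD|apply: le_lt_trans (key _ (@ltr01 R)) (ltry _)].
split => //; apply/ler_addgt0Pr => e e0.
have xe : 0 < x + e / 2 by rewrite ltr_wpDl// divr_gt0.
have ye : 0 < y + e / 2 by rewrite ltr_wpDl// divr_gt0.
have := key ((y + e / 2) / (x + e / 2)) (divr_gt0 ye xe).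
rewrite hs_hn// lee_fin => h.
rewrite -(@ler_sqr R) ?nnegrE ?hn_ge0 ?addr_ge0//; last exact: ltW.
apply: (le_trans h).
set X := x + e / 2 in xe *; set Y := y + e / 2 in ye *.
have -> : x + y + e = X + Y by rewrite /X /Y; field.
have -> : (X + Y) ^+ 2 = (1 + Y / X) * X ^+ 2 + (1 + (Y / X)^-1) * Y ^+ 2.
  by field; rewrite !gt_eqF.
have e2 : 0 < e / 2 by rewrite divr_gt0.
have YX : 0 <= Y / X by rewrite ltW// divr_gt0.
have xX : x ^+ 2 <= X ^+ 2 by rewrite ler_sqr ?nnegrE// ?(ltW xe)// /X lerDl ltW.
have yY : y ^+ 2 <= Y ^+ 2 by rewrite ler_sqr ?nnegrE// ?(ltW ye)// /Y lerDl ltW.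
by apply: lerD; rewrite ler_wpM2l// addr_ge0// invr_ge0.
Qed.

Lemma hsD0 U B n : hs U B n 0 = 0%E.
Proof.
rewrite HsE; apply: integral0_eq => t _; by rewrite nc0 expr0n mul0r.
Qed.

Lemma HE0 U B n : HE U B n 0 /\ hn U B n 0 = 0.
Proof.
split; first by split; [exact: entire0|rewrite hsD0].
by rewrite /Hnorm hsD0 sqrtr0.
Qed.

Lemma HEN U B n f : cone U -> HE U B n f -> HE U B n (- f) /\ hn U B n (- f) = hn U B n f.
Proof.
move=> cU /(HEZ (-1) cU)[h e]; rewrite -scaleN1r; split => //.
by rewrite e ncN nc1 mul1r.
Qed.

Lemma HEB U B n f g : cone U -> HE U B n f -> HE U B n g ->
  HE U B n (f - g) /\ hn U B n (f - g) <= hn U B n f + hn U B n g.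
Proof. by move=> cU hf /(HEN cU)[hg <-]; exact: HED. Qed.

(** The Hilbert norm controls weighted pointwise values, with room for an integrable
factor: integrate [wt_compare] against the unit cube of [point_bound]. *)
Lemma H_point B B' n n' : 0 < B -> B < B' -> (n'.+1 <= n)%N ->
  exists2 K, 0 < K & forall U f t, cone U -> HE U B n f ->
    nc (f (pt t)) ^+ 2 * wt U B' n' t <= K * hn U B n f ^+ 2 * pdec t.
Proof.
move=> B0 BB nn; have [K K0 hK] := @point_bound R d.
have [K' K'0 hK'] := wt_compare hb0 hb1 hN B0 BB nn.
exists (K * K'); first exact: mulr_gt0.
move=> U f t cU hE; have [ef _] := hE.
have w0 := wt_ge0 U B' n' t; have p0 := ltW (pdec_gt0 t).
have mc : measurable (pcube t 1) by exact: measurable_pcube.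
have msq : measurable_fun setT (fun s => (nc (f (pt s)) ^+ 2)%:E).
  by apply/measurable_EFinP; apply: measurable_nc_sqr; exact: entire_cmeas.
rewrite -lee_fin mulrC EFinM.
apply: (le_trans (lee_wpmul2l _ (hK f t ef))); first by rewrite lee_fin.
rewrite muleCA [leRHS](_ : _ = K%:E * (((K' * pdec t)%:E) * hs U B n f))%E; last first.
  by rewrite hs_hn// -!EFinM; congr EFin; ring.
apply: lee_wpmul2l; first by rewrite lee_fin ltW.
rewrite HsE -ge0_integralZl_EFin//; last 2 first.
- by move=> s _; rewrite lee_fin sqr_ge0.
- exact: measurable_funTS.
apply: (@le_trans _ _ (\int[lebp d]_(s in pcube t 1) ((K' * pdec t)%:E * (nc (f (pt s)) ^+ 2 * wt U B n s)%:E))%E).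
  apply: ge0_le_integral => //.
  - by move=> s _; rewrite -EFinM lee_fin mulr_ge0 ?sqr_ge0.
  - by apply: measurable_funeM; exact: measurable_funTS.
  - by apply: measurable_funeM; apply: measurable_funTS; exact: measurable_dens.
  - move=> s hs; rewrite -!EFinM lee_fin [X in _ <= _ * X]mulrC [leRHS]mulrA.
    by apply: ler_wpM2r; [exact: sqr_ge0|exact: hK'].
have Kp : 0 <= K' * pdec t by apply: mulr_ge0 => //; exact: ltW.
rewrite -ge0_integralZl_EFin//; last 2 first.
- by move=> s _; exact: dens_ge0.
- exact: measurable_dens.
apply: ge0_subset_integral => //.
- by apply: measurable_funeM; exact: measurable_dens.
- by move=> s _; rewrite mule_ge0 ?dens_ge0// lee_fin mulr_ge0// ltW.
Qed.

End HilbertNorms.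

(** * Inner products and completeness *)

Section InnerProduct.
Context {R : realType} {d : nat}.
Local Notation mR := (measurableTypeR R).
Notation C := R[i].
Notation pts := (d.-tuple mR * d.-tuple mR)%type.
Variables (beta : R) (N : 'rV[R]_d -> R).
Hypothesis hb0 : 0 <= beta.
Hypothesis hb1 : beta < 1.
Hypothesis hN : is_norm N.
Implicit Types (U : set 'rV[R]_d) (B : R) (n : nat) (t : pts) (f g : cfun R d).

Local Notation wt := (wt beta N).
Local Notation hn := (Hnorm beta N).
Local Notation hs := (Hsqnorm beta N).
Local Notation HE := (HE beta N).
Local Notation lebp d := (@lebesgue_tuple R d \x @lebesgue_tuple R d)%E.

Lemma mul_lin (x a y z w : C) : x * (a * y + z) * w = a * (x * y * w) + x * z * w.
Proof. ring. Qed.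

Lemma mul_conj (x y : C) (w : R) : Re (y^* * x * w%:C) = Re (x^* * y * w%:C) /\
  Im (y^* * x * w%:C) = - 1 * Im (x^* * y * w%:C).
Proof. by rewrite !ReIm; case: x y => a b [c e] /=; split; ring. Qed.

Lemma mul_real (x w : R) : Re (x%:C * w%:C) = x * w /\ Im (x%:C * w%:C) = 0.
Proof. by rewrite !ReIm /=; split; ring. Qed.

Definition ipd U B n f g t : C := (f (pt t))^* * g (pt t) * (wt U B n t)%:C.

Definition ip U B n f g : C := cint (lebp d) setT (ipd U B n f g).

Lemma cmeas_ipd U B n f g : cone U -> entire f -> entire g -> cmeas setT (ipd U B n f g).
Proof.
move=> cU ef eg; apply: cmeasM; last by apply: cmeas_real; exact: measurable_wt.
by apply: cmeasM; [apply: cmeasJ; exact: entire_cmeas|exact: entire_cmeas].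
Qed.

Lemma integrable_dens U B n f : cone U -> HE U B n f ->
  (lebp d).-integrable setT (EFin \o (fun t => nc (f (pt t)) ^+ 2 * wt U B n t)).
Proof.
move=> cU [ef hf]; apply/integrableP; split; first exact: measurable_dens.
apply: le_lt_trans hf; rewrite HsE le_eqVlt; apply/orP; left; apply/eqP.
apply: eq_integral => t _ /=; rewrite ger0_norm//.
by apply: mulr_ge0; [exact: sqr_ge0|exact: wt_ge0].
Qed.

Lemma nc_ipd U B n f g t : nc (ipd U B n f g t) <=
  nc (f (pt t)) ^+ 2 * wt U B n t + nc (g (pt t)) ^+ 2 * wt U B n t.
Proof.
have w0 := wt_ge0 beta N U B n t.
rewrite !ncM ncJ ncR ger0_norm// -mulrDl ler_wpM2r//.
set a := nc _; set b := nc _.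
have := sqr_ge0 (a - b); rewrite sqrrB; have := sqr_ge0 (a + b); rewrite sqrrD.
have : 0 <= a by exact: nc_ge0.
have : 0 <= b by exact: nc_ge0.
nra.
Qed.

Lemma cintegrable_ipd U B n f g : cone U -> HE U B n f -> HE U B n g ->
  cintegrable (lebp d) setT (ipd U B n f g).
Proof.
move=> cU hf hg; have [ef _] := hf; have [eg _] := hg.
apply: (@cintegrable_le _ _ _ _ _ _ (fun t => nc (f (pt t)) ^+ 2 * wt U B n t + nc (g (pt t)) ^+ 2 * wt U B n t)).
- exact: measurableT.
- exact: cmeas_ipd.
- exact: (integrableD measurableT (integrable_dens cU hf) (integrable_dens cU hg)).
- by move=> t _; exact: nc_ipd.
Qed.

Lemma ip_lin U B n f (a : C) g h : cone U -> HE U B n f -> HE U B n g -> HE U B n h ->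
  ip U B n f (a *: g + h) = a * ip U B n f g + ip U B n f h.
Proof.
move=> cU hf hg hh; rewrite /ip -cintZ; [|exact: measurableT|exact: cintegrable_ipd].
rewrite -cintD.
- by apply: eq_cint => t _; exact: mul_lin.
- exact: measurableT.
- by apply: cintegrableZ; [exact: measurableT|exact: cintegrable_ipd].
- exact: cintegrable_ipd.
Qed.

Lemma ip_conj U B n f g : cone U -> HE U B n f -> HE U B n g -> ip U B n g f = (ip U B n f g)^*.
Proof.
move=> cU hf hg; rewrite /ip /cint; apply: complexP => /=.
  by apply: eq_Rintegral => t _; exact: (mul_conj _ _ _).1.
rewrite -mulN1r -RintegralZl//; last by have [] := cintegrable_ipd cU hf hg.
by apply: eq_Rintegral => t _; exact: (mul_conj _ _ _).2.
Qed.

Lemma ip_diag U B n f : HE U B n f -> ip U B n f f = (hn U B n f ^+ 2)%:C.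
Proof.
move=> hf; rewrite /ip /cint; apply: complexP => /=.
  rewrite -[RHS]/(fine (hn U B n f ^+ 2)%:E) -hs_hn//.
  congr fine; apply: eq_integral => t _; congr EFin; rewrite /ipd mulJ_nc; exact: (mul_real _ _).1.
rewrite /Rintegral integral0_eq// => t _; congr EFin; rewrite /ipd mulJ_nc; exact: (mul_real _ _).2.
Qed.

End InnerProduct.

Section Frechet.
Context {R : realType} {d : nat}.
Local Notation mR := (measurableTypeR R).
Notation C := R[i].
Notation pts := (d.-tuple mR * d.-tuple mR)%type.
Variables (beta : R) (N : 'rV[R]_d -> R).
Hypothesis hb0 : 0 <= beta.
Hypothesis hb1 : beta < 1.
Hypothesis hN : is_norm N.
Implicit Types (U : set 'rV[R]_d) (B : R) (n : nat) (t : pts) (f g : cfun R d).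

Local Notation wt := (wt beta N).
Local Notation hn := (Hnorm beta N).
Local Notation HE := (HE beta N).

Lemma sqr_le (x y : R) : 0 <= x -> x <= y -> x ^+ 2 <= y ^+ 2.
Proof. by move=> x0 xy; rewrite ler_sqr ?nnegrE// (le_trans x0). Qed.

Lemma le_sqr (x y : R) : 0 <= y -> x ^+ 2 <= y ^+ 2 -> x <= y.
Proof.
move=> y0; have [x0|x0] := leP 0 x; first by rewrite ler_sqr.
by move=> _; rewrite ltW// (lt_le_trans x0).
Qed.

Lemma half_ge0 m : 0 <= 2^-1 ^+ m :> R.
Proof. by apply: exprn_ge0; rewrite invr_ge0. Qed.

Lemma pdec_le1 t : pdec t <= 1.
Proof.
have T (u : d.-tuple mR) : 0 <= tdec u <= 1.
  rewrite ltW ?tdec_gt0//= /tdec; apply: prodr_ile1 => j _; rewrite idec_le1 andbT ltW//.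
  exact: idec_gt0.
have /andP[a1 a2] := T t.1; have /andP[a3 a4] := T t.2.
by rewrite /pdec mulr_ile1.
Qed.

Lemma wt_lower U B n rho : cone U -> 0 < B -> exists2 c, 0 < c &
  forall t, cn (pt t) <= rho -> c <= wt U B n t.
Proof.
move=> cU B0; have [K K0 hK] := N_upper hN; pose p := (1 - beta)^-1.
have p0 : 0 <= p by rewrite invr_ge0 subr_ge0 ltW.
pose r := `|rho|; pose X := (B * (K * r)) `^ p.
exists (expR (- 4 * X)); first exact: expR_gt0.
move=> t ht; have tr : cn (pt t) <= r by apply: le_trans ht (ler_norm _).
rewrite wtE -[leLHS]mul1r; apply: ler_pM; rewrite ?expR_ge0//; first exact: polyw_ge1.
rewrite ler_expR.
have r0 : 0 <= r by exact: normr_ge0.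
have h1 : N (real_point t.1) <= K * r.
  apply: (le_trans (hK _)); rewrite ler_wpM2l ?(ltW K0)//; apply: rn_leP => // j; rewrite mxE.
  have := le_trans (le_cn (pt t) j) tr; rewrite ptE; apply: le_trans.
  exact: (Re_le_nc ((tnth t.1 j : R) +i* (tnth t.2 j : R))).
have h2 : N (real_point t.2) <= K * r.
  apply: (le_trans (hK _)); rewrite ler_wpM2l ?(ltW K0)//; apply: rn_leP => // j; rewrite mxE.
  have := le_trans (le_cn (pt t) j) tr; rewrite ptE; apply: le_trans.
  exact: (Im_le_nc ((tnth t.1 j : R) +i* (tnth t.2 j : R))).
have e1 : dist_set N (B *: real_point t.1) U `^ p <= X.
  apply: powR_mono => //; first by apply: dist_ge0 => //; case: cU.
  rewrite dist_cone// ler_wpM2l ?(ltW B0)//; apply: le_trans h1.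
  exact: dist_leN.
have e2 : N (B *: real_point t.2) `^ p <= X.
  apply: powR_mono => //; first exact: N_ge0.
  by rewrite NZ_pos ?(ltW B0)// ler_wpM2l ?(ltW B0).
move: e1 e2; rewrite /p; set a := _ `^ _; set b := _ `^ _; lra.
Qed.

(** The carrier of the Frechet space of scale [b]. *)
Definition Sb U (b : R) f : Prop := forall B n, b < B -> HE U B n f.

Lemma Sb_lin U b (a : C) f g : cone U -> Sb U b f -> Sb U b g -> Sb U b (a *: f + g).
Proof.
move=> cU hf hg B n bB.
by have [] := HED hN cU (HEZ hN a cU (hf B n bB)).1 (hg B n bB).
Qed.

Lemma Sb0 U b : Sb U b 0.
Proof. by move=> B n _; have [] := HE0 beta N U B n. Qed.

Lemma SbB U b f g : cone U -> Sb U b f -> Sb U b g -> Sb U b (f - g).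
Proof. by move=> cU hf hg; rewrite addrC -scaleN1r; exact: Sb_lin. Qed.

Lemma Sb_entire U b f : Sb U b f -> entire f.
Proof. by move=> /(_ (b + 1) 0%N); rewrite ltrDl => /(_ ltr01)[]. Qed.

(** Scales decreasing to [b]: the norms with indices [Bm b m] and [m] increase with [m]
and are cofinal among those that define the space. *)
Definition Bm (b : R) (m : nat) : R := b + m.+1%:R^-1.

Lemma Bm_gt b m : b < Bm b m.
Proof. by rewrite ltrDl invr_gt0 ltr0n. Qed.

Lemma Bm_mono b m m' : (m <= m')%N -> Bm b m' <= Bm b m.
Proof. by move=> mm; rewrite lerD2l lef_pV2 ?posrE ?ltr0n// ler_nat. Qed.

Lemma Bm_small b B : b < B -> exists m0, forall m, (m0 <= m)%N -> Bm b m <= B.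
Proof.
move=> bB; have e0 : 0 < B - b by rewrite subr_gt0.
have [m hm] : exists m : nat, (B - b)^-1 < m%:R.
  by exists (Num.bound ((B - b)^-1)); rewrite archi_boundP// invr_ge0 ltW.
exists m => k mk; rewrite /Bm -lerBrDl -[leRHS]invrK lef_pV2 ?posrE ?invr_gt0 ?ltr0n//.
by apply: (le_trans (ltW hm)); rewrite ler_nat (leq_trans mk).
Qed.

Lemma hn_tele U B n (F : nat -> cfun R d) i : cone U -> (forall m, HE U B n (F m)) ->
  (forall j, (i <= j)%N -> hn U B n (F j.+1 - F j) <= 2^-1 ^+ j) ->
  forall j, (i <= j)%N -> hn U B n (F j - F i) <= 2 * 2^-1 ^+ i.
Proof.
move=> cU hF hd j ij.
suff : hn U B n (F j - F i) <= 2 * 2^-1 ^+ i - 2 * 2^-1 ^+ j.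
  by move=> /le_trans; apply; rewrite gerBl mulr_ge0// exprn_ge0// invr_ge0.
rewrite -(subnKC ij); elim: (j - i)%N => [|k ih].
  by rewrite addn0 !subrr (HE0 beta N U B n).2.
rewrite addnS; have -> : F (i + k).+1 - F i = (F (i + k).+1 - F (i + k)%N) + (F (i + k)%N - F i).
  by rewrite addrA subrK.
have HB g h : HE U B n g -> HE U B n h -> HE U B n (g - h).
  by move=> hg hh; have [] := HEB hN cU hg hh.
apply: (le_trans (HED hN cU (HB _ _ (hF _) (hF _)) (HB _ _ (hF _) (hF _))).2).
apply: (le_trans (lerD (hd _ (leq_addr _ _)) ih)).
rewrite exprS; set a := _ ^+ i; set c := _ ^+ _; lra.
Qed.

Lemma Sb_mono U B B' n n' f : cone U -> 0 < B -> HE U B n f -> B <= B' -> (n' <= n)%N ->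
  hn U B' n' f <= hn U B n f.
Proof.
move=> cU B0 hf BB nn.
by have [] := HE_mono hN cU cU (fun t => wt_mono hb0 hb1 hN t cU B0 BB nn) hf.
Qed.

(** The limit is taken pointwise, which the point estimates allow; they pass to the
limit, and integrating them gives convergence in the norms. *)
Lemma Sb_complete U b (F : nat -> cfun R d) : cone U -> 0 < b -> (forall m, Sb U b (F m)) ->
  (forall m, hn U (Bm b m) m (F m.+1 - F m) <= 2^-1 ^+ m) ->
  exists2 G, Sb U b G & forall B n e, b < B -> 0 < e ->
    exists M, forall j, (M <= j)%N -> hn U B n (G - F j) <= e.
Proof.
move=> cU b0 hF hd.
have pw B n : b < B -> exists m0, exists2 K, 0 < K & forall i j t, (m0 <= i)%N -> (i <= j)%N ->
    nc (F j (pt t) - F i (pt t)) ^+ 2 * wt U B n t <= K * (2^-1 ^+ i) ^+ 2 * pdec t.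
  move=> bB; pose B1 := (b + B) / 2.
  have bB1 : b < B1 by rewrite /B1; lra.
  have B10 : 0 < B1 by apply: lt_trans bB1.
  have B1B : B1 < B by rewrite /B1; lra.
  have [m0 hm0] := Bm_small bB1.
  have [K K0 hK] := H_point hb0 hb1 hN B10 B1B (leqnn n.+1).
  exists (maxn m0 n.+1), (K * 4); first by rewrite mulr_gt0.
  move=> i j t; rewrite geq_max => /andP[mi ni] ij.
  have H : HE U B1 n.+1 (F j - F i) by have [] := HEB hN cU (hF j B1 n.+1 bB1) (hF i B1 n.+1 bB1).
  apply: (le_trans (hK U _ t cU H)).
  have -> : K * 4 * (2^-1 ^+ i) ^+ 2 = K * (2 * 2^-1 ^+ i) ^+ 2 by rewrite exprMn; ring.
  rewrite ler_wpM2r ?(ltW (pdec_gt0 _))// ler_wpM2l ?(ltW K0)//.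
  apply: sqr_le; first exact: hn_ge0.
  apply: hn_tele => // [m|k ik]; first exact: hF.
  apply: le_trans (hd k); apply: Sb_mono.
  - exact: cU.
  - by apply: lt_trans (Bm_gt b k).
  - by have [] := HEB hN cU (hF k.+1 _ k (Bm_gt b k)) (hF k _ k (Bm_gt b k)).
  - by apply: hm0; apply: leq_trans ik.
  - by apply: leq_trans ik.
have lim z : exists l, forall e, 0 < e -> exists M, forall j, (M <= j)%N -> nc (F j z - l) <= e.
  have bb : b < b + 1 by rewrite ltrDl.
  have [m0 [K K0 hK]] := pw (b + 1) 0%N bb.
  pose w := wt U (b + 1) 0 (unpt z); have w0 : 0 < w by exact: wt_gt0.
  have p0 := pdec_gt0 (unpt z).
  pose c := Num.sqrt (K * pdec (unpt z) / w).
  have c0 : 0 <= c by exact: sqrtr_ge0.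
  have est i j : (m0 <= i)%N -> (i <= j)%N -> nc (F j z - F i z) <= c * 2^-1 ^+ i.
    move=> mi ij; have := hK i j (unpt z) mi ij; rewrite unptK -/w => h.
    apply: le_sqr; first by apply: mulr_ge0; rewrite ?half_ge0.
    have q0 : 0 <= K * pdec (unpt z) / w by apply: divr_ge0; [apply: mulr_ge0; exact: ltW|exact: ltW].
    rewrite exprMn sqr_sqrtr//.
    rewrite mulrAC ler_pdivlMr//; apply: (le_trans h); rewrite [leLHS]mulrAC; exact: lexx.
  have [|l hl] := @complex_net _ nat (fun k => F (m0 + k)%N z) (fun k => c * 2^-1 ^+ (m0 + k)) 0%N.
    move=> i j /=; case/orP: (leq_total i j) => ij.
      rewrite nc_distC; apply: (le_trans (est _ _ (leq_addr _ _) _)); first by rewrite leq_add2l.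
      by rewrite lerDl; apply: mulr_ge0; rewrite ?half_ge0.
    apply: (le_trans (est _ _ (leq_addr _ _) _)); first by rewrite leq_add2l.
    by rewrite lerDr; apply: mulr_ge0; rewrite ?half_ge0.
  exists l => e e0; have [M hM] := half_pow_small (2 * c) e0.
  exists (m0 + M)%N => j mj; have jm : (m0 <= j)%N by apply: leq_trans mj; exact: leq_addr.
  have := hl (j - m0)%N; rewrite subnKC// => /le_trans; apply; apply: le_trans hM.
  rewrite mulrA ler_wpM2l ?mulr_ge0// ler_wiXn2l ?invr_ge0// ?invf_le1 ?ler1n//.
  by apply: leq_trans mj; exact: leq_addl.
pose G : cfun R d := fun z => projT1 (cid (lim z)).
have hG z e : 0 < e -> exists M, forall j, (M <= j)%N -> nc (F j z - G z) <= e.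
  by rewrite /G; case: (cid (lim z)) => l hl; exact: hl.
have pwG B n : b < B -> exists m0, exists2 K, 0 < K & forall i t, (m0 <= i)%N ->
    nc (G (pt t) - F i (pt t)) ^+ 2 * wt U B n t <= K * (2^-1 ^+ i) ^+ 2 * pdec t.
  move=> /(pw _ n)[m0 [K K0 hK]]; exists m0, K => // i t mi.
  have w0 := wt_gt0 beta N U B n t; have p0 := pdec_gt0 t.
  rewrite -ler_pdivlMr//; set X := _ / _.
  have X0 : 0 <= X by apply: divr_ge0; [apply: mulr_ge0; [apply: mulr_ge0; [exact: ltW|exact: sqr_ge0]|exact: ltW]|exact: ltW].
  rewrite -[leRHS]sqr_sqrtr//; apply: sqr_le; first exact: nc_ge0.
  apply/ler_addgt0Pr => e e0; have [M hM] := hG (pt t) e e0.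
  pose j := maxn M i.
  have := hM j (leq_maxl _ _); rewrite nc_distC => h1.
  have h2 : nc (F j (pt t) - F i (pt t)) <= Num.sqrt X.
    apply: le_sqr; first exact: sqrtr_ge0.
    rewrite sqr_sqrtr// ler_pdivlMr//.
    by apply: hK => //; exact: leq_maxr.
  have -> : G (pt t) - F i (pt t) = (F j (pt t) - F i (pt t)) + (G (pt t) - F j (pt t)) by ring.
  by apply: (le_trans (ncD _ _)); exact: lerD.
have bb : b < b + 1 by rewrite ltrDl.
have bb0 : 0 < b + 1 by apply: lt_trans bb.
have eF m : entire (F m) by apply: Sb_entire (hF m).
have loc rho : exists M, forall z k, cn z <= rho -> nc (F k z) <= M.
  have [m0 [K K0 hK]] := pw (b + 1) 0%N bb.
  have [c c0 hc] := @wt_lower U (b + 1) 0%N rho cU bb0.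
  have [M hM] : exists M, forall k z, (k <= m0)%N -> cn z <= rho -> nc (F k z) <= M.
    elim: m0 {hK} => [|m [M hM]].
      have [M hM] := entire_bounded (eF 0%N) rho; exists M => k z; rewrite leqn0 => /eqP ->.
      exact: hM.
    have [M' hM'] := entire_bounded (eF m.+1) rho; exists (Num.max M M') => k z.
    rewrite leq_eqVlt le_max => /orP[/eqP -> h|km h]; first by rewrite hM' ?orbT.
    by rewrite hM.
  exists (M + Num.sqrt (K / c)) => z k hz.
  have M0 : 0 <= M by apply: le_trans (hM 0%N z (leq0n _) hz); exact: nc_ge0.
  have [km|/ltnW mk] := leqP k m0; first by apply: (le_trans (hM k z km hz)); rewrite lerDl sqrtr_ge0.
  have -> : F k z = F m0 z + (F k z - F m0 z) by rewrite addrC subrK.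
  apply: (le_trans (ncD _ _)); apply: lerD; first exact: hM.
  have := hK m0 k (unpt z) (leqnn _) mk; rewrite unptK => h.
  have hw := hc (unpt z); rewrite unptK in hw; have {}hw := hw hz.
  apply: le_sqr; first exact: sqrtr_ge0.
  rewrite sqr_sqrtr; last by apply: divr_ge0; exact: ltW.
  rewrite ler_pdivlMr//.
  apply: (le_trans (ler_wpM2l (sqr_ge0 _) hw)); apply: (le_trans h).
  rewrite -mulrA ler_piMr ?(ltW K0)// mulr_ile1 ?sqr_ge0 ?(ltW (pdec_gt0 _))//.
    by rewrite expr_le1 ?exprn_ge0 ?invr_ge0// exprn_ile1 ?invr_ge0// invf_le1 ?ler1n.
  exact: pdec_le1.
have eG : entire G.
  apply: (entire_lim eF hG) => rho; have [M hM] := loc rho.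
  by exists M => n z; exact: hM.
have conv B n : b < B -> exists m0, exists2 K, 0 <= K & forall i, (m0 <= i)%N ->
   HE U B n (G - F i) /\ hn U B n (G - F i) <= K * 2^-1 ^+ i.
  move=> bB; have [m0 [K K0 hK]] := pwG B n bB.
  exists m0, (Num.sqrt (K * @pmass R d)); first exact: sqrtr_ge0.
  move=> i mi; have K1 : 0 <= K * @pmass R d by apply: mulr_ge0; [exact: ltW|exact: pmass_ge0].
  have [|h1 h2] := HE_dens hN cU (entireB eG (eF i)) _ (fun t => hK i t mi).
    by apply: mulr_ge0; [exact: ltW|exact: sqr_ge0].
  split; first exact: h1.
  apply: le_sqr; first by apply: mulr_ge0; rewrite ?half_ge0 ?sqrtr_ge0.
  by apply: (le_trans h2); rewrite [leRHS]exprMn sqr_sqrtr// [leLHS]mulrAC.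
exists G.
  move=> B n bB; have [m0 [K K0 hK]] := conv B n bB.
  rewrite -[G](subrK (F m0)).
  by have [] := HED hN cU (hK m0 (leqnn _)).1 (hF m0 B n bB).
move=> B n e bB e0; have [m0 [K K0 hK]] := conv B n bB.
have [M hM] := half_pow_small K e0.
exists (maxn m0 M) => j; rewrite geq_max => /andP[mj Mj].
apply: (le_trans (hK j mj).2); apply: le_trans hM; rewrite ler_wpM2l//.
by rewrite ler_wiXn2l ?invr_ge0// ?invf_le1 ?ler1n.
Qed.

End Frechet.

(** * Bilinear forms and orthonormal systems in a space with two norms *)

Section Seminorms.
Context {R : realType} {V : lmodType R[i]}.
Notation C := R[i].
Implicit Types (E : set V) (p : V -> R) (f g : V).

Definition linsub E := E 0 /\ forall (a : C) f g, E f -> E g -> E (a *: f + g).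

Definition seminorm E p := [/\ forall f, E f -> 0 <= p f,
  forall f g, E f -> E g -> p (f + g) <= p f + p g &
  forall (a : C) f, E f -> p (a *: f) = nc a * p f].

Lemma linsubD E f g : linsub E -> E f -> E g -> E (f + g).
Proof. by move=> [_ hE] hf hg; have := hE 1 f g hf hg; rewrite scale1r. Qed.

Lemma linsubZ E (a : C) f : linsub E -> E f -> E (a *: f).
Proof. by move=> [E0 hE] hf; have := hE a f 0 hf E0; rewrite addr0. Qed.

Lemma linsubB E f g : linsub E -> E f -> E g -> E (f - g).
Proof. by move=> hE hf hg; rewrite -scaleN1r; apply: linsubD => //; exact: linsubZ. Qed.

Lemma linsub_sum E (F : nat -> V) n : linsub E -> (forall k, (k < n)%N -> E (F k)) ->
  E (\sum_(k < n) F k).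
Proof.
move=> hE; elim: n => [|n ih] hF; first by rewrite big_ord0; case: hE.
rewrite big_ord_recr /=; apply: linsubD => //; last exact: hF.
by apply: ih => k kn; apply: hF; exact: ltnW.
Qed.

Lemma linear_on0 E (l : V -> C) : linsub E -> linear_on E l -> l 0 = 0.
Proof.
move=> [E0 _] hl; have := hl 1 0 0 E0 E0; rewrite scale1r addr0 mul1r => h.
by apply: (addrI (l 0)); rewrite addr0 -h.
Qed.

Lemma linear_onD E (l : V -> C) f g : linear_on E l -> E f -> E g -> l (f + g) = l f + l g.
Proof. by move=> hl hf hg; have := hl 1 f g hf hg; rewrite scale1r mul1r. Qed.

Lemma linear_onZ E (l : V -> C) (a : C) f : linsub E -> linear_on E l -> E f -> l (a *: f) = a * l f.
Proof.
move=> hE hl hf; have [E0 _] := hE.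
by have := hl a f 0 hf E0; rewrite addr0 (linear_on0 hE hl) addr0.
Qed.

Lemma linear_onB E (l : V -> C) f g : linsub E -> linear_on E l -> E f -> E g -> l (f - g) = l f - l g.
Proof.
move=> hE hl hf hg; rewrite -scaleN1r addrC; have := hl (-1) g f hg hf => ->.
by rewrite mulN1r addrC.
Qed.

Lemma linear_on_sum E (l : V -> C) n (F : nat -> V) : linsub E -> linear_on E l ->
  (forall k, E (F k)) -> l (\sum_(k < n) F k) = \sum_(k < n) l (F k).
Proof.
move=> hE hl hF; elim: n => [|n ih]; first by rewrite !big_ord0 (linear_on0 hE hl).
by rewrite !big_ord_recr /= (linear_onD hl)// ?ih//; exact: (@linsub_sum E F n hE).
Qed.

Lemma seminorm0 E p : linsub E -> seminorm E p -> p 0 = 0.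
Proof. by move=> [E0 _] [_ _ hp]; have := hp 0 0 E0; rewrite scale0r nc0 mul0r. Qed.

Lemma add_eps (x a c : R) : 0 <= c -> (forall e, 0 < e -> x <= (a + e) * c) -> x <= a * c.
Proof.
move=> c0 h; apply/ler_addgt0Pr => e e0.
have c1 : 0 < c + 1 by rewrite ltr_wpDl.
apply: (le_trans (h (e / (c + 1)) (divr_gt0 e0 c1))).
rewrite mulrDl lerD2l mulrAC ler_pdivrMr//; nra.
Qed.

(** Homogeneity turns a bound on a ball into a bound by the seminorm. *)
Lemma homog_bound E p (l : V -> R) (r K : R) : linsub E -> seminorm E p ->
  (forall (a : C) f, E f -> l (a *: f) = nc a * l f) -> 0 < r -> 0 <= K ->
  (forall f, E f -> p f <= r -> l f <= K) -> forall f, E f -> l f <= p f * (K / r).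
Proof.
move=> hE [p0 _ pZ] hl r0 K0 h f hf.
have Kr : 0 <= K / r by apply: divr_ge0 => //; exact: ltW.
apply: add_eps => // e e0.
have s0 : 0 < p f + e by rewrite ltr_wpDl// p0.
pose a : C := (r / (p f + e))%:C.
have na : nc a = r / (p f + e) by rewrite ncR ger0_norm// divr_ge0// ltW.
have Ef : E (a *: f) by exact: linsubZ.
have := h _ Ef; rewrite pZ// hl// na => hh.
have : r / (p f + e) * l f <= K.
  apply: hh; rewrite mulrAC ler_pdivrMr// ler_wpM2l ?(ltW r0)// lerDl ltW//.
rewrite mulrAC ler_pdivrMr// => h2.
by rewrite mulrA ler_pdivlMr// mulrC (mulrC _ K).
Qed.

Lemma linear_bound E p (l : V -> C) (r K : R) : linsub E -> seminorm E p ->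
  linear_on E l -> 0 < r -> 0 <= K ->
  (forall f, E f -> p f <= r -> nc (l f) <= K) -> forall f, E f -> nc (l f) <= p f * (K / r).
Proof.
move=> hE hp hl r0 K0 h; apply: (homog_bound (l := fun f => nc (l f)) hE hp) => // a f hf.
by rewrite (linear_onZ _ hE hl hf) ncM.
Qed.

Lemma sum_nat_geE (u : nat -> R) n m : (forall k, 0 <= u k) -> (n <= m)%N ->
  \sum_(k < n) u k <= \sum_(k < m) u k.
Proof.
move=> u0 nm; rewrite -(subnKC nm); elim: (m - n)%N => [|k ih]; first by rewrite addn0.
by rewrite addnS big_ord_recr /= (le_trans ih)// lerDl.
Qed.

(** The partial sums converge absolutely on each vector, by homogeneity, and linearity
passes to the limit. *)
Lemma series_functional E p (s : nat -> V -> C) (M : R) : linsub E -> seminorm E p ->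
  (forall k, linear_on E (s k)) -> 0 <= M ->
  (forall h n, E h -> p h <= 1 -> \sum_(k < n) nc (s k h) <= M) ->
  exists2 l : V -> C, linear_on E l &
   (forall h, E h -> nc (l h) <= p h * M) /\
   forall h e, E h -> 0 < e -> exists n0, forall n, (n0 <= n)%N -> nc (\sum_(k < n) s k h - l h) <= e.
Proof.
move=> hE hp hs M0 hM.
have hM' n h : E h -> \sum_(k < n) nc (s k h) <= p h * M.
  rewrite -[M in X in _ -> X]divr1; apply: (homog_bound (l := fun h => \sum_(k < n) nc (s k h)) hE hp) => //.
    move=> a f hf; rewrite mulr_sumr; apply: eq_bigr => k _.
    by rewrite (linear_onZ _ hE (hs k) hf) ncM.
  by move=> f hf; exact: hM.
have lim h : E h -> exists l, forall e, 0 < e -> exists n0, forall n, (n0 <= n)%N ->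
    nc (\sum_(k < n) s k h - l) <= e.
  move=> hh; pose D n := \sum_(k < n) nc (s k h).
  pose S := range D.
  have hS : has_sup S by split; [exists (D 0%N); exists 0%N|exists (p h * M) => _ [n _ <-]; exact: hM'].
  have ub n : D n <= sup S by apply: ub_le_sup; [case: hS|exists n].
  have dif i j : (i <= j)%N -> nc (\sum_(k < j) s k h - \sum_(k < i) s k h) <= D j - D i.
    move=> ij; rewrite -(subnKC ij); elim: (j - i)%N => [|m ih].
      by rewrite addn0 !subrr nc0.
    rewrite addnS /D !big_ord_recr /=.
    rewrite addrAC [leRHS]addrAC; apply: (le_trans (ncD _ _)); exact: lerD.
  have [|l hl] := @complex_net _ nat (fun n => \sum_(k < n) s k h) (fun n => sup S - D n) 0%N.
    move=> i j /=; case/orP: (leq_total i j) => ij.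
      rewrite nc_distC; apply: (le_trans (dif _ _ ij)); have := ub i; have := ub j; lra.
    apply: (le_trans (dif _ _ ij)); have := ub i; have := ub j; lra.
  exists l => e e0; have e2 : 0 < e / 2 by rewrite divr_gt0.
  have [_ [n0 _ <-] hn0] := sup_adherent e2 hS.
  exists n0 => n nn; apply: (le_trans (hl n)).
  have : D n0 <= D n by apply: (@sum_nat_geE (fun k => nc (s k h)) n0 n) => // k; exact: nc_ge0.
  lra.
pose l h := if pselect (E h) is left hh then projT1 (cid (lim h hh)) else 0.
have hl h e : E h -> 0 < e -> exists n0, forall n, (n0 <= n)%N -> nc (\sum_(k < n) s k h - l h) <= e.
  move=> hh; rewrite /l; case: pselect => // h2; case: cid => x hx /=; exact: hx.
have nc_small (x : C) : (forall e, 0 < e -> nc x <= e) -> x = 0.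
  move=> hx; apply/eqP; rewrite -nc_eq0; apply/eqP/le_anti; rewrite nc_ge0 andbT.
  by apply/ler_addgt0Pr => e e0; rewrite add0r hx.
exists l; last split => //.
- move=> a f g hf hg; apply/eqP; rewrite -subr_eq0; apply/eqP/nc_small => e e0.
  have Efg : E (a *: f + g) by case: hE => _; apply.
  have na : 0 < nc a + 2 by rewrite ltr_wpDl ?nc_ge0.
  pose e' := e / (nc a + 2); have e'0 : 0 < e' by rewrite divr_gt0.
  have [n1 h1] := hl _ _ hf e'0; have [n2 h2] := hl _ _ hg e'0; have [n3 h3] := hl _ _ Efg e'0.
  pose n := maxn n1 (maxn n2 n3).
  have {}h1 := h1 n (leq_maxl _ _).
  have {}h2 := h2 n (leq_trans (leq_maxl _ _) (leq_maxr _ _)).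
  have {}h3 := h3 n (leq_trans (leq_maxr _ _) (leq_maxr _ _)).
  have Es : \sum_(k < n) s k (a *: f + g) = a * (\sum_(k < n) s k f) + \sum_(k < n) s k g.
    by rewrite mulr_sumr -big_split; apply: eq_bigr => k _; exact: hs.
  rewrite Es in h3.
  set A := \sum_(k < n) s k f in h1 h3; set B := \sum_(k < n) s k g in h2 h3.
  have -> : l (a *: f + g) - (a * l f + l g) =
     a * (A - l f) + (B - l g) - (a * A + B - l (a *: f + g)) by ring.
  apply: (le_trans (ncB _ _)); apply: (le_trans (lerD (ncD _ _) (lexx _))).
  rewrite ncM; apply: (@le_trans _ _ (nc a * e' + e' + e')).
    by rewrite !lerD// ler_wpM2l ?nc_ge0.
  have -> : nc a * e' + e' + e' = (nc a + 2) * e' by ring.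
  by rewrite /e' mulrC divfK ?gt_eqF.
- move=> h hh; apply/ler_addgt0Pr => e e0; have [n0 h0] := hl _ _ hh e0.
  have {}h0 := h0 n0 (leqnn _).
  have -> : l h = \sum_(k < n0) s k h - (\sum_(k < n0) s k h - l h) by ring.
  apply: (le_trans (ncB _ _)); apply: lerD => //.
  by apply: (le_trans (nc_sum _ _ _)); exact: hM'.
Qed.

End Seminorms.

Section BanachSteinhaus.
Context {R : realType} {V1 V2 : lmodType R[i]}.
Notation C := R[i].
Variables (E1 : set V1) (E2 : set V2) (p : nat -> V1 -> R) (q : nat -> V2 -> R).
Hypothesis hE1 : linsub E1.
Hypothesis hp : forall k, seminorm E1 (p k).
Hypothesis hq : forall k, seminorm E2 (q k).
Hypothesis p_mono : forall k k' f, (k <= k')%N -> E1 f -> p k f <= p k' f.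
Hypothesis q_mono : forall k k' g, (k <= k')%N -> E2 g -> q k g <= q k' g.
Hypothesis complete : forall F : nat -> V1, (forall m, E1 (F m)) ->
  (forall m, p m (F m.+1 - F m) <= 2^-1 ^+ m) ->
  exists2 G, E1 G & forall k e, 0 < e -> exists M, forall j, (M <= j)%N -> p k (G - F j) <= e.
Variable w : V1 -> V2 -> C.
Hypothesis hw : bilinear_on E1 E2 w.
Hypothesis w1 : forall f, E1 f -> exists k (c : R), forall g, E2 g -> nc (w f g) <= c * q k g.
Hypothesis w2 : forall g, E2 g -> exists k (c : R), forall f, E1 f -> nc (w f g) <= c * p k f.

Let good (m : nat) f := forall g, E2 g -> nc (w f g) <= m%:R * q m g.

(** Baire category, in the form of nested balls: the sets [good m] cover the complete
space, so one of them contains a ball. *)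
Lemma good_ball : exists m k r f0, [/\ 0 < r, E1 f0 &
  forall f, E1 f -> p k (f - f0) <= r -> good m f].
Proof.
apply/not_existsP => nb.
have p0 k f : E1 f -> 0 <= p k f by case: (hp k) => + _ _; apply.
have step m (s : V1 * nat * R) : E1 s.1.1 -> 0 < s.2 -> exists s' : V1 * nat * R,
   [/\ E1 s'.1.1, (s.1.2 <= s'.1.2)%N /\ (m < s'.1.2)%N, 0 < s'.2 <= s.2 / 2, p s.1.2 (s'.1.1 - s.1.1) <= s.2 / 2 &
    forall u, E1 u -> p s'.1.2 (u - s'.1.1) <= s'.2 -> ~ good m u].
  case: s => [[f k] r] /= Ef r0; have r2 : 0 < r / 2 by rewrite divr_gt0.
  have [f' [Ef' pf' ng]] : exists f', [/\ E1 f', p k (f' - f) <= r / 2 & ~ good m f'].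
    apply: contrapT => h; apply: (nb m); exists k, (r / 2), f; split => // u Eu pu.
    by apply: contrapT => gu; apply: h; exists u.
  have [g [Eg gg]] : exists g, E2 g /\ m%:R * q m g < nc (w f' g).
    apply: contrapT => h; apply: ng => g Eg; rewrite leNgt; apply/negP => gg.
    by apply: h; exists g.
  have [k' [c hc]] := w2 Eg.
  pose c' := `|c| + 1; have c'0 : 0 < c' by rewrite ltr_wpDl.
  pose gap := nc (w f' g) - m%:R * q m g; have gap0 : 0 < gap by rewrite subr_gt0.
  exists (f', maxn k (maxn k' m.+1), Num.min (r / 2) (gap / (2 * c'))) => /=; split => //.
  - by rewrite leq_maxl !leq_max ltnSn !orbT.
  - by rewrite ge_min lexx andbT lt_min r2 divr_gt0 ?mulr_gt0.
  - move=> u Eu; rewrite le_min => /andP[_ pu] gu.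
    have Eu' : E1 (u - f') by exact: linsubB.
    have kk : p k' (u - f') <= gap / (2 * c').
      by apply: le_trans pu; apply: p_mono => //; rewrite !leq_max leqnn orbT.
    have h1 : nc (w (u - f') g) <= gap / 2.
      apply: (le_trans (hc _ Eu')); apply: (@le_trans _ _ (c' * (gap / (2 * c')))).
        apply: (le_trans _ (ler_wpM2l (ltW c'0) kk)); apply: ler_wpM2r; first exact: p0.
        by rewrite /c'; have := ler_norm c; lra.
      have -> : c' * (gap / (2 * c')) = gap / 2 by field; rewrite gt_eqF.
      exact: lexx.
    have := gu _ Eg; have [_ hl] := hw; rewrite (linear_onB hE1 (hl g Eg) Eu Ef') in h1.
    have := ncD (w u g) (- (w u g - w f' g)); rewrite ncN.
    have -> : w u g - (w u g - w f' g) = w f' g by ring.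
    move: gap0 h1; rewrite /gap; lra.
(* Otherwise there are balls, given by a centre, the index of a norm and a radius,
each inside its predecessor and the m-th one missing the m-th set. *)
have [s hs] : {s : nat -> V1 * nat * R | s 0%N = (0, 0%N, 1) /\ forall m,
   [/\ E1 (s m.+1).1.1, ((s m).1.2 <= (s m.+1).1.2)%N /\ (m < (s m.+1).1.2)%N,
     0 < (s m.+1).2 <= (s m).2 / 2, p (s m).1.2 ((s m.+1).1.1 - (s m).1.1) <= (s m).2 / 2 &
    forall u, E1 u -> p (s m.+1).1.2 (u - (s m.+1).1.1) <= (s m.+1).2 -> ~ good m u]}.
  pose T := {s : V1 * nat * R | E1 s.1.1 /\ 0 < s.2}.
  have stp m (t : T) : {t' : T | [/\ E1 (sval t').1.1, ((sval t).1.2 <= (sval t').1.2)%N /\ (m < (sval t').1.2)%N,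
     0 < (sval t').2 <= (sval t).2 / 2, p (sval t).1.2 ((sval t').1.1 - (sval t).1.1) <= (sval t).2 / 2 &
    forall u, E1 u -> p (sval t').1.2 (u - (sval t').1.1) <= (sval t').2 -> ~ good m u]}.
    apply: cid; case: t => t [t1 t2] /=; have [t' [h1 h2 h3 h4 h5]] := step m t t1 t2.
    have t'0 : 0 < t'.2 by case/andP: h3.
    by exists (exist _ t' (conj h1 t'0)).
  have t0 : E1 ((0 : V1), 0%N, (1 : R)).1.1 /\ 0 < ((0 : V1), 0%N, (1 : R)).2.
    by split => //=; case: hE1.
  pose t := fix t n := if n is m.+1 then sval (stp m (t m)) else (exist _ _ t0 : T).
  by exists (fun n => sval (t n)); split => // m; exact: svalP (stp m (t m)).
case: hs => s0 hs.
pose f m := (s m).1.1; pose k m := (s m).1.2; pose r m := (s m).2.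
have Ef m : E1 (f m) by case: m => [|m]; rewrite /f ?s0; [case: hE1|case: (hs m)].
have r0 m : 0 < r m by case: m => [|m]; rewrite /r ?s0//; case: (hs m) => _ _ /andP[].
have km m : (m <= k m)%N by case: m => // m; case: (hs m) => _ [].
have kk m j : (m <= j)%N -> (k m <= k j)%N.
  move=> mj; rewrite -(subnKC mj); elim: (j - m)%N => [|i ih]; first by rewrite addn0.
  by rewrite addnS (leq_trans ih)//; case: (hs (m + i)%N) => _ [].
have rh m : r m.+1 <= r m / 2 by case: (hs m) => _ _ /andP[].
have pd m : p (k m) (f m.+1 - f m) <= r m / 2 by case: (hs m).
have rp m : r m <= 2^-1 ^+ m.
  elim: m => [|m ih]; first by rewrite /r s0.
  by apply: (le_trans (rh m)); rewrite exprS mulrC ler_wpM2l ?invr_ge0.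
have Ed i j : E1 (f i - f j) by exact: linsubB.
have [|G EG hG] := complete Ef.
  move=> m; apply: (le_trans (p_mono (km m) (Ed _ _))); apply: (le_trans (pd m)).
  by have := rp m; have := r0 m; lra.
have tele m j : (m <= j)%N -> p (k m) (f j - f m) <= r m - r j.
  move=> mj; rewrite -(subnKC mj); elim: (j - m)%N => [|i ih].
    by rewrite addn0 !subrr (seminorm0 hE1 (hp _)).
  rewrite addnS; have -> : f (m + i).+1 - f m = (f (m + i).+1 - f (m + i)%N) + (f (m + i)%N - f m).
    by rewrite addrA subrK.
  have [_ hD _] := hp (k m); apply: (le_trans (hD _ _ (Ed _ _) (Ed _ _))).
  have := le_trans (p_mono (kk m (m + i)%N (leq_addr _ _)) (Ed (m + i).+1 (m + i)%N)) (pd (m + i)%N).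
  have := rh (m + i)%N; lra.
have inb m : p (k m) (G - f m) <= r m.
  apply/ler_addgt0Pr => e e0; have [M hM] := hG (k m) e e0.
  pose j := maxn M m; have := hM j (leq_maxl _ _) => h1.
  have h2 := tele m j (leq_maxr _ _).
  have -> : G - f m = (G - f j) + (f j - f m) by rewrite addrA subrK.
  have [_ hD _] := hp (k m); have EGj : E1 (G - f j) by exact: linsubB.
  apply: (le_trans (hD _ _ EGj (Ed _ _))); have := r0 j; lra.
have [k0 [c hc]] := w1 EG.
pose m := maxn k0 (Num.bound `|c|).
have [_ _ _ _ nG] := hs m; apply: (nG G EG (inb m.+1)) => g Eg.
have q0 : 0 <= q m g by case: (hq m) => + _ _; apply.
apply: (le_trans (hc g Eg)); apply: (@le_trans _ _ (`|c| * q m g)).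
  have h1 : q k0 g <= q m g by apply: q_mono => //; exact: leq_maxl.
  apply: (@le_trans _ _ (`|c| * q k0 g)).
    by rewrite ler_wpM2r ?ler_norm//; case: (hq k0) => + _ _; apply.
  by rewrite ler_wpM2l.
rewrite ler_wpM2r//; apply: (@le_trans _ _ (Num.bound `|c|)%:R).
  by rewrite ltW// archi_boundP.
by rewrite ler_nat leq_maxr.
Qed.

(** The ball of [good_ball] is moved to the origin by bilinearity. *)
Theorem banach_steinhaus : exists k (c : R), 0 <= c /\
  forall f g, E1 f -> E2 g -> nc (w f g) <= p k f * (c * q k g).
Proof.
have [m [k [r [f0 [r0 Ef0 h]]]]] := good_ball.
exists (maxn k m), (2 * m%:R / r); split; first by apply: divr_ge0; [exact: mulr_ge0|exact: ltW].
move=> f g Ef Eg; have [hw1 hw2] := hw.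
have q0 : 0 <= q m g by case: (hq m) => + _ _; apply.
have b u : E1 u -> p k u <= r -> nc (w u g) <= 2 * m%:R * q m g.
  move=> Eu pu.
  have h1 : nc (w (f0 + u) g) <= m%:R * q m g.
    by apply: h => //; [exact: linsubD|rewrite addrC addKr].
  have h2 : nc (w f0 g) <= m%:R * q m g.
    by apply: h => //; rewrite subrr (seminorm0 hE1 (hp k)) ltW.
  rewrite (linear_onD (hw2 g Eg) Ef0 Eu) in h1.
  have := ncB (w f0 g + w u g) (w f0 g).
  have -> : w f0 g + w u g - w f0 g = w u g by ring.
  lra.
have K0 : 0 <= 2 * m%:R * q m g by rewrite !mulr_ge0.
have := linear_bound hE1 (hp k) (hw2 g Eg) r0 K0 b Ef => /le_trans; apply.
apply: (@le_trans _ _ (p k f * (2 * m%:R / r * q m g))).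
  by rewrite [X in _ <= _ * X]mulrAC.
apply: ler_pM.
- by case: (hp k) => + _ _; apply.
- by rewrite mulr_ge0// divr_ge0 ?mulr_ge0// ltW.
- by apply: p_mono => //; exact: leq_maxl.
- apply: ler_wpM2l; first by rewrite divr_ge0 ?mulr_ge0// ltW.
  by apply: q_mono => //; exact: leq_maxr.
Qed.

End BanachSteinhaus.

Section Greedy.
Context {R : realType} {V : lmodType R[i]}.
Notation C := R[i].
Variables (E : set V) (ip : V -> V -> C) (sn wn : V -> R) (M : R).
Hypothesis hE : linsub E.
Hypothesis ip_lin : forall f, E f -> linear_on E (ip f).
Hypothesis ip_conj : forall f g, E f -> E g -> ip g f = conjc (ip f g).
Hypothesis ip_diag : forall f, E f -> ip f f = (sn f ^+ 2)%:C.
Hypothesis hsn : seminorm E sn.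
Hypothesis hwn : seminorm E wn.
Hypothesis wn_le : forall f, E f -> wn f <= M * sn f.

Definition unit_or_zero f := f = 0 \/ sn f = 1.

Let next_spec (s : seq V) u := [/\ E u, forall x, x \in s -> ip x u = 0, unit_or_zero u &
  forall g, E g -> (forall x, x \in s -> ip x g = 0) -> wn g <= 2 * wn u * sn g].

Lemma next_ex s : (forall x, x \in s -> E x) -> exists u, next_spec s u.
Proof.
move=> hs.
have [sn0 _ snZ] := hsn; have [wn0 _ wnZ] := hwn; have [E0 _] := hE.
pose O := [set g | [/\ E g, forall x, x \in s -> ip x g = 0 & sn g <= 1]].
pose S := wn @` O.
have O0 : O 0.
  split => //; last by rewrite (seminorm0 hE hsn).
  by move=> x xs; exact: (linear_on0 hE (ip_lin (hs x xs))).
have hS : has_sup S.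
  split; first by exists (wn 0); exists 0.
  exists `|M| => _ [g [Eg _ g1] <-]; apply: (le_trans (wn_le Eg)).
  apply: (@le_trans _ _ (`|M| * sn g)); first by rewrite ler_wpM2r ?sn0 ?ler_norm.
  by rewrite ler_piMr.
have ub g : O g -> wn g <= sup S by move=> Og; apply: ub_le_sup; [case: hS|exists g].
have main g : E g -> (forall x, x \in s -> ip x g = 0) -> wn g <= sup S * sn g.
  move=> Eg gs; have [g0|g0] := eqVneq (sn g) 0.
    by rewrite g0 mulr0; have := wn_le Eg; rewrite g0 mulr0.
  have g0' : 0 < sn g by rewrite lt_neqAle eq_sym g0 sn0.
  have nn : nc ((sn g)^-1)%:C = (sn g)^-1 by rewrite ncR ger0_norm// invr_ge0 sn0.
  have := ub (((sn g)^-1)%:C *: g); rewrite wnZ// nn => h.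
  rewrite -ler_pdivrMr// mulrC; apply: h; split; first exact: linsubZ.
    by move=> x xs; rewrite (linear_onZ _ hE (ip_lin (hs x xs)) Eg) gs// mulr0.
  by rewrite snZ// nn mulVf.
have [S0|S0] := leP (sup S) 0.
  exists 0; split => //; [by case: O0|by left|].
  move=> g Eg gs; rewrite (seminorm0 hE hwn) mulr0 mul0r; apply: (le_trans (main g Eg gs)).
  by rewrite mulr_le0_ge0// sn0.
have S2 : 0 < sup S / 2 by rewrite divr_gt0.
have [_ [u [Eu us u1] <-] hu] := sup_adherent S2 hS.
have wu : sup S / 2 < wn u by move: hu; lra.
have u0 : 0 < sn u.
  rewrite lt_neqAle sn0// andbT eq_sym; apply/eqP => u0.
  by have := wn_le Eu; rewrite u0 mulr0; move: (lt_trans S2 wu); lra.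
have nn : nc ((sn u)^-1)%:C = (sn u)^-1 by rewrite ncR ger0_norm// invr_ge0 sn0.
exists (((sn u)^-1)%:C *: u); split.
- exact: linsubZ.
- by move=> x xs; rewrite (linear_onZ _ hE (ip_lin (hs x xs)) Eu) us// mulr0.
- by right; rewrite snZ// nn mulVf ?gt_eqF.
- move=> g Eg gs; apply: (le_trans (main g Eg gs)); apply: ler_wpM2r; first exact: sn0.
  rewrite wnZ// nn; have : wn u <= (sn u)^-1 * wn u.
    by rewrite ler_peMl ?wn0// invf_ge1.
  by move: wu; lra.
Qed.

(** Orthonormal, up to zero vectors, which continue the sequence once a
finite-dimensional space is exhausted. *)
Definition orthosystem (e : nat -> V) := [/\ forall k, E (e k), forall k, unit_or_zero (e k) &
  forall j k, (j < k)%N -> ip (e j) (e k) = 0].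

(** Each new vector is chosen nearly maximal for the weak seminorm in the orthogonal
complement of its predecessors. *)
Lemma greedy : exists2 e, orthosystem e &
  forall n g, E g -> (forall k, (k < n)%N -> ip (e k) g = 0) -> wn g <= 2 * wn (e n) * sn g.
Proof.
pose T := {s : seq V | forall x, x \in s -> E x}.
have stp (t : T) : {u | next_spec (sval t) u} by apply: cid; case: t => s hs; exact: next_ex.
have ext (t : T) : forall x, x \in rcons (sval t) (sval (stp t)) -> E x.
  case: t (stp t) => s hs [u [/= Eu _ _ _]] x; rewrite mem_rcons inE => /orP[/eqP ->//|]; exact: hs.
have nil0 : forall x, x \in ([::] : seq V) -> E x by [].
pose t := fix t n := if n is m.+1 then (exist _ _ (ext (t m)) : T) else (exist _ _ nil0 : T).
pose e n := sval (stp (t n)).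
have mem n k : (k < n)%N -> e k \in sval (t n).
  elim: n => // n ih; rewrite ltnS leq_eqVlt /= mem_rcons inE => /orP[/eqP ->|/ih ->].
    by rewrite eqxx.
  by rewrite orbT.
have memP n x : x \in sval (t n) -> exists2 k, (k < n)%N & x = e k.
  elim: n => // n ih; rewrite /= mem_rcons inE => /orP[/eqP ->|/ih[k kn ->]]; first by exists n.
  by exists k => //; exact: ltnW.
exists e.
  split=> [k|k|j k jk]; first by case: (svalP (stp (t k))).
    by case: (svalP (stp (t k))).
  by case: (svalP (stp (t k))) => _ h _ _; apply: h; exact: mem.
move=> n g Eg h; case: (svalP (stp (t n))) => _ _ _; apply => //.
by move=> x /memP[k kn ->]; exact: h.
Qed.

Section System.
Variable e : nat -> V.
Hypothesis he : orthosystem e.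

Definition oproj n g := \sum_(k < n) ip (e k) g *: e k.

Let Ee k : E (e k). Proof. by case: he. Qed.

Lemma ip0r f : E f -> ip f 0 = 0.
Proof. by move=> hf; exact: (linear_on0 hE (ip_lin hf)). Qed.

Lemma ip0l f : E f -> ip 0 f = 0.
Proof. by move=> hf; case: hE => E0 _; rewrite (ip_conj hf E0) ip0r// conjc0. Qed.

Lemma ip_ee j k : (j != k) -> ip (e j) (e k) = 0.
Proof.
have [_ _ h] := he.
case: ltngtP => // jk _; first exact: h.
by rewrite (ip_conj (Ee k) (Ee j)) h// conjc0.
Qed.

Lemma E_proj n g : E (oproj n g).
Proof.
by apply: (@linsub_sum _ _ _ (fun k => ip (e k) g *: e k)) => // k _; exact: linsubZ.
Qed.

Lemma projS n g : oproj n.+1 g = oproj n g + ip (e n) g *: e n.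
Proof. by rewrite /oproj big_ord_recr. Qed.

Lemma ip_proj n j g : E g -> ip (e j) (oproj n g) = if (j < n)%N then ip (e j) g else 0.
Proof.
move=> Eg; elim: n => [|n ih]; first by rewrite /oproj big_ord0 ip0r.
have Ez : E (ip (e n) g *: e n) by exact: linsubZ.
rewrite projS (linear_onD (ip_lin (Ee j)) (E_proj n g) Ez) ih.
rewrite (linear_onZ _ hE (ip_lin (Ee j)) (Ee n)) ltnS.
case: ltngtP => jn.
- by rewrite ip_ee ?mulr0 ?addr0// ltn_eqF.
- by rewrite ip_ee ?mulr0 ?addr0// gtn_eqF.
rewrite jn add0r; have [_ /(_ n)[e0|e1] _] := he.
  by rewrite e0 ip0l// mul0r.
by rewrite (ip_diag (Ee n)) e1 expr1n mulr1.
Qed.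

Lemma ip_residual n k g : E g -> (k < n)%N -> ip (e k) (g - oproj n g) = 0.
Proof.
by move=> Eg kn; rewrite (linear_onB hE (ip_lin (Ee k)) Eg (E_proj n g)) ip_proj// kn subrr.
Qed.

Lemma conj_lin (a b c : C) : conjc (a + c * b) = conjc a + conjc c * conjc b.
Proof. by rewrite rmorphD rmorphM. Qed.

Lemma nc_prod (c : C) (x : R) : (nc c ^+ 2 * x)%:C = conjc c * c * x%:C.
Proof. by rewrite rmorphM; congr (_ * _); exact/esym/mulJ_nc. Qed.

Lemma real_comb (a b : R) : a%:C - b%:C - b%:C + b%:C = (a - b)%:C.
Proof. by apply: complexP; rewrite !ReIm /=; ring. Qed.

Lemma RC_inj (x y : R) : x%:C = y%:C -> x = y.
Proof. by move=> /(congr1 (fun z : C => Re z)). Qed.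

Lemma sqnorm_add x y (c : C) : E x -> E y ->
  (sn (x + c *: y) ^+ 2)%:C = (sn x ^+ 2)%:C + c * ip x y + conjc c * ip y x + (nc c ^+ 2 * sn y ^+ 2)%:C.
Proof.
move=> Ex Ey; have Ec : E (c *: y) by exact: linsubZ.
have Es : E (x + c *: y) by exact: linsubD.
have l1 z : E z -> ip z (x + c *: y) = ip z x + c * ip z y.
  move=> Ez; rewrite (linear_onD (ip_lin Ez) Ex Ec).
  by rewrite (linear_onZ _ hE (ip_lin Ez) Ey).
rewrite -(ip_diag Es) l1// (ip_conj Ex Es) (ip_conj Ey Es) !l1//.
rewrite !conj_lin -(ip_conj Ex Ey) -(ip_conj Ex Ex) -(ip_conj Ey Ex) -(ip_conj Ey Ey).
by rewrite (ip_diag Ex) (ip_diag Ey) nc_prod; ring.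
Qed.

Lemma bessel_eq n g : E g -> sn (g - oproj n g) ^+ 2 + \sum_(k < n) nc (ip (e k) g) ^+ 2 = sn g ^+ 2.
Proof.
move=> Eg; elim: n => [|n ih]; first by rewrite /oproj !big_ord0 subr0 addr0.
rewrite -ih big_ord_recr /= projS opprD [g + _]addrA -scaleNr.
set x := g - oproj n g; set c := ip (e n) g.
have Ex : E x by apply: linsubB => //; exact: E_proj.
have cx : ip (e n) x = c.
  by rewrite /x (linear_onB hE (ip_lin (Ee n)) Eg (E_proj n g)) ip_proj// ltnn subr0.
have : (sn (x + - c *: e n) ^+ 2)%:C = (sn x ^+ 2 - nc c ^+ 2)%:C.
  rewrite sqnorm_add// (ip_conj (Ee n) Ex) cx ncN rmorphN /= mulNr mulNr.
  rewrite (mulrC c) mulJ_nc.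
  have [_ /(_ n)[e0|e1] _] := he.
    have c0 : c = 0 by rewrite /c e0 ip0l.
    by rewrite -real_comb c0 nc0 expr0n /= mul0r.
  by rewrite e1 expr1n mulr1 real_comb.
move=> /RC_inj ->; lra.
Qed.

Lemma bessel n g : E g -> \sum_(k < n) nc (ip (e k) g) ^+ 2 <= sn g ^+ 2.
Proof. by move=> Eg; rewrite -(bessel_eq n Eg) lerDr sqr_ge0. Qed.

Lemma sn_residual n g : E g -> sn (g - oproj n g) <= sn g.
Proof.
move=> Eg; have [sn0 _ _] := hsn; apply: le_sqr; first exact: sn0.
by rewrite -(bessel_eq n Eg) lerDl sumr_ge0// => k _; exact: sqr_ge0.
Qed.

Lemma sn_comb n (a : nat -> C) : sn (\sum_(k < n) a k *: e k) ^+ 2 <= \sum_(k < n) nc (a k) ^+ 2.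
Proof.
elim: n => [|n ih]; first by rewrite !big_ord0 (seminorm0 hE hsn) expr0n.
rewrite !big_ord_recr /=; set x := \sum_(k < n) _ in ih *.
have Ex : E x by apply: (@linsub_sum _ _ _ (fun k => a k *: e k)) => // k _; exact: linsubZ.
have o : ip (e n) x = 0.
  rewrite /x (@linear_on_sum _ _ E (ip (e n)) n (fun k => a k *: e k))//; last 2 first.
  - exact: ip_lin.
  - by move=> k; exact: linsubZ.
  apply: big1 => k _; rewrite (linear_onZ _ hE (ip_lin (Ee n)) (Ee k)) ip_ee ?mulr0//.
  by rewrite gtn_eqF.
have : (sn (x + a n *: e n) ^+ 2)%:C = (sn x ^+ 2 + nc (a n) ^+ 2 * sn (e n) ^+ 2)%:C.
  by rewrite sqnorm_add// (ip_conj (Ee n) Ex) o conjc0 !mulr0 !addr0 rmorphD.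
move=> /RC_inj ->; apply: lerD => //.
have [_ /(_ n)[e0|e1] _] := he; last by rewrite e1 expr1n mulr1.
by rewrite e0 (seminorm0 hE hsn) expr0n /= mulr0 sqr_ge0.
Qed.

End System.
End Greedy.

(** * Products of cones *)

Section ProductPoints.
Context {R : realType} {d1 d2 : nat}.
Local Notation mR := (measurableTypeR R).
Notation C := R[i].
Notation pts d := (d.-tuple mR * d.-tuple mR)%type.

Definition pcat (t1 : pts d1) (t2 : pts d2) : pts (d1 + d2) :=
  (cat_tuple t1.1 t2.1, cat_tuple t1.2 t2.2).

Lemma real_point_cat (a : d1.-tuple mR) (b : d2.-tuple mR) :
  real_point (cat_tuple a b) = row_mx (real_point a) (real_point b).
Proof.
apply/rowP => j; rewrite !mxE; case: split_ordP => k ->; rewrite mxE.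
  by rewrite tnth_lshift.
by rewrite tnth_rshift.
Qed.

Lemma pt_pcat t1 t2 : pt (pcat t1 t2) = row_mx (pt t1) (pt t2).
Proof.
rewrite /pt /= !real_point_cat; apply/rowP => j; rewrite !mxE.
by case: split_ordP => k _; rewrite !mxE.
Qed.

Lemma pt_inj d (t s : pts d) : pt t = pt s -> t = s.
Proof.
case: t s => t1 t2 [s1 s2] h.
have h' j : tnth t1 j = tnth s1 j /\ tnth t2 j = tnth s2 j.
  by move/rowP/(_ j): h; rewrite !ptE => -[].
by congr pair; apply: eq_from_tnth => j; case: (h' j).
Qed.

Lemma pcat_surj (t : pts (d1 + d2)) : exists t1 t2, t = pcat t1 t2.
Proof.
exists (unpt (lsubmx (pt t))), (unpt (rsubmx (pt t))); apply: pt_inj.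
by rewrite pt_pcat !unptK hsubmxK.
Qed.

Lemma pdec_pcat t1 t2 : pdec (pcat t1 t2) = pdec t1 * pdec t2.
Proof.
rewrite /pdec /tdec /= !big_split_ord /=.
have E (a : d1.-tuple mR) (b : d2.-tuple mR) :
    (\prod_(i < d1) idec (tnth (cat_tuple a b) (lshift d2 i)) = \prod_(i < d1) idec (tnth a i)) *
    (\prod_(i < d2) idec (tnth (cat_tuple a b) (rshift d1 i)) = \prod_(i < d2) idec (tnth b i)).
  by split; apply: eq_bigr => i _; rewrite ?tnth_lshift ?tnth_rshift.
by rewrite !E; ring.
Qed.

Lemma polyw_pcat n t1 t2 : polyw n (pcat t1 t2) = polyw n t1 * polyw n t2 :> R.
Proof.
rewrite /polyw big_split_ord /=; congr (_ * _); apply: eq_bigr => i _.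
  by rewrite tnth_lshift.
by rewrite tnth_rshift.
Qed.

Lemma cn_row_mx (z1 : 'rV[C]_d1) (z2 : 'rV[C]_d2) r : cn z1 <= r -> cn z2 <= r -> cn (row_mx z1 z2) <= r.
Proof.
move=> h1 h2; apply: cn_leP => [|j]; first by apply: le_trans h1; exact: cn_ge0.
rewrite mxE; case: split_ordP => k _; first by apply: le_trans h1; exact: le_cn.
by apply: le_trans h2; exact: le_cn.
Qed.

Lemma cn_lsubmx (z : 'rV[C]_(d1 + d2)) : cn (lsubmx z) <= cn z.
Proof. by apply: cn_leP => [|j]; [exact: cn_ge0|rewrite mxE le_cn]. Qed.

Lemma cn_rsubmx (z : 'rV[C]_(d1 + d2)) : cn (rsubmx z) <= cn z.
Proof. by apply: cn_leP => [|j]; [exact: cn_ge0|rewrite mxE le_cn]. Qed.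

Definition slice (h : cfun R (d1 + d2)) (z1 : 'rV[C]_d1) : cfun R d2 := fun z2 => h (row_mx z1 z2).

Lemma entire_slice h z1 : entire h -> entire (slice h z1).
Proof.
move=> eh; have [h1 h2] := entire_holo eh; apply/entireP; split.
  move=> z v; rewrite (_ : (fun s => _) = fun s : C => h (row_mx z1 z + s *: row_mx 0 v)); first exact: h1.
  by apply/funext => s; rewrite /slice scale_row_mx scaler0 add_row_mx addr0.
move=> z; have [r [M [r0 hM]]] := h2 (row_mx z1 z); exists r, M; split => // k kr.
have -> : slice h z1 (z + k) = h (row_mx z1 z + row_mx 0 k) by rewrite add_row_mx addr0.
by apply: hM; apply: cn_row_mx => //; rewrite cn0 ltW.
Qed.

Lemma entire_slice_line h z v z2 : entire h -> ent1 (fun s : C => slice h (z + s *: v) z2).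
Proof.
move=> eh; have [h1 _] := entire_holo eh.
rewrite (_ : (fun s => _) = fun s : C => h (row_mx z z2 + s *: row_mx v 0)); first exact: h1.
by apply/funext => s; rewrite /slice scale_row_mx scaler0 add_row_mx addr0.
Qed.

Lemma entire_tensor (f : cfun R d1) (g : cfun R d2) : entire f -> entire g -> entire (tensor f g).
Proof.
move=> /entire_holo[f1 f2] /entire_holo[g1 g2]; apply/entireP; split.
  move=> z v w; apply: cdiffM.
    have := f1 (lsubmx z) (lsubmx v) w; congr (cdiff _ _); apply/funext => s.
    by congr f; apply/rowP => j; rewrite !mxE.
  have := g1 (rsubmx z) (rsubmx v) w; congr (cdiff _ _); apply/funext => s.
  by congr g; apply/rowP => j; rewrite !mxE.
move=> z; have [r [M [r0 hM]]] := f2 (lsubmx z); have [r' [M' [r'0 hM']]] := g2 (rsubmx z).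
exists (Num.min r r'), (M * M'); split; first by rewrite lt_min r0.
move=> h; rewrite le_min => /andP[hr hr']; rewrite /tensor ncM; apply: ler_pM; rewrite ?nc_ge0//.
  have -> : lsubmx (z + h) = lsubmx z + lsubmx h by apply/rowP => j; rewrite !mxE.
  by apply: hM; apply: le_trans hr; exact: cn_lsubmx.
have -> : rsubmx (z + h) = rsubmx z + rsubmx h by apply/rowP => j; rewrite !mxE.
by apply: hM'; apply: le_trans hr'; exact: cn_rsubmx.
Qed.

Lemma tensorE (f : cfun R d1) (g : cfun R d2) z1 z2 : tensor f g (row_mx z1 z2) = f z1 * g z2.
Proof. by rewrite /tensor row_mxKl row_mxKr. Qed.

Lemma cone_prod_cone (U1 : set 'rV[R]_d1) (U2 : set 'rV[R]_d2) : cone U1 -> cone U2 -> cone (cone_prod U1 U2).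
Proof.
move=> [[u1 h1] c1] [[u2 h2] c2]; split.
  by exists (row_mx u1 u2); rewrite /cone_prod /= row_mxKl row_mxKr.
move=> t x t0 [/= x1 x2]; split => /=.
  have -> : lsubmx (t *: x) = t *: lsubmx x by apply/rowP => j; rewrite !mxE.
  exact: c1.
have -> : rsubmx (t *: x) = t *: rsubmx x by apply/rowP => j; rewrite !mxE.
exact: c2.
Qed.

End ProductPoints.

Section PowerSums.
Context {R : realType}.
Implicit Types (x y z p : R).

Lemma powR_double p x : 1 <= p -> 0 <= x -> 2 * x `^ p <= (2 * x) `^ p.
Proof.
move=> p1 x0; rewrite powRM// ler_wpM2r ?powR_ge0//.
have : 2 `^ 1 <= 2 `^ p :> R by rewrite ler_powR// ler1n.
by rewrite powRr1.
Qed.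

Lemma powR_sum_le p x y z : 1 <= p -> 0 <= x -> 0 <= y -> x <= z -> y <= z ->
  x `^ p + y `^ p <= (2 * z) `^ p.
Proof.
move=> p1 x0 y0 xz yz; have z0 : 0 <= z by apply: le_trans xz.
have p0 : 0 <= p by apply: le_trans p1.
apply: le_trans (powR_double p1 z0); rewrite mulr_natl mulr2n.
by apply: lerD; apply: powR_mono.
Qed.

Lemma powR_le_sum p x y z : 1 <= p -> 0 <= x -> 0 <= y -> 0 <= z -> z <= x + y ->
  z `^ p <= (2 * x) `^ p + (2 * y) `^ p.
Proof.
move=> p1 x0 y0 z0 h; have p0 : 0 <= p by apply: le_trans p1.
have [xy|xy] := leP x y.
  apply: (@le_trans _ _ ((2 * y) `^ p)); last by rewrite lerDr powR_ge0.
  by apply: powR_mono => //; lra.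
apply: (@le_trans _ _ ((2 * x) `^ p)); last by rewrite lerDl powR_ge0.
by apply: powR_mono => //; lra.
Qed.

End PowerSums.

Section ProductWeights.
Context {R : realType} {d1 d2 : nat}.
Local Notation mR := (measurableTypeR R).
Notation C := R[i].
Notation pts d := (d.-tuple mR * d.-tuple mR)%type.
Variables (beta : R).
Hypothesis hb0 : 0 <= beta.
Hypothesis hb1 : beta < 1.
Variables (N1 : 'rV[R]_d1 -> R) (N2 : 'rV[R]_d2 -> R) (N12 : 'rV[R]_(d1 + d2) -> R).
Hypothesis hN1 : is_norm N1.
Hypothesis hN2 : is_norm N2.
Hypothesis hN12 : is_norm N12.
Let p := (1 - beta)^-1.

Lemma norm_compare : exists c, [/\ 1 <= c, forall x1 x2, N1 x1 <= c * N12 (row_mx x1 x2),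
   forall x1 x2, N2 x2 <= c * N12 (row_mx x1 x2) &
   forall x1 x2, N12 (row_mx x1 x2) <= c * (N1 x1 + N2 x2)].
Proof.
have [k1 k10 h1] := N_upper hN1; have [l1 l10 h1'] := N_lower hN1.
have [k2 k20 h2] := N_upper hN2; have [l2 l20 h2'] := N_lower hN2.
have [k k0 h] := N_upper hN12; have [l l0 h'] := N_lower hN12.
have r1 (x1 : 'rV[R]_d1) (x2 : 'rV[R]_d2) : rn x1 <= rn (row_mx x1 x2).
  apply: rn_leP => [|j]; first exact: rn_ge0.
  by have := le_rn (row_mx x1 x2) (lshift d2 j); rewrite row_mxEl.
have r2 (x1 : 'rV[R]_d1) (x2 : 'rV[R]_d2) : rn x2 <= rn (row_mx x1 x2).
  apply: rn_leP => [|j]; first exact: rn_ge0.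
  by have := le_rn (row_mx x1 x2) (rshift d1 j); rewrite row_mxEr.
have r12 (x1 : 'rV[R]_d1) (x2 : 'rV[R]_d2) : rn (row_mx x1 x2) <= rn x1 + rn x2.
  apply: rn_leP => [|j]; first by rewrite addr_ge0 ?rn_ge0.
  rewrite mxE; case: split_ordP => i _.
    by apply: (le_trans (le_rn x1 i)); rewrite lerDl rn_ge0.
  by apply: (le_trans (le_rn x2 i)); rewrite lerDr rn_ge0.
have a1 := mulr_gt0 k10 l0; have a2 := mulr_gt0 k20 l0.
have a3 := mulr_gt0 k0 l10; have a4 := mulr_gt0 k0 l20.
exists (1 + k1 * l + k2 * l + k * l1 + k * l2); split; first lra.
- move=> x1 x2; have n0 := N_ge0 hN12 (row_mx x1 x2).
  apply: (@le_trans _ _ (k1 * l * N12 (row_mx x1 x2))); last by apply: ler_wpM2r => //; lra.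
  apply: (le_trans (h1 _)); rewrite -mulrA ler_wpM2l ?(ltW k10)//.
  exact: le_trans (r1 x1 x2) (h' _).
- move=> x1 x2; have n0 := N_ge0 hN12 (row_mx x1 x2).
  apply: (@le_trans _ _ (k2 * l * N12 (row_mx x1 x2))); last by apply: ler_wpM2r => //; lra.
  apply: (le_trans (h2 _)); rewrite -mulrA ler_wpM2l ?(ltW k20)//.
  exact: le_trans (r2 x1 x2) (h' _).
- move=> x1 x2; have n1 := N_ge0 hN1 x1; have n2 := N_ge0 hN2 x2.
  apply: (@le_trans _ _ (k * (l1 * N1 x1 + l2 * N2 x2))).
    apply: (le_trans (h _)); rewrite ler_wpM2l ?(ltW k0)//; apply: (le_trans (r12 _ _)).
    exact: lerD (h1' _) (h2' _).
  rewrite mulrDr mulrDr; apply: lerD.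
    by rewrite mulrA ler_wpM2r//; lra.
  by rewrite mulrA ler_wpM2r//; lra.
Qed.

Lemma dist_compare : exists c, [/\ 1 <= c, forall x1 x2, N1 x1 <= c * N12 (row_mx x1 x2),
   forall x1 x2, N2 x2 <= c * N12 (row_mx x1 x2) &
   forall x1 x2, N12 (row_mx x1 x2) <= c * (N1 x1 + N2 x2)] /\
   forall U1 U2, U1 !=set0 -> U2 !=set0 -> forall x1 x2,
   [/\ dist_set N1 x1 U1 <= c * dist_set N12 (row_mx x1 x2) (cone_prod U1 U2),
       dist_set N2 x2 U2 <= c * dist_set N12 (row_mx x1 x2) (cone_prod U1 U2) &
       dist_set N12 (row_mx x1 x2) (cone_prod U1 U2) <= c * (dist_set N1 x1 U1 + dist_set N2 x2 U2)].
Proof.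
have [c [c1 h1 h2 h12]] := norm_compare; exists c; split => // U1 U2 U10 U20 x1 x2.
have c0 : 0 < c by lra.
have P0 : cone_prod U1 U2 !=set0.
  by case: U10 U20 => [u1 ?] [u2 ?]; exists (row_mx u1 u2); rewrite /cone_prod /= row_mxKl row_mxKr.
have rB (u : 'rV[R]_(d1 + d2)) : row_mx x1 x2 - u = row_mx (x1 - lsubmx u) (x2 - rsubmx u).
  by rewrite -{1}(hsubmxK u) opp_row_mx add_row_mx.
split.
- rewrite mulrC -ler_pdivrMr//; apply: dist_leP => // u [/= u1 u2]; rewrite ler_pdivrMr// mulrC rB.
  by apply: (le_trans (dist_le hN1 x1 u1)); exact: h1.
- rewrite mulrC -ler_pdivrMr//; apply: dist_leP => // u [/= u1 u2]; rewrite ler_pdivrMr// mulrC rB.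
  by apply: (le_trans (dist_le hN2 x2 u2)); exact: h2.
- apply/ler_addgt0Pr => e e0; have ec : 0 < e / (2 * c) by rewrite divr_gt0// mulr_gt0.
  have [u1 U1u /ltW hu1] := dist_approx hN1 x1 U10 ec.
  have [u2 U2u /ltW hu2] := dist_approx hN2 x2 U20 ec.
  have Pu : cone_prod U1 U2 (row_mx u1 u2) by rewrite /cone_prod /= row_mxKl row_mxKr.
  apply: (le_trans (dist_le hN12 (row_mx x1 x2) Pu)); rewrite rB row_mxKl row_mxKr.
  apply: (le_trans (h12 _ _)); apply: (le_trans (ler_wpM2l (ltW c0) (lerD hu1 hu2))).
  rewrite le_eqVlt; apply/orP; left; apply/eqP; field; rewrite gt_eqF//.
Qed.

(** Distances and norms of a product are equivalent to the sums of those of the factors,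
and a power of a sum is absorbed by a dilation. *)
Lemma wt_product : exists kap, 1 <= kap /\ forall U1 U2 B n t1 t2, cone U1 -> cone U2 -> 0 < B ->
   wt beta N12 (cone_prod U1 U2) (kap * B) n (pcat t1 t2) <= wt beta N1 U1 B n t1 * wt beta N2 U2 B n t2 /\
   wt beta N1 U1 (kap * B) n t1 * wt beta N2 U2 (kap * B) n t2 <= wt beta N12 (cone_prod U1 U2) B n (pcat t1 t2).
Proof.
have [c [[c1 h1 h2 h12] hd]] := dist_compare.
exists (2 * c); split; first lra.
move=> U1 U2 B n t1 t2 cU1 cU2 B0.
have c0 : 0 < c by lra.
have kB0 : 0 < 2 * c * B by rewrite !mulr_gt0.
have cP := cone_prod_cone cU1 cU2.
have p1 : 1 <= p by exact: p_ge1.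
rewrite !wtE polyw_pcat /= !real_point_cat.
set x1 := real_point t1.1; set x2 := real_point t2.1; set y1 := real_point t1.2; set y2 := real_point t2.2.
rewrite !(dist_cone hN1)// !(dist_cone hN2)// !(dist_cone hN12)//.
rewrite !(NZ_pos hN1 _ (ltW kB0)) !(NZ_pos hN2 _ (ltW kB0)) !(NZ_pos hN12 _ (ltW kB0)).
rewrite !(NZ_pos hN1 _ (ltW B0)) !(NZ_pos hN2 _ (ltW B0)) !(NZ_pos hN12 _ (ltW B0)).
have [e1 e2 e12] := hd U1 U2 (proj1 cU1) (proj1 cU2) x1 x2.
have f1 := h1 y1 y2; have f2 := h2 y1 y2; have f12 := h12 y1 y2.
have X1 := dist_ge0 hN1 x1 (proj1 cU1); have X2 := dist_ge0 hN2 x2 (proj1 cU2).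
have X12 := dist_ge0 hN12 (row_mx x1 x2) (proj1 cP).
have Y1 := N_ge0 hN1 y1; have Y2 := N_ge0 hN2 y2; have Y12 := N_ge0 hN12 (row_mx y1 y2).
set D1 := dist_set N1 _ _ in e1 e12 X1 *; set D2 := dist_set N2 _ _ in e2 e12 X2 *.
set D12 := dist_set N12 _ _ in e1 e2 e12 X12 *.
set M1 := N1 _ in f1 f12 Y1 *; set M2 := N2 _ in f2 f12 Y2 *; set M12 := N12 _ in f1 f2 f12 Y12 *.
have P1 := ltW (polyw_gt0 n t1); have P2 := ltW (polyw_gt0 n t2).
have ba x1' x2' x12 : 0 <= x1' -> 0 <= x2' -> 0 <= x12 -> x1' <= c * x12 -> x2' <= c * x12 ->
    (B * x1') `^ p + (B * x2') `^ p <= (2 * c * B * x12) `^ p.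
  move=> u1 u2 u12 v1 v2; have -> : 2 * c * B * x12 = 2 * (B * (c * x12)) by ring.
  by apply: powR_sum_le => //; rewrite ?mulr_ge0 ?(ltW B0)//; apply: ler_wpM2l => //; exact: ltW.
have bb x1' x2' x12 : 0 <= x1' -> 0 <= x2' -> 0 <= x12 -> x12 <= c * (x1' + x2') ->
    (B * x12) `^ p <= (2 * c * B * x1') `^ p + (2 * c * B * x2') `^ p.
  move=> u1 u2 u12 v.
  have -> : 2 * c * B * x1' = 2 * (c * B * x1') by ring.
  have -> : 2 * c * B * x2' = 2 * (c * B * x2') by ring.
  have cB : 0 <= c * B by rewrite mulr_ge0// ltW.
  apply: powR_le_sum => //; try (by apply: mulr_ge0 => //; exact: ltW).
  have := ler_wpM2l (ltW B0) v; have -> : B * (c * (x1' + x2')) = c * B * x1' + c * B * x2' by ring.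
  exact.
split.
- rewrite mulrACA -expRD; apply: ler_wpM2l; first exact: mulr_ge0.
  rewrite ler_expR; have := ba _ _ _ X1 X2 X12 e1 e2; have := ba _ _ _ Y1 Y2 Y12 f1 f2.
  rewrite /p; lra.
- rewrite mulrACA -expRD; apply: ler_wpM2l; first exact: mulr_ge0.
  rewrite ler_expR; have := bb _ _ _ X1 X2 X12 e12; have := bb _ _ _ Y1 Y2 Y12 f12.
  rewrite /p; lra.
Qed.

End ProductWeights.

(** * Slices and their coefficients *)

(* Unification must not look inside the integrals and the weights. *)
Opaque Hnorm Hsqnorm wt ip.

Section Systems.
Context {R : realType} {d : nat}.
Local Notation mR := (measurableTypeR R).
Notation C := R[i].
Notation pts := (d.-tuple mR * d.-tuple mR)%type.
Variables (beta : R) (N : 'rV[R]_d -> R).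
Hypothesis hb0 : 0 <= beta.
Hypothesis hb1 : beta < 1.
Hypothesis hN : is_norm N.
Implicit Types (U : set 'rV[R]_d) (B : R) (n : nat) (t : pts) (f g : cfun R d).
Local Notation wt := (wt beta N).
Local Notation hn := (Hnorm beta N).
Local Notation hs := (Hsqnorm beta N).
Local Notation HE := (HE beta N).
Local Notation Sb := (Sb beta N).
Local Notation lebp d := (@lebesgue_tuple R d \x @lebesgue_tuple R d)%E.

Lemma linsub_Sb U b : cone U -> linsub (Sb U b).
Proof. by move=> cU; split; [exact: (@Sb0 R d beta N U b)|move=> a f g; exact: Sb_lin]. Qed.

Lemma seminorm_hn U b B n : cone U -> b < B -> seminorm (Sb U b) (hn U B n).
Proof.
move=> cU bB; split=> [f _|f g hf hg|a f hf]; first exact: hn_ge0.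
  by have [] := HED hN cU (hf B n bB) (hg B n bB).
by have [] := HEZ hN a cU (hf B n bB).
Qed.

Lemma hn_sum U B n (F : nat -> cfun R d) m (A : R) : cone U -> (forall k, HE U B n (F k)) -> 0 <= A ->
  (forall t, \sum_(k < m) nc (F k (pt t)) ^+ 2 * wt U B n t <= A * pdec t) ->
  \sum_(k < m) hn U B n (F k) ^+ 2 <= A * @pmass R d.
Proof.
move=> cU hF A0 h; rewrite -lee_fin -sumEFin.
under eq_bigr do rewrite -hs_hn// HsE.
rewrite -ge0_integral_sum//.
- rewrite EFinM -pmassE -ge0_integralZl_EFin//; last 2 first.
  + by move=> t _; rewrite lee_fin ltW// pdec_gt0.
  + by apply/measurable_EFinP; exact: measurable_pdec.
  apply: ge0_le_integral => //.
  + by move=> t _; apply: sume_ge0 => k _; exact: dens_ge0.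
  + by apply: emeasurable_sum => k; apply: measurable_dens => //; case: (hF k).
  + by apply: measurable_funeM; apply/measurable_EFinP; exact: measurable_pdec.
  + by move=> t _; rewrite sumEFin -EFinM lee_fin; exact: h.
- by move=> k; apply: measurable_dens => //; case: (hF k).
- by move=> k t _; exact: dens_ge0.
Qed.

(** The weak norm is Hilbert-Schmidt with respect to the strong one: the point estimate,
evaluated on the combination whose coefficients are conjugate to the values at a point,
bounds the whole diagonal. *)
Lemma diagonal_bound U b Bs ns Bw nw : cone U -> 0 < b -> b < Bs -> Bs < Bw -> (nw.+1 <= ns)%N ->
  exists2 K, 0 < K & forall e, orthosystem (Sb U b) (ip beta N U Bs ns) (hn U Bs ns) e ->
   forall m t, \sum_(k < m) nc (e k (pt t)) ^+ 2 * wt U Bw nw t <= K * pdec t.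
Proof.
move=> cU b0 bs sw nn; have Bs0 : 0 < Bs by apply: lt_trans bs.
have [K K0 hK] := H_point hb0 hb1 hN Bs0 sw nn.
exists K => // e he m t; have [he1 _ _] := he.
have hE := @linsub_Sb U b cU.
pose S := \sum_(k < m) nc (e k (pt t)) ^+ 2.
have S0 : 0 <= S by apply: sumr_ge0 => k _; exact: sqr_ge0.
pose g : cfun R d := \sum_(k < m) conjc (e k (pt t)) *: e k.
have hg : Sb U b g by exact: (@linsub_sum _ _ _ (fun k => conjc (e k (pt t)) *: e k) m hE (fun k _ => linsubZ _ hE (he1 k))).
have gt : g (pt t) = S%:C.
  rewrite /g /S rmorph_sum /= fct_sumE; apply: eq_bigr => k _; exact: mulJ_nc.
have sg : hn U Bs ns g ^+ 2 <= S.
  have := @sn_comb _ _ _ (ip beta N U Bs ns) (hn U Bs ns) hE _ _ _ _ e he m (fun k => conjc (e k (pt t))).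
  have E : \sum_(k < m) nc (conjc (e k (pt t))) ^+ 2 = S by apply: eq_bigr => k _; rewrite [nc _]ncJ.
  rewrite E; apply.
  - by move=> f hf a u v hu hv; apply: (ip_lin hN) => //; [exact: hf|exact: hu|exact: hv].
  - by move=> f u hf hu; apply: (ip_conj hN) => //; [exact: hf|exact: hu].
  - by move=> f hf; apply: ip_diag; exact: hf.
  - exact: seminorm_hn.
have := hK U g t cU (hg Bs ns bs); rewrite gt ncR ger0_norm// => h.
rewrite -mulr_suml -/S.
have w0 := wt_ge0 beta N U Bw nw t; have p0 := ltW (pdec_gt0 t).
have [S00|S00] := eqVneq S 0; first by rewrite S00 mul0r mulr_ge0// ltW.
have Sp : 0 < S by rewrite lt_neqAle eq_sym S00.
rewrite -(ler_pM2l Sp) mulrA -expr2; apply: (le_trans h).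
have -> : S * (K * pdec t) = K * S * pdec t by ring.
by apply: ler_wpM2r => //; apply: ler_wpM2l => //; exact: ltW.
Qed.

(** The greedy sequence for a strong and a weak norm of the same family. Together, the
two conclusions make orthogonal expansions converge in the weak norm, uniformly on
strong balls. *)
Lemma good_system U b Bs ns Bw nw : cone U -> 0 < b -> b < Bs -> Bs < Bw -> (nw.+1 <= ns)%N ->
  exists2 e, orthosystem (Sb U b) (ip beta N U Bs ns) (hn U Bs ns) e &
  (forall n g, Sb U b g -> (forall k, (k < n)%N -> ip beta N U Bs ns (e k) g = 0) ->
     hn U Bw nw g <= 2 * hn U Bw nw (e n) * hn U Bs ns g) /\
  exists2 M, 0 <= M & forall m, \sum_(k < m) hn U Bw nw (e k) ^+ 2 <= M.
Proof.
move=> cU b0 bs sw nn; have Bs0 : 0 < Bs by apply: lt_trans bs.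
have bw : b < Bw by apply: lt_trans sw.
have [||||e he hg] := @greedy _ _ (Sb U b) (ip beta N U Bs ns) (hn U Bs ns) (hn U Bw nw) 1 (@linsub_Sb U b cU).
- by move=> f hf a u v hu hv; apply: (ip_lin hN) => //; [exact: hf|exact: hu|exact: hv].
- exact: seminorm_hn.
- exact: seminorm_hn.
- move=> f hf; rewrite mul1r; apply: Sb_mono => //; [exact: hf|exact: ltW|].
  by apply: leq_trans nn; exact: leqnSn.
exists e => //; split; first exact: hg.
have [K K0 hK] := diagonal_bound cU b0 bs sw nn.
have [he1 _ _] := he.
exists (K * @pmass R d); first by apply: mulr_ge0; [exact: ltW|exact: pmass_ge0].
move=> m; apply: hn_sum => //; [by move=> k; exact: he1|exact: ltW|exact: hK].
Qed.

Lemma summable_small (u : nat -> R) (M del : R) n0 : (forall m, \sum_(k < m) u k ^+ 2 <= M) ->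
  (forall k, 0 <= u k) -> 0 < del -> exists2 n, (n0 <= n)%N & u n <= del.
Proof.
move=> hM u0 d0; apply: contrapT => h.
have {}h k : (n0 <= k)%N -> del ^+ 2 <= u k ^+ 2.
  move=> nk; apply: sqr_le; first exact: ltW.
  by rewrite leNgt; apply/negP => /ltW hk; apply: h; exists k.
have lo m : m%:R * del ^+ 2 <= \sum_(k < n0 + m) u k ^+ 2.
  elim: m => [|m ih]; first by rewrite mul0r sumr_ge0// => k _; exact: sqr_ge0.
  rewrite addnS big_ord_recr /= -natr1 mulrDl mul1r; apply: lerD => //.
  by apply: h; exact: leq_addr.
have d2 : 0 < del ^+ 2 by rewrite exprn_gt0.
pose m := Num.bound (`|M| / del ^+ 2).
have := archi_boundP (divr_ge0 (normr_ge0 M) (ltW d2)); rewrite -/m ltr_pdivrMr// => hm.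
have := le_trans (lo m) (hM _); have := ler_norm M; lra.
Qed.

Lemma nc_small (x : C) : (forall e, 0 < e -> nc x <= e) -> x = 0.
Proof.
move=> hx; apply/eqP; rewrite -nc_eq0; apply/eqP/le_anti; rewrite nc_ge0 andbT.
by apply/ler_addgt0Pr => e e0; rewrite add0r hx.
Qed.

Lemma Sb_le U b b' f : b <= b' -> Sb U b f -> Sb U b' f.
Proof. by move=> bb hf B n bB; apply: hf; apply: le_lt_trans bB. Qed.

End Systems.

Section Slices.
Context {R : realType} {d1 d2 : nat}.
Local Notation mR := (measurableTypeR R).
Notation C := R[i].
Notation pts d := (d.-tuple mR * d.-tuple mR)%type.
Variables (beta : R).
Hypothesis hb0 : 0 <= beta.
Hypothesis hb1 : beta < 1.
Variables (N1 : 'rV[R]_d1 -> R) (N2 : 'rV[R]_d2 -> R) (N12 : 'rV[R]_(d1 + d2) -> R).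
Hypothesis hN1 : is_norm N1.
Hypothesis hN2 : is_norm N2.
Hypothesis hN12 : is_norm N12.
Variable kap : R.
Hypothesis kap1 : 1 <= kap.
Hypothesis hkap : forall U1 U2 B n t1 t2, cone U1 -> cone U2 -> 0 < B ->
   wt beta N12 (cone_prod U1 U2) (kap * B) n (pcat t1 t2) <= wt beta N1 U1 B n t1 * wt beta N2 U2 B n t2 /\
   wt beta N1 U1 (kap * B) n t1 * wt beta N2 U2 (kap * B) n t2 <= wt beta N12 (cone_prod U1 U2) B n (pcat t1 t2).
Local Notation hn1 := (Hnorm beta N1).
Local Notation hn2 := (Hnorm beta N2).
Local Notation hn12 := (Hnorm beta N12).
Local Notation wt1 := (wt beta N1).
Local Notation wt2 := (wt beta N2).
Local Notation wt12 := (wt beta N12).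
Local Notation Sb1 := (Sb beta N1).
Local Notation Sb2 := (Sb beta N2).
Local Notation Sb12 := (Sb beta N12).

Let kap0 : 0 < kap. Proof. by apply: lt_le_trans kap1. Qed.

Lemma tensor_Sb U1 U2 b f g : cone U1 -> cone U2 -> 0 < b -> Sb1 U1 b f -> Sb2 U2 b g ->
  Sb12 (cone_prod U1 U2) (kap * b) (tensor f g).
Proof.
move=> cU1 cU2 b0 hf hg B n bB.
have bB' : b < B / kap by rewrite ltr_pdivlMr// mulrC.
pose B1 := (b + B / kap) / 2.
have b1 : b < B1 by rewrite /B1; lra.
have b2 : B1 < B / kap by rewrite /B1; lra.
have B10 : 0 < B1 by apply: lt_trans b1.
have B20 : 0 < B / kap by apply: lt_trans b2.
have [L1 L10 hL1] := H_point hb0 hb1 hN1 B10 b2 (leqnn n.+1).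
have [L2 L20 hL2] := H_point hb0 hb1 hN2 B10 b2 (leqnn n.+1).
pose A := L1 * hn1 U1 B1 n.+1 f ^+ 2 * (L2 * hn2 U2 B1 n.+1 g ^+ 2).
have A0 : 0 <= A.
  by apply: mulr_ge0; apply: mulr_ge0; rewrite ?sqr_ge0// ltW.
have ef := Sb_entire hf; have eg := Sb_entire hg.
suff h t : nc (tensor f g (pt t)) ^+ 2 * wt12 (cone_prod U1 U2) B n t <= A * pdec t.
  by have [] := HE_dens hN12 (cone_prod_cone cU1 cU2) (entire_tensor ef eg) A0 h.
have [t1 [t2 ->]] := pcat_surj t; rewrite pt_pcat tensorE pdec_pcat ncM exprMn.
have [w _] := hkap n t1 t2 cU1 cU2 B20; have {}w : wt12 (cone_prod U1 U2) B n (pcat t1 t2) <=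
    wt1 U1 (B / kap) n t1 * wt2 U2 (B / kap) n t2.
  by move: w; have -> : kap * (B / kap) = B by field; rewrite gt_eqF.
apply: (le_trans (ler_wpM2l (mulr_ge0 (sqr_ge0 _) (sqr_ge0 _)) w)).
rewrite mulrACA /A [leRHS]mulrACA; apply: ler_pM.
- by apply: mulr_ge0; [exact: sqr_ge0|exact: wt_ge0].
- by apply: mulr_ge0; [exact: sqr_ge0|exact: wt_ge0].
- exact: (hL1 U1 f t1 cU1 (hf B1 n.+1 b1)).
- exact: (hL2 U2 g t2 cU2 (hg B1 n.+1 b1)).
Qed.

Lemma slice_bound b B1 n1 B2 n2 : 0 < b -> kap * b < B1 -> kap * b < B2 -> exists B n K,
  [/\ b < B, 0 < K & forall U1 U2 h t1 t2, cone U1 -> cone U2 -> HE beta N12 (cone_prod U1 U2) B n h ->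
   nc (h (row_mx (pt t1) (pt t2))) ^+ 2 * (wt1 U1 B1 n1 t1 * wt2 U2 B2 n2 t2) <=
   K * hn12 (cone_prod U1 U2) B n h ^+ 2 * (pdec t1 * pdec t2)].
Proof.
move=> b0 h1 h2; pose Bk := Num.min B1 B2 / kap; pose nk := maxn n1 n2.
have bk : b < Bk by rewrite ltr_pdivlMr// mulrC lt_min h1.
pose B := (b + Bk) / 2.
have bB : b < B by rewrite /B; lra.
have BB : B < Bk by rewrite /B; lra.
have B0 : 0 < B by apply: lt_trans bB.
have Bk0 : 0 < Bk by apply: lt_trans BB.
have kB : kap * Bk = Num.min B1 B2 by rewrite /Bk mulrC divfK// gt_eqF.
have m0 : 0 < Num.min B1 B2 by rewrite -kB mulr_gt0.
have [K K0 hK] := H_point hb0 hb1 hN12 B0 BB (leqnn nk.+1).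
exists B, nk.+1, K; split => // U1 U2 h t1 t2 cU1 cU2 hh.
have := hK _ h (pcat t1 t2) (cone_prod_cone cU1 cU2) hh; rewrite pt_pcat pdec_pcat => /(le_trans _); apply.
apply: ler_wpM2l; first exact: sqr_ge0.
have [_ w] := hkap nk t1 t2 cU1 cU2 Bk0; apply: le_trans w; rewrite kB.
apply: ler_pM; try exact: wt_ge0; apply: wt_mono => //.
- by rewrite ge_min lexx.
- exact: leq_maxl.
- by rewrite ge_min lexx orbT.
- exact: leq_maxr.
Qed.

(** Freeze the first variable in the point estimate and integrate the second one. *)
Lemma slice_norm b B1 n1 B2 n2 : 0 < b -> kap * b < B1 -> kap * b < B2 -> exists B n K,
  [/\ b < B, 0 <= K & forall U1 U2 h t1, cone U1 -> cone U2 -> HE beta N12 (cone_prod U1 U2) B n h ->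
   HE beta N2 U2 B2 n2 (slice h (pt t1)) /\
   hn2 U2 B2 n2 (slice h (pt t1)) ^+ 2 * wt1 U1 B1 n1 t1 <= K * hn12 (cone_prod U1 U2) B n h ^+ 2 * pdec t1].
Proof.
move=> b0 h1 h2; have [B [n [K [bB K0 hK]]]] := slice_bound n1 n2 b0 h1 h2.
exists B, n, (K * @pmass R d2); split => //; first by apply: mulr_ge0; [exact: ltW|exact: pmass_ge0].
move=> U1 U2 h t1 cU1 cU2 hh.
have w0 := wt_gt0 beta N1 U1 B1 n1 t1.
pose A := K * hn12 (cone_prod U1 U2) B n h ^+ 2 * pdec t1 / wt1 U1 B1 n1 t1.
have A0 : 0 <= A.
  apply: divr_ge0; last exact: ltW.
  by apply: mulr_ge0; [apply: mulr_ge0; [exact: ltW|exact: sqr_ge0]|apply: ltW; exact: pdec_gt0].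
have dens t2 : nc (slice h (pt t1) (pt t2)) ^+ 2 * wt2 U2 B2 n2 t2 <= A * pdec t2.
  rewrite /A [leRHS]mulrAC ler_pdivlMr//.
  have := hK U1 U2 h t1 t2 cU1 cU2 hh.
  by rewrite [wt1 _ _ _ _ * _]mulrC !mulrA.
have [a1 a2] := HE_dens hN2 cU2 (entire_slice (pt t1) (proj1 hh)) A0 dens.
split => //.
apply: (le_trans (ler_wpM2r (ltW w0) a2)).
rewrite /A le_eqVlt; apply/orP; left; apply/eqP; field; rewrite gt_eqF//.
Qed.

Lemma slice_Sb U1 U2 b h z1 : cone U1 -> cone U2 -> 0 < b -> Sb12 (cone_prod U1 U2) b h ->
  Sb2 U2 (kap * b) (slice h z1).
Proof.
move=> cU1 cU2 b0 hh B2 n2 h2; rewrite -(unptK z1).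
have [B [n [K [bB K0 hK]]]] := @slice_norm b B2 n2 B2 n2 b0 h2 h2.
by have [] := hK U1 U2 h (unpt z1) cU1 cU2 (hh B n bB).
Qed.

Section Coefficients.
Variables (U1 : set 'rV[R]_d1) (U2 : set 'rV[R]_d2) (b : R) (Bs : R) (ns : nat).
Hypothesis cU1 : cone U1.
Hypothesis cU2 : cone U2.
Hypothesis b0 : 0 < b.
Hypothesis bs : kap * b < Bs.
Local Notation U12 := (cone_prod U1 U2).
Local Notation ip2 := (ip beta N2 U2 Bs ns).

(** The coefficient of the slices [h (z1, .)] along [e], as a function of [z1]. *)
Definition lam (e : cfun R d2) (h : cfun R (d1 + d2)) : cfun R d1 := fun z1 => ip2 e (slice h z1).

Let kb0 : 0 < kap * b. Proof. exact: mulr_gt0. Qed.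

Lemma lam_majorant e h rho : Sb2 U2 (kap * b) e -> Sb12 U12 b h ->
  exists M : pts d2 -> R, (@lebesgue_tuple R d2 \x @lebesgue_tuple R d2)%E.-integrable setT (EFin \o M) /\
   forall z1 t, cn z1 <= rho -> nc (ipd beta N2 U2 Bs ns e (slice h z1) t) <= M t.
Proof.
move=> he hh.
have [B [n [K [bB K0 hK]]]] := slice_bound ns ns b0 bs bs.
have Bs0 : 0 < Bs by apply: lt_trans bs.
have [c c0 hc] := wt_lower hb1 hN1 ns rho cU1 Bs0.
pose A := K * hn12 U12 B n h ^+ 2 / c.
exists (fun t => nc (e (pt t)) ^+ 2 * wt2 U2 Bs ns t + A * pdec t); split.
  have i1 := integrable_dens hN2 cU2 (he Bs ns bs).
  have i2 : (@lebesgue_tuple R d2 \x @lebesgue_tuple R d2)%E.-integrable setT (EFin \o (fun t => A * pdec t)).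
    exact: (integrableZl measurableT A (integrable_pdec d2)).
  exact: (integrableD measurableT i1 i2).
move=> z1 t hz; apply: (le_trans (nc_ipd _ _ _ _ _ _ _ _)); rewrite lerD2l.
have := hK U1 U2 h (unpt z1) t cU1 cU2 (hh B n bB); rewrite unptK => h1.
have w1 : c <= wt1 U1 Bs ns (unpt z1) by apply: hc; rewrite unptK.
have w2 := wt_ge0 beta N2 U2 Bs ns t.
rewrite /A [leRHS]mulrAC ler_pdivlMr//.
apply: (@le_trans _ _ (K * hn12 U12 B n h ^+ 2 * (pdec (unpt z1) * pdec t))); last first.
  apply: ler_wpM2l; first by apply: mulr_ge0; [exact: ltW|exact: sqr_ge0].
  by rewrite ler_piMl ?(ltW (pdec_gt0 _))// pdec_le1.
apply: le_trans h1; rewrite -mulrA; apply: ler_wpM2l; first exact: sqr_ge0.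
by rewrite mulrC; exact: (ler_wpM2r w2 w1).
Qed.

Lemma entire_lam e h : Sb2 U2 (kap * b) e -> Sb12 U12 b h -> entire (lam e h).
Proof.
move=> he hh; have eh := Sb_entire hh; have ee := Sb_entire he.
have hint z1 : cintegrable (@lebesgue_tuple R d2 \x @lebesgue_tuple R d2)%E setT (ipd beta N2 U2 Bs ns e (slice h z1)).
  apply: cintegrable_ipd => //; first exact: he.
  by apply: (slice_Sb z1 cU1 cU2 b0 hh).
apply/entireP; split.
  move=> z v; apply: (@ent1_cint _ _ _ _ _ (fun s t => ipd beta N2 U2 Bs ns e (slice h (z + s *: v)) t)).
  - exact: measurableT.
  - move=> t _ w; apply: cdiffM; last exact: cdiff_cst.
    apply: cdiffM; first exact: cdiff_cst.
    exact: entire_slice_line.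
  - by move=> w; apply: cmeas_ipd => //; exact: entire_slice.
  - move=> rho; have [M [iM hM]] := lam_majorant (cn z + `|rho| * cn v) he hh.
    exists M; split => // w t hw _; apply: hM.
    apply: (le_trans (cnD _ _)); rewrite lerD2l; apply: (le_trans (cnZ _ _)).
    by rewrite ler_wpM2r ?cn_ge0// (le_trans hw) ?ler_norm.
move=> z; have [M [iM hM]] := lam_majorant (cn z + 1) he hh.
exists 1, (2 * \int[(@lebesgue_tuple R d2 \x @lebesgue_tuple R d2)%E]_t M t); split => // k hk.
apply: (cint_le measurableT (hint _) iM) => t _; apply: hM; apply: (le_trans (cnD _ _)).
by rewrite lerD2l.
Qed.

Lemma lam_lin e a h h' : Sb2 U2 (kap * b) e -> Sb12 U12 b h -> Sb12 U12 b h' ->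
  lam e (a *: h + h') = a *: lam e h + lam e h'.
Proof.
move=> he hh hh'; apply/funext => z1.
apply: (ip_lin hN2 a cU2 (he Bs ns bs)).
  by apply: (slice_Sb z1 cU1 cU2 b0 hh).
by apply: (slice_Sb z1 cU1 cU2 b0 hh').
Qed.

Lemma ip2_lin f : Sb2 U2 (kap * b) f -> linear_on (Sb2 U2 (kap * b)) (ip2 f).
Proof. by move=> hf a u v hu hv; apply: (ip_lin hN2) => //; [exact: hf|exact: hu|exact: hv]. Qed.

Lemma ip2_conj f u : Sb2 U2 (kap * b) f -> Sb2 U2 (kap * b) u -> ip2 u f = conjc (ip2 f u).
Proof. by move=> hf hu; apply: (ip_conj hN2) => //; [exact: hf|exact: hu]. Qed.

Lemma ip2_diag f : Sb2 U2 (kap * b) f -> ip2 f f = (hn2 U2 Bs ns f ^+ 2)%:C.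
Proof. by move=> hf; apply: ip_diag; exact: hf. Qed.

(** Bessel's inequality on the slices, integrated in the first variable. *)
Lemma lam_bessel B1 n1 : kap * b < B1 -> exists B n K, [/\ b < B, 0 <= K &
  forall e h m, orthosystem (Sb2 U2 (kap * b)) ip2 (hn2 U2 Bs ns) e -> Sb12 U12 b h ->
   (forall k, Sb1 U1 (kap * b) (lam (e k) h)) /\
   \sum_(k < m) hn1 U1 B1 n1 (lam (e k) h) ^+ 2 <= K * hn12 U12 B n h ^+ 2].
Proof.
move=> h1.
have gen B1' n1' : kap * b < B1' -> exists B n K, [/\ b < B, 0 <= K &
  forall e h m, orthosystem (Sb2 U2 (kap * b)) ip2 (hn2 U2 Bs ns) e -> Sb12 U12 b h ->
   forall t, \sum_(k < m) nc (lam (e k) h (pt t)) ^+ 2 * wt1 U1 B1' n1' t <= K * hn12 U12 B n h ^+ 2 * pdec t].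
  move=> h1'; have [B [n [K [bB K0 hK]]]] := slice_norm n1' ns b0 h1' bs.
  exists B, n, K; split => // e h m he hh t.
  have [_ hS] := hK U1 U2 h t cU1 cU2 (hh B n bB).
  apply: le_trans hS; rewrite -mulr_suml; apply: ler_wpM2r; first exact: wt_ge0.
  apply: (@bessel _ _ (Sb2 U2 (kap * b)) ip2 (hn2 U2 Bs ns) (@linsub_Sb R d2 beta N2 hN2 U2 (kap * b) cU2) ip2_lin ip2_conj ip2_diag e he m (slice h (pt t))).
  exact: (slice_Sb (pt t) cU1 cU2 b0 hh).
have [B [n [K [bB K0 hK]]]] := gen B1 n1 h1.
exists B, n, (K * @pmass R d1); split => //; first by apply: mulr_ge0 => //; exact: pmass_ge0.
move=> e h m he hh; have [he1 _ _] := he.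
have hS k : Sb1 U1 (kap * b) (lam (e k) h).
  move=> B' n' h'; have [B2 [n2 [K2 [bB2 K20 hK2]]]] := gen B' n' h'.
  have A0 : 0 <= K2 * hn12 U12 B2 n2 h ^+ 2 by apply: mulr_ge0 => //; exact: sqr_ge0.
  suff D t : nc (lam (e k) h (pt t)) ^+ 2 * wt1 U1 B' n' t <= K2 * hn12 U12 B2 n2 h ^+ 2 * pdec t.
    by have [] := HE_dens hN1 cU1 (entire_lam (he1 k) hh) A0 D.
  apply: le_trans (hK2 e h k.+1 he hh t); rewrite big_ord_recr /= lerDr.
  by apply: sumr_ge0 => i _; apply: mulr_ge0; [exact: sqr_ge0|exact: wt_ge0].
split => //.
have A0 : 0 <= K * hn12 U12 B n h ^+ 2 by apply: mulr_ge0 => //; exact: sqr_ge0.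
rewrite [leRHS]mulrAC.
apply: (@hn_sum R d1 beta N1 hN1 U1 B1 n1 (fun k => lam (e k) h) m _ cU1 (fun k => hS k B1 n1 h1) A0).
exact: hK.
Qed.

Lemma lam_tensor e f g : Sb2 U2 (kap * b) e -> Sb2 U2 (kap * b) g -> lam e (tensor f g) = ip2 e g *: f.
Proof.
move=> he hg; apply/funext => z1.
have hE := @linsub_Sb R d2 beta N2 hN2 U2 (kap * b) cU2.
rewrite /lam (_ : slice (tensor f g) z1 = f z1 *: g); last first.
  by apply/funext => z2; rewrite /slice tensorE.
by rewrite (linear_onZ _ hE (ip2_lin he) hg) mulrC.
Qed.

End Coefficients.
End Slices.

(** * Extension and uniqueness for a fixed pair of cones *)

Section LocalKernel.
Context {R : realType} {d1 d2 : nat}.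
Local Notation mR := (measurableTypeR R).
Notation C := R[i].
Notation pts d := (d.-tuple mR * d.-tuple mR)%type.
Variables (beta : R).
Hypothesis hb0 : 0 <= beta.
Hypothesis hb1 : beta < 1.
Variables (N1 : 'rV[R]_d1 -> R) (N2 : 'rV[R]_d2 -> R) (N12 : 'rV[R]_(d1 + d2) -> R).
Hypothesis hN1 : is_norm N1.
Hypothesis hN2 : is_norm N2.
Hypothesis hN12 : is_norm N12.
Variable kap : R.
Hypothesis kap1 : 1 <= kap.
Hypothesis hkap : forall U1 U2 B n t1 t2, cone U1 -> cone U2 -> 0 < B ->
   wt beta N12 (cone_prod U1 U2) (kap * B) n (pcat t1 t2) <= wt beta N1 U1 B n t1 * wt beta N2 U2 B n t2 /\
   wt beta N1 U1 (kap * B) n t1 * wt beta N2 U2 (kap * B) n t2 <= wt beta N12 (cone_prod U1 U2) B n (pcat t1 t2).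
Local Notation hn1 := (Hnorm beta N1).
Local Notation hn2 := (Hnorm beta N2).
Local Notation hn12 := (Hnorm beta N12).
Local Notation wt1 := (wt beta N1).
Local Notation wt2 := (wt beta N2).
Local Notation wt12 := (wt beta N12).
Local Notation Sb1 := (Sb beta N1).
Local Notation Sb2 := (Sb beta N2).
Local Notation Sb12 := (Sb beta N12).

Let kap0 : 0 < kap. Proof. by apply: lt_le_trans kap1. Qed.

Section Pair.
Variables (U1 : set 'rV[R]_d1) (U2 : set 'rV[R]_d2) (b : R).
Hypothesis cU1 : cone U1.
Hypothesis cU2 : cone U2.
Hypothesis b0 : 0 < b.
Local Notation U12 := (cone_prod U1 U2).

Let kb0 : 0 < kap * b. Proof. exact: mulr_gt0. Qed.

Variable w : cfun R d1 -> cfun R d2 -> C.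

(** Separate boundedness on the Frechet factors gives a joint bound, and expanding the
slices along an adapted sequence extends the form from tensors to all functions. Both
families of coefficients are square summable, hence the absolute convergence. *)
Theorem local_functional : bilinear_on (Sb1 U1 (kap * b)) (Sb2 U2 (kap * b)) w ->
  (forall f, Sb1 U1 (kap * b) f -> exists B n c, kap * b < B /\ forall g, Sb2 U2 (kap * b) g -> nc (w f g) <= c * hn2 U2 B n g) ->
  (forall g, Sb2 U2 (kap * b) g -> exists B n c, kap * b < B /\ forall f, Sb1 U1 (kap * b) f -> nc (w f g) <= c * hn1 U1 B n f) ->
  exists2 l : cfun R (d1 + d2) -> C, linear_on (Sb12 U12 b) l &
   (exists B n c, b < B /\ forall h, Sb12 U12 b h -> nc (l h) <= c * hn12 U12 B n h) /\
   forall f g, Sb1 U1 (kap * b) f -> Sb2 U2 (kap * b) g -> Sb12 U12 b (tensor f g) -> l (tensor f g) = w f g.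
Proof.
move=> hw hw1 hw2.
have S1 : linsub (Sb1 U1 (kap * b)) by exact: linsub_Sb.
have S2 : linsub (Sb2 U2 (kap * b)) by exact: linsub_Sb.
have S12 : linsub (Sb12 U12 b) by apply: linsub_Sb => //; exact: cone_prod_cone.
pose p1 k := hn1 U1 (Bm (kap * b) k) k; pose p2 k := hn2 U2 (Bm (kap * b) k) k.
have Bm0 k : 0 < Bm (kap * b) k by apply: lt_trans (Bm_gt _ _).
have dom1 B n : kap * b < B -> exists k, forall f, Sb1 U1 (kap * b) f -> hn1 U1 B n f <= p1 k f.
  move=> bB; have [m hm] := Bm_small bB; exists (maxn m n) => f hf.
  apply: (Sb_mono hb0 hb1 hN1 cU1 (Bm0 _)); first by apply: hf; exact: Bm_gt.
    by apply: hm; exact: leq_maxl.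
  exact: leq_maxr.
have dom2 B n : kap * b < B -> exists k, forall f, Sb2 U2 (kap * b) f -> hn2 U2 B n f <= p2 k f.
  move=> bB; have [m hm] := Bm_small bB; exists (maxn m n) => f hf.
  apply: (Sb_mono hb0 hb1 hN2 cU2 (Bm0 _)); first by apply: hf; exact: Bm_gt.
    by apply: hm; exact: leq_maxl.
  exact: leq_maxr.
have absb (c x y z : R) : 0 <= x -> x <= y -> z <= c * x -> z <= `|c| * y.
  move=> x0 xy /le_trans; apply; apply: (@le_trans _ _ (`|c| * x)).
    by apply: ler_wpM2r => //; exact: ler_norm.
  by apply: ler_wpM2l.
have [|||||||k [c [c0 hc]]] := @banach_steinhaus R (cfun R d1) (cfun R d2) (Sb1 U1 (kap * b)) (Sb2 U2 (kap * b))
    p1 p2 S1 _ _ _ _ _ w hw.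
- by move=> k; apply: seminorm_hn => //; exact: Bm_gt.
- by move=> k; apply: seminorm_hn => //; exact: Bm_gt.
- move=> k k' f kk hf; apply: (Sb_mono hb0 hb1 hN1 cU1 (Bm0 _)) => //; last exact: Bm_mono.
  by apply: hf; exact: Bm_gt.
- move=> k k' f kk hf; apply: (Sb_mono hb0 hb1 hN2 cU2 (Bm0 _)) => //; last exact: Bm_mono.
  by apply: hf; exact: Bm_gt.
- move=> F hF hd; have [G hG lim] := Sb_complete hb0 hb1 hN1 cU1 kb0 hF hd.
  by exists G => // k e e0; apply: lim => //; exact: Bm_gt.
- move=> f hf; have [B [n [c [bB hc]]]] := hw1 f hf; have [k hk] := dom2 B n bB.
  exists k, `|c| => g hg; apply: (absb c (hn2 U2 B n g)); [exact: hn_ge0|exact: hk|exact: hc].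
- move=> g hg; have [B [n [c [bB hc]]]] := hw2 g hg; have [k hk] := dom1 B n bB.
  exists k, `|c| => f hf; apply: (absb c (hn1 U1 B n f)); [exact: hn_ge0|exact: hk|exact: hc].
pose Bw := Bm (kap * b) k; have kw : kap * b < Bw by exact: Bm_gt.
pose Bs := (kap * b + Bw) / 2.
have bs : kap * b < Bs by rewrite /Bs; lra.
have sw : Bs < Bw by rewrite /Bs; lra.
have [e he [hres [M2 M20 hM2]]] := good_system hb0 hb1 hN2 cU2 kb0 bs sw (leqnn k.+1).
have [he1 _ _] := he.
have [B [n [K [bB K0 hK]]]] := lam_bessel hb0 hb1 hN1 hN2 hN12 kap1 hkap k.+1 cU1 cU2 b0 bs k kw.
have lamS h j : Sb12 U12 b h -> Sb1 U1 (kap * b) (lam beta N2 U2 Bs k.+1 (e j) h).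
  by move=> hh; have [/(_ j)] := hK e h 0%N he hh.
(* The terms of the series that defines the extension of w. *)
pose s j h := w (lam beta N2 U2 Bs k.+1 (e j) h) (e j).
have sl j : linear_on (Sb12 U12 b) (s j).
  move=> a h h' hh hh'; rewrite /s (lam_lin hb0 hb1 hN1 hN2 hN12 kap1 hkap _ cU1 cU2 b0 bs)//.
  by apply: (proj2 hw) => //; exact: lamS.
have M0 : 0 <= c * (K + M2) by apply: mulr_ge0 => //; exact: addr_ge0.
(* The Bessel bound for the coefficients and the Hilbert-Schmidt bound for the vectors
make both families square summable. *)
have bnd h m : Sb12 U12 b h -> hn12 U12 B n h <= 1 -> \sum_(j < m) nc (s j h) <= c * (K + M2).
  move=> hh h1; pose A j := p1 k (lam beta N2 U2 Bs k.+1 (e j) h); pose D j := p2 k (e j).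
  apply: (@le_trans _ _ (\sum_(j < m) c * (A j ^+ 2 + D j ^+ 2))).
    apply: ler_sum => j _; apply: (le_trans (hc _ _ (lamS h j hh) (he1 j))).
    rewrite mulrCA; apply: ler_wpM2l => //.
    have A0 : 0 <= A j by exact: hn_ge0.
    have D0 : 0 <= D j by exact: hn_ge0.
    rewrite -/(A j) -/(D j); have := sqr_ge0 (A j - D j); rewrite sqrrB.
    have := sqr_ge0 (A j + D j); rewrite sqrrD; nra.
  rewrite -mulr_sumr big_split /=; apply: ler_wpM2l => //; apply: lerD; last exact: hM2.
  have [_ hS] := hK e h m he hh; apply: (le_trans hS).
  rewrite -[leRHS]mulr1; apply: ler_wpM2l => //.
  by rewrite -(expr1n _ 2); apply: sqr_le; [exact: hn_ge0|].
have sn12 : seminorm (Sb12 U12 b) (hn12 U12 B n) by apply: seminorm_hn => //; exact: cone_prod_cone.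
have [l ll [lb lim]] := series_functional S12 sn12 sl M0 (fun h m hh h1 => bnd h m hh h1).
exists l => //; split.
  by exists B, n, (c * (K + M2)); split => // h hh; rewrite mulrC; exact: lb.
move=> f g hf hg hfg; apply/eqP; rewrite -subr_eq0; apply/eqP/nc_small => eps eps0.
have wlin := proj1 hw f hf.
have part m : \sum_(j < m) s j (tensor f g) = w f (oproj (ip beta N2 U2 Bs k.+1) e m g).
  rewrite /oproj (@linear_on_sum _ _ _ (w f) m (fun j => ip beta N2 U2 Bs k.+1 (e j) g *: e j) S2 wlin); last first.
    by move=> j; exact: (linsubZ _ S2 (he1 j)).
  apply: eq_bigr => j _; rewrite /s (lam_tensor hN2 _ cU2 bs)//.
  rewrite (linear_onZ _ S1 (proj2 hw (e j) (he1 j)) hf).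
  by rewrite (linear_onZ _ S2 wlin (he1 j)).
have i_lin : forall f, Sb2 U2 (kap * b) f -> linear_on (Sb2 U2 (kap * b)) (ip beta N2 U2 Bs k.+1 f).
  by move=> f0; exact: (ip2_lin hN2 _ cU2 bs).
have i_conj f0 g0 : Sb2 U2 (kap * b) f0 -> Sb2 U2 (kap * b) g0 ->
  ip beta N2 U2 Bs k.+1 g0 f0 = conjc (ip beta N2 U2 Bs k.+1 f0 g0).
  exact: (ip2_conj hN2 _ cU2 bs).
have i_diag := @ip2_diag _ _ beta N2 kap U2 b Bs k.+1 bs.
pose P1 := p1 k f; pose S := hn2 U2 Bs k.+1 g.
have P10 : 0 <= P1 by exact: hn_ge0.
have Sg0 : 0 <= S by exact: hn_ge0.
have est m : nc (w f g - w f (oproj (ip beta N2 U2 Bs k.+1) e m g)) <= p2 k (e m) * (2 * P1 * c * S).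
  have Ep : Sb2 U2 (kap * b) (oproj (ip beta N2 U2 Bs k.+1) e m g) by exact: (E_proj S2 he).
  have Er : Sb2 U2 (kap * b) (g - oproj (ip beta N2 U2 Bs k.+1) e m g) by exact: (linsubB S2 hg Ep).
  rewrite -(linear_onB S2 wlin hg Ep); apply: (le_trans (hc _ _ hf Er)).
  have r1 := hres m _ Er (fun j jm => ip_residual S2 i_lin i_conj i_diag he hg jm).
  have r2 : hn2 U2 Bs k.+1 (g - oproj (ip beta N2 U2 Bs k.+1) e m g) <= S.
    apply: (@sn_residual _ _ _ _ _ S2 i_lin i_conj i_diag _ _ he m g hg).
    by apply: seminorm_hn.
  have D0 : 0 <= p2 k (e m) by exact: hn_ge0.
  apply: (@le_trans _ _ (P1 * (c * (2 * p2 k (e m) * S)))).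
    have D2 : 0 <= 2 * p2 k (e m) by apply: mulr_ge0.
    exact: (ler_wpM2l P10 (ler_wpM2l c0 (le_trans r1 (ler_wpM2l D2 r2)))).
  rewrite le_eqVlt; apply/orP; left; apply/eqP; ring.
have e2 : 0 < eps / 2 by rewrite divr_gt0.
have [n0 hn0] := lim _ _ hfg e2.
pose Q := 2 * P1 * c * S; have Q0 : 0 <= Q by rewrite /Q; do 3 ! apply: mulr_ge0 => //.
have d0 : 0 < eps / 2 / (Q + 1) by rewrite divr_gt0// ltr_wpDl.
have [m mn0 hm] := @summable_small R (fun j => p2 k (e j)) M2 _ n0 hM2 (fun j => hn_ge0 _ _ _ _ _ _) d0.
have := hn0 m mn0; rewrite part => h1.
have h2 : nc (w f g - w f (oproj (ip beta N2 U2 Bs k.+1) e m g)) <= eps / 2.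
  apply: (le_trans (est m)); rewrite -/Q; apply: (@le_trans _ _ (eps / 2 / (Q + 1) * Q)).
    by apply: ler_wpM2r.
  rewrite mulrAC ler_pdivrMr ?ltr_wpDl//; apply: ler_wpM2l; first exact: ltW.
  by rewrite lerDl.
set X := w f (oproj _ _ _ _) in h1 h2.
have -> : l (tensor f g) - w f g = - (X - l (tensor f g)) - (w f g - X) by ring.
apply: (le_trans (ncB _ _)); rewrite ncN; move: h1 h2; lra.
Qed.

(** The partial sums of the expansion of the slices are finite sums of tensors, on which
the functional vanishes, and they converge in its norm. *)
Theorem local_uniqueness (v : cfun R (d1 + d2) -> C) B3 n3 (c3 : R) :
  linear_on (Sb12 U12 (kap * (kap * b))) v -> kap * (kap * b) < B3 ->
  (forall h, Sb12 U12 (kap * (kap * b)) h -> nc (v h) <= c3 * hn12 U12 B3 n3 h) ->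
  (forall f g, Sb1 U1 (kap * b) f -> Sb2 U2 (kap * b) g -> v (tensor f g) = 0) ->
  forall h, Sb12 U12 b h -> v h = 0.
Proof.
move=> lv b3 hv vt h hh.
have cU12 : cone U12 by exact: cone_prod_cone.
have S2 : linsub (Sb2 U2 (kap * b)) by exact: linsub_Sb.
have S12 : linsub (Sb12 U12 (kap * (kap * b))) by exact: linsub_Sb.
have kkb : b <= kap * (kap * b).
  have h1 : b <= kap * b by rewrite ler_peMl// ltW.
  by apply: (le_trans h1); rewrite ler_peMl// ltW.
have hh' : Sb12 U12 (kap * (kap * b)) h by apply: Sb_le hh.
pose Bp := B3 / kap.
have kp : kap * b < Bp by rewrite ltr_pdivlMr// mulrC.
have kBp : kap * Bp = B3 by rewrite /Bp mulrC divfK// gt_eqF.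
pose Bw := (kap * b + Bp) / 2.
have kw : kap * b < Bw by rewrite /Bw; lra.
have wp : Bw < Bp by rewrite /Bw; lra.
pose Bs := (kap * b + Bw) / 2.
have bs : kap * b < Bs by rewrite /Bs; lra.
have sw : Bs < Bw by rewrite /Bs; lra.
have Bw0 : 0 < Bw by apply: lt_trans kw.
have Bp0 : 0 < Bp by apply: lt_trans wp.
have [e he [hres [M2 M20 hM2]]] := good_system hb0 hb1 hN2 cU2 kb0 bs sw (leqnn n3.+2).
have [he1 _ _] := he.
have [L L0 hL] := H_point hb0 hb1 hN2 Bw0 wp (leqnn n3.+1).
have [B [n [K [bB K0 hK]]]] := slice_norm hb0 hb1 hN1 hN2 hN12 kap1 hkap n3 n3.+2 b0 kp bs.
have [B4 [n4 [K4 [bB4 K40 hK4]]]] := lam_bessel hb0 hb1 hN1 hN2 hN12 kap1 hkap n3.+2 cU1 cU2 b0 bs n3 kp.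
have lamS j : Sb1 U1 (kap * b) (lam beta N2 U2 Bs n3.+2 (e j) h).
  by have [/(_ j)] := hK4 e h 0%N he hh.
have i_lin : forall f, Sb2 U2 (kap * b) f -> linear_on (Sb2 U2 (kap * b)) (ip beta N2 U2 Bs n3.+2 f).
  by move=> f0; exact: (ip2_lin hN2 _ cU2 bs).
have i_conj f0 g0 : Sb2 U2 (kap * b) f0 -> Sb2 U2 (kap * b) g0 ->
  ip beta N2 U2 Bs n3.+2 g0 f0 = conjc (ip beta N2 U2 Bs n3.+2 f0 g0).
  exact: (ip2_conj hN2 _ cU2 bs).
have i_diag := @ip2_diag _ _ beta N2 kap U2 b Bs n3.+2 bs.
pose tn j := tensor (lam beta N2 U2 Bs n3.+2 (e j) h) (e j).
have tS j : Sb12 U12 (kap * (kap * b)) (tn j) by apply: (tensor_Sb hb0 hb1 hN1 hN2 hN12 kap1 hkap cU1 cU2 kb0).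
pose T m : cfun R (d1 + d2) := \sum_(j < m) tn j.
have TS m : Sb12 U12 (kap * (kap * b)) (T m) by apply: (@linsub_sum _ _ _ tn m S12) => j _.
have vT m : v (T m) = 0.
  by rewrite (linear_on_sum _ S12 lv tS) big1// => j _; exact: vt.
pose u j := hn2 U2 Bw n3.+1 (e j).
have u0 j : 0 <= u j by exact: hn_ge0.
pose A := 4 * L * K * hn12 U12 B n h ^+ 2.
have A0 : 0 <= A.
  by rewrite /A; apply: mulr_ge0; [apply: mulr_ge0 => //; apply: mulr_ge0 => //; exact: ltW|exact: sqr_ge0].
have dens m t : nc ((h - T m) (pt t)) ^+ 2 * wt12 U12 B3 n3 t <= A * u m ^+ 2 * pdec t.
  have [t1 [t2 ->]] := pcat_surj t; rewrite pt_pcat pdec_pcat.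
  pose g := slice h (pt t1).
  have hg : Sb2 U2 (kap * b) g by apply: (slice_Sb hb0 hb1 hN1 hN2 hN12 kap1 hkap (pt t1) cU1 cU2 b0 hh).
  have E : (h - T m) (row_mx (pt t1) (pt t2)) = (g - oproj (ip beta N2 U2 Bs n3.+2) e m g) (pt t2).
    rewrite /T /oproj; congr (_ - _); rewrite !fct_sumE; apply: eq_bigr => j _.
    by rewrite /tn tensorE.
  rewrite E; set r := g - _.
  have hr : Sb2 U2 (kap * b) r by exact: (linsubB S2 hg (E_proj S2 he _ _)).
  have [w12 _] := hkap n3 t1 t2 cU1 cU2 Bp0; rewrite kBp in w12.
  apply: (le_trans (ler_wpM2l (sqr_ge0 _) w12)).
  have r1 := hres m _ hr (fun j jm => ip_residual S2 i_lin i_conj i_diag he hg jm).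
  have r2 : hn2 U2 Bs n3.+2 r <= hn2 U2 Bs n3.+2 g.
    apply: (@sn_residual _ _ _ _ _ S2 i_lin i_conj i_diag _ _ he m g hg).
    by apply: seminorm_hn.
  have r3 : hn2 U2 Bw n3.+1 r ^+ 2 <= 4 * u m ^+ 2 * hn2 U2 Bs n3.+2 g ^+ 2.
    have -> : 4 * u m ^+ 2 * hn2 U2 Bs n3.+2 g ^+ 2 = (2 * u m * hn2 U2 Bs n3.+2 g) ^+ 2 by ring.
    apply: sqr_le; first exact: hn_ge0.
    have u2 : 0 <= 2 * u m by apply: mulr_ge0; [|exact: u0].
    exact: (le_trans r1 (ler_wpM2l u2 r2)).
  have q1 := hL U2 r t2 cU2 (hr Bw n3.+1 kw).
  have [_ q2] := hK U1 U2 h t1 cU1 cU2 (hh B n bB).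
  have w10 := wt_ge0 beta N1 U1 Bp n3 t1.
  have p10 := ltW (pdec_gt0 t1); have p20 := ltW (pdec_gt0 t2).
  rewrite mulrCA; apply: (@le_trans _ _ (wt1 U1 Bp n3 t1 * (L * (4 * u m ^+ 2 * hn2 U2 Bs n3.+2 g ^+ 2) * pdec t2))).
    apply: ler_wpM2l => //; apply: (le_trans q1); apply: ler_wpM2r => //.
    by apply: ler_wpM2l => //; exact: ltW.
  have -> : wt1 U1 Bp n3 t1 * (L * (4 * u m ^+ 2 * hn2 U2 Bs n3.+2 g ^+ 2) * pdec t2) =
     (4 * L * u m ^+ 2 * pdec t2) * (hn2 U2 Bs n3.+2 g ^+ 2 * wt1 U1 Bp n3 t1) by ring.
  have -> : A * u m ^+ 2 * (pdec t1 * pdec t2) =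
     (4 * L * u m ^+ 2 * pdec t2) * (K * hn12 U12 B n h ^+ 2 * pdec t1) by rewrite /A; ring.
  apply: (ler_wpM2l _ q2).
  by apply: mulr_ge0; [apply: mulr_ge0; [apply: mulr_ge0; [by []|exact: ltW]|exact: sqr_ge0]|exact: p20].
pose Q := Num.sqrt (A * @pmass R (d1 + d2)).
have Am : 0 <= A * @pmass R (d1 + d2) by apply: mulr_ge0 => //; exact: pmass_ge0.
have vb m : nc (v h) <= `|c3| * Q * u m.
  have hS : Sb12 U12 (kap * (kap * b)) (h - T m) by exact: (linsubB S12 hh' (TS m)).
  have -> : v h = v (h - T m) by rewrite (linear_onB S12 lv)// vT subr0.
  have Au : 0 <= A * u m ^+ 2 by apply: mulr_ge0 => //; exact: sqr_ge0.
  have [_ q] := HE_dens hN12 cU12 (Sb_entire hS) Au (dens m).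
  have {}q : hn12 U12 B3 n3 (h - T m) <= Q * u m.
    apply: le_sqr; first by apply: mulr_ge0 => //; exact: sqrtr_ge0.
    by apply: (le_trans q); rewrite [leRHS]exprMn /Q (sqr_sqrtr Am) [leLHS]mulrAC.
  apply: (le_trans (hv _ hS)); rewrite -mulrA.
  apply: (@le_trans _ _ (`|c3| * hn12 U12 B3 n3 (h - T m))).
    by apply: ler_wpM2r; [exact: hn_ge0|exact: ler_norm].
  by apply: ler_wpM2l.
apply: nc_small => eps eps0.
have X0 : 0 <= `|c3| * Q by apply: mulr_ge0 => //; exact: sqrtr_ge0.
have d0 : 0 < eps / (`|c3| * Q + 1) by rewrite divr_gt0// ltr_wpDl.
have [m _ hm] := @summable_small R u M2 _ 0%N hM2 u0 d0.
apply: (le_trans (vb m)); apply: (le_trans (ler_wpM2l X0 hm)).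
have X1 : 0 < `|c3| * Q + 1 by rewrite ltr_wpDl.
rewrite mulrA ler_pdivrMr// mulrC; apply: ler_wpM2l; first exact: ltW.
by rewrite lerDl.
Qed.

End Pair.
End LocalKernel.

(** * Projective and inductive limit topologies *)

Section Topologies.
Context {V : Type}.
Implicit Types (E : set V) (T S : set (set V)) (X : tspace V) (F : set (tspace V)).

Lemma powerset_topology E : is_topology E [set A | A `<=` E].
Proof.
split => //=; first by move=> A B AE _ x [/AE].
by move=> F hF x [A FA Ax]; exact: hF FA _ Ax.
Qed.

Lemma generated_is_topology E S : S `<=` [set A | A `<=` E] -> is_topology E (generated_topology E S).
Proof.
move=> SE; split.
- by move=> A; apply => //; exact: powerset_topology.
- by move=> T [].
- by move=> A B hA hB T hT ST; have [_ _ h _] := hT; apply: h; [exact: hA|exact: hB].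
- move=> F hF T hT ST; have [_ _ _ h] := hT; apply: h => A FA; exact: hF.
Qed.

Lemma trace_topology E F : (forall X, F X -> is_topology (car X) (opens X)) -> (forall X, F X -> car X `<=` E) ->
  is_topology E [set A | A `<=` E /\ forall X, F X -> opens X (A `&` car X)].
Proof.
move=> hF FE; split.
- by move=> A [].
- split => // X FX; rewrite setIidr; last exact: FE.
  by have [_ h _ _] := hF X FX.
- move=> A B [AE hA] [BE hB]; split=> [x [/AE]//|X FX].
  rewrite (_ : A `&` B `&` car X = (A `&` car X) `&` (B `&` car X)).
    by have [_ _ h _] := hF X FX; apply: h; [exact: hA|exact: hB].
  by apply/seteqP; split=> x /=; tauto.
- move=> G hG; split=> [x [A GA Ax]|X FX]; first by have [+ _] := hG A GA; apply.
  have [_ _ _ h] := hF X FX.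
  rewrite (_ : \bigcup_(A in G) A `&` car X = \bigcup_(A in [set B `&` car X | B in G]) A).
    by apply: h => _ [B GB <-]; have [_] := hG B GB; apply.
  apply/seteqP; split=> [x [[A GA Ax] Xx]|x [_ [A GA <-] [Ax Xx]]].
    by exists (A `&` car X) => //; exists A.
  by split => //; exists A.
Qed.

Lemma projlim_topology E F : is_topology E (opens (projlim E F)).
Proof. by apply: generated_is_topology => _ [A _ <-] x []. Qed.

End Topologies.

Section InductiveLimits.
Context {R : realType} {V : lmodType R[i]}.
Notation C := R[i].
Implicit Types (E : set V) (X : tspace V) (F : set (tspace V)) (v : V -> C).

Lemma indlim_topology E F : is_topology E (opens (indlim E F)).
Proof.
apply: generated_is_topology => A [T [[hT _ _ _] _] TA].
by have [h _ _ _] := hT; exact: h.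
Qed.

Lemma indlim_trace E F A X : (forall X, F X -> is_topology (car X) (opens X)) ->
  (forall X, F X -> car X `<=` E) -> F X -> opens (indlim E F) A -> opens X (A `&` car X).
Proof.
move=> hF FE FX hA; have := hA _ (trace_topology hF FE) => -[]; last by move=> _; apply.
move=> B [T [[hT _ _ _] cont] TB]; split; first by have [h _ _ _] := hT; exact: h.
by move=> Y FY; have [_ h] := cont Y FY; exact: h.
Qed.

Lemma continuous_indlim_sub E F X v : (forall X, F X -> is_topology (car X) (opens X)) ->
  (forall X, F X -> car X `<=` E) -> F X -> continuous_on (indlim E F) v -> continuous_on X v.
Proof.
move=> hF FE FX hv O oO; have := indlim_trace hF FE FX (hv O oO) => /=.
by rewrite -setIA (setIidr (FE X FX)).
Qed.

Lemma openC_ball (O : set C) (z : C) : open (O : set C^o) -> O z ->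
  exists2 r : R, 0 < r & forall y, nc (y - z) <= r -> O y.
Proof.
move=> oO Oz; apply/nbhsC_le; exact: open_nbhs_nbhs.
Qed.

Lemma open_ncball (c : C) (r : R) : open ([set z | nc (z - c) < r] : set C^o).
Proof.
rewrite openE => z /= hz; apply/nbhsC_le.
exists ((r - nc (z - c)) / 2); first by rewrite divr_gt0// subr_gt0.
move=> y hy /=; have -> : y - c = (y - z) + (z - c) by ring.
by apply: (le_lt_trans (ncD _ _)); move: hz hy; lra.
Qed.

(** The initial topology of [v]. *)
Definition preopens E v : set (set V) := [set A | exists2 O : set C, open (O : set C^o) & A = v @^-1` O `&` E].

Lemma preopens_lc E v : linsub E -> linear_on E v -> is_lc_topology E (preopens E v).
Proof.
move=> hE lv; split.
- split.
  + by move=> _ [Q _ ->] x [].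
  + by exists setT; [exact: openT|rewrite preimage_setT setTI].
  + move=> _ _ [Q oO ->] [P oP ->]; exists (Q `&` P); first exact: openI.
    by apply/seteqP; split=> x /=; tauto.
  + move=> F hF; exists (\bigcup_(Q in [set Q | open (Q : set C^o) /\ F (v @^-1` Q `&` E)]) Q).
      by apply: bigcup_open => Q [].
    apply/seteqP; split=> [x [A FA Ax]|x [[Q [oO FO] Ox] Ex]].
      have [Q oO AE] := hF A FA; move: Ax; rewrite AE => -[Ox Ex]; split => //.
      by exists Q => //; split => //; rewrite -AE.
    by exists (v @^-1` Q `&` E).
- move=> _ f g [Q oO ->] Ef Eg [/= Ofg _].
  have [r r0 hr] := openC_ball oO Ofg; have r2 : 0 < r / 2 by rewrite divr_gt0.
  exists (v @^-1` [set z | nc (z - v f) < r / 2] `&` E), (v @^-1` [set z | nc (z - v g) < r / 2] `&` E).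
  split.
  + by exists [set z | nc (z - v f) < r / 2] => //; exact: open_ncball.
  + by exists [set z | nc (z - v g) < r / 2] => //; exact: open_ncball.
  + by split => //=; rewrite subrr nc0.
  + by split => //=; rewrite subrr nc0.
  + move=> u u' [/= hu Eu] [/= hu' Eu']; split => /=; last exact: linsubD.
    apply: hr; rewrite !(linear_onD lv)//.
    have -> : v u + v u' - (v f + v g) = (v u - v f) + (v u' - v g) by ring.
    by apply: (le_trans (ncD _ _)); move: hu hu'; lra.
- move=> _ a f [Q oO ->] Ef [/= Oaf _].
  have [r r0 hr] := openC_ball oO Oaf.
  pose M := nc a + nc (v f) + 1 + r.
  have M0 : 0 < M by have := nc_ge0 a; have := nc_ge0 (v f); rewrite /M; lra.
  pose dl := Num.min 1 (r / (2 * M)).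
  have dl0 : 0 < dl by rewrite lt_min ltr01 divr_gt0// mulr_gt0.
  have dl1 : dl <= 1 by rewrite ge_min lexx.
  have dlr : dl * (2 * M) <= r.
    by rewrite -ler_pdivlMr ?mulr_gt0// ge_min lexx orbT.
  exists dl%:C, (v @^-1` [set z | nc (z - v f) < dl] `&` E); split.
  + by rewrite ltcR.
  + by exists [set z | nc (z - v f) < dl] => //; exact: open_ncball.
  + by split => //=; rewrite subrr nc0.
  + move=> b u hb [/= hu Eu]; split => /=; last exact: linsubZ.
    move: hb; rewrite ncE ltcR => hb.
    apply: hr; rewrite !(linear_onZ _ hE lv)//.
    have -> : b * v u - a * v f = (b - a) * v f + a * (v u - v f) + (b - a) * (v u - v f) by ring.
    apply: (le_trans (ncD _ _)); apply: (le_trans (lerD (ncD _ _) (lexx _))); rewrite !ncM.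
    have := nc_ge0 a; have := nc_ge0 (v f); have := nc_ge0 (b - a); have := nc_ge0 (v u - v f).
    move: hb hu dlr dl0 dl1 r0; rewrite /M; move: (nc (b - a)) (nc (v u - v f)) (nc a) (nc (v f)) => x y A F.
    nra.
- move=> _ f [Q oO ->] [/= Of Ef].
  have [r r0 hr] := openC_ball oO Of.
  exists (v @^-1` [set z | nc (z - v f) < r] `&` E); split.
  + by exists [set z | nc (z - v f) < r] => //; exact: open_ncball.
  + by split => //=; rewrite subrr nc0.
  + by move=> u [/= hu Eu]; split => //=; apply: hr; exact: ltW.
  + move=> x y l /set_mem[/= hx Ex] /set_mem[/= hy Ey]; apply/mem_set.
    pose s := Re (l%:num : C).
    have sE : (l%:num : C) = s%:C by rewrite RRe_real// ger0_real.
    have s0 : 0 <= s by have : 0 <= (l%:num : C) by []; rewrite sE lecR.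
    have s1 : s <= 1 by have : (l%:num : C) <= 1 by []; rewrite sE lecR.
    rewrite (_ : conv l x y = (l%:num : C) *: (x : V) + (1 - (l%:num : C)) *: (y : V)); last by [].
    have Exy : E ((l%:num : C) *: (x : V) + (1 - (l%:num : C)) *: (y : V)).
      by apply: linsubD => //; exact: linsubZ.
    split => //=; rewrite (linear_onD lv); try exact: linsubZ.
    rewrite !(linear_onZ _ hE lv)// sE.
    have -> : s%:C * v x + (1 - s%:C) * v y - v f = s%:C * (v x - v f) + (1 - s)%:C * (v y - v f).
      by rewrite rmorphB /=; ring.
    apply: (le_lt_trans (ncD _ _)); rewrite !ncM !ncR ger0_norm// ger0_norm ?subr_ge0//.
    have [s00|sp] := eqVneq s 0; first by rewrite s00 mul0r add0r subr0 mul1r.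
    have sp' : 0 < s by rewrite lt_neqAle eq_sym sp.
    move: hx hy s1 sp'; move: (nc _) (nc _) => A B; nra.
Qed.

(** The initial topology of a linear form is locally convex, hence coarser than the
topology of the inductive limit when the restrictions are continuous. *)
Lemma continuous_indlim E F v : linsub E -> linear_on E v -> (forall X, F X -> car X `<=` E) ->
  (forall X, F X -> continuous_on X v) -> continuous_on (indlim E F) v.
Proof.
move=> hE lv FE hv Q oO T hT; apply; exists (preopens E v); last by exists Q.
split; first exact: preopens_lc.
move=> X FX; split; first exact: FE.
move=> _ /= [P oP ->]; rewrite -setIA (setIidr (FE X FX)).
exact: hv.
Qed.

Lemma linsub_linspan (A : set V) : linsub (linspan A).
Proof.
split; first by exists 0%N, (fun=> 0), (fun=> 0); split; [case|rewrite big_ord0].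
move=> a _ _ [n [c [f [hf ->]]]] [m [e [g [hg ->]]]].
exists (n + m)%N, (fun i : 'I_(n + m) => match fintype.split i with inl j => a * c j | inr j => e j end),
  (fun i : 'I_(n + m) => match fintype.split i with inl j => f j | inr j => g j end); split.
  by move=> i; case: (fintype.split i) => j.
rewrite big_split_ord /= scaler_sumr; congr (_ + _); apply: eq_bigr => i _.
  by rewrite (unsplitK (inl i)) scalerA.
by rewrite (unsplitK (inr i)).
Qed.

Lemma sub_linspan (A : set V) : A `<=` linspan A.
Proof.
move=> f Af; exists 1%N, (fun=> 1), (fun=> f); split => //.
by rewrite big_ord_recl big_ord0 addr0 scale1r.
Qed.

End InductiveLimits.

Section FrechetTopology.
Context {R : realType} {d : nat}.
Notation C := R[i].
Variables (beta : R) (N : 'rV[R]_d -> R).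
Hypothesis hb0 : 0 <= beta.
Hypothesis hb1 : beta < 1.
Hypothesis hN : is_norm N.
Implicit Types (U : set 'rV[R]_d) (B : R) (n : nat) (f g : cfun R d).
Local Notation hn := (Hnorm beta N).
Local Notation Sb := (Sb beta N).

Lemma car_Sopen_type U b : car (Sopen_type beta N U b) = Sb U b.
Proof.
rewrite /Sopen_type /projlim /=; apply/seteqP; split=> [f hf B n bB|f hf X [B [n [bB ->]]]].
  by apply: (hf (Hspace beta N U B n)); exists B, n.
exact: hf.
Qed.

Lemma Sopen_type_topology U b : is_topology (Sb U b) (opens (Sopen_type beta N U b)).
Proof. by rewrite -car_Sopen_type; exact: projlim_topology. Qed.

Lemma Sopen_type_nbhs U b A f : cone U -> 0 < b -> opens (Sopen_type beta N U b) A -> A f ->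
  exists B n e, [/\ b < B, 0 < e & forall g, Sb U b g -> hn U B n (g - f) < e -> A g].
Proof.
move=> cU b0 hA Af.
have EE : \bigcap_(X in [set X | exists B n, b < B /\ X = Hspace beta N U B n]) car X = Sb U b.
  exact: car_Sopen_type.
move: hA; rewrite /Sopen_type /= EE => hA.
pose T := [set A : set (cfun R d) | A `<=` Sb U b /\ forall f, A f ->
   exists B n e, [/\ b < B, 0 < e & forall g, Sb U b g -> hn U B n (g - f) < e -> A g]].
suff [_ h] : T A by exact: h.
apply: hA; last first.
  move=> _ [D [X [B [n [bB ->]]] [/= DE hD]] <-].
  split=> [x []//|u [Du Su]].
  have [e e0 he] := hD u Du; exists B, n, e; split => // g Sg hg; split => //.
  by apply: he hg; exact: (Sg B n bB).
split.
- by move=> D [].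
- split => // u Su; exists (b + 1), 0%N, 1; split => //; by rewrite ltrDl.
- move=> D D' [DE hD] [D'E hD']; split=> [x [/DE]//|u [Du D'u]].
  have [B [n [e [bB e0 he]]]] := hD u Du; have [B' [n' [e' [bB' e'0 he']]]] := hD' u D'u.
  pose B2 := Num.min B B'; pose n2 := maxn n n'; pose e2 := Num.min e e'.
  have bB2 : b < B2 by rewrite lt_min bB.
  have B20 : 0 < B2 by apply: lt_trans bB2.
  exists B2, n2, e2; split => //; first by rewrite lt_min e0.
  move=> g Sg; rewrite lt_min => /andP[ge ge'].
  have Sgu : HE beta N U B2 n2 (g - u) by apply: (SbB hN cU Sg (DE u Du)).
  have h1 : hn U B n (g - u) <= hn U B2 n2 (g - u).
    by apply: (Sb_mono hb0 hb1 hN cU B20 Sgu); [rewrite ge_min lexx|exact: leq_maxl].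
  have h2 : hn U B' n' (g - u) <= hn U B2 n2 (g - u).
    by apply: (Sb_mono hb0 hb1 hN cU B20 Sgu); [rewrite ge_min lexx orbT|exact: leq_maxr].
  by split; [exact: (he g Sg (le_lt_trans h1 ge))|exact: (he' g Sg (le_lt_trans h2 ge'))].
- move=> G hG; split=> [x [D GD Dx]|u [D GD Du]]; first by have [+ _] := hG D GD; apply.
  have [_ /(_ u Du)[B [n [e [bB e0 he]]]]] := hG D GD.
  by exists B, n, e; split => // g Sg hg; exists D => //; exact: he.
Qed.

(** A neighbourhood of 0 contains a ball of one of the norms, and a linear form bounded
on a ball is bounded by the norm. *)
Lemma continuous_bounded U b (v : cfun R d -> C) : cone U -> 0 < b -> linear_on (Sb U b) v ->
  continuous_on (Sopen_type beta N U b) v ->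
  exists B n c, b < B /\ forall f, Sb U b f -> nc (v f) <= c * hn U B n f.
Proof.
move=> cU b0 lv hv; have hE := @linsub_Sb _ _ beta N hN U b cU.
have := hv _ (@open_ncball R 0 1); rewrite car_Sopen_type => hO.
have O0 : (v @^-1` [set z | nc (z - 0) < 1] `&` Sb U b) 0.
  split; last by case: hE.
  by rewrite /= (linear_on0 hE lv) subrr nc0.
have [B [n [e [bB e0 he]]]] := Sopen_type_nbhs cU b0 hO O0.
exists B, n, (1 / (e / 2)); split => // f hf; rewrite mulrC.
have e2 : 0 < e / 2 by rewrite divr_gt0.
have ball g : Sb U b g -> hn U B n g <= e / 2 -> nc (v g) <= 1.
  move=> Sg hg; have [|/= h _] := he g Sg; last by rewrite ltW// -[v g]subr0.
  by rewrite subr0; apply: (le_lt_trans hg); lra.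
have hS : seminorm (Sb U b) (hn U B n) by exact: seminorm_hn.
have H := linear_bound hE hS lv e2 ler01 ball.
exact: (H f hf).
Qed.

Lemma bounded_continuous U b (v : cfun R d -> C) B n c : cone U -> linear_on (Sb U b) v -> b < B ->
  (forall f, Sb U b f -> nc (v f) <= c * hn U B n f) -> continuous_on (Sopen_type beta N U b) v.
Proof.
move=> cU lv bB hv O oO; have hE := @linsub_Sb _ _ beta N hN U b cU.
have [_ _ _] := Sopen_type_topology U b => _.
rewrite car_Sopen_type.
pose D := [set g | HE beta N U B n g /\ exists f e, [/\ Sb U b f, O (v f), 0 < e,
   (forall u, Sb U b u -> hn U B n (u - f) < e -> O (v u)) & hn U B n (g - f) < e]].
have E1 : v @^-1` O `&` Sb U b = D `&` Sb U b.
  apply/seteqP; split=> [f [Of Sf]|f [[Hf [u [e [Su Ou e0 he hu]]]] Sf]]; last by split => //; exact: he.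
  split => //; split; first exact: Sf.
  have [r r0 hr] := openC_ball oO Of.
  have c1 : 0 < `|c| + 1 by rewrite ltr_wpDl.
  exists f, (r / (`|c| + 1)); split => //; first exact: divr_gt0.
    move=> u Su hu; apply: hr; rewrite -(linear_onB hE lv)//.
    apply: (le_trans (hv _ (linsubB hE Su Sf))).
    move: hu; rewrite ltr_pdivlMr// => /ltW; apply: le_trans.
    rewrite mulrC; apply: ler_wpM2l; first exact: hn_ge0.
    by have := ler_norm c; lra.
  by rewrite subrr (HE0 beta N U B n).2 divr_gt0.
rewrite E1 -{1}(car_Sopen_type U b); move=> T hT; apply; exists D => //; exists (Hspace beta N U B n); first by exists B, n.
split=> [x []//|g [Hg [f [e [Sf Of e0 he hg]]]]].
exists (e - hn U B n (g - f)); first by rewrite subr_gt0.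
move=> k Hk hk; split => //; exists f, e; split => //.
have -> : k - f = (k - g) + (g - f) by rewrite addrA subrK.
have h1 : HE beta N U B n (k - g) by have [] := HEB hN cU Hk Hg.
have h2 : HE beta N U B n (g - f) by have [] := HEB hN cU Hg (Sf B n bB).
by apply: (le_lt_trans (HED hN cU h1 h2).2); move: hk; lra.
Qed.

Lemma car_Sopen U f : car (Sopen beta N U) f <-> exists2 b, 0 < b & Sb U b f.
Proof.
split=> [[X [b /= b0 <-]]|[b b0 hf]].
  by rewrite car_Sopen_type => hf; exists b.
by exists (Sopen_type beta N U b); [exists b|rewrite car_Sopen_type].
Qed.

Lemma linsub_Sopen U : cone U -> linsub (car (Sopen beta N U)).
Proof.
move=> cU; split; first by apply/car_Sopen; exists 1; [exact: ltr01|exact: (@Sb0 _ _ beta N U 1)].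
move=> a f g /car_Sopen[b b0 hf] /car_Sopen[b' b'0 hg]; apply/car_Sopen.
exists (Num.max b b'); first by rewrite lt_max b0.
apply: (Sb_lin hN) => //; first by apply: Sb_le hf; rewrite le_max lexx.
by apply: Sb_le hg; rewrite le_max lexx orbT.
Qed.

Lemma Sopen_sub U X : [set Sopen_type beta N U b | b in [set b : R | 0 < b]] X -> car X `<=` car (Sopen beta N U).
Proof. by move=> hX f Xf; exists X. Qed.

Lemma Sopen_fam_topology U X : [set Sopen_type beta N U b | b in [set b : R | 0 < b]] X -> is_topology (car X) (opens X).
Proof. by move=> [b _ <-]; exact: projlim_topology. Qed.

Lemma Sopen_topology U : is_topology (car (Sopen beta N U)) (opens (Sopen beta N U)).
Proof. exact: indlim_topology. Qed.

Lemma Sopen_continuousP U (v : cfun R d -> C) : cone U -> linear_on (car (Sopen beta N U)) v ->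
  continuous_on (Sopen beta N U) v <->
  forall b, 0 < b -> exists B n c, b < B /\ forall f, Sb U b f -> nc (v f) <= c * hn U B n f.
Proof.
move=> cU lv.
have lb b : 0 < b -> linear_on (Sb U b) v.
  by move=> b0 a f g hf hg; apply: lv; apply/car_Sopen; exists b.
split=> [hv b b0|hv].
  apply: continuous_bounded => //; first exact: lb.
  apply: continuous_indlim_sub hv; [exact: Sopen_fam_topology|exact: Sopen_sub|by exists b].
apply: continuous_indlim => //; [exact: linsub_Sopen|exact: Sopen_sub|].
move=> _ [b b0 <-]; have [B [n [c [bB hc]]]] := hv b b0.
exact: (bounded_continuous cU (lb b b0) bB hc).
Qed.

End FrechetTopology.

(** * Gluing over the pairs of cones *)

Section Domination.
Context {R : realType} {d : nat}.
Notation C := R[i].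
Variables (beta : R) (N : 'rV[R]_d -> R).
Hypothesis hb0 : 0 <= beta.
Hypothesis hb1 : beta < 1.
Hypothesis hN : is_norm N.
Implicit Types (U K : set 'rV[R]_d) (f : cfun R d).
Local Notation hn := (Hnorm beta N).
Local Notation Sb := (Sb beta N).

(** [U'] lies in the closure of [U]. Unlike inclusion, this places {0} below every
cone. *)
Definition cdom U' U := forall u, U' u -> forall e : R, 0 < e -> exists2 x, U x & rn (u - x) < e.

Lemma cdom_sub U' U : U' `<=` U -> cdom U' U.
Proof.
move=> UU u Uu e e0; exists u; first exact: UU.
rewrite subrr; apply: le_lt_trans e0; apply: rn_leP => // j; by rewrite mxE normr0.
Qed.

Lemma cdom0 U : cone U -> cdom [set 0] U.
Proof.
move=> [[x Ux] hU] u -> e e0; pose t := e / (rn x + 1).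
have x1 : 0 < rn x + 1 by rewrite ltr_wpDl ?rn_ge0.
have t0 : 0 < t by rewrite divr_gt0.
exists (t *: x); first exact: hU.
rewrite sub0r -scaleNr; apply: (le_lt_trans (rnZ _ _)); rewrite normrN gtr0_norm//.
by rewrite /t mulrAC ltr_pdivrMr// ltr_pM2l// ltrDl.
Qed.

Lemma cdom_dist U' U x : U' !=set0 -> U !=set0 -> cdom U' U -> dist_set N x U <= dist_set N x U'.
Proof.
move=> U'0 U0 hd; have [k k0 hk] := N_upper hN.
apply: dist_leP => // u U'u; apply/ler_addgt0Pr => e e0.
have [y Uy hy] := hd u U'u (e / k) (divr_gt0 e0 k0).
apply: (le_trans (dist_le hN x Uy)).
have -> : x - y = (x - u) + (u - y) by rewrite addrA subrK.
apply: (le_trans (ND hN _ _)); rewrite lerD2l; apply: (le_trans (hk _)).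
by rewrite mulrC -ler_pdivlMr// ltW.
Qed.

Lemma wt_cdom U' U B n t : cone U' -> cone U -> cdom U' U -> wt beta N U' B n t <= wt beta N U B n t.
Proof.
move=> cU' cU hd; rewrite !wtE; apply: ler_wpM2l; first exact/ltW/polyw_gt0.
rewrite ler_expR.
have p0 : 0 <= (1 - beta)^-1 by rewrite invr_ge0 subr_ge0 ltW.
have := cdom_dist (B *: real_point t.1) (proj1 cU') (proj1 cU) hd => h.
have := powR_mono p0 (dist_ge0 hN _ (proj1 cU)) h; lra.
Qed.

Lemma Sb_cdom U' U b f : cone U' -> cone U -> cdom U' U -> Sb U b f -> Sb U' b f.
Proof.
move=> cU' cU hd hf B n bB.
by have [] := HE_mono hN cU cU' (fun t => wt_cdom B n t cU' cU hd) (hf B n bB).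
Qed.

Lemma hn_cdom U' U b B n f : cone U' -> cone U -> cdom U' U -> b < B -> Sb U b f -> hn U' B n f <= hn U B n f.
Proof.
move=> cU' cU hd bB hf.
by have [] := HE_mono hN cU cU' (fun t => wt_cdom B n t cU' cU hd) (hf B n bB).
Qed.

(** For a nondegenerate cone its open neighbouring cones, and for the degenerate cone
only itself: in this way either family is directed downwards. *)
Definition admissible K U := (K = [set 0] /\ U = [set 0]) \/
  (K <> [set 0] /\ open_cone U /\ cone_compact_in K U).

Lemma cone0 : cone ([set 0] : set 'rV[R]_d).
Proof. by split; [exists 0|move=> t x _ ->; rewrite scaler0]. Qed.

Lemma admissible_cone K U : admissible K U -> cone U.
Proof. by move=> [[_ ->]|[_ [[cU _] _]]] //; exact: cone0. Qed.

Lemma admissible_ex K : exists U, admissible K U.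
Proof.
have [K0|K0] := pselect (K = [set 0]); first by exists [set 0]; left.
exists setT; right; split => //; split; last by [].
by split; [split; [exists 0|]|exact: openT].
Qed.

Lemma admissible_inter K U U' : closed_cone K -> admissible K U -> admissible K U' ->
  exists2 U'', admissible K U'' & cdom U'' U /\ cdom U'' U'.
Proof.
move=> [[Kn _] Kcl] [[K0 ->]|[K0 [[cU oU] hU]]] [[K0' ->]|[K0' [[cU' oU'] hU']]] //.
  by exists [set 0]; [left|split; exact: cdom_sub].
exists (U `&` U'); last by split; apply: cdom_sub => x [].
right; split => //; split; last by move=> x Kx; split; [exact: hU|exact: hU'].
split; last exact: openI.
split; last first.
  by move=> t x t0 [Ux U'x]; split; [case: cU => _; apply|case: cU' => _; apply].
have [x [Kx x0]] : exists x, K x /\ x <> 0.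
  apply: contrapT => h; apply: K0; apply/seteqP; split=> [x Kx|x ->].
    by apply: contrapT => x0; apply: h; exists x.
  have [k Kk] := Kn; have [k0|k0] := pselect (k = 0); first by rewrite -k0.
  by exfalso; apply: h; exists k.
exists x; split; [apply: hU|apply: hU']; split => //; exact: subset_closure.
Qed.

Lemma open_admissible K U : open_cone U -> cone_compact_in K U ->
  exists2 U', admissible K U' & cdom U' U.
Proof.
move=> oU hU; have [K0|K0] := pselect (K = [set 0]).
  by exists [set 0]; [left|apply: cdom0; case: oU].
by exists U; [right|exact: cdom_sub].
Qed.

Lemma car_Scone K f : car (Scone beta N K) f <-> exists U b, [/\ admissible K U, 0 < b & Sb U b f].
Proof.
rewrite /Scone; case: pselect => K0.
  rewrite car_Sopen; split=> [[b b0 hf]|[U [b [[[_ ->]|[]//] b0 hf]]]]; last by exists b.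
  by exists [set 0], b; split => //; left.
split=> [[X [U [oU hU] <-]] /car_Sopen[b b0 hf]|[U [b [[[]//|[_ [oU hU]]] b0 hf]]]].
  by exists U, b; split => //; right.
by exists (Sopen beta N U); [exists U|apply/car_Sopen; exists b].
Qed.

Lemma Scone_open K U b f : open_cone U -> cone_compact_in K U -> 0 < b -> Sb U b f -> car (Scone beta N K) f.
Proof.
move=> oU hU b0 hf; apply/car_Scone; have [U' aU' hd] := open_admissible oU hU.
have cU : cone U by case: oU.
exists U', b; split; [exact: aU'|exact: b0|].
exact: (Sb_cdom (admissible_cone aU') cU hd hf).
Qed.

Lemma Scone_bounded K U b (v : cfun R d -> C) : linear_on (car (Scone beta N K)) v ->
  continuous_on (Scone beta N K) v -> admissible K U -> 0 < b ->
  exists B n c, b < B /\ forall f, Sb U b f -> nc (v f) <= c * hn U B n f.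
Proof.
move=> lv hv aU b0; have cU := admissible_cone aU.
have sub f : car (Sopen beta N U) f -> car (Scone beta N K) f.
  by move=> /car_Sopen[b' b'0 hf]; apply/car_Scone; exists U, b'.
have lU : linear_on (car (Sopen beta N U)) v by move=> a f g hf hg; apply: lv; exact: sub.
have := Sopen_continuousP hb0 hb1 hN cU lU => -[H _]; apply: H => //.
move: hv; rewrite /Scone; case: pselect => K0.
  by case: aU => [[_ UE] hv|[nK _]]; [rewrite UE; exact: hv|case: nK].
case: aU => [[]//|[_ [oU hU]]].
apply: continuous_indlim_sub.
- by move=> X [U' _ <-]; exact: Sopen_topology.
- by move=> X hX f Xf; exists X.
- by exists U.
Qed.

End Domination.

Section ProductDomination.
Context {R : realType} {d1 d2 : nat}.

Lemma cdom_prod (U1' U1 : set 'rV[R]_d1) (U2' U2 : set 'rV[R]_d2) : cdom U1' U1 -> cdom U2' U2 -> cdom (cone_prod U1' U2') (cone_prod U1 U2).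
Proof.
move=> h1 h2 u [u1 u2] e e0.
have [x1 Ux1 hx1] := h1 _ u1 e e0; have [x2 Ux2 hx2] := h2 _ u2 e e0.
exists (row_mx x1 x2); first by rewrite /cone_prod /= row_mxKl row_mxKr.
rewrite -(hsubmxK u) opp_row_mx add_row_mx.
apply: (@le_lt_trans _ _ (Num.max (rn (lsubmx u - x1)) (rn (rsubmx u - x2)))); last by rewrite gt_max hx1.
apply: rn_leP => [|j]; first by rewrite le_max rn_ge0.
rewrite mxE le_max; case: split_ordP => k _; first by rewrite le_rn.
by rewrite le_rn orbT.
Qed.

Lemma mul4 (a x b y : R[i]) : (a * x) * (b * y) = a * (b * (x * y)).
Proof. ring. Qed.

Lemma linspan_tensor (A : set (cfun R d1)) (B : set (cfun R d2)) (D : set (cfun R (d1 + d2))) f g :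
  linspan A f -> linspan B g -> (forall f g, A f -> B g -> linspan D (tensor f g)) -> linspan D (tensor f g).
Proof.
move=> [n [a [F [hF ->]]]] [m [b [G [hG ->]]]] h.
have hD := @linsub_linspan R (cfun R (d1 + d2)) D.
have comb k (c : 'I_k -> R[i]) (H : 'I_k -> cfun R (d1 + d2)) : (forall i, linspan D (H i)) ->
    linspan D (\sum_(i < k) c i *: H i).
  move=> hH; elim/big_ind : _ => //; [by case: hD|by move=> x y; exact: linsubD|].
  by move=> i _; exact: linsubZ.
have -> : tensor (\sum_(i < n) a i *: F i) (\sum_(j < m) b j *: G j) =
    \sum_(i < n) a i *: (\sum_(j < m) b j *: tensor (F i) (G j)).
  apply/funext => z; rewrite /tensor !fct_sumE mulr_suml; apply: eq_bigr => i _.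
  rewrite mulr_sumr [RHS]/GRing.scale /= fct_sumE scaler_sumr; apply: eq_bigr => j _.
  exact: (mul4 (a i) (F i _) (b j) (G j _)).
apply: (comb n a (fun i => \sum_(j < m) b j *: tensor (F i) (G j))) => i.
by apply: (comb m b (fun j => tensor (F i) (G j))) => j; exact: h.
Qed.

End ProductDomination.

Lemma closure_set0 (R : realType) d (x : 'rV[R]_d) : (closure ([set 0] : set 'rV[R]_d) `\` [set 0]) x -> False.
Proof.
have h : closed ([set 0] : set 'rV[R]_d).
  by apply: accessible_closed_set1; apply: hausdorff_accessible; exact: norm_hausdorff.
by move=> [hx]; apply; move: hx; rewrite -((closure_id _).1 h).
Qed.

Section Gluing.
Context {R : realType} {d1 d2 : nat}.
Local Notation mR := (measurableTypeR R).
Notation C := R[i].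
Notation pts d := (d.-tuple mR * d.-tuple mR)%type.
Variables (beta : R).
Hypothesis hb0 : 0 <= beta.
Hypothesis hb1 : beta < 1.
Variables (N1 : 'rV[R]_d1 -> R) (N2 : 'rV[R]_d2 -> R) (N12 : 'rV[R]_(d1 + d2) -> R).
Hypothesis hN1 : is_norm N1.
Hypothesis hN2 : is_norm N2.
Hypothesis hN12 : is_norm N12.
Variable kap : R.
Hypothesis kap1 : 1 <= kap.
Hypothesis hkap : forall U1 U2 B n t1 t2, cone U1 -> cone U2 -> 0 < B ->
   wt beta N12 (cone_prod U1 U2) (kap * B) n (pcat t1 t2) <= wt beta N1 U1 B n t1 * wt beta N2 U2 B n t2 /\
   wt beta N1 U1 (kap * B) n t1 * wt beta N2 U2 (kap * B) n t2 <= wt beta N12 (cone_prod U1 U2) B n (pcat t1 t2).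
Local Notation hn1 := (Hnorm beta N1).
Local Notation hn2 := (Hnorm beta N2).
Local Notation hn12 := (Hnorm beta N12).
Local Notation wt1 := (wt beta N1).
Local Notation wt2 := (wt beta N2).
Local Notation wt12 := (wt beta N12).
Local Notation Sb1 := (Sb beta N1).
Local Notation Sb2 := (Sb beta N2).
Local Notation Sb12 := (Sb beta N12).

Let kap0 : 0 < kap. Proof. by apply: lt_le_trans kap1. Qed.

Variables (K1 : set 'rV[R]_d1) (K2 : set 'rV[R]_d2).
Hypothesis hK1 : closed_cone K1.
Hypothesis hK2 : closed_cone K2.
Variable w : cfun R d1 -> cfun R d2 -> C.
Hypothesis hw : bilinear_on (car (Scone beta N1 K1)) (car (Scone beta N2 K2)) w.
Hypothesis hwc : separately_continuous (Scone beta N1 K1) (Scone beta N2 K2) w.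

Let adm2 (U : set 'rV[R]_d1 * set 'rV[R]_d2) := admissible K1 U.1 /\ admissible K2 U.2.
Let dom2 (U' U : set 'rV[R]_d1 * set 'rV[R]_d2) := cdom U'.1 U.1 /\ cdom U'.2 U.2.
Let prod2 (U : set 'rV[R]_d1 * set 'rV[R]_d2) := cone_prod U.1 U.2.
Let S12 := Sconepair beta N12 K1 K2.
Implicit Types (U : set 'rV[R]_d1 * set 'rV[R]_d2) (b : R).

Let good U b (l : cfun R (d1 + d2) -> C) := [/\ linear_on (Sb12 (prod2 U) b) l,
   exists B n c, b < B /\ forall h, Sb12 (prod2 U) b h -> nc (l h) <= c * hn12 (prod2 U) B n h &
   forall f g, Sb1 U.1 (kap * b) f -> Sb2 U.2 (kap * b) g -> Sb12 (prod2 U) b (tensor f g) -> l (tensor f g) = w f g].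

Let Sc1 U b f : adm2 U -> 0 < b -> Sb1 U.1 b f -> car (Scone beta N1 K1) f.
Proof. by move=> [a1 _] b0 hf; apply/car_Scone; exists U.1, b. Qed.

Let Sc2 U b f : adm2 U -> 0 < b -> Sb2 U.2 b f -> car (Scone beta N2 K2) f.
Proof. by move=> [_ a2] b0 hf; apply/car_Scone; exists U.2, b. Qed.

Lemma good_ex U b : adm2 U -> 0 < b -> exists l, good U b l.
Proof.
move=> aU b0; have [a1 a2] := aU; have kb : 0 < kap * b by exact: mulr_gt0.
have [|||l ll [lb lt]] := @local_functional _ _ _ beta hb0 hb1 N1 N2 N12 hN1 hN2 hN12 kap kap1 hkap U.1 U.2 b
   (admissible_cone a1) (admissible_cone a2) b0 w.
- split=> [f hf a u v hu hv|g hg a u v hu hv].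
    by apply: (proj1 hw); [exact: Sc1 hf|exact: Sc2 hu|exact: Sc2 hv].
  by apply: (proj2 hw); [exact: Sc2 hg|exact: Sc1 hu|exact: Sc1 hv].
- move=> f hf; have cf := Sc1 aU kb hf.
  exact: (Scone_bounded hb0 hb1 hN2 (proj1 hw f cf) (proj1 hwc f cf) a2 kb).
- move=> g hg; have cg := Sc2 aU kb hg.
  exact: (Scone_bounded hb0 hb1 hN1 (proj2 hw g cg) (proj2 hwc g cg) a1 kb).
by exists l.
Qed.

Let kk b := kap * (kap * b).

Let kk_gt0 b : 0 < b -> 0 < kk b.
Proof. by move=> b0; rewrite /kk !mulr_gt0. Qed.

Let le_kap b : 0 < b -> b <= kap * b.
Proof. by move=> b0; rewrite ler_peMl// ltW. Qed.

Let le_kk b : 0 < b -> b <= kk b.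
Proof. by move=> b0; apply: (le_trans (le_kap b0)); apply: le_kap; exact: mulr_gt0. Qed.

Let le_kkm b b' : b <= b' -> kk b <= kk b'.
Proof. by move=> bb; rewrite /kk !ler_pM2l. Qed.

Let cprod U : adm2 U -> cone (prod2 U).
Proof. by move=> [a1 a2]; exact: (cone_prod_cone (admissible_cone a1) (admissible_cone a2)). Qed.

Let SbP U b : adm2 U -> linsub (Sb12 (prod2 U) b).
Proof. by move=> aU; apply: linsub_Sb => //; exact: cprod. Qed.

(** The difference vanishes on tensors, so uniqueness applies to it. *)
Lemma agree (C1 : set 'rV[R]_d1) (C2 : set 'rV[R]_d2) b (v v' : cfun R (d1 + d2) -> C) :
  cone C1 -> cone C2 -> 0 < b ->
  linear_on (Sb12 (cone_prod C1 C2) (kk b)) v -> linear_on (Sb12 (cone_prod C1 C2) (kk b)) v' ->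
  (exists B n c, kk b < B /\ forall h, Sb12 (cone_prod C1 C2) (kk b) h -> nc (v h) <= c * hn12 (cone_prod C1 C2) B n h) ->
  (exists B n c, kk b < B /\ forall h, Sb12 (cone_prod C1 C2) (kk b) h -> nc (v' h) <= c * hn12 (cone_prod C1 C2) B n h) ->
  (forall f g, Sb1 C1 (kap * b) f -> Sb2 C2 (kap * b) g -> v (tensor f g) = v' (tensor f g)) ->
  forall h, Sb12 (cone_prod C1 C2) b h -> v h = v' h.
Proof.
move=> c1 c2 b0 lv lv' [B [n [c [bB hv]]]] [B' [n' [c' [bB' hv']]]] vt h hh.
have cP := cone_prod_cone c1 c2.
pose B2 := Num.min B B'; pose n2 := maxn n n'.
have bB2 : kk b < B2 by rewrite lt_min bB.
have B20 : 0 < B2 by apply: lt_trans bB2; exact: kk_gt0.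
apply/eqP; rewrite -subr_eq0; apply/eqP.
apply: (@local_uniqueness _ _ _ beta hb0 hb1 N1 N2 N12 hN1 hN2 hN12 kap kap1 hkap C1 C2 b c1 c2 b0
   (fun h => v h - v' h) B2 n2 (`|c| + `|c'|) _ bB2 _ _ h hh).
- by move=> a f g hf hg; rewrite (lv a f g hf hg) (lv' a f g hf hg); ring.
- move=> u hu; apply: (le_trans (ncB _ _)); rewrite mulrDl.
  have h1 : hn12 (cone_prod C1 C2) B n u <= hn12 (cone_prod C1 C2) B2 n2 u.
    apply: (Sb_mono hb0 hb1 hN12 cP B20 (hu B2 n2 bB2)); [by rewrite ge_min lexx|exact: leq_maxl].
  have h2 : hn12 (cone_prod C1 C2) B' n' u <= hn12 (cone_prod C1 C2) B2 n2 u.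
    apply: (Sb_mono hb0 hb1 hN12 cP B20 (hu B2 n2 bB2)); [by rewrite ge_min lexx orbT|exact: leq_maxr].
  apply: lerD.
    apply: (le_trans (hv u hu)); apply: (@le_trans _ _ (`|c| * hn12 (cone_prod C1 C2) B n u)).
      by apply: ler_wpM2r; [exact: hn_ge0|exact: ler_norm].
    exact: (ler_wpM2l (normr_ge0 c) h1).
  apply: (le_trans (hv' u hu)); apply: (@le_trans _ _ (`|c'| * hn12 (cone_prod C1 C2) B' n' u)).
    by apply: ler_wpM2r; [exact: hn_ge0|exact: ler_norm].
  exact: (ler_wpM2l (normr_ge0 c') h2).
- by move=> f g hf hg; rewrite (vt f g hf hg) subrr.
Qed.

Let good_restrict U U' b b' l : adm2 U -> adm2 U' -> dom2 U' U -> 0 < b -> b <= b' -> good U' (kk b') l ->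
  [/\ linear_on (Sb12 (prod2 U) (kk b)) l,
    exists B n c, kk b < B /\ forall h, Sb12 (prod2 U) (kk b) h -> nc (l h) <= c * hn12 (prod2 U) B n h &
    forall f g, Sb1 U.1 (kap * b) f -> Sb2 U.2 (kap * b) g -> l (tensor f g) = w f g].
Proof.
move=> aU aU' [hd1 hd2] b0 bb [ll [B [n [c [bB hB]]]] lt].
have [a1 a2] := aU; have [a1' a2'] := aU'.
have hd : cdom (prod2 U') (prod2 U) by exact: cdom_prod.
have sub h : Sb12 (prod2 U) (kk b) h -> Sb12 (prod2 U') (kk b') h.
  move=> hh; apply: (Sb_le (le_kkm bb)).
  exact: (Sb_cdom hb1 hN12 (cprod aU') (cprod aU) hd hh).
split.
- by move=> a f g hf hg; apply: ll; exact: sub.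
- exists B, n, `|c|; split; first by apply: le_lt_trans bB; exact: le_kkm.
  move=> h hh; apply: (le_trans (hB h (sub h hh))).
  apply: (@le_trans _ _ (`|c| * hn12 (prod2 U') B n h)).
    by apply: ler_wpM2r; [exact: hn_ge0|exact: ler_norm].
  have bB1 : kk b < B by apply: le_lt_trans bB; exact: le_kkm.
  exact: (ler_wpM2l (normr_ge0 c) (hn_cdom hb1 hN12 n (cprod aU') (cprod aU) hd bB1 hh)).
- move=> f g hf hg.
  have b'0 : 0 < b' by apply: lt_le_trans bb.
  have kbb : kap * b <= kap * kk b' by rewrite ler_pM2l//; apply: (le_trans bb); exact: le_kk.
  have kb0 : 0 < kap * b by exact: mulr_gt0.
  apply: lt.
  + apply: (Sb_le kbb); apply: (Sb_cdom hb1 hN1 (admissible_cone a1') (admissible_cone a1) hd1 hf).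
  + apply: (Sb_le kbb); apply: (Sb_cdom hb1 hN2 (admissible_cone a2') (admissible_cone a2) hd2 hg).
  + apply: sub; apply: (tensor_Sb hb0 hb1 hN1 hN2 hN12 kap1 hkap (admissible_cone a1) (admissible_cone a2) kb0 hf hg).
Qed.

Let dom2_refl U : dom2 U U.
Proof. by split; exact: cdom_sub. Qed.

Let adm2_inter U U' : adm2 U -> adm2 U' -> exists2 U'', adm2 U'' & dom2 U'' U /\ dom2 U'' U'.
Proof.
move=> [a1 a2] [a1' a2'].
have [V1 v1 [e1 e1']] := admissible_inter hK1 a1 a1'.
have [V2 v2 [e2 e2']] := admissible_inter hK2 a2 a2'.
by exists (V1, V2).
Qed.

(** Both are restrictions of the functional attached to a smaller pair of cones and a
larger scale, whose space contains both spaces. *)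
Lemma good_agree U b l U' b' l' h : adm2 U -> 0 < b -> good U (kk b) l -> Sb12 (prod2 U) b h ->
  adm2 U' -> 0 < b' -> good U' (kk b') l' -> Sb12 (prod2 U') b' h -> l h = l' h.
Proof.
move=> aU b0 gl hh aU' b'0 gl' hh'.
have [U2 aU2 [e e']] := adm2_inter aU aU'.
pose b2 := Num.max b b'.
have b20 : 0 < b2 by rewrite lt_max b0.
have [l2 gl2] := good_ex aU2 (kk_gt0 b20).
have key V c m : adm2 V -> 0 < c -> good V (kk c) m -> Sb12 (prod2 V) c h -> dom2 U2 V -> c <= b2 -> m h = l2 h.
  move=> aV c0 gm hc eV cb; have [a1 a2] := aV.
  have [lm bm tm] := good_restrict aV aV (dom2_refl V) c0 (lexx c) gm.
  have [l2' b2' t2'] := good_restrict aV aU2 eV c0 cb gl2.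
  apply: (agree (admissible_cone a1) (admissible_cone a2) c0 lm l2' bm b2' _ hc).
  by move=> f g hf hg; rewrite (tm f g hf hg) (t2' f g hf hg).
have k1 : b <= b2 by rewrite le_max lexx.
have k2 : b' <= b2 by rewrite le_max lexx orbT.
by rewrite (key U b l aU b0 gl hh e k1) (key U' b' l' aU' b'0 gl' hh' e' k2).
Qed.

Let located h := exists l U b, [/\ adm2 U, 0 < b, good U (kk b) l & Sb12 (prod2 U) b h].

(** The functional of some pair of cones and some scale at which [h] lives; [good_agree]
makes this choice irrelevant. *)
Definition glued h : C := match pselect (located h) with
  | left H => projT1 (cid H) h | right _ => 0 end.

Lemma gluedE U b l h : adm2 U -> 0 < b -> good U (kk b) l -> Sb12 (prod2 U) b h -> glued h = l h.
Proof.
move=> aU b0 gl hh; rewrite /glued; case: pselect => [H|[]]; last by exists l, U, b.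
case: cid => l' /= [U' [b' [aU' b'0 gl' hh']]].
exact: (good_agree aU' b'0 gl' hh' aU b0 gl hh).
Qed.

Lemma pair_located h : car S12 h -> exists U b, [/\ adm2 U, 0 < b & Sb12 (prod2 U) b h].
Proof.
move=> [n [a [g [hg ->]]]]; elim/big_ind : _ => [|x y|i _].
- have [U1 a1] := admissible_ex K1; have [U2 a2] := admissible_ex K2.
  exists (U1, U2), 1; split; [by []|exact: ltr01|exact: (@Sb0 _ _ beta N12 (cone_prod U1 U2) 1)].
- move=> [U [b [aU b0 hx]]] [U' [b' [aU' b'0 hy]]].
  have [U2 aU2 [[e1 e2] [e1' e2']]] := adm2_inter aU aU'.
  exists U2, (Num.max b b'); split; [exact: aU2|by rewrite lt_max b0|].
  apply: (linsubD (SbP _ aU2)).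
    apply: (@Sb_le _ _ _ _ _ b); first by rewrite le_max lexx.
    exact: (Sb_cdom hb1 hN12 (cprod aU2) (cprod aU) (cdom_prod e1 e2) hx).
  apply: (@Sb_le _ _ _ _ _ b'); first by rewrite le_max lexx orbT.
  exact: (Sb_cdom hb1 hN12 (cprod aU2) (cprod aU') (cdom_prod e1' e2') hy).
- have [X [C1 [C2 [q1 k1 q2 k2 ->]]] /car_Sopen[b b0 hb]] := hg i.
  have [U1 a1 e1] := open_admissible q1 k1; have [U2 a2 e2] := open_admissible q2 k2.
  exists (U1, U2), b; split; [by []|exact: b0|].
  apply: (linsubZ _ (@SbP (U1, U2) b (conj a1 a2))).
  apply: (Sb_cdom hb1 hN12 _ _ (cdom_prod e1 e2) hb); first exact: (@cprod (U1, U2) (conj a1 a2)).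
  by apply: cone_prod_cone; [case: q1|case: q2].
Qed.

Lemma glued_linear : linear_on (car S12) glued.
Proof.
move=> a h h' /pair_located[U [b [aU b0 hh]]] /pair_located[U' [b' [aU' b'0 hh']]].
have [U2 aU2 [[e1 e2] [e1' e2']]] := adm2_inter aU aU'.
pose b2 := Num.max b b'; have b20 : 0 < b2 by rewrite lt_max b0.
have [l gl] := good_ex aU2 (kk_gt0 b20).
have x : Sb12 (prod2 U2) b2 h.
  apply: (@Sb_le _ _ _ _ _ b); first by rewrite le_max lexx.
  exact: (Sb_cdom hb1 hN12 (cprod aU2) (cprod aU) (cdom_prod e1 e2) hh).
have y : Sb12 (prod2 U2) b2 h'.
  apply: (@Sb_le _ _ _ _ _ b'); first by rewrite le_max lexx orbT.
  exact: (Sb_cdom hb1 hN12 (cprod aU2) (cprod aU') (cdom_prod e1' e2') hh').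
have xy : Sb12 (prod2 U2) b2 (a *: h + h') by have [_] := SbP b2 aU2; apply.
rewrite (gluedE aU2 b20 gl x) (gluedE aU2 b20 gl y) (gluedE aU2 b20 gl xy).
by have [ll _ _] := gl; apply: ll; [exact: Sb_le (le_kk b20) x|exact: Sb_le (le_kk b20) y].
Qed.

Lemma glued_tensor f g : car (Scone beta N1 K1) f -> car (Scone beta N2 K2) g -> glued (tensor f g) = w f g.
Proof.
move=> /car_Scone[U1 [b1 [a1 b10 hf]]] /car_Scone[U2 [b2 [a2 b20 hg]]].
pose U := (U1, U2); have aU : adm2 U by [].
pose b := Num.max b1 b2; have b0 : 0 < b by rewrite lt_max b10.
have kb0 : 0 < kap * b by exact: mulr_gt0.
have [l gl] := good_ex aU (kk_gt0 kb0).
have hf' : Sb1 U1 b f by apply: Sb_le hf; rewrite le_max lexx.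
have hg' : Sb2 U2 b g by apply: Sb_le hg; rewrite le_max lexx orbT.
have ht : Sb12 (prod2 U) (kap * b) (tensor f g).
  apply: (tensor_Sb hb0 hb1 hN1 hN2 hN12 kap1 hkap (admissible_cone a1) (admissible_cone a2) b0 hf' hg').
rewrite (gluedE aU kb0 gl ht).
have bk : b <= kap * kk (kap * b).
  apply: (le_trans (le_kap b0)); apply: (le_trans (le_kk kb0)); apply: le_kap; exact: kk_gt0.
have [_ _ lt] := gl; apply: lt; [exact: Sb_le hf'|exact: Sb_le hg'|].
by apply: Sb_le ht; exact: le_kk.
Qed.

Let subS (C1 : set 'rV[R]_d1) (C2 : set 'rV[R]_d2) : open_cone C1 -> cone_compact_in K1 C1 ->
  open_cone C2 -> cone_compact_in K2 C2 -> car (Sopen beta N12 (cone_prod C1 C2)) `<=` car S12.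
Proof.
move=> q1 k1 q2 k2 f hf; apply: sub_linspan.
by exists (Sopen beta N12 (cone_prod C1 C2)) => //; exists C1, C2.
Qed.

Lemma glued_bounded C1 C2 b : open_cone C1 -> cone_compact_in K1 C1 ->
  open_cone C2 -> cone_compact_in K2 C2 -> 0 < b ->
  exists B n c, b < B /\ forall h, Sb12 (cone_prod C1 C2) b h -> nc (glued h) <= c * hn12 (cone_prod C1 C2) B n h.
Proof.
move=> q1 k1 q2 k2 b0.
have [U1 a1 e1] := open_admissible q1 k1; have [U2 a2 e2] := open_admissible q2 k2.
have aU : adm2 (U1, U2) by [].
have [l gl] := good_ex aU (kk_gt0 b0).
have [_ [B [n [c [bB hc]]]] _] := gl.
have bB' : b < B by apply: le_lt_trans bB; exact: le_kk.
have cP : cone (cone_prod C1 C2) by apply: cone_prod_cone; [case: q1|case: q2].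
exists B, n, `|c|; split => // h hh.
have hU : Sb12 (prod2 (U1, U2)) b h by exact: (Sb_cdom hb1 hN12 (cprod aU) cP (cdom_prod e1 e2) hh).
rewrite (gluedE aU b0 gl hU); apply: (le_trans (hc h (Sb_le (le_kk b0) hU))).
apply: (@le_trans _ _ (`|c| * hn12 (prod2 (U1, U2)) B n h)).
  by apply: ler_wpM2r; [exact: hn_ge0|exact: ler_norm].
exact: (ler_wpM2l (normr_ge0 c) (hn_cdom hb1 hN12 n (cprod aU) cP (cdom_prod e1 e2) bB' hh)).
Qed.

Let linear_sub (C1 : set 'rV[R]_d1) (C2 : set 'rV[R]_d2) v : open_cone C1 -> cone_compact_in K1 C1 ->
  open_cone C2 -> cone_compact_in K2 C2 -> linear_on (car S12) v -> linear_on (car (Sopen beta N12 (cone_prod C1 C2))) v.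
Proof. by move=> q1 k1 q2 k2 lv a f g hf hg; apply: lv; exact: (subS q1 k1 q2 k2). Qed.

Lemma glued_continuous : continuous_on S12 glued.
Proof.
apply: continuous_indlim.
- exact: linsub_linspan.
- exact: glued_linear.
- by move=> X [C1 [C2 [q1 k1 q2 k2 ->]]]; exact: subS.
- move=> X [C1 [C2 [q1 k1 q2 k2 ->]]].
  apply/(Sopen_continuousP hb0 hb1 hN12); first by apply: cone_prod_cone; [case: q1|case: q2].
    exact: (linear_sub q1 k1 q2 k2 glued_linear).
  by move=> b b0; exact: glued_bounded.
Qed.

Lemma glued_unique v : linear_on (car S12) v -> continuous_on S12 v ->
  (forall f g, car (Scone beta N1 K1) f -> car (Scone beta N2 K2) g -> w f g = v (tensor f g)) ->
  forall h, car S12 h -> v h = glued h.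
Proof.
move=> lv cv vt h [n [a [g [hg ->]]]].
have hS : linsub (car S12) by exact: linsub_linspan.
have base x : (\bigcup_(X in [set X | exists (U1 : set 'rV[R]_d1) (U2 : set 'rV[R]_d2),
    [/\ open_cone U1, cone_compact_in K1 U1, open_cone U2,
        cone_compact_in K2 U2 & X = Sopen beta N12 (cone_prod U1 U2)]]) car X) x -> car S12 x /\ v x = glued x.
  move=> [X [C1 [C2 [q1 k1 q2 k2 ->]]] hx]; split; first exact: (subS q1 k1 q2 k2).
  have c1 : cone C1 by case: q1.
  have c2 : cone C2 by case: q2.
  have cP := cone_prod_cone c1 c2.
  have sub b u : 0 < b -> Sb12 (cone_prod C1 C2) b u -> car S12 u.
    by move=> b0 hu; apply: (subS q1 k1 q2 k2); apply/car_Sopen; exists b.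
  move: hx => /car_Sopen[b b0 hx]; have kb0 : 0 < kap * b by exact: mulr_gt0.
  have kkb0 := kk_gt0 b0.
  apply: (agree c1 c2 b0) hx.
  - by move=> c f f' hf hf'; apply: lv; exact: sub kkb0 _.
  - by move=> c f f' hf hf'; apply: glued_linear; exact: sub kkb0 _.
  - have lX := linear_sub q1 k1 q2 k2 lv.
    have [H _] := Sopen_continuousP hb0 hb1 hN12 cP lX; apply: H => //.
    apply: continuous_indlim_sub cv.
    + by move=> X' [V1 [V2 [_ _ _ _ ->]]]; exact: Sopen_topology.
    + by move=> X' [V1 [V2 [q1' k1' q2' k2' ->]]]; exact: subS.
    + by exists C1, C2.
  - exact: glued_bounded.
  - move=> f g' hf hg'.
    have sf := Scone_open hb1 hN1 q1 k1 kb0 hf; have sg := Scone_open hb1 hN2 q2 k2 kb0 hg'.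
    by rewrite -vt// glued_tensor.
suff [] : car S12 (\sum_(i < n) a i *: g i) /\ v (\sum_(i < n) a i *: g i) = glued (\sum_(i < n) a i *: g i) by [].
elim/big_ind : _ => [|x y [Sx vx] [Sy vy]|i _].
- by split; [case: hS|rewrite (linear_on0 hS lv) (linear_on0 hS glued_linear)].
- split; first exact: linsubD.
  by rewrite (linear_onD lv Sx Sy) (linear_onD glued_linear Sx Sy) vx vy.
- have [Sg vg] := base _ (hg i); split; first exact: linsubZ.
  by rewrite (linear_onZ _ hS lv Sg) (linear_onZ _ hS glued_linear Sg) vg.
Qed.

Definition splits (d : nat) (N : 'rV[R]_d -> R) := forall b f, 0 < b -> Sb beta N [set 0] b f ->
  linspan [set g | exists U : set 'rV[R]_d, open_cone U /\ car (Sopen beta N U) g] f.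

Lemma Scone_linspan d (N : 'rV[R]_d -> R) K f : splits N -> car (Scone beta N K) f ->
  linspan [set g | exists U : set 'rV[R]_d, [/\ open_cone U, cone_compact_in K U & car (Sopen beta N U) g]] f.
Proof.
move=> hs /car_Scone[U [b [[[-> ->]|[_ [oU hU]]] b0 hf]]]; last first.
  by apply: sub_linspan; exists U; split; [exact: oU|exact: hU|apply/car_Sopen; exists b].
have [n [a [g [hg ->]]]] := hs b f b0 hf; exists n, a, g; split => // i.
have [V [oV hV]] := hg i; exists V; split => // x hx.
by have := closure_set0 hx.
Qed.

(** The space of the pair involves open cones only, so a factor from the degenerate
space has to be split first. *)
Lemma tensor_in_pair f g : splits N1 -> splits N2 -> car (Scone beta N1 K1) f -> car (Scone beta N2 K2) g ->
  car S12 (tensor f g).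
Proof.
move=> s1 s2 /(Scone_linspan s1) hf /(Scone_linspan s2) hg; apply: (linspan_tensor hf hg).
move=> f' g' [U1 [q1 k1 /car_Sopen[b1 b10 h1]]] [U2 [q2 k2 /car_Sopen[b2 b20 h2]]].
apply: sub_linspan; exists (Sopen beta N12 (cone_prod U1 U2)); first by exists U1, U2.
apply/car_Sopen; exists (kap * Num.max b1 b2); first by rewrite mulr_gt0// lt_max b10.
apply: (tensor_Sb hb0 hb1 hN1 hN2 hN12 kap1 hkap).
- by case: q1.
- by case: q2.
- by rewrite lt_max b10.
- by apply: Sb_le h1; rewrite le_max lexx.
- by apply: Sb_le h2; rewrite le_max lexx orbT.
Qed.

End Gluing.

(** * The cardinal sine *)

Section CardinalSine.
Context {R : realType}.
Notation C := R[i].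

Lemma abs_sin_le (x : R) : `|sin x| <= `|x|.
Proof.
have P (t : R) : 0 <= t -> `|sin t| <= t.
  move=> t0; have [|c _] := @MVT_segment R sin cos 0 t t0 (fun u _ => is_derive_sin u).
    by apply: continuous_subspaceT => u; exact: continuous_sin.
  rewrite sin0 !subr0 => ->; rewrite normrM (ger0_norm t0) ler_piMl//.
  by have := cos_max c.
have [x0|x0] := leP 0 x; first by rewrite (ger0_norm x0) P.
by rewrite -normrN -sinN -(normrN x) (@ger0_norm _ (- x)) ?P// oppr_ge0 ltW.
Qed.

Definition sh (y : R) : R := (expR y - expR (- y)) / 2.

Lemma shN y : sh (- y) = - sh y.
Proof. by rewrite /sh opprK -mulNr opprB. Qed.

Lemma abs_sh_le y : `|sh y| <= `|y| * expR `|y|.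
Proof.
have P (t : R) : 0 <= t -> `|sh t| <= t * expR t.
  move=> t0.
  have e1 : expR (- t) = expR t * expR (- (2 * t)).
    by rewrite -expRD; congr expR; ring.
  have := expR_ge1Dx (- (2 * t)) => h.
  have e0 := expR_gt0 t.
  have h2 : expR t - expR (- t) <= expR t * (2 * t).
    rewrite e1 -[X in X - _]mulr1 -mulrBr ler_pM2l//; lra.
  have h3 : expR (- t) <= expR t by rewrite ler_expR; lra.
  rewrite ger0_norm /sh; last by rewrite divr_ge0// subr_ge0.
  rewrite ler_pdivrMr//; apply: (le_trans h2); rewrite le_eqVlt; apply/orP; left; apply/eqP; ring.
have [y0|y0] := leP 0 y; first by rewrite (ger0_norm y0) P.
by rewrite -normrN -shN -(normrN y) (@ger0_norm _ (- y)) ?P// oppr_ge0 ltW.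
Qed.

Lemma sh_sqr_le y : 1 + sh y ^+ 2 <= expR `|y| ^+ 2.
Proof.
have E : 1 + sh y ^+ 2 = ((expR y + expR (- y)) / 2) ^+ 2.
  have := expRxMexpNx_1 y; rewrite /sh => h.
  by rewrite -[X in X + _]h; field.
rewrite E ler_pXn2r ?nnegrE ?expR_ge0 ?mulr_ge0 ?addr_ge0 ?expR_ge0 ?invr_ge0//.
rewrite ler_pdivrMr// mulr_natr mulr2n lerD// ler_expR; first exact: ler_norm.
by rewrite -normrN ler_norm.
Qed.

Definition csin (w : C) : C := (cexp ('i * w) - cexp (- ('i * w))) * (2 * 'i)^-1.

Lemma csinE (w : C) : csin w =
  (sin (Re w) * ((expR (Im w) + expR (- Im w)) / 2)) +i* (cos (Re w) * sh (Im w)).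
Proof.
have h2 : 2 * 'i != 0 :> C.
  by rewrite -nc_gt0 ncM nci mulr1 (_ : 2 = (2%:R : R)%:C) ?ncR ?normr_nat// rmorph_nat.
apply: (mulIf h2); rewrite /csin mulfVK// /cexp /sh.
case: w => x y /=.
rewrite (_ : (2 : C) = (2%:R : R)%:C); last by rewrite rmorph_nat.
apply: complexP; rewrite !ReIm /= !(mul0r, mul1r, mulr0, mulr1, add0r, sub0r, addr0, subr0, opprK, oppr0) ?cosN ?sinN; by field.
Qed.

Lemma ent1_csin : ent1 csin.
Proof.
move=> w; have E : cdiff (fun z : C => 'i * z) w.
  by apply: cdiffM; [exact: cdiff_cst|exact: cdiff_id].
apply: cdiffM; last exact: cdiff_cst.
apply: cdiffB; first by apply: (cdiff_comp E); exact: cdiff_cexp.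
by apply: (cdiff_comp (cdiffN E)); exact: cdiff_cexp.
Qed.

Lemma nc_csin_sqr w : nc (csin w) ^+ 2 = sin (Re w) ^+ 2 + sh (Im w) ^+ 2.
Proof.
rewrite csinE nc_sqr /= (@exprMn _ 2 (sin _)) (@exprMn _ 2 (cos _)).
have E : ((expR (Im w) + expR (- Im w)) * 2^-1) ^+ 2 = 1 + sh (Im w) ^+ 2.
  have := expRxMexpNx_1 (Im w); rewrite /sh => h.
  by rewrite -[X in _ = X + _]h; field.
rewrite E mulrDr mulr1 -addrA; congr (_ + _).
by rewrite -mulrDl addrC cos2Dsin2 mul1r.
Qed.

Lemma nc_csin_le w : nc (csin w) <= expR `|Im w|.
Proof.
rewrite -(@ler_pXn2r _ 2) ?nnegrE ?nc_ge0 ?expR_ge0// nc_csin_sqr.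
apply: le_trans (sh_sqr_le _); rewrite lerD2r.
by rewrite sin2cos2 gerBl sqr_ge0.
Qed.

Lemma nc_csin_lin w : nc (csin w) <= nc w * expR `|Im w|.
Proof.
rewrite -(@ler_pXn2r _ 2) ?nnegrE ?nc_ge0 ?mulr_ge0 ?nc_ge0 ?expR_ge0// nc_csin_sqr.
rewrite (@exprMn _ 2 (nc w)) nc_sqr mulrDl; apply: lerD.
  rewrite -[leLHS]mulr1; apply: ler_pM; rewrite ?sqr_ge0//.
    rewrite -(real_normK (num_real (sin _))) -(real_normK (num_real (Re w))).
    by rewrite ler_pXn2r ?nnegrE ?normr_ge0// abs_sin_le.
  by rewrite exprn_ege1// -expR0 ler_expR.
rewrite -exprMn -(real_normK (num_real (sh _))) -(real_normK (num_real (_ * _))).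
rewrite ler_pXn2r ?nnegrE ?normr_ge0// (le_trans (abs_sh_le _))//.
by rewrite normrM (ger0_norm (expR_ge0 _)).
Qed.

Lemma csin0 : csin 0 = 0.
Proof. by rewrite /csin mulr0 oppr0 subrr mul0r. Qed.

Lemma csin_real (x : R) : csin x%:C = (sin x)%:C.
Proof.
rewrite csinE /= /sh oppr0 subrr mul0r mulr0 expR0.
by congr (_ +i* _); field.
Qed.

(** The derivative of the complex sine at 0, read off on the real axis. *)
Lemma acoef_csin : acoef csin 1 = 1.
Proof.
apply/eqP; rewrite -subr_eq0; apply: contraT; rewrite -nc_gt0 => a0.
set c := nc _ in a0.
have c4 : 0 < c / 4 by rewrite divr_gt0.
have [r1 r10 h1] := real_diff_eps (is_derive_sin 0) c4.
have [M hM] := bound_disc (fun w => cdiff_ccont (ent1_csin w)) 1.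
have M0 : 0 <= M by apply: le_trans (hM 0 _); rewrite ?nc_ge0// nc0.
pose s := Num.min (Num.min r1 (1 / 2)) (c / 4 / (4 * M + 1)).
have M1 : 0 < 4 * M + 1 by rewrite ltr_wpDl// mulr_ge0.
have s0 : 0 < s by rewrite !lt_min r10 divr_gt0//= divr_gt0.
have ss : nc (s%:C : C) = s by rewrite ncR ger0_norm// ltW.
have sr1 : s <= r1 by rewrite /s !ge_min lexx.
have sh2 : s <= 1 / 2 by rewrite /s !ge_min lexx orbT.
have sM : s <= c / 4 / (4 * M + 1) by rewrite /s !ge_min lexx !orbT.
have := h1 s; rewrite (ger0_norm (ltW s0)) add0r sin0 cos0 subr0 mul1r => /(_ sr1) k1.
have h1' : nc (s%:C : C) <= 1 / 2 by rewrite ss.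
have := @ent1_second R csin 0 1 M s%:C ent1_csin ltr01 h1'.
rewrite add0r csin0 subr0 (_ : (fun u => csin (0 + u)) = csin); last first.
  by apply/funext => u; rewrite add0r.
move=> T.
have {T} : nc (csin s%:C - acoef csin 1 * s%:C) <= 4 * M / 1 ^+ 2 * nc s%:C ^+ 2.
  by apply: T => u u1; rewrite add0r hM// u1.
rewrite expr1n divr1 ss csin_real => k2.
have k3 : c * s <= c / 4 * s + 4 * M * s ^+ 2.
  rewrite /c -[X in _ * X <= _]ss -ncM.
  rewrite (_ : _ * _ = ((sin s)%:C - s%:C) - ((sin s)%:C - acoef csin 1 * s%:C)); last by ring.
  by apply: (le_trans (ncB _ _)); apply: lerD => //; rewrite -rmorphB ncR.
have k4 : s * (4 * M + 1) <= c / 4 by rewrite -ler_pdivlMr.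
have k5 : c * s <= c / 4 * s + s * (c / 4).
  apply: (le_trans k3); rewrite lerD2l expr2 mulrA mulrC ler_pM2l//.
  have : 0 <= s by exact: ltW.
  move: k4; rewrite mulrDr mulr1 (mulrC s) => *; lra.
have k6 : 0 < c * s by rewrite mulr_gt0.
move: k5 k6; rewrite (mulrC s) -mulrDl -mulrDr => k5 k6.
have k7 : c * s <= c * s / 2 by apply: (le_trans k5); rewrite le_eqVlt; apply/orP; left; apply/eqP; field.
lra.
Qed.

(** At 0, a Taylor expansion to second order gives the derivative of the quotient. *)
Lemma ent1_div_id (f : C -> C) : ent1 f -> f 0 = 0 ->
  ent1 (fun w => if w == 0 then acoef f 1 else f w / w).
Proof.
move=> hf f0 w; have [->|w0] := eqVneq w 0.
  have [M hM] := bound_disc (fun w => cdiff_ccont (hf w)) 1.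
  have M0 : 0 <= M by apply: le_trans (hM 0 _); rewrite ?nc_ge0// nc0.
  exists (acoef f 2) => e e0; exists (Num.min (1 / 2) (e / (4 * M + 1))).
    by rewrite lt_min !divr_gt0// ltr_wpDl// mulr_ge0.
  move=> h; rewrite le_min => /andP[hh1 hh2]; rewrite add0r eqxx.
  have [->|h0] := eqVneq h 0.
    by rewrite subrr mulr0 subr0 nc0 mulr0.
  have hn : 0 < nc h by rewrite nc_gt0.
  have := @taylor R f h 1 M 3 hf ltr01 hh1 (fun u u1 => hM u (eq_ind_r (fun x => x <= 1) (lexx 1) u1)).
  rewrite !big_ord_recr big_ord0 /= add0r expr0 expr1 mulr1 acoef0// f0 add0r divr1 => T.
  rewrite -(ler_pM2r hn) -ncM.
  rewrite (_ : _ * h = f h - (acoef f 1 * h + acoef f 2 * h ^+ 2)); last by field.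
  apply: (le_trans T); rewrite exprS expr2 !mulrA ler_pM2r// ler_pM2r//.
  move: hh2; rewrite ler_pdivlMr; last by rewrite ltr_wpDl// mulr_ge0.
  rewrite mulrDr mulr1 (mulrC (nc h)); lra.
have wn : 0 < nc w / 2 by rewrite divr_gt0// nc_gt0.
apply: (cdiff_near (f := fun z => f z * z^-1) wn).
  move=> h hh; case: eqP => // E.
  have : nc w <= nc w / 2 by rewrite -[w in leLHS](addrK h) E sub0r ncN.
  by move=> k; exfalso; move: wn; move: (nc w) k => a; lra.
by apply: cdiffM => //; apply: cdiffV => //; exact: cdiff_id.
Qed.

Definition csinc (w : C) : C := if w == 0 then 1 else csin w / w.

Lemma ent1_csinc : ent1 csinc.
Proof.
have := ent1_div_id ent1_csin csin0; rewrite acoef_csin; exact.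
Qed.

Lemma csinc_mul w : w * csinc w = csin w.
Proof.
by rewrite /csinc; case: eqP => [->|/eqP w0]; rewrite ?mul0r ?csin0// mulrCA divff// mulr1.
Qed.

Lemma nc_csinc w : nc (csinc w) <= expR `|Im w|.
Proof.
rewrite /csinc; case: eqP => [->|/eqP w0]; first by rewrite nc1 -expR0 ler_expR.
by rewrite ncM ncV ler_pdivrMr ?nc_gt0// mulrC nc_csin_lin.
Qed.

Lemma nc_csinc_decay w : nc w * nc (csinc w) <= expR `|Im w|.
Proof. by rewrite -ncM csinc_mul nc_csin_le. Qed.

Lemma csinc_real (x : R) : Im (csinc x%:C) = 0.
Proof.
rewrite /csinc; case: eqP => // _; rewrite csin_real -fmorphV -rmorphM //.
Qed.

(** The constant 4 exp 1 covers both the quadratic Taylor remainder on the disc of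
radius 1/2 and the trivial bound outside it. *)
Lemma nc_csinc_sub1 w : nc (csinc w - 1) <= 4 * expR 1 * nc w * expR `|Im w|.
Proof.
have e1 : 1 <= expR 1 :> R by rewrite -expR0 ler_expR.
have ey : 1 <= expR `|Im w| by rewrite -expR0 ler_expR.
have w0 := nc_ge0 w.
have [h|h] := leP (nc w) (1 / 2); last first.
  apply: (le_trans (ncB _ _)); rewrite nc1.
  have h1 := nc_csinc w.
  have : 4 * expR 1 * nc w >= 2.
    have : expR 1 * nc w >= 1 * (1 / 2) by apply: ler_pM => //; exact: ltW.
    rewrite -mulrA; lra.
  move=> h2; have : 2 * expR `|Im w| <= 4 * expR 1 * nc w * expR `|Im w|.
    by rewrite ler_wpM2r// expR_ge0.
  lra.
have [->|wn] := eqVneq w 0.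
  by rewrite /csinc eqxx subrr nc0 mulr0 mul0r.
have wn' : 0 < nc w by rewrite nc_gt0.
have := @ent1_second R csin 0 1 (expR 1) w ent1_csin ltr01 h.
rewrite add0r csin0 subr0 (_ : (fun u => csin (0 + u)) = csin); last first.
  by apply/funext => u; rewrite add0r.
rewrite acoef_csin mul1r expr1n divr1 -csinc_mul => T.
rewrite -(ler_pM2l wn') -ncM mulrBr mulr1.
apply: (le_trans (T _)).
  move=> u u1; rewrite add0r (le_trans (nc_csin_le _))// ler_expR.
  by rewrite -u1 Im_le_nc.
rewrite expr2 mulrCA [leRHS]mulrA ler_peMr//.
by rewrite !mulr_ge0// expR_ge0.
Qed.

End CardinalSine.

(** * A rapidly decreasing function of exponential type *)

Section RapidDecay.
Context {R : realType}.
Notation C := R[i].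

Definition hpow (j : nat) : R := 2^-1 ^+ j.

Lemma hpow_gt0 j : 0 < hpow j.
Proof. by rewrite exprn_gt0. Qed.

Lemma hpow_ge0 j : 0 <= hpow j.
Proof. exact/ltW/hpow_gt0. Qed.

Lemma hpowS j : hpow j.+1 = hpow j / 2.
Proof. by rewrite /hpow exprS; field. Qed.

Lemma hpowK j : hpow j * 2 ^+ j = 1.
Proof. by rewrite /hpow -exprMn mulVf ?expr1n// pnatr_eq0. Qed.

Definition sincprod (m : nat) (w : C) : C := \prod_(j < m) csinc ((hpow j.+1)%:C * w).

Lemma sincprodS m w : sincprod m.+1 w = sincprod m w * csinc ((hpow m.+1)%:C * w).
Proof. by rewrite /sincprod big_ord_recr. Qed.

Lemma ent1_sincprod m : ent1 (sincprod m).
Proof.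
move=> w; apply: (@cdiff_prod R m (fun j w => csinc ((hpow j.+1)%:C * w))) => j.
apply: (@cdiff_comp R (fun z => (hpow j.+1)%:C * z) csinc); last exact: ent1_csinc.
by apply: cdiffM; [exact: cdiff_cst|exact: cdiff_id].
Qed.

Lemma Im_scale (a : R) (w : C) : 0 <= a -> `|Im (a%:C * w)| = a * `|Im w|.
Proof. by move=> a0; rewrite !ReIm /= mul0r addr0 normrM (ger0_norm a0). Qed.

Lemma nc_scale (a : R) (w : C) : 0 <= a -> nc (a%:C * w) = a * nc w.
Proof. by move=> a0; rewrite ncM ncR (ger0_norm a0). Qed.

Lemma nc_sincprod m w : nc (sincprod m w) <= expR ((1 - hpow m) * `|Im w|).
Proof.
elim: m => [|m ih].
  by rewrite /sincprod big_ord0 nc1 /hpow expr0 subrr mul0r expR0.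
rewrite sincprodS ncM; have := nc_csinc ((hpow m.+1)%:C * w).
rewrite Im_scale ?hpow_ge0// => h.
have -> : (1 - hpow m.+1) * `|Im w| = (1 - hpow m) * `|Im w| + hpow m.+1 * `|Im w|.
  by rewrite hpowS; field.
by rewrite expRD; apply: (ler_pM (nc_ge0 _) (nc_ge0 _) ih h).
Qed.

Lemma nc_sincprod_le m w : nc (sincprod m w) <= expR `|Im w|.
Proof.
apply: (le_trans (nc_sincprod m w)); rewrite ler_expR ler_piMl//.
by rewrite gerBl ltW// hpow_gt0.
Qed.

(** Each of the first [N] factors absorbs one power of [w], at a cost of at most 2 ^
N. *)
Lemma nc_sincprod_decay N m w : (N <= m)%N ->
  nc w ^+ N * nc (sincprod m w) <= (2 ^+ N) ^+ N * expR ((1 - hpow m) * `|Im w|).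
Proof.
move=> Nm; rewrite -(subnK Nm); move: (m - N)%N => k {m Nm}.
have S m : expR ((1 - hpow m.+1) * `|Im w|) = expR ((1 - hpow m) * `|Im w|) * expR (hpow m.+1 * `|Im w|).
  by rewrite -expRD; congr expR; rewrite hpowS; field.
have e0 (x : R) := expR_ge0 x.
elim: k => [|k ih].
  rewrite add0n; elim: N => [|N ih].
    by rewrite !expr0 !mul1r nc_sincprod.
  rewrite sincprodS ncM S exprSr.
  have h : nc w * nc (csinc ((hpow N.+1)%:C * w)) <= 2 ^+ N.+1 * expR (hpow N.+1 * `|Im w|).
    have := nc_csinc_decay ((hpow N.+1)%:C * w).
    rewrite Im_scale ?nc_scale ?hpow_ge0// => h.
    rewrite -(ler_pM2l (hpow_gt0 N.+1)) [leRHS]mulrA hpowK mul1r mulrA; exact: h.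
  rewrite -mulrA (mulrA (nc w)) [nc w * _]mulrC -mulrA [X in nc w ^+ N * X <= _]mulrC.
  rewrite (_ : _ * _ = (nc w ^+ N * nc (sincprod N w)) * (nc w * nc (csinc ((hpow N.+1)%:C * w)))); last by ring.
  apply: (le_trans (ler_pM (mulr_ge0 (exprn_ge0 _ (nc_ge0 _)) (nc_ge0 _)) (mulr_ge0 (nc_ge0 _) (nc_ge0 _)) ih h)).
  have h2 : (2 ^+ N) ^+ N * 2 ^+ N.+1 <= (2 ^+ N.+1) ^+ N.+1 :> R.
    rewrite [leRHS]exprSr ler_pM2r ?exprn_gt0//.
    by apply: lerXn2r; rewrite ?nnegrE ?exprn_ge0// exprS ler_peMl ?exprn_ge0// ler1n.
  rewrite mulrACA; apply: ler_wpM2r h2; exact: mulr_ge0.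
rewrite addSn sincprodS ncM S.
have := nc_csinc ((hpow (k + N).+1)%:C * w).
rewrite Im_scale ?hpow_ge0// => h.
rewrite !mulrA; exact: (ler_pM (mulr_ge0 (exprn_ge0 _ (nc_ge0 _)) (nc_ge0 _)) (nc_ge0 _) ih h).
Qed.

Lemma sincprod_real m (x : R) : Im (sincprod m x%:C) = 0.
Proof.
elim: m => [|m ih]; first by rewrite /sincprod big_ord0.
by rewrite sincprodS !ReIm ih -rmorphM csinc_real mulr0 mul0r addr0.
Qed.

Let Kc (w : C) : R := 4 * expR 1 * nc w * expR (2 * `|Im w|).

Lemma Kc_ge0 w : 0 <= Kc w.
Proof. by rewrite /Kc !mulr_ge0 ?expR_ge0 ?nc_ge0. Qed.

Lemma sincprod_step m w : nc (sincprod m.+1 w - sincprod m w) <= Kc w * hpow m.+1.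
Proof.
rewrite sincprodS -[X in _ - X]mulr1 -mulrBr ncM.
have h1 := nc_sincprod_le m w.
have := nc_csinc_sub1 ((hpow m.+1)%:C * w).
rewrite Im_scale ?nc_scale ?hpow_ge0// => h2.
apply: (le_trans (ler_pM (nc_ge0 _) (nc_ge0 _) h1 h2)).
have h3 : expR (hpow m.+1 * `|Im w|) <= expR `|Im w|.
  rewrite ler_expR ler_piMl// /hpow exprn_ile1//; lra.
rewrite /Kc (_ : 2 * `|Im w| = `|Im w| + `|Im w|) ?expRD; last by ring.
rewrite [leRHS](_ : _ = expR `|Im w| * (4 * expR 1 * (hpow m.+1 * nc w) * expR `|Im w|)); last by ring.
apply: ler_wpM2l; first exact: expR_ge0.
by apply: ler_wpM2l h3; rewrite !mulr_ge0 ?expR_ge0 ?nc_ge0 ?hpow_ge0.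
Qed.

Lemma sincprod_cauchy m n w :
  nc (sincprod m w - sincprod n w) <= Kc w * hpow m + Kc w * hpow n.
Proof.
have A i k : nc (sincprod (k + i) w - sincprod i w) <= Kc w * (hpow i - hpow (k + i)).
  elim: k => [|k ih]; first by rewrite !subrr nc0 mulr0.
  rewrite addSn -(subrKA (sincprod (k + i) w)).
  apply: (le_trans (ncD _ _)); apply: (le_trans (lerD (sincprod_step _ _) ih)).
  by rewrite hpowS -mulrDr le_eqVlt; apply/orP; left; apply/eqP; field.
have B i k : Kc w * (hpow i - hpow k) <= Kc w * hpow i + Kc w * hpow k.
  rewrite -mulrDr; apply: (ler_wpM2l (Kc_ge0 w)); have := hpow_gt0 k; lra.
have [mn|nm] := leqP m n.
  by rewrite -ncN opprB -(subnK mn); apply: (le_trans (A _ _)); exact: B.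
rewrite -(subnK (ltnW nm)); apply: (le_trans (A _ _)); rewrite [leRHS]addrC; exact: B.
Qed.

(** The infinite product of the functions sinc (w / 2 ^ j), that is, the Fourier
transform of an infinite convolution of uniform laws. The types 2 ^- j of the factors
add up to 1, while each factor contributes one power of decay. *)
Theorem rapid_exp_type : exists P : C -> C, [/\ ent1 P,
  (forall N, exists2 M : R, 0 <= M & forall w, nc (P w) * (1 + `|Re w|) ^+ N <= M * expR `|Im w|),
  (forall x : R, Im (P x%:C) = 0) &
  (forall x : R, nc (P x%:C - 1) <= 8 * expR 1 * `|x|)].
Proof.
have /choice[P hP] : forall w, exists l, forall m, nc (sincprod m w - l) <= 2 * (Kc w * hpow m).
  by move=> w; apply: (complex_net 0%N) => i j; exact: sincprod_cauchy.
have small w e : 0 < e -> exists N, forall m, (N <= m)%N -> 2 * (Kc w * hpow m) <= e.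
  move=> e0; have [N hN] := half_pow_small (2 * Kc w) e0; exists N => m Nm.
  apply: le_trans hN; rewrite mulrA; apply: ler_wpM2l; first by rewrite mulr_ge0 ?Kc_ge0.
  by rewrite /hpow ler_wiXn2l ?invr_ge0 ?invf_le1 ?ler1n.
exists P; split.
- apply: (@ent1_lim R sincprod P); first exact: ent1_sincprod.
    move=> w e /(small w)[N hN]; exists N => m /hN; apply: le_trans; exact: hP.
  move=> rho; exists (expR rho) => m w hw; apply: (le_trans (nc_sincprod_le _ _)).
  by rewrite ler_expR (le_trans (Im_le_nc _)).
- move=> N; exists (2 ^+ N * (1 + (2 ^+ N) ^+ N)) => [|w].
    by rewrite mulr_ge0 ?addr_ge0 ?exprn_ge0.
  have h1 : nc (P w) * (1 + nc w ^+ N) <= (1 + (2 ^+ N) ^+ N) * expR `|Im w|.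
    apply/ler_addgt0Pr => e e0.
    have k0 : 0 < 1 + nc w ^+ N by rewrite ltr_wpDr// exprn_ge0// nc_ge0.
    have [n hn] := small w _ (divr_gt0 e0 k0).
    pose m := maxn n N; have nm := hn m (leq_maxl _ _).
    have h2 := nc_sincprod_decay w (leq_maxr n N).
    have h3 := nc_sincprod_le m w.
    have h4 : nc (P w) <= nc (sincprod m w) + e / (1 + nc w ^+ N).
      apply: (le_trans (nc_le_dist _ (sincprod m w))); rewrite lerD2l nc_distC.
      exact: le_trans (hP w m) nm.
    apply: (le_trans (ler_wpM2r (ltW k0) h4)); rewrite mulrDl divfK ?gt_eqF// lerD2r.
    rewrite mulrDr mulr1 mulrDl mul1r lerD//.
    rewrite mulrC; apply: (le_trans h2); rewrite ler_wpM2l ?exprn_ge0//.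
    by rewrite ler_expR ler_piMl// gerBl ltW// hpow_gt0.
  have h2 : (1 + `|Re w|) ^+ N <= 2 ^+ N * (1 + nc w ^+ N).
    have w0 := nc_ge0 w.
    apply: (@le_trans _ _ ((1 + nc w) ^+ N)).
      by apply: lerXn2r; rewrite ?nnegrE ?addr_ge0// lerD2l Re_le_nc.
    have [h|h] := leP (nc w) 1.
      apply: (@le_trans _ _ (2 ^+ N * 1)).
        by rewrite mulr1; apply: lerXn2r; rewrite ?nnegrE ?addr_ge0//; lra.
      by rewrite ler_wpM2l ?exprn_ge0// lerDl exprn_ge0.
    apply: (@le_trans _ _ (2 ^+ N * nc w ^+ N)).
      by rewrite -exprMn; apply: lerXn2r; rewrite ?nnegrE ?addr_ge0 ?mulr_ge0//; lra.
    by rewrite ler_wpM2l ?exprn_ge0// lerDr.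
  apply: (le_trans (ler_wpM2l (nc_ge0 _) h2)); rewrite mulrCA -mulrA ler_wpM2l ?exprn_ge0//.
- move=> x; apply/eqP; rewrite -normr_eq0 eq_le normr_ge0 andbT.
  apply/ler_addgt0Pr => e e0; rewrite add0r; have [N hN] := small x%:C e e0.
  apply: le_trans (hN N (leqnn _)); apply: le_trans (hP _ N).
  apply: le_trans (Im_le_nc _); by rewrite ImD ImN sincprod_real sub0r normrN.
- move=> x; rewrite nc_distC; have := hP x%:C 0%N.
  rewrite /sincprod big_ord0 /hpow expr0 mulr1 /Kc /= normr0 mulr0 expR0 mulr1 ncR => h.
  apply: (le_trans h); rewrite le_eqVlt; apply/orP; left; apply/eqP; ring.
Qed.

End RapidDecay.

(** * The identity theorem and translation invariance *)

Section IdentityTheorem.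
Context {R : realType}.
Notation C := R[i].

(** The Taylor coefficients at 0 vanish one after the other, since the first nonzero one
would dominate near 0. *)
Lemma ent1_real_zero (g : C -> C) : ent1 g -> (forall s : R, g s%:C = 0) -> forall z, g z = 0.
Proof.
move=> hg g0.
have a0 k : acoef g k = 0.
  elim/ltn_ind : k => m ih.
  apply/eqP; apply: contraT; rewrite -nc_gt0 => c0; set c := nc _ in c0.
  have [M hM] := bound_disc (fun w => cdiff_ccont (hg w)) 1.
  have M0 : 0 <= M by apply: le_trans (hM 0 _); rewrite ?nc_ge0// nc0.
  have M1 : 0 < 4 * M + 1 by rewrite ltr_wpDl// mulr_ge0.
  pose s := Num.min (1 / 2) (c / 2 / (4 * M + 1)).
  have s0 : 0 < s by rewrite lt_min !divr_gt0.
  have ss : nc (s%:C : C) = s by rewrite ncR ger0_norm// ltW.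
  have s1 : nc (s%:C : C) <= 1 / 2 by rewrite ss /s ge_min lexx.
  have := @taylor R g s%:C 1 M m.+1 hg ltr01 s1 (fun u u1 => hM u (eq_ind_r (fun x => x <= 1) (lexx 1) u1)).
  rewrite big_ord_recr /= big1; last by move=> i _; rewrite ih// mul0r.
  rewrite g0 !add0r ncN ncM ncX ss divr1 -/c exprS mulrA ler_pM2r ?exprn_gt0// => h.
  have h2 : s * (4 * M + 1) <= c / 2.
    by rewrite -ler_pdivlMr// /s ge_min lexx orbT.
  have h3 : 4 * M * s = s * (4 * M + 1) - s by ring.
  by move: h h2 h3 c0 s0; clearbody s; clearbody c; move: (s * _) (4 * M * s) => x y *; lra.
move=> z; apply/eqP; rewrite -nc_eq0; apply/eqP/le_anti; rewrite nc_ge0 andbT.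
pose r := 2 * nc z + 1.
have r0 : 0 < r by rewrite ltr_wpDl// mulr_ge0 ?nc_ge0.
have zr : nc z <= r / 2 by rewrite /r; have := nc_ge0 z; lra.
have [M hM] := bound_disc (fun w => cdiff_ccont (hg w)) r.
have M0 : 0 <= M by apply: le_trans (hM 0 _); rewrite ?nc_ge0// nc0 ltW.
apply/ler_addgt0Pr => e e0; rewrite add0r.
have [n hn] := half_pow_small (4 * M) e0; apply: le_trans hn.
have := @taylor R g z r M n hg r0 zr (fun u u1 => hM u (eq_ind_r (fun x => x <= r) (lexx r) u1)).
rewrite big1 ?subr0; last by move=> i _; rewrite a0 mul0r.
move=> h; apply: (le_trans h); apply: ler_wpM2l; first by rewrite mulr_ge0.
apply: lerXn2r; rewrite ?nnegrE ?divr_ge0 ?nc_ge0 ?(ltW r0) ?invr_ge0//.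
by rewrite ler_pdivrMr// mulrC.
Qed.

End IdentityTheorem.

Section Translation.
Context {R : realType}.
Notation C := R[i].
Notation leb := (@lebesgue_measure R).

Lemma ge0_integral_translate (G : R -> R) (h : R) : continuous G -> (forall x, 0 <= G x) ->
  (\int[leb]_x (G (x + h))%:E = \int[leb]_x (G x)%:E)%E.
Proof.
move=> cG G0.
have F' : derive1 (fun x : R => x + h : R) = fun=> 1.
  apply/funext => x; rewrite derive1E.
  have E : is_derive x (1 : R) (id + cst h) (1 + 0) by exact: is_deriveD.
  by rewrite -[LHS]/('D_1 (id + cst h) x) derive_val addr0.
rewrite [RHS](@increasing_ge0_integration_by_substitutionT R (fun x => x + h) G)//.
- by apply: eq_integral => x _; rewrite F' !fctE mulr1.
- by move=> x y; rewrite ltrD2r.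
- by rewrite F' => x; exact: cvg_cst.
- by rewrite F'; exact: is_cvg_cst.
- by rewrite F'; exact: is_cvg_cst.
- exact: cvg_addrr_Ny.
- exact: cvg_addrr.
Qed.

Lemma continuous_max0 (v : R -> R) : continuous v -> continuous (fun x => Num.max (v x) 0).
Proof. by move=> cv x; apply: continuous_max; [exact: cv|exact: cst_continuous]. Qed.

Lemma Rintegral_translate (v : R -> R) (h : R) : continuous v ->
  \int[leb]_x v (x + h) = \int[leb]_x v x.
Proof.
move=> cv; rewrite /Rintegral; congr fine.
rewrite [LHS]integralE [RHS]integralE; congr (_ - _)%E.
- rewrite -[RHS](_ : \int[leb]_x (Num.max (v x) 0)%:E = _)%E; last first.
    by apply: eq_integral => x _; rewrite funeposE EFin_max.
  rewrite -(@ge0_integral_translate (fun x => Num.max (v x) 0) h).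
  + by apply: eq_integral => x _; rewrite funeposE EFin_max.
  + exact: continuous_max0.
  + by move=> x; rewrite le_max lexx orbT.
- rewrite -[RHS](_ : \int[leb]_x (Num.max (- v x) 0)%:E = _)%E; last first.
    by apply: eq_integral => x _; rewrite funenegE EFin_max EFinN.
  rewrite -(@ge0_integral_translate (fun x => Num.max (- v x) 0) h).
  + by apply: eq_integral => x _; rewrite funenegE EFin_max EFinN.
  + by apply: (@continuous_max0 (fun x => - v x)) => x; exact: (@continuousN R R R v x (cv x)).
  + by move=> x; rewrite le_max lexx orbT.
Qed.

Lemma ent1_line_cont (f : C -> C) (w : C) : ent1 f ->
  continuous (fun u : R => Re (f (w + u%:C))) /\ continuous (fun u : R => Im (f (w + u%:C))).
Proof.
move=> hf.
have H x : ccat (fun u : R => f (w + u%:C)) x.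
  apply: ccatP => e e0; have [r r0 hr] := cdiff_ccont (hf (w + x%:C)) e0.
  exists r => // t ht; rewrite (_ : w + t%:C = w + x%:C + (t - x)%:C).
    by apply: hr; rewrite ncR.
  by rewrite rmorphB /=; ring.
by split=> x; have [] := H x.
Qed.

Lemma ent1_line_cmeas (D : set R) (f : C -> C) (w : C) : ent1 f -> measurable D ->
  cmeas D (fun u : measurableTypeR R => f (w + u%:C)).
Proof.
move=> hf mD; have [c1 c2] := ent1_line_cont w hf.
by split; apply: measurable_funTS; exact: continuous_measurable_fun.
Qed.

Lemma idec_translate (x u : R) : idec (x + u) <= 2 * (1 + x ^+ 2) * idec u.
Proof.
rewrite /idec; have := sqr_ge0 x; have := sqr_ge0 u; have := sqr_ge0 (x + u) => a b c.
rewrite ler_pdivlMr; last by lra.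
rewrite mulrC ler_pdivrMr; last by lra.
have := sqr_ge0 (2 * x + u); have := mulr_ge0 a c.
rewrite !sqrrD !mulrDr !mulrDl => d e; lra.
Qed.

Lemma integrable_idec (k : R) (D : set R) : measurable D ->
  leb.-integrable D (EFin \o (fun u => k * idec u)).
Proof.
move=> mD; apply: (@integrableS _ _ _ leb setT) => //.
have : leb.-integrable setT (EFin \o (@idec R)).
  apply/integrableP; split; first by apply/measurable_EFinP; exact: measurable_idec.
  under eq_integral => t _ do rewrite /= ger0_norm ?(ltW (idec_gt0 _))//.
  exact: integral_idec.
move=> h; rewrite (_ : _ \o _ = (fun u => k%:E * (idec u)%:E)%E); first exact: integrableZl.
by apply/funext => u /=; rewrite EFinM.
Qed.

End Translation.

(** * Cutoff functions *)

Lemma Rintegral_subT (R : realType) (D : set (measurableTypeR R)) (v : R -> R) : measurable D ->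
  (@lebesgue_measure R).-integrable setT (EFin \o v) -> (forall x, 0 <= v x) ->
  \int[@lebesgue_measure R]_(x in D) v x <= \int[@lebesgue_measure R]_x v x.
Proof.
move=> mD iv v0; have iv' := iv; rewrite -(setUv D) in iv'.
have D' : [disjoint D & ~` D] by apply/disj_setPS => x [].
rewrite -[X in _ <= Rintegral _ X _](setUv D) Rintegral_setU//; last exact: measurableC.
by rewrite lerDl; apply: Rintegral_ge0.
Qed.

Section Cutoff.
Context {R : realType}.
Notation C := R[i].
Notation leb := (@lebesgue_measure R).
Variables (psi : C -> C) (E : R -> R) (dl : R).
Hypothesis hpsi : ent1 psi.
Hypothesis E0 : forall y, 0 <= E y.
Hypothesis Emono : forall y y', 0 <= y -> y <= y' -> E y <= E y'.
Hypothesis psiE : forall w, nc (psi w) <= E `|Im w| * idec (Re w).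
Hypothesis psi_real : forall u : R, Im (psi u%:C) = 0 /\ 0 <= Re (psi u%:C).
Hypothesis dl0 : 0 < dl.
Hypothesis psi_low : forall u : R, `|u| <= dl -> 1 / 4 <= Re (psi u%:C).

Definition halfline (s : bool) : set (measurableTypeR R) := if s then `[0, +oo[%classic else `]-oo, 0[%classic.

Lemma measurable_halfline s : measurable (halfline s).
Proof. by case: s; exact: measurable_itv. Qed.

Lemma psi_shift (w : C) (u : R) :
  nc (psi (w + u%:C)) <= E `|Im w| * (2 * (1 + Re w ^+ 2)) * idec u.
Proof.
apply: (le_trans (psiE _)); rewrite ImD ReD /= addr0 -mulrA.
by apply: (ler_wpM2l (E0 _)); exact: idec_translate.
Qed.

Lemma psi_integrable (D : set (measurableTypeR R)) w : measurable D ->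
  cintegrable leb D (fun u : measurableTypeR R => psi (w + u%:C)).
Proof.
move=> mD; apply: (cintegrable_le mD (ent1_line_cmeas w hpsi mD) (integrable_idec _ mD)).
by move=> u _; exact: psi_shift.
Qed.

Definition cutint (D : set (measurableTypeR R)) (w : C) : C := cint leb D (fun u : measurableTypeR R => psi (w + u%:C)).

Lemma ent1_cutint (D : set (measurableTypeR R)) : measurable D -> ent1 (cutint D).
Proof.
move=> mD; apply: (ent1_cint mD (phi := fun w (u : measurableTypeR R) => psi (w + u%:C))).
- move=> u _ w; apply: (@cdiff_comp R (fun z => z + u%:C) psi); last exact: hpsi.
  by apply: cdiffD; [exact: cdiff_id|exact: cdiff_cst].
- by move=> w; exact: ent1_line_cmeas.
- move=> rho; exists (fun u => E rho * (2 * (1 + rho ^+ 2)) * idec u); split.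
    exact: integrable_idec.
  move=> w u hw _; apply: (le_trans (psi_shift _ _)); apply: (ler_wpM2r (ltW (idec_gt0 _))).
  apply: ler_pM; rewrite ?mulr_ge0 ?addr_ge0 ?sqr_ge0 ?E0//.
    by apply: Emono => //; exact: le_trans (Im_le_nc _) hw.
  rewrite ler_wpM2l// lerD2l -(real_normK (num_real (Re w))); apply: lerXn2r; rewrite ?nnegrE//.
    exact: le_trans (nc_ge0 w) hw.
  exact: le_trans (Re_le_nc _) hw.
Qed.

Lemma cutint_le (D : set (measurableTypeR R)) w a k : measurable D -> 0 <= a -> 0 <= k ->
  (forall u, D u -> a * nc (psi (w + u%:C)) <= k * idec u) ->
  a * nc (cutint D w) <= 2 * k * \int[leb]_u idec u.
Proof.
move=> mD; rewrite le_eqVlt => /predU1P[<-|a0] k0 h.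
  rewrite mul0r !mulr_ge0//; apply: Rintegral_ge0 => u _; exact/ltW/idec_gt0.
have {}h u : D u -> nc (psi (w + u%:C)) <= a^-1 * k * idec u.
  by move=> /h; rewrite -!mulrA -ler_pdivlMl.
have h' := cint_le mD (psi_integrable w mD) (integrable_idec _ mD) h.
rewrite -ler_pdivlMl//; apply: (le_trans h'); rewrite mulrCA -mulrA ler_wpM2l//.
have i1 : leb.-integrable setT (EFin \o @idec R).
  have := @integrable_idec R 1 setT measurableT.
  by rewrite (_ : (fun u => 1 * idec u) = @idec R)//; apply/funext => u; rewrite mul1r.
rewrite RintegralZl//; last exact: integrableS i1.
rewrite (mulrC a^-1) -mulrA; apply: (ler_wpM2l k0); rewrite ler_pM2l ?invr_gt0//; apply: Rintegral_subT => // u; exact/ltW/idec_gt0.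
Qed.

(** The integral over the whole line is invariant under real translations of [w], hence
constant on the real axis, and then everywhere. *)
Lemma cutint_const w : cutint setT w = cutint setT 0.
Proof.
apply/eqP; rewrite -subr_eq0; apply/eqP; move: w.
apply: ent1_real_zero.
  by move=> w; apply: cdiffB; [exact: (ent1_cutint measurableT)|exact: cdiff_cst].
move=> s; apply/eqP; rewrite subr_eq0; apply/eqP.
have [c1 c2] := ent1_line_cont 0 hpsi.
rewrite /cutint /cint -[in RHS](Rintegral_translate s c1) -[in RHS](Rintegral_translate s c2).
congr (_ +i* _); apply: eq_Rintegral => u _; rewrite add0r rmorphD /=.
all: by rewrite addrC.
Qed.

Lemma cutint_split w : cutint (halfline true) w + cutint (halfline false) w = cutint setT w.
Proof.
have [i1 i2] := psi_integrable w measurableT.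
have T : setT = halfline true `|` halfline false.
  apply/seteqP; split=> // u _; rewrite /halfline /= !in_itv /= andbT.
  by have [h|h] := leP 0 u; [left|right].
have D : [disjoint halfline true & halfline false].
  apply/disj_setPS => u [] /=; rewrite !in_itv /= andbT => a b.
  by move: (le_lt_trans a b); rewrite ltxx.
rewrite /cutint /cint T in i1 i2 *.
rewrite !Rintegral_setU//; try exact: measurable_halfline.
Qed.

Lemma cutint_total : dl / 2 <= nc (cutint setT 0).
Proof.
apply: le_trans (Re_le_nc _); apply: le_trans (ler_norm _); rewrite /cutint /=.
have [i1 _] := psi_integrable 0 measurableT.
have E1 : dl / 2 = \int[leb]_(u in `[- dl, dl]) (1 / 4).
  by rewrite Rint_cst; [field|have := ltW dl0; move: dl => x x0; lra].
rewrite E1.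
apply: (@le_trans _ _ (\int[leb]_(u in `[- dl, dl]) Re (psi (0 + u%:C)))).
  apply: le_Rintegral => //; first exact: cst_integrable.
    by apply: integrableS i1.
  move=> u; rewrite /= in_itv /= add0r => hu; apply: psi_low; by rewrite ler_norml.
apply: Rintegral_subT => //.
by move=> u; rewrite add0r; have [] := psi_real u.
Qed.

End Cutoff.

(** * Growth of order p *)

Section Growth.
Context {R : realType}.
Notation C := R[i].
Variable p : R.
Hypothesis p1 : 1 <= p.

Let p0 : 0 < p. Proof. exact: lt_le_trans p1. Qed.
Let p0' : 0 <= p. Proof. exact: ltW. Qed.

(** The radius at which the Cauchy estimate of the n-th Taylor coefficient is best, up
to constants, for a function bounded by exp (A |z| ^ p). *)
Definition rdn (n : nat) : R := n.+1%:R `^ p^-1.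

Lemma rdn_ge1 n : 1 <= rdn n.
Proof.
have -> : 1 = 1 `^ p^-1 :> R by rewrite powR1.
by apply: powR_mono; rewrite ?invr_ge0// ler1n.
Qed.

Lemma rdn_gt0 n : 0 < rdn n.
Proof. exact: lt_le_trans (rdn_ge1 n). Qed.

Lemma rdnp n : rdn n `^ p = n.+1%:R.
Proof. by rewrite /rdn -powRrM mulVf ?gt_eqF// powRr1. Qed.

Lemma young_rdn n (y : R) : 0 <= y -> n.+1%:R / rdn n * y <= n.+1%:R + y `^ p.
Proof.
move=> y0; have r0 := rdn_gt0 n; have [h|h] := leP y (rdn n).
  apply: (@le_trans _ _ n.+1%:R); last by rewrite lerDl powR_ge0.
  by rewrite -mulrA ler_piMr// mulrC ler_pdivrMr// mul1r.
apply: (@le_trans _ _ (y `^ p)); last by rewrite lerDr.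
have y0' : 0 < y by exact: lt_trans h.
have S (a : R) : 0 < a -> a `^ p = a * a `^ (p - 1).
  move=> a0; rewrite -{2}(powRr1 (ltW a0)) -powRD; last by rewrite (gt_eqF a0) implybT.
  by congr (_ `^ _); ring.
rewrite -rdnp (S _ r0) (mulrC (rdn n)) mulfK ?gt_eqF// (S _ y0') (mulrC y) ler_pM2r//.
by apply: powR_mono; [rewrite subr_ge0|exact: ltW|exact: ltW].
Qed.

Lemma le_exp_powR (y : R) : 0 <= y -> y <= expR (y `^ p).
Proof.
move=> y0; have [h|h] := leP y 1.
  by apply: (le_trans h); rewrite -expR0 ler_expR powR_ge0.
have := powR_ge_lin p1 y0; have := expR_ge1Dx (y `^ p); lra.
Qed.

Lemma pow_le_exp n (y : R) : 0 <= y -> (y / rdn n) ^+ n <= expR (y `^ p).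
Proof.
move=> y0; have r0 := rdn_gt0 n.
have q0 : 0 <= y / rdn n by rewrite divr_ge0// ltW.
apply: (@le_trans _ _ (expR ((y / rdn n) `^ p) ^+ n)).
  by apply: lerXn2r; rewrite ?nnegrE ?expR_ge0 ?le_exp_powR.
rewrite -expRM_natl ler_expR powRM ?invr_ge0 ?(ltW r0)//.
have -> : (rdn n)^-1 `^ p = n.+1%:R^-1.
  have n0 : n.+1%:R != 0 :> R by rewrite pnatr_eq0.
  apply: (mulIf n0); rewrite mulVf// -rdnp -powRM ?invr_ge0 ?(ltW r0)//.
  by rewrite mulVf ?gt_eqF// powR1.
rewrite mulrCA ler_piMr ?powR_ge0//.
by rewrite ler_pdivrMr ?ltr0n// mul1r ler_nat.
Qed.

Lemma powR_two (x y : R) : 0 <= x -> 0 <= y -> (x + y) `^ p <= 2 `^ p * (x `^ p + y `^ p).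
Proof.
move=> x0 y0; wlog xy : x y x0 y0 / x <= y.
  move=> W; have [h|h] := leP x y; first exact: W.
  by rewrite addrC (addrC (x `^ p)); apply: W => //; exact: ltW.
apply: (@le_trans _ _ ((2 * y) `^ p)).
  by apply: powR_mono => //; [rewrite addr_ge0|lra].
by rewrite powRM// ler_wpM2l ?powR_ge0// lerDr powR_ge0.
Qed.

(** The label of a coordinate tells on which side of the imaginary axis the function
decays, if on any. *)
Definition decays (tau : option bool) (x : R) : bool :=
  match tau with Some true => 0 <= x | Some false => x <= 0 | None => false end.

(** One factor of the growth bounds, for a single complex coordinate. *)
Definition gf (tau : option bool) (A : R) (N : nat) (w : C) : R :=
  expR (A * `|Im w| `^ p) *
  (if decays tau (Re w) then ((1 + `|Re w|) ^+ N)^-1 else expR (A * `|Re w| `^ p)).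

Lemma gf_gt0 tau A N w : 0 < gf tau A N w.
Proof.
rewrite mulr_gt0 ?expR_gt0//; case: ifP => _; rewrite ?expR_gt0//.
Qed.

Lemma gf_mono tau A A' N w : A <= A' -> gf tau A N w <= gf tau A' N w.
Proof.
move=> AA; have h (x : R) : expR (A * `|x| `^ p) <= expR (A' * `|x| `^ p).
  by rewrite ler_expR ler_wpM2r ?powR_ge0.
apply: ler_pM; rewrite ?expR_ge0//; case: ifP => _; rewrite ?expR_ge0//.
Qed.

Lemma gf_weak tau A N w : 0 <= A -> gf tau A N w <= gf None A N w.
Proof.
move=> A0; rewrite /gf /= ler_wpM2l ?expR_ge0//; case: ifP => // _.
apply: (@le_trans _ _ 1).
  by rewrite invf_le1 ?exprn_gt0 ?ltr_pwDl// exprn_ege1// lerDl.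
by rewrite -expR0 ler_expR mulr_ge0 ?powR_ge0.
Qed.

End Growth.

(** * The kernels *)

Section Kernel.
Context {R : realType}.
Notation C := R[i].
Notation leb := (@lebesgue_measure R).
Variables (P : C -> C) (p D : R).
Hypothesis p1 : 1 <= p.
Hypothesis D1 : 1 <= D.
Hypothesis hP : ent1 P.
Hypothesis Pdec : forall N, exists2 M : R, 0 <= M &
  forall w, nc (P w) * (1 + `|Re w|) ^+ N <= M * expR `|Im w|.
Hypothesis P_real : forall x : R, Im (P x%:C) = 0.
Hypothesis P_near1 : forall x : R, nc (P x%:C - 1) <= 8 * expR 1 * `|x|.

Let D0 : 0 < D. Proof. exact: lt_le_trans D1. Qed.

Local Notation r := (rdn p).
Let r1 n : 1 <= r n. Proof. exact: rdn_ge1. Qed.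
Let r0 n : 0 < r n. Proof. exact: rdn_gt0. Qed.
Let Dr n : 0 < D / r n. Proof. by rewrite divr_gt0. Qed.

Definition omega (n : nat) (w : C) : C := P w * csinc ((D / r n)%:C * w) ^+ n.+1.

Definition ckern (n : nat) (w : C) : C := omega n w ^+ 2.

Lemma ent1_ckern n : ent1 (ckern n).
Proof.
move=> w; apply: cdiffX; apply: cdiffM; first exact: hP.
apply: (@cdiffX R (fun w => csinc ((D / r n)%:C * w))).
apply: (@cdiff_comp R (fun w => (D / r n)%:C * w)); last exact: ent1_csinc.
by apply: cdiffM; [exact: cdiff_cst|exact: cdiff_id].
Qed.

(** The growth of the kernel along the imaginary axis: Young's inequality applied to the
2 (n + 1) cardinal sines, and the type of the rapidly decreasing factor. *)
Definition kgrow (n : nat) (y : R) : R := expR (2 * (n.+1%:R + (D * y) `^ p) + 2 * y).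

Lemma kgrow_gt0 n y : 0 < kgrow n y.
Proof. exact: expR_gt0. Qed.

Lemma kgrow_mono n y y' : 0 <= y -> y <= y' -> kgrow n y <= kgrow n y'.
Proof.
move=> y0 yy; rewrite ler_expR.
have : (D * y) `^ p <= (D * y') `^ p.
  apply: powR_mono; first exact: le_trans p1.
    by rewrite mulr_ge0// ltW.
  by rewrite ler_wpM2l// ltW.
lra.
Qed.

(** At most [n] of the 2 (n + 1) cardinal sines are spent to absorb powers of the
argument. *)
Lemma ckern_decay N : exists2 M, 0 <= M & forall n k w, (k <= n)%N ->
  (D * nc w / r n) ^+ k * nc (ckern n w) <=
  M * kgrow n `|Im w| * (((1 + `|Re w|) ^+ N)^-1 * idec (Re w)).
Proof.
have [M1 M10 h1] := Pdec N; have [M2 M20 h2] := Pdec 2.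
exists (M1 * M2) => [|n k w kn]; first exact: mulr_ge0.
set x := Re w in h1 h2 *; set y := Im w in h1 h2 *.
pose s := (D / r n)%:C * w; pose S := nc (csinc s); pose e := expR (D / r n * `|y|).
have ns : nc s = D * nc w / r n by rewrite nc_scale 1?mulrAC// ltW.
have Ss : S <= e by have := nc_csinc s; rewrite Im_scale// ltW.
have Sd : nc s * S <= e by have := nc_csinc_decay s; rewrite Im_scale// ltW.
have S0 : 0 <= S by exact: nc_ge0.
have s0 : 0 <= nc s by exact: nc_ge0.
have e0 : 0 <= e by exact: expR_ge0.
have K1 : nc s ^+ k * S ^+ (2 * n.+1) <= expR (2 * (n.+1%:R + (D * `|y|) `^ p)).
  apply: (@le_trans _ _ (e ^+ (2 * n.+1))).
    have kk : (k <= 2 * n.+1)%N by rewrite (leq_trans (leqW kn))// leq_pmull.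
    rewrite -{1}(subnKC kk) exprD mulrA -exprMn -[in leRHS](subnKC kk) exprD.
    by apply: ler_pM; rewrite ?exprn_ge0 ?mulr_ge0//; apply: lerXn2r; rewrite ?nnegrE ?mulr_ge0.
  rewrite -expRM_natl ler_expR natrM -mulrA ler_wpM2l//.
  rewrite (_ : _ * _ = n.+1%:R / r n * (D * `|y|)); last by ring.
  by apply: young_rdn => //; rewrite mulr_ge0// ltW.
have K2 : nc (P w) ^+ 2 <= M1 * M2 * expR (2 * `|y|) * (((1 + `|x|) ^+ N)^-1 * idec x).
  have a0 : 0 < (1 + `|x|) ^+ N by rewrite exprn_gt0// ltr_pwDl.
  have b0 : 0 < (1 + `|x|) ^+ 2 by rewrite exprn_gt0// ltr_pwDl.
  have k1 : nc (P w) <= M1 * expR `|y| / (1 + `|x|) ^+ N by rewrite ler_pdivlMr.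
  have k2 : nc (P w) <= M2 * expR `|y| / (1 + `|x|) ^+ 2 by rewrite ler_pdivlMr.
  rewrite expr2; apply: (le_trans (ler_pM (nc_ge0 _) (nc_ge0 _) k1 k2)).
  rewrite (_ : 2 * `|y| = `|y| + `|y|) ?expRD; last by ring.
  have R4 (a a' b b' c : R) : a * b * c * (a' * b * b') = a * a' * (b * b) * (c * b').
    by ring.
  rewrite R4.
  apply: ler_wpM2l; first by rewrite !mulr_ge0 ?expR_ge0.
  rewrite ler_pM2l ?invr_gt0// /idec lef_pV2 ?posrE//; last by have := sqr_ge0 x; lra.
  rewrite -[X in _ + X <= _](real_normK (num_real x)) sqrrD expr1n.
  have := normr_ge0 x; rewrite !mul1r; move: `|x| => a; rewrite mulr2n; lra.
rewrite /ckern /omega ncX ncM ncX -/s -/S -ns exprMn -exprM mulnC.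
rewrite /kgrow expRD.
rewrite (_ : _ * (_ * _) = (nc s ^+ k * S ^+ (2 * n.+1)) * nc (P w) ^+ 2); last by ring.
rewrite [leRHS](_ : _ = expR (2 * (n.+1%:R + (D * `|y|) `^ p)) * (M1 * M2 * expR (2 * `|y|) * (((1 + `|x|) ^+ N)^-1 * idec x))); last by ring.
apply: ler_pM K1 K2; rewrite ?mulr_ge0 ?exprn_ge0//; exact: nc_ge0.
Qed.

Lemma ckern_real n (u : R) : Im (ckern n u%:C) = 0 /\ Re (ckern n u%:C) = nc (omega n u%:C) ^+ 2.
Proof.
have hom : Im (omega n u%:C) = 0.
  rewrite /omega; have : Im (csinc ((D / r n)%:C * u%:C) ^+ n.+1) = 0.
    rewrite -rmorphM; move: (csinc_real (D / r n * u)); move: (csinc _) => c c0.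
    elim: (n.+1) => [|m ih]; first by rewrite expr0.
    by rewrite exprS !ReIm c0 ih mulr0 mul0r addr0.
  by move=> h; rewrite !ReIm h P_real mulr0 mul0r addr0.
rewrite /ckern (@nc_sqr _ (omega _ _)) hom (_ : omega n u%:C ^+ 2 = omega n u%:C * omega n u%:C)//.
move: (omega n u%:C) hom => q hom.
by rewrite !ReIm hom !mulr0 !mul0r addr0 subr0 expr0n /= addr0 expr2.
Qed.

Lemma bernoulli_sub m (a : R) : 0 <= a -> a <= 1 -> 1 - m%:R * a <= (1 - a) ^+ m.
Proof.
move=> a0 a1; elim: m => [|m ih]; first by rewrite mul0r subr0 expr0.
have h : (1 - m%:R * a) * (1 - a) <= (1 - a) ^+ m * (1 - a).
  by apply: ler_wpM2r ih; rewrite subr_ge0.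
rewrite exprSr; apply: le_trans h; rewrite -natr1.
have : 0 <= m%:R * a * a by rewrite !mulr_ge0.
rewrite !mulrDl !mulrDr !mulrN !mulNr opprK !mul1r !mulr1; lra.
Qed.

(** The half-width of an interval on which the kernel stays above 1/4: the constant
keeps [P] above 3/4 and the power of the cardinal sine above 7/8 there. *)
Definition core (n : nat) : R := (32 * expR 1 * D * n.+1%:R)^-1.

Lemma core_gt0 n : 0 < core n.
Proof. by rewrite invr_gt0 !mulr_gt0// expR_gt0. Qed.

Lemma ckern_low n (u : R) : `|u| <= core n -> 1 / 4 <= Re (ckern n u%:C).
Proof.
move=> hu; rewrite (ckern_real n u).2 (_ : 1 / 4 = (1 / 2) ^+ 2); last by field.
apply: lerXn2r; rewrite ?nnegrE ?nc_ge0// /omega ncM ncX.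
have n1 : 1 <= n.+1%:R :> R by rewrite ler1n.
have e0 : 0 < expR 1 :> R by exact: expR_gt0.
pose a := 4 * expR 1 * (D / r n) * `|u|.
have a0 : 0 <= a by rewrite /a mulr_ge0// (mulr_ge0 _ (ltW (Dr n)))// mulr_ge0// ltW.
have hU : 32 * expR 1 * D * n.+1%:R * `|u| <= 1.
  by rewrite mulrC -ler_pdivlMr ?div1r// !mulr_gt0.
have eD : expR 1 * `|u| <= 1 / 32.
  have : 32 * expR 1 * 1 * 1 * `|u| <= 32 * expR 1 * D * n.+1%:R * `|u|.
    apply: ler_wpM2r => //; apply: ler_pM; rewrite ?mulr_ge0 ?(ltW e0)//.
    by apply: ler_wpM2l => //; rewrite mulr_ge0// ltW.
  move/le_trans => /(_ _ hU); rewrite !mulr1; move: (expR 1) => q; lra.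
have na : n.+1%:R * a <= 1 / 8.
  have : a <= 4 * expR 1 * D * `|u|.
    apply: ler_wpM2r => //; rewrite ler_wpM2l ?mulr_ge0 ?(ltW e0)//.
    by rewrite ler_pdivrMr// ler_peMr// ltW.
  move=> h; have := ler_wpM2l (ler0n R n.+1) h; move/le_trans; apply.
  move: hU; rewrite (_ : n.+1%:R * _ = 32 * expR 1 * D * n.+1%:R * `|u| / 8); last by field.
  lra.
have a1 : a <= 1.
  have : 1 * a <= n.+1%:R * a by apply: ler_wpM2r.
  rewrite mul1r; lra.
have p3 : 3 / 4 <= nc (P u%:C).
  have := P_near1 u; rewrite -mulrA => h.
  have := nc_le_dist 1 (P u%:C); rewrite nc1 (nc_distC 1); lra.
have s3 : 1 - a <= nc (csinc ((D / r n)%:C * u%:C)).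
  have := nc_csinc_sub1 ((D / r n)%:C * u%:C).
  rewrite Im_scale ?nc_scale ?(ltW (Dr n))// ncR /= normr0 mulr0 expR0 mulr1.
  rewrite mulrA -/a => h.
  have := nc_le_dist 1 (csinc ((D / r n)%:C * u%:C)); rewrite nc1 (nc_distC 1); lra.
have s4 : 7 / 8 <= nc (csinc ((D / r n)%:C * u%:C)) ^+ n.+1.
  apply: (@le_trans _ _ ((1 - a) ^+ n.+1)).
    apply: le_trans (bernoulli_sub n.+1 a0 a1); lra.
  by apply: lerXn2r; rewrite ?nnegrE ?nc_ge0 ?subr_ge0.
apply: (@le_trans _ _ (3 / 4 * (7 / 8))); first lra.
by apply: ler_pM.
Qed.

End Kernel.

(** * Splitting the monomials *)

Section MonomialSplit.
Context {R : realType}.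
Notation C := R[i].
Notation leb := (@lebesgue_measure R).

Lemma idec_anti (u v : R) : `|u| <= `|v| -> idec v <= idec u.
Proof.
move=> uv; rewrite /idec lef_pV2 ?posrE ?ltr_pwDl ?sqr_ge0// lerD2l.
by rewrite -(real_normK (num_real u)) -(real_normK (num_real v)); apply: lerXn2r; rewrite ?nnegrE.
Qed.

Lemma halfline_far s (x u : R) : decays (Some s) x -> halfline s u ->
  `|x| <= `|x + u| /\ `|u| <= `|x + u|.
Proof.
case: s => /= x0; rewrite in_itv /= ?andbT => u0.
  by rewrite !ger0_norm ?addr_ge0//; split; [rewrite lerDl|rewrite lerDr].
have u0' := ltW u0.
have xu : x + u <= 0 by rewrite -(addr0 0) lerD.
by rewrite !ler0_norm// opprD; split; [rewrite lerDl|rewrite lerDr]; rewrite oppr_ge0.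
Qed.

(** Multiplying w ^+ n by a smoothed indicator function of a half-plane, obtained by
integrating a kernel over a half-line, splits it into two entire functions, each
decaying in one direction of the real axis. The kernel depends on [n]: its width,
proportional to [rdn p n], and the number of its factors are tuned so that the loss is
beaten by the decay of the Taylor coefficients of functions of order [p]. *)
Theorem monomial_split (p A0 : R) : 1 <= p -> 0 <= A0 ->
  exists A (M : nat -> bool -> C -> C), [/\ 0 <= A,
    forall n s, ent1 (M n s),
    forall n w, M n true w + M n false w = w ^+ n &
    forall N, exists2 K, 0 <= K & forall n s w,
      expR (A0 * n.+1%:R) / (rdn p n) ^+ n * nc (M n s w) <= K * 2^-1 ^+ n * gf p (Some s) A N w].
Proof.
move=> p1 A00; have [P [hP Pdec Pr P1]] := @rapid_exp_type R.
(* [D ^- n] absorbs exp (A0 n), the exp (2 n) from the growth of the kernel and the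
factor n + 1 from its normalisation, and still leaves 2 ^- n. *)
pose D : R := 2 * expR (A0 + 3).
have D1 : 1 <= D.
  have : 1 <= expR (A0 + 3) by rewrite -expR0 ler_expR addr_ge0.
  by rewrite /D; lra.
have D0 : 0 < D by exact: lt_le_trans D1.
have Kp n y := kgrow_gt0 p D n y.
have ek n := @ent1_ckern R P p D hP n.
have pp : 0 <= p by exact: le_trans p1.
have [M0 M00 hM0] := ckern_decay p1 D1 Pdec 0.
have E00 n y : 0 <= M0 * kgrow p D n y by rewrite mulr_ge0// ltW.
have Em n y y' : 0 <= y -> y <= y' -> M0 * kgrow p D n y <= M0 * kgrow p D n y'.
  by move=> y0 yy; rewrite ler_wpM2l// kgrow_mono.
have hE n w : nc (ckern P p D n w) <= M0 * kgrow p D n `|Im w| * idec (Re w).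
  by have := hM0 n 0%N w (leq0n n); rewrite !expr0 mul1r invr1 mul1r.
have kr n (u : R) : Im (ckern P p D n u%:C) = 0 /\ 0 <= Re (ckern P p D n u%:C).
  by have [h1 h2] := ckern_real p D Pr n u; rewrite h2 sqr_ge0.
pose cut n D' w := cutint (ckern P p D n) D' w.
have I_low n : core D n / 2 <= nc (cut n setT 0).
  exact: (cutint_total (ek n) (E00 n) (hE n) (kr n) (core_gt0 D1 n) (fun u => @ckern_low R P p D p1 D1 Pr P1 n u)).
have I_gt0 n : 0 < nc (cut n setT 0).
  by apply: lt_le_trans (I_low n); rewrite divr_gt0// core_gt0.
have I_neq0 n : cut n setT 0 != 0 by rewrite -nc_gt0.
pose M n s w := w ^+ n * (cut n (halfline s) w / cut n setT 0).
pose Id : R := \int[leb]_u idec u.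
have Id0 : 0 <= Id by apply: Rintegral_ge0 => u _; exact/ltW/idec_gt0.
pose A := 2 * D `^ p + 2 + 2 `^ p * D `^ p.
have A1 : 0 <= D `^ p by exact: powR_ge0.
have A2 : 0 <= 2 `^ p * D `^ p by rewrite mulr_ge0 ?powR_ge0.
exists A, M; split.
- rewrite /A; lra.
- move=> n s w; apply: cdiffM; first by apply: cdiffX; exact: cdiff_id.
  apply: cdiffM; last exact: cdiff_cst.
  exact: (ent1_cutint (ek n) (E00 n) (Em n) (hE n) (measurable_halfline s)).
- move=> n w; rewrite /M -mulrDr -mulrDl (cutint_split (ek n) (E00 n) (hE n)).
  by rewrite (cutint_const (ek n) (E00 n) (Em n) (hE n)) -/(cut n setT 0) divff// mulr1.
move=> N; have [MN MN0 hMN] := ckern_decay p1 D1 Pdec N.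
pose Kc := 4 * (MN + M0) * Id.
have Kc0 : 0 <= Kc by rewrite !mulr_ge0 ?addr_ge0.
exists (Kc * (64 * expR 1 * D) * (D / 2) * expR 4).
  apply: mulr_ge0 (expR_ge0 _); apply: mulr_ge0; last by rewrite divr_ge0// ltW.
  apply: (mulr_ge0 Kc0); apply: mulr_ge0 (ltW D0); by rewrite mulr_ge0 ?expR_ge0.
move=> n s w; set x := Re w; set y := Im w; set r := rdn p n.
have r0 : 0 < r by exact: rdn_gt0.
pose G := if decays (Some s) x then ((1 + `|x|) ^+ N)^-1 else (1 + x ^+ 2) * expR ((D * nc w) `^ p).
have G0 : 0 <= G.
  rewrite /G; case: ifP => _; first by rewrite invr_ge0 exprn_ge0// addr_ge0.
  by rewrite mulr_ge0 ?expR_ge0// addr_ge0 ?sqr_ge0.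
have q0 : 0 <= D * nc w / r by rewrite !mulr_ge0 ?invr_ge0 ?nc_ge0 ?(ltW D0) ?(ltW r0).
have Kn0 := ltW (Kp n `|y|).
have Z1 (a b c : R) : 0 <= a * b * c -> 2 * (MN * a * c) * b <= 4 * (MN + M0) * b * a * c.
  move=> z; rewrite (_ : 2 * _ * b = 2 * MN * (a * b * c)); last by ring.
  rewrite [leRHS](_ : _ = 4 * (MN + M0) * (a * b * c)); last by ring.
  by apply: (ler_wpM2r z); lra.
have Z2 (a b c e : R) : 0 <= a * b * (c * e) ->
    e * (2 * (M0 * a * (2 * c)) * b) <= 4 * (MN + M0) * b * a * (c * e).
  move=> z; rewrite (_ : e * _ = 4 * M0 * (a * b * (c * e))); last by ring.
  rewrite [leRHS](_ : _ = 4 * (MN + M0) * (a * b * (c * e))); last by ring.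
  by apply: (ler_wpM2r z); lra.
have main : (D * nc w / r) ^+ n * nc (cut n (halfline s) w) <= Kc * kgrow p D n `|y| * G.
  rewrite /G; case: ifP => hs.
    have k0 : 0 <= MN * kgrow p D n `|y| * ((1 + `|x|) ^+ N)^-1.
      by rewrite !mulr_ge0 ?invr_ge0 ?exprn_ge0 ?addr_ge0.
    have := cutint_le (ek n) (E00 n) (hE n) (measurable_halfline s) (exprn_ge0 n q0) k0.
    move=> /(_ w) T; apply: (le_trans (T _)).
      move=> u hu; have [f1 f2] := halfline_far hs hu.
      have := hMN n n (w + u%:C) (leqnn n).
      rewrite ReD ImD /= addr0 -/x -/y => h.
      have a1 : (D * nc w / r) ^+ n <= (D * nc (w + u%:C) / r) ^+ n.
        have a2 : nc w <= nc (w + u%:C).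
          apply: le_sqr; first exact: nc_ge0.
          rewrite !nc_sqr ReD ImD /= addr0 lerD2r.
          rewrite -(real_normK (num_real (Re w))) -(real_normK (num_real (Re w + u))).
          by apply: lerXn2r; rewrite ?nnegrE.
        apply: lerXn2r; rewrite ?nnegrE ?mulr_ge0 ?invr_ge0 ?nc_ge0 ?(ltW D0) ?(ltW r0)//.
        by rewrite ler_pM2r ?invr_gt0// ler_pM2l.
      apply: (le_trans (ler_wpM2r (nc_ge0 _) a1)); apply: (le_trans h).
      rewrite -[leRHS]mulrA; apply: ler_wpM2l; first by rewrite mulr_ge0.
      apply: ler_pM; rewrite ?(ltW (idec_gt0 _)) ?invr_ge0 ?exprn_ge0 ?addr_ge0//; last exact: idec_anti.
      rewrite lef_pV2 ?posrE ?exprn_gt0 ?ltr_pwDl//.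
      by apply: lerXn2r; rewrite ?nnegrE ?addr_ge0// lerD2l.
    rewrite -/Id /Kc; have c0 : 0 <= ((1 + `|x|) ^+ N)^-1 by rewrite invr_ge0 exprn_ge0// addr_ge0.
    exact: (Z1 _ _ _ (mulr_ge0 (mulr_ge0 Kn0 Id0) c0)).
  have k0 : 0 <= M0 * kgrow p D n `|y| * (2 * (1 + x ^+ 2)).
    by rewrite !mulr_ge0 ?addr_ge0 ?sqr_ge0.
  have := cutint_le (ek n) (E00 n) (hE n) (measurable_halfline s) ler01 k0.
  move=> /(_ w) T.
  have {T} : nc (cut n (halfline s) w) <= 2 * (M0 * kgrow p D n `|y| * (2 * (1 + x ^+ 2))) * Id.
    rewrite -[leLHS]mul1r; apply: T => u _; rewrite mul1r.
    exact: (psi_shift (E00 n) (hE n)).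
  have T2 := pow_le_exp p1 n (mulr_ge0 (ltW D0) (nc_ge0 w)).
  move=> T1; apply: (le_trans (ler_pM (exprn_ge0 _ q0) (nc_ge0 _) T2 T1)).
  rewrite /Kc; have c0 := mulr_ge0 (mulr_ge0 Kn0 Id0) G0.
  by move: c0; rewrite /G hs; exact: Z2.
have F : expR (A0 * n.+1%:R) * n.+1%:R * kgrow p D n `|y| <=
    (D / 2) ^+ n.+1 * expR (2 * (D * `|y|) `^ p + 2 * `|y|).
  have m1 : n.+1%:R <= expR n.+1%:R :> R by have := expR_ge1Dx (n.+1%:R : R); lra.
  rewrite (_ : D / 2 = expR (A0 + 3)); last by rewrite /D mulrC mulKf.
  rewrite -expRM_natr.
  apply: (@le_trans _ _ (expR (A0 * n.+1%:R) * expR n.+1%:R * kgrow p D n `|y|)).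
    by apply: (ler_wpM2r Kn0); apply: (ler_wpM2l (expR_ge0 _)).
  rewrite /kgrow -!expRD le_eqVlt; apply/orP; left; apply/eqP; congr expR; ring.
have H : expR (2 * (D * `|y|) `^ p + 2 * `|y|) * G <= expR 4 * gf p (Some s) A N w.
  have y0 := normr_ge0 y; have x0 := normr_ge0 x.
  have y1 := powR_ge_lin p1 y0; have x1 := powR_ge_lin p1 x0.
  have yp := powR_ge0 `|y| p; have xp := powR_ge0 `|x| p.
  have Ep (t : R) : 0 <= t -> (D * t) `^ p = D `^ p * t `^ p by move=> t0; rewrite powRM// ltW.
  have AY : 0 <= 2 `^ p * D `^ p * `|y| `^ p by rewrite mulr_ge0.
  have DX : 0 <= D `^ p * `|x| `^ p by rewrite mulr_ge0.
  rewrite (Ep _ y0) /gf /G -/x -/y; case: ifP => hs.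
    rewrite [leRHS]mulrA ler_pM2r; last by rewrite invr_gt0 exprn_gt0// ltr_pwDl.
    rewrite -expRD ler_expR /A.
    move: AY y1; rewrite !mulrDl; move: (D `^ p) (2 `^ p) (`|y| `^ p) => *; lra.
  have w1 : (D * nc w) `^ p <= 2 `^ p * (D `^ p * `|x| `^ p + D `^ p * `|y| `^ p).
    rewrite -!Ep//; apply: le_trans (powR_two p1 _ _); rewrite ?mulr_ge0 ?(ltW D0)//.
    apply: powR_mono => //; first by rewrite mulr_ge0 ?nc_ge0 ?(ltW D0).
    by rewrite -mulrDr ler_wpM2l ?nc_le_ReIm ?(ltW D0).
  have x2 : 1 + x ^+ 2 <= expR (2 * `|x|).
    apply: (@le_trans _ _ ((1 + `|x|) ^+ 2)).
      rewrite -[X in _ + X <= _](real_normK (num_real x)) sqrrD expr1n mul1r mulr2n; lra.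
    rewrite (_ : 2 * `|x| = `|x| * 2%:R); last by ring.
    rewrite expRM_natr; apply: lerXn2r; rewrite ?nnegrE ?expR_ge0 ?addr_ge0//.
    exact: expR_ge1Dx.
  apply: (@le_trans _ _ (expR (2 * (D `^ p * `|y| `^ p) + 2 * `|y|) * (expR (2 * `|x|) * expR ((D * nc w) `^ p)))).
    by apply: (ler_wpM2l (expR_ge0 _)); apply: (ler_wpM2r (expR_ge0 _)).
  rewrite -!expRD ler_expR /A.
  move: w1 AY DX y1 x1; rewrite !mulrDl !mulrDr !mulrA; move: (_ `^ p) => a.
  move: (D `^ p) (2 `^ p) (`|y| `^ p) (`|x| `^ p) => *; lra.
have Iinv : (nc (cut n setT 0))^-1 <= 64 * expR 1 * D * n.+1%:R.
  have h : (nc (cut n setT 0))^-1 <= (core D n / 2)^-1.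
    by rewrite lef_pV2 ?posrE// divr_gt0// core_gt0.
  apply: (le_trans h); rewrite /core invfM !invrK; rewrite le_eqVlt; apply/orP; left; apply/eqP; ring.
have E1 : expR (A0 * n.+1%:R) / r ^+ n * nc (M n s w) =
   expR (A0 * n.+1%:R) * (D ^- n * ((D * nc w / r) ^+ n * nc (cut n (halfline s) w)) * (nc (cut n setT 0))^-1).
  have EA (e a q c i b d : R) : b * d = 1 -> e * a * (q * (c * i)) = e * (b * (d * q * a * c) * i).
    by move=> bd; rewrite -[LHS]mul1r -bd; ring.
  rewrite /M (ncM (w ^+ n)) ncX (ncM (cut n _ w)) ncV (exprMn n (D * nc w)) (exprMn n D) exprVn.
  by apply: EA; rewrite mulVf// expf_neq0// gt_eqF.
rewrite E1.
have Dn0 : 0 <= D ^- n by rewrite invr_ge0 exprn_ge0// ltW.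
have step1 : D ^- n * ((D * nc w / r) ^+ n * nc (cut n (halfline s) w)) * (nc (cut n setT 0))^-1 <=
    D ^- n * (Kc * kgrow p D n `|y| * G) * (64 * expR 1 * D * n.+1%:R).
  apply: ler_pM Iinv; rewrite ?invr_ge0 ?nc_ge0//.
    by apply: mulr_ge0 => //; rewrite mulr_ge0 ?nc_ge0 ?exprn_ge0.
  exact: ler_wpM2l.
apply: (le_trans (ler_wpM2l (expR_ge0 _) step1)).
have C0 : 0 <= Kc * (64 * expR 1 * D).
  apply: (mulr_ge0 Kc0); apply: mulr_ge0 (ltW D0); by rewrite mulr_ge0 ?expR_ge0.
have RA (e b K k g q m : R) : e * (b * (K * k * g) * (q * m)) = K * q * (b * (e * m * k) * g) by ring.
have RB (c d e h g : R) : c * d * e * h * g = c * (d * (h * (e * g))) by ring.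
rewrite [leLHS]RA [leRHS]RB; apply: (ler_wpM2l C0).
apply: (le_trans (ler_wpM2r G0 (ler_wpM2l Dn0 F))).
have Dn : D ^- n * (D / 2) ^+ n.+1 = D / 2 * 2^-1 ^+ n.
  by rewrite exprS (exprMn n D) mulrCA mulKf// expf_neq0// gt_eqF.
have RC (a b c g : R) : a * (b * c) * g = a * b * (c * g) by ring.
rewrite RC Dn -mulrA; apply: ler_wpM2l; first by rewrite divr_ge0// ltW.
by apply: (ler_wpM2l _ H); rewrite exprn_ge0// invr_ge0.
Qed.

End MonomialSplit.

(** * Taylor coefficients with respect to one variable *)

Section EntireClosure.
Context {R : realType} {d : nat}.
Notation C := R[i].
Notation V := 'rV[C]_d.

Lemma entire_coord (g : C -> C) (j : 'I_d) : ent1 g -> entire (fun z : V => g (z 0 j) : C^o).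
Proof.
move=> hg; apply/entireP; split.
  move=> z v; rewrite (_ : (fun s => _) = fun s : C => g (z 0 j + s * v 0 j)); last first.
    by apply/funext => s; rewrite !mxE.
  move=> w; apply: (@cdiff_comp R (fun s => z 0 j + s * v 0 j) g); last exact: hg.
  by apply: cdiffD; [exact: cdiff_cst|apply: cdiffM; [exact: cdiff_id|exact: cdiff_cst]].
move=> z; have [M hM] := bound_disc (fun w => cdiff_ccont (hg w)) (cn z + 1).
exists 1, M; split=> // h hh; apply: hM; apply: le_trans (le_cn _ j) _.
by apply: (le_trans (cnD _ _)); rewrite lerD2l.
Qed.

Lemma entireM (f g : cfun R d) : entire f -> entire g -> entire (fun z => f z * g z : C^o).
Proof.
move=> /entireP[f1 f2] /entireP[g1 g2]; apply/entireP; split.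
  move=> z v w; apply: cdiffM; [exact: f1|exact: g1].
move=> z; have [r [M [r0 h1]]] := f2 z; have [r' [M' [r'0 h2]]] := g2 z.
exists (Num.min r r'), (M * M'); split; first by rewrite lt_min r0.
move=> h; rewrite le_min => /andP[hh hh']; rewrite ncM.
by apply: ler_pM; rewrite ?nc_ge0 ?h1 ?h2.
Qed.

Variable j : 'I_d.
Local Notation ej := (delta_mx 0 j : V).

Definition drop_coord (z : V) : V := z - z 0 j *: ej.

Lemma drop_coordE z i : drop_coord z 0 i = if i == j then 0 else z 0 i.
Proof.
rewrite !mxE eqxx /=; case: eqP => [->|_]; first by rewrite mulr1 subrr.
by rewrite mulr0 subr0.
Qed.

Lemma drop_coordK z : drop_coord z + z 0 j *: ej = z.
Proof. exact: subrK. Qed.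

Lemma drop_coord_at z (s : C) : (drop_coord z + s *: ej) 0 j = s.
Proof. by rewrite mxE drop_coordE eqxx add0r !mxE !eqxx mulr1. Qed.

Lemma drop_coord_off z (s : C) i : i != j -> (drop_coord z + s *: ej) 0 i = z 0 i.
Proof.
by move=> ij; rewrite mxE drop_coordE (negbTE ij) !mxE (negbTE ij) andbF mulr0 addr0.
Qed.

Lemma drop_coord_line z v (t : C) :
  drop_coord (z + t *: v) = drop_coord z + t *: drop_coord v.
Proof.
rewrite /drop_coord !mxE scalerBr scalerDl opprD scalerA.
by rewrite addrACA.
Qed.

Lemma cn_drop z : cn (drop_coord z) <= cn z.
Proof.
apply: (cn_leP (cn_ge0 z)) => i; rewrite drop_coordE; case: eqP => _; last exact: le_cn.
by rewrite nc0 cn_ge0.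
Qed.

Lemma cn_ej : cn ej <= 1.
Proof.
apply: cn_leP => // i; rewrite mxE; case: eqP => _ /=; case: (i == j); rewrite ?nc0 ?nc1//.
Qed.

(** Taylor coefficients with respect to the j-th variable, as functions of the
others. *)
Definition pcoef (f : cfun R d) (n : nat) : cfun R d :=
  fun z => acoef (fun s : C => f (drop_coord z + s *: ej)) n.

Lemma entire_pcoef f n : entire f -> entire (pcoef f n).
Proof.
move=> hf; apply/entireP.
have eb := entire_bounded hf.
have nce (t : R) : nc (cexp (0 +i* t)) = 1 by rewrite nc_cexp expR0.
have cnle (z v : V) (w u : C) rho : nc w <= rho -> nc u = 1 ->
    cn (drop_coord z + w *: drop_coord v + u *: ej) <= cn z + rho * cn v + 1.
  move=> hw hu; apply: (le_trans (cnD _ _)); apply: lerD.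
    apply: (le_trans (cnD _ _)); apply: lerD; first exact: cn_drop.
    apply: (le_trans (cnZ _ _)); apply: ler_pM; rewrite ?nc_ge0 ?cn_ge0 ?cn_drop//.
  by apply: (le_trans (cnZ _ _)); rewrite hu mul1r cn_ej.
split.
  move=> z v.
  pose phi (w : C) (t : R) := f (drop_coord z + w *: drop_coord v + cexp (0 +i* t) *: ej) * (cexp (0 +i* t))^-1 ^+ n.
  rewrite (_ : (fun s => _) = fun w : C => ((2 * pi)^-1)%:C * cint (@lebesgue_measure R) `[(- pi)%R, pi] (phi w)); last first.
    by apply/funext => w; rewrite /pcoef /acoef /vint /cI drop_coord_line.
  move=> w0; apply: cdiffM; first exact: cdiff_cst.
  have mI : measurable (`[(- pi)%R, pi]%classic : set (measurableTypeR R)) by exact: measurable_itv.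
  apply: (@ent1_cint R _ (measurableTypeR R) (@lebesgue_measure R) `[(- pi)%R, pi]%classic phi mI).
  - move=> t _ w; apply: cdiffM; last exact: cdiff_cst.
    rewrite (_ : (fun w => _) = fun w : C => f (drop_coord z + cexp (0 +i* t) *: ej + w *: drop_coord v)).
      exact: entire_line.
    by apply/funext => u; rewrite addrAC.
  - move=> w; apply: cintegrable_meas.
    apply: (lineint (G := fun u => f (drop_coord z + w *: drop_coord v + cexp u *: ej) * (cexp u)^-1 ^+ n)) => t.
    apply: cdiff_ccont.
    apply: (@cdiff_fexp R (fun s => f (drop_coord z + w *: drop_coord v + s *: ej)) n).
    exact: entire_line.
  - move=> rho; have [M hM] := eb (cn z + rho * cn v + 1).
    exists (fun=> M); split; first exact: cst_integrable.
    move=> w t hw _; rewrite /phi ncM exprVn_nc /= expR0 expr1n invr1 mulr1.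
    by apply: hM; exact: cnle.
move=> z; have [M hM] := eb (cn z + 1 + 1).
exists 1, (2 * M / 1 ^+ n); split=> // h hh; apply: (acoef_le n _ ltr01).
  exact: entire_line.
move=> s s1; apply: hM; apply: (le_trans (cnD _ _)); apply: lerD.
  apply: (le_trans (cn_drop _)); apply: (le_trans (cnD _ _)); by rewrite lerD2l.
by apply: (le_trans (cnZ _ _)); rewrite s1 mul1r cn_ej.
Qed.

End EntireClosure.

Section GeometricSeries.
Context {R : realType}.
Notation C := R[i].
Implicit Types (c : nat -> C) (B : R).

Lemma geo_tail c B m k : (forall i, nc (c i) <= B * 2^-1 ^+ i) ->
  nc (\sum_(i < k + m) c i - \sum_(i < m) c i) <= 2 * B * (2^-1 ^+ m - 2^-1 ^+ (k + m)).
Proof.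
move=> hc; elim: k => [|k ih]; first by rewrite !subrr nc0 mulr0.
rewrite addSn big_ord_recr /= addrAC; apply: (le_trans (ncD _ _)).
apply: (le_trans (lerD ih (hc _))); rewrite le_eqVlt; apply/orP; left; apply/eqP.
by rewrite exprS; field.
Qed.

Lemma geo_partial c B n : (forall i, nc (c i) <= B * 2^-1 ^+ i) ->
  nc (\sum_(i < n) c i) <= 2 * B.
Proof.
move=> hc; have B0 : 0 <= B.
  by have := hc 0%N; rewrite expr0 mulr1; apply: le_trans; exact: nc_ge0.
have := geo_tail 0 n hc; rewrite addn0 big_ord0 subr0 expr0 => h.
by apply: (le_trans h); rewrite ler_piMr ?mulr_ge0// gerBl exprn_ge0// invr_ge0.
Qed.

Lemma geo_series c B : (forall i, nc (c i) <= B * 2^-1 ^+ i) ->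
  exists l, forall n, nc (\sum_(i < n) c i - l) <= 2 * (2 * B * 2^-1 ^+ n).
Proof.
move=> hc; have B0 : 0 <= B.
  by have := hc 0%N; rewrite expr0 mulr1; apply: le_trans; exact: nc_ge0.
apply: (complex_net 0%N) => m n.
have P (k i : nat) : 0 <= 2 * B * 2^-1 ^+ k :> R.
  by rewrite !mulr_ge0// exprn_ge0// invr_ge0.
have T a b : (a <= b)%N -> nc (\sum_(i < b) c i - \sum_(i < a) c i) <= 2 * B * 2^-1 ^+ a.
  move=> ab; rewrite -(subnK ab); apply: (le_trans (geo_tail _ _ hc)).
  by rewrite mulrBr gerBl P.
have [mn|nm] := leqP m n.
  by rewrite nc_distC; apply: (le_trans (T _ _ mn)); rewrite lerDl P.
by apply: (le_trans (T _ _ (ltnW nm))); rewrite lerDr P.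
Qed.

End GeometricSeries.

(** * Splitting one variable at a time *)

Section SplitVariables.
Context {R : realType} {d : nat}.
Notation C := R[i].
Notation V := 'rV[C]_d.
Variable p : R.
Hypothesis p1 : 1 <= p.
Implicit Types (tau : 'I_d -> option bool) (f : cfun R d).

Definition gfp tau (A : R) (N : nat) (z : V) : R := \prod_(j < d) gf p (tau j) A N (z 0 j).

Lemma gfp_gt0 tau A N z : 0 < gfp tau A N z.
Proof. by apply: prodr_gt0 => j _; exact: gf_gt0. Qed.

Lemma gfp_bounded tau A N rho : 0 <= A -> exists M, forall z, cn z <= rho -> gfp tau A N z <= M.
Proof.
move=> A0; exists (\prod_(j < d) expR (A * rho `^ p) ^+ 2) => z hz.
apply: ler_prod => j _; rewrite ltW ?gf_gt0//=.
apply: (le_trans (gf_weak p (tau j) N (z 0 j) A0)); rewrite /gf /= expr2.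
have zr : nc (z 0 j) <= rho by exact: le_trans (le_cn _ _) hz.
have pp : 0 <= p by exact: le_trans p1.
have E (x : R) : `|x| <= rho -> expR (A * `|x| `^ p) <= expR (A * rho `^ p).
  by move=> xr; rewrite ler_expR ler_wpM2l// powR_mono.
apply: ler_pM; [exact: expR_ge0|exact: expR_ge0| |]; apply: E; apply: le_trans zr;
  [exact: Im_le_nc|exact: Re_le_nc].
Qed.

(** Growth of order [p] in the coordinates labelled None, rapid decay in one direction
of the real axis in the others. *)
Definition dclass tau f := entire f /\ exists2 A, 0 <= A &
  forall N, exists2 K, 0 <= K & forall z, nc (f z) <= K * gfp tau A N z.

Definition relabel tau (j : 'I_d) (s : bool) : 'I_d -> option bool :=
  fun i => if i == j then Some s else tau i.

(** Expand in powers of the j-th variable and split every power by [monomial_split]; the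
Cauchy estimates at the radii [rdn p n] make both series converge. *)
Lemma dclass_split tau j f : tau j = None -> dclass tau f ->
  exists f1 f2, [/\ dclass (relabel tau j true) f1, dclass (relabel tau j false) f2 & f = f1 + f2].
Proof.
move=> tj [ef [A A0 hA]].
have A02 : 0 <= 2 * A by rewrite mulr_ge0.
have [A' [M [A'0 hM1 hM2 hM3]]] := monomial_split p1 A02.
have pp : 0 <= p by exact: le_trans p1.
pose A'' := A + A'.
have AA : A <= A'' by rewrite lerDl.
have AA' : A' <= A'' by rewrite lerDr.
have A''0 : 0 <= A'' by rewrite addr_ge0.
pose rest N (z : V) : R := \prod_(i < d | i != j) gf p (tau i) A N (z 0 i).
have rest0 N z : 0 <= rest N z by apply: prodr_ge0 => i _; exact/ltW/gf_gt0.
(* The Cauchy estimate on the circle of radius rdn p n, on which both exponentials of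
the chosen variable are at most exp (A (n + 1)). *)
have step1 N : exists2 K, 0 <= K & forall n z,
    nc (pcoef j f n z) <= K * rest N z * (expR (2 * A * n.+1%:R) / rdn p n ^+ n).
  have [K K0 hK] := hA N; exists (2 * K) => [|n z]; first by rewrite mulr_ge0.
  have r0 : 0 < rdn p n by exact: rdn_gt0.
  have RG (a b c e : R) : 2 * a * b * (c * e) = 2 * (a * (c * b)) * e by ring.
  rewrite RG.
  apply: (@acoef_le R _ n (rdn p n)) => //; first exact: entire_line.
  move=> s sr; apply: (le_trans (hK _)); apply: (ler_wpM2l K0).
  rewrite /gfp (bigD1 j isT) /= drop_coord_at tj; apply: ler_pM; first exact: (ltW (gf_gt0 _ _ _ _ _)).
  - by apply: prodr_ge0 => i _; exact/ltW/gf_gt0.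
  - rewrite /gf /= -expRD ler_expR.
    have E (x : R) : `|x| <= nc s -> A * `|x| `^ p <= A * n.+1%:R.
      by move=> xs; apply: (ler_wpM2l A0); rewrite -(rdnp p1 n) -sr powR_mono.
    by have := E _ (Im_le_nc s); have := E _ (Re_le_nc s); rewrite -mulrA; lra.
  - rewrite le_eqVlt; apply/orP; left; apply/eqP; apply: eq_bigr => i ij.
    by rewrite drop_coord_off.
pose term s k : cfun R d := fun z => pcoef j f k z * M k s (z 0 j).
have eterm s k : entire (term s k).
  by apply: entireM; [exact: entire_pcoef|exact: entire_coord].
have step2 N : exists2 K, 0 <= K & forall s n z,
    nc (term s n z) <= K * gfp (relabel tau j s) A'' N z * 2^-1 ^+ n.
  have [K K0 hK] := step1 N; have [K' K'0 hK'] := hM3 N.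
  exists (K * K') => [|s n z]; first exact: mulr_ge0.
  rewrite /term ncM; apply: (le_trans (ler_wpM2r (nc_ge0 _) (hK n z))).
  rewrite -[leLHS]mulrA; have KR : 0 <= K * rest N z by rewrite mulr_ge0.
  apply: (le_trans (ler_wpM2l KR (hK' n s _))).
  have RG (a b c e g : R) : a * b * (c * e * g) = a * c * (g * b) * e by ring.
  rewrite RG; apply: ler_wpM2r; first by rewrite exprn_ge0// invr_ge0.
  apply: ler_wpM2l; first exact: mulr_ge0.
  rewrite /gfp (bigD1 j)//= {1}/relabel eqxx; apply: ler_pM; first exact/ltW/gf_gt0.
  - exact: rest0.
  - exact: gf_mono.
  - apply: ler_prod => i ij; rewrite (ltW (gf_gt0 _ _ _ _ _))//= /relabel (negbTE ij).
    exact: gf_mono.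
have [K0 K00 hK0] := step2 0%N.
have /choice[F hF] : forall sz : bool * V, exists l, forall n,
   nc (\sum_(i < n) term sz.1 i sz.2 - l) <= 2 * (2 * (K0 * gfp (relabel tau j sz.1) A'' 0 sz.2) * 2^-1 ^+ n).
  by move=> [s z]; apply: (@geo_series R (fun i => term s i z)) => i; exact: hK0.
have small (a e : R) : 0 <= a -> 0 < e -> exists n, forall m, (n <= m)%N -> 2 * (2 * a * 2^-1 ^+ m) <= e.
  move=> a0 e0; have [n hn] := half_pow_small (2 * (2 * a)) e0; exists n => m nm; apply: le_trans hn.
  rewrite mulrA; apply: ler_wpM2l; first by rewrite !mulr_ge0.
  by apply: ler_wiXn2l => //; rewrite ?invr_ge0// invf_le1// ler1n.
pose f_ s : cfun R d := fun z => F (s, z).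
have lim s z e : 0 < e -> exists n, forall m, (n <= m)%N -> nc (\sum_(i < m) term s i z - f_ s z) <= e.
  move=> e0; have [n hn] := small _ e (mulr_ge0 K00 (ltW (gfp_gt0 (relabel tau j s) A'' 0 z))) e0.
  by exists n => m nm; apply: le_trans (hF (s, z) m) (hn m nm).
have ef_ s : entire (f_ s).
  apply: (@entire_lim R d (fun n z => \sum_(i < n) term s i z)).
  - elim=> [|n ih].
      rewrite (_ : (fun z => _) = 0); first exact: entire0.
      by apply/funext => z; rewrite big_ord0.
    rewrite (_ : (fun z => _) = (fun z => \sum_(i < n) term s i z : C^o) + term s n).
      exact: entireD.
    by apply/funext => z; rewrite big_ord_recr.
  - by move=> z e; exact: lim.
  - move=> rho; have [B hB] := gfp_bounded (relabel tau j s) 0 rho A''0.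
    exists (2 * (K0 * B)) => n z hz; apply: (@geo_partial R (fun i => term s i z) _ n) => i.
    apply: (le_trans (hK0 s i z)); apply: ler_wpM2r; first by rewrite exprn_ge0// invr_ge0.
    by apply: (ler_wpM2l K00); exact: hB.
have bound s : dclass (relabel tau j s) (f_ s).
  split; first exact: ef_.
  exists A'' => // N; have [K K1 hK] := step2 N.
  exists (2 * K) => [|z]; first by rewrite mulr_ge0.
  apply/ler_addgt0Pr => e e0; have [n /(_ n (leqnn n)) hn] := lim s z e e0.
  apply: (le_trans (nc_le_dist _ (\sum_(i < n) term s i z))); rewrite nc_distC; apply: lerD => //.
  rewrite -mulrA; apply: (@geo_partial R (fun i => term s i z) _ n) => i; exact: hK.
exists (f_ true), (f_ false); split; [exact: bound|exact: bound|].
apply/funext => z; apply/eqP; rewrite -subr_eq0 -nc_eq0; apply/eqP/le_anti; rewrite nc_ge0 andbT.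
apply/ler_addgt0Pr => e e0; rewrite add0r.
have e3 : 0 < e / 3 by rewrite divr_gt0.
pose r := 2 * nc (z 0 j) + 1.
have r0 : 0 < r by rewrite ltr_wpDl// mulr_ge0 ?nc_ge0.
have zr : nc (z 0 j) <= r / 2 by rewrite /r; have := nc_ge0 (z 0 j); lra.
have eg : ent1 (fun s : C => f (drop_coord j z + s *: delta_mx 0 j)) by exact: entire_line.
have [B hB] := bound_disc (fun w => cdiff_ccont (eg w)) r.
have B0 : 0 <= B by apply: le_trans (hB 0 _); rewrite ?nc_ge0// nc0 ltW.
have [n1 h1] := lim true z _ e3; have [n2 h2] := lim false z _ e3.
have [n3 h3] := half_pow_small (4 * B) e3.
pose n := maxn n3 (maxn n1 n2).
have k1 := h1 n (leq_trans (leq_maxl _ _) (leq_maxr _ _)).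
have k2 := h2 n (leq_trans (leq_maxr _ _) (leq_maxr _ _)).
have := @taylor R _ (z 0 j) r B n eg r0 zr (fun u u1 => hB u (eq_ind_r (fun x => x <= r) (lexx r) u1)).
rewrite drop_coordK => k3.
have k3' : nc (f z - \sum_(k < n) pcoef j f k z * z 0 j ^+ k) <= e / 3.
  apply: (le_trans k3); apply: le_trans h3; apply: ler_wpM2l; first by rewrite mulr_ge0.
  apply: (@le_trans _ _ (2^-1 ^+ n)).
    apply: lerXn2r; rewrite ?nnegrE ?divr_ge0 ?nc_ge0 ?(ltW r0) ?invr_ge0//.
    by rewrite ler_pdivrMr// mulrC.
  apply: ler_wiXn2l; rewrite ?invr_ge0 ?invf_le1 ?ler1n//; exact: leq_maxl.
have E : \sum_(k < n) pcoef j f k z * z 0 j ^+ k = \sum_(i < n) term true i z + \sum_(i < n) term false i z.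
  rewrite -big_split; apply: eq_bigr => i _ /=; rewrite /term -mulrDr; congr (_ * _).
  by rewrite hM2.
rewrite -[X in X <= _]/(nc (f z - (f_ true z + f_ false z))).
rewrite (_ : _ - _ = (f z - \sum_(k < n) pcoef j f k z * z 0 j ^+ k) +
   ((\sum_(i < n) term true i z - f_ true z) + (\sum_(i < n) term false i z - f_ false z))); last first.
  by rewrite E; ring.
apply: (le_trans (ncD _ _)); apply: (le_trans (lerD k3' (le_trans (ncD _ _) (lerD k1 k2)))).
by rewrite le_eqVlt; apply/orP; left; apply/eqP; field.
Qed.

Lemma dclass_span tau f : dclass tau f ->
  linspan [set g | exists sigma : 'I_d -> bool, dclass (fun j => Some (sigma j)) g] f.
Proof.
move: {2}(#|[pred j | tau j == None]|) (erefl #|[pred j | tau j == None]|) => m.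
elim: m tau f => [|m ih] tau f cm hf.
  apply: sub_linspan; exists (fun j => tau j == Some true).
  have E : tau = (fun j => Some (tau j == Some true)).
    apply/funext => j; have := card0_eq cm j; rewrite inE /=.
    by case: (tau j) => [[]|].
  by rewrite -E.
have /card_gt0P[j] : (0 < #|[pred j | tau j == None]|)%N by rewrite cm.
rewrite inE => /eqP tj; have [f1 [f2 [h1 h2 ->]]] := dclass_split tj hf.
have cs s : #|[pred i | relabel tau j s i == None]| = m.
  move: cm; rewrite (cardD1 j) inE tj eqxx add1n => -[<-]; apply: eq_card => i.
  by rewrite !inE /relabel; case: (i == j).
have [_ L] := linsub_linspan [set g : cfun R d | exists sigma : 'I_d -> bool, dclass (fun j => Some (sigma j)) g].
by have := L 1 f1 f2 (ih _ _ (cs true) h1) (ih _ _ (cs false) h2); rewrite scale1r.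
Qed.

End SplitVariables.

(** * Orthants *)

Section Orthants.
Context {R : realType} {d : nat}.
Notation C := R[i].
Variables (beta : R) (N : 'rV[R]_d -> R).
Hypothesis hb0 : 0 <= beta.
Hypothesis hb1 : beta < 1.
Hypothesis hN : is_norm N.
Local Notation p := ((1 - beta)^-1).

Let p1 : 1 <= p. Proof. exact: p_ge1. Qed.
Let pp : 0 <= p. Proof. exact: le_trans p1. Qed.

Definition orthant (sigma : 'I_d -> bool) : set 'rV[R]_d :=
  [set x | forall j, if sigma j then 0 < x 0 j else x 0 j < 0].

Lemma orthant_open_cone sigma : open_cone (orthant sigma).
Proof.
split; first split.
- exists (\row_j (if sigma j then 1 else -1)) => j; rewrite mxE.
  by case: (sigma j); rewrite ?ltr01// oppr_lt0.
- move=> t x t0 hx j; have := hx j; rewrite mxE.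
  by case: (sigma j) => h; rewrite ?pmulr_rgt0 ?pmulr_rlt0.
- rewrite openE => x hx; rewrite /interior /orthant.
  apply: (@filter_forall _ _ (fun j (y : 'rV[R]_d) => if sigma j then 0 < y 0 j else y 0 j < 0) (nbhs x)) => j; have := hx j; have c := @coord_continuous R 1 d 0 j x.
  case: (sigma j) => h.
    by apply: (c [set u : R | 0 < u]); apply: open_nbhs_nbhs; split; [exact: open_gt|exact: h].
  by apply: (c [set u : R | u < 0]); apply: open_nbhs_nbhs; split; [exact: open_lt|exact: h].
Qed.

(** To reach the orthant, a coordinate with the wrong sign has to be moved at least to
0. *)
Lemma dist_orthant sigma (k B : R) (x : 'rV[R]_d) j : 0 < k -> (forall y, rn y <= k * N y) -> 0 <= B ->
  ~~ decays (Some (sigma j)) (x 0 j) -> B * `|x 0 j| / k <= dist_set N (B *: x) (orthant sigma).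
Proof.
move=> k0 hk B0 hd; apply: (dist_leP hN); first by have [[]] := orthant_open_cone sigma.
move=> xi hxi; rewrite ler_pdivrMr// [leRHS]mulrC; apply: le_trans (hk _).
apply: le_trans (le_rn _ j); rewrite !mxE -[X in X * _ <= _](ger0_norm B0) -normrM.
have := hxi j; move: hd => /=; case: (sigma j) => /=; rewrite -ltNge => h1 h2.
  have h3 : B * x 0 j <= 0 by rewrite mulr_ge0_le0// ltW.
  by rewrite !ler0_norm//; lra.
have h3 : 0 <= B * x 0 j by rewrite mulr_ge0// ltW.
by rewrite !ger0_norm//; lra.
Qed.

Lemma pow_le_expR (m : nat) (t : R) : 0 <= t -> (1 + t) ^+ m <= m.+1%:R ^+ m * expR t.
Proof.
move=> t0; have m0 : 0 < m.+1%:R :> R by rewrite ltr0n.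
have h : 1 + t <= m.+1%:R * expR (t / m.+1%:R).
  apply: (@le_trans _ _ (m.+1%:R * (1 + t / m.+1%:R))).
    by rewrite mulrDr mulr1 mulrC divfK ?gt_eqF// lerD2r ler1n.
  by rewrite ler_pM2l// expR_ge1Dx.
apply: (@le_trans _ _ ((m.+1%:R * expR (t / m.+1%:R)) ^+ m)).
  by apply: lerXn2r; rewrite ?nnegrE ?addr_ge0// mulr_ge0 ?expR_ge0.
rewrite exprMn ler_pM2l ?exprn_gt0// -expRM_natl ler_expR mulrCA ler_piMr//.
by rewrite ler_pdivrMr// mul1r ler_nat.
Qed.

(** In one coordinate, the weight of an orthant with a large scale dominates the square
of the growth of a function of the class attached to that orthant. *)
Lemma coord_bound (A : R) (n : nat) (s : bool) : 0 <= A -> exists2 K, 0 <= K & forall w : C,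
  gf p (Some s) A n.+1 w ^+ 2 * (1 + `|Re w|) ^+ (2 * n) *
  expR (- (2 * (A + 1) * ((if decays (Some s) (Re w) then 0 else `|Re w|) `^ p + `|Im w| `^ p))) <=
  K * (idec (Re w) * idec (Im w)).
Proof.
move=> A0; pose m := (2 * n)%N.
have e0 (t : R) := expR_ge0 t.
have E2 (t : R) : 0 <= t -> expR (- (2 * t `^ p)) <= expR 2 * expR (- (2 * t)).
  by move=> t0; rewrite -expRD ler_expR; have := powR_ge_lin p1 t0; lra.
have two0 : 0 < 2 :> R by [].
pose K1 : R := expR 2 * (1 + 4 / 2 ^+ 2).
pose K2 : R := expR 2 * m.+1%:R ^+ m * (1 + 4 / 1 ^+ 2).
have K10 : 0 <= K1 by rewrite mulr_ge0// addr_ge0// divr_ge0// exprn_ge0.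
have K20 : 0 <= K2 by rewrite !mulr_ge0 ?exprn_ge0// addr_ge0// divr_ge0// exprn_ge0.
exists ((1 + K2) * K1) => [|w]; first by rewrite mulr_ge0// addr_ge0.
set x := Re w; set y := Im w.
have y1 : expR (A * `|y| `^ p) ^+ 2 * expR (- (2 * (A + 1) * `|y| `^ p)) <= K1 * idec y.
  rewrite -expRM_natl -expRD (_ : _ + _ = - (2 * `|y| `^ p)); last by ring.
  apply: (le_trans (E2 _ (normr_ge0 y))); rewrite /K1 -mulrA; apply: (ler_wpM2l (e0 2)).
  exact: exp_idec.
pose v := if decays (Some s) x then 0 else `|x|.
pose g := if decays (Some s) x then ((1 + `|x|) ^+ n.+1)^-1 else expR (A * `|x| `^ p).
have x1 : g ^+ 2 * (1 + `|x|) ^+ m * expR (- (2 * (A + 1) * v `^ p)) <= (1 + K2) * idec x.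
  have i0 := ltW (idec_gt0 x).
  rewrite /g /v; case: ifP => _.
    rewrite powR0 ?gt_eqF ?(lt_le_trans ltr01 p1)// mulr0 oppr0 expR0 mulr1.
    apply: (@le_trans _ _ (idec x)); last by rewrite ler_peMl// lerDl.
    have a0 : 0 < 1 + `|x| by rewrite ltr_pwDl.
    rewrite exprVn -exprM mulrC (_ : (n.+1 * 2 = m + 2)%N); last by rewrite /m; ring.
    rewrite exprD invfM mulrA divff ?expf_neq0 ?gt_eqF// mul1r.
    rewrite /idec lef_pV2 ?posrE ?exprn_gt0//; last by rewrite ltr_pwDl// sqr_ge0.
    rewrite -[X in _ + X <= _](real_normK (num_real x)) sqrrD expr1n.
    have := normr_ge0 x; rewrite !mul1r; move: `|x| => a; rewrite mulr2n; lra.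
  rewrite -expRM_natl mulrAC -expRD (_ : _ + _ = - (2 * `|x| `^ p)); last by ring.
  apply: (@le_trans _ _ (K2 * idec x)); last by apply: (ler_wpM2r i0); rewrite lerDr.
  have h1 := pow_le_expR m (normr_ge0 x).
  apply: (le_trans (ler_pM (e0 _) (exprn_ge0 _ (addr_ge0 ler01 (normr_ge0 x))) (E2 _ (normr_ge0 x)) h1)).
  have h2 : expR (- (2 * `|x|)) * expR `|x| <= (1 + 4 / 1 ^+ 2) * idec x.
    by rewrite -expRD (_ : _ + _ = - (1 * `|x|)); [exact: exp_idec|ring].
  have RG (a b c e : R) : a * b * (c * e) = a * c * (b * e) by ring.
  rewrite RG /K2 -[leRHS]mulrA; apply: ler_wpM2l h2; by rewrite mulr_ge0// exprn_ge0.
rewrite /gf -/x -/y -/g -/v exprMn mulrDr opprD expRD.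
have RG (a b c e f : R) : a * b * c * (e * f) = (b * c * e) * (a * f) by ring.
have RH (a b c e : R) : a * b * (c * e) = (a * c) * (b * e) by ring.
have g0 : 0 <= g by rewrite /g; case: ifP => _; rewrite ?invr_ge0 ?exprn_ge0 ?addr_ge0.
rewrite [leLHS]RG [leRHS]RH; apply: ler_pM x1 y1; last by rewrite mulr_ge0 ?exprn_ge0.
by rewrite mulr_ge0// mulr_ge0 ?exprn_ge0 ?addr_ge0.
Qed.

Lemma sum_powR_le (A k B T : R) (v : 'I_d -> R) : 0 <= A -> 0 < k -> 0 <= T ->
  k * ((A + 1) * d.+1%:R) < B ->
  (forall j, 0 <= v j) -> (forall j, B * v j / k <= T) -> (A + 1) * \sum_j v j `^ p <= T `^ p.
Proof.
move=> A0 k0 T0 bB v0 hv.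
have d0 : 0 < d.+1%:R :> R by rewrite ltr0n.
have q1 : 1 <= (A + 1) * d.+1%:R.
  by rewrite mulr_ege1// ?ler1n// lerDr.
have q2 : (A + 1) * d.+1%:R <= B / k by rewrite ler_pdivlMr// mulrC ltW.
have q3 : (A + 1) * d.+1%:R <= (B / k) `^ p.
  apply: (le_trans q2); have q4 : 1 <= B / k by exact: le_trans q2.
  by rewrite -{1}(powRr1 (le_trans ler01 q4)) ler_powR.
have h j : (A + 1) * d.+1%:R * v j `^ p <= T `^ p.
  apply: (@le_trans _ _ ((B / k) `^ p * v j `^ p)).
    by apply: ler_wpM2r q3; exact: powR_ge0.
  have Bk : 0 <= B / k by apply: le_trans q2; exact: le_trans q1.
  rewrite -powRM//; apply: powR_mono => //; first by rewrite mulr_ge0.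
  by rewrite mulrAC.
rewrite -(ler_pM2l d0) mulrA (mulrC d.+1%:R) mulr_sumr.
apply: (@le_trans _ _ (\sum_(j < d) T `^ p)); first by apply: ler_sum => j _; exact: h.
rewrite sumr_const card_ord -[leLHS]mulr_natl; apply: ler_wpM2r; first exact: powR_ge0.
by rewrite ler_nat.
Qed.

(** Where the function decays no help is needed from the weight; where it grows, the
point is far from the orthant and a large scale pays for the growth. *)
Lemma dclass_orthant sigma (f : cfun R d) : dclass p (fun j => Some (sigma j)) f ->
  exists2 b, 0 < b & Sb beta N (orthant sigma) b f.
Proof.
move=> [ef [A A0 hA]]; have [k k0 hk] := N_lower hN.
have b0 : 0 < k * ((A + 1) * d.+1%:R) by rewrite mulr_gt0// mulr_gt0 ?ltr0n// ltr_wpDl.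
(* The largest coordinate with the wrong sign only controls the sum of their powers up
to the number of coordinates, hence the factor d + 1. *)
exists (k * ((A + 1) * d.+1%:R)) => // B n bB.
have B0 : 0 < B by exact: lt_trans bB.
have [K K0 hK] := hA n.+1.
have /choice[c hc] : forall j, exists c, 0 <= c /\ forall w : C,
    gf p (Some (sigma j)) A n.+1 w ^+ 2 * (1 + `|Re w|) ^+ (2 * n) *
    expR (- (2 * (A + 1) * ((if decays (Some (sigma j)) (Re w) then 0 else `|Re w|) `^ p + `|Im w| `^ p))) <=
    c * (idec (Re w) * idec (Im w)).
  by move=> j; have [c c0 h] := coord_bound n (sigma j) A0; exists c.
have cU := (orthant_open_cone sigma).1.
have M0 : 0 <= K ^+ 2 * \prod_j c j.
  by apply: mulr_ge0; [exact: sqr_ge0|apply: prodr_ge0 => j _; exact: (hc j).1].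
apply: (HE_dens (d := d) hN cU ef M0 _).1 => t.
pose z := pt t; pose v j := if decays (Some (sigma j)) (Re (z 0 j)) then 0 else `|Re (z 0 j)|.
have zr j : Re (z 0 j) = real_point t.1 0 j by rewrite ptE mxE.
have zi j : Im (z 0 j) = real_point t.2 0 j by rewrite ptE mxE.
have v0 j : 0 <= v j by rewrite /v; case: ifP.
have U0 : orthant sigma !=set0 by case: cU.
have S1 : (A + 1) * \sum_j v j `^ p <= dist_set N (B *: real_point t.1) (orthant sigma) `^ p.
  apply: (sum_powR_le A0 k0 _ bB v0); first exact: dist_ge0.
  move=> j; rewrite /v; case: ifPn => h.
    by rewrite mulr0 mul0r; exact: dist_ge0.
  by rewrite zr; apply: (dist_orthant k0 hk (ltW B0)); rewrite -zr.
have S2 : (A + 1) * \sum_j `|Im (z 0 j)| `^ p <= N (B *: real_point t.2) `^ p.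
  apply: (sum_powR_le A0 k0 _ bB _); first exact: N_ge0.
    by move=> j; exact: normr_ge0.
  move=> j; rewrite ler_pdivrMr// (NZ_pos hN _ (ltW B0)) -mulrA; apply: (ler_wpM2l (ltW B0)).
  by rewrite mulrC zi; apply: le_trans (hk _); exact: le_rn.
rewrite wtE; set E := expR _.
have hE : E <= \prod_(j < d) expR (- (2 * (A + 1) * (v j `^ p + `|Im (z 0 j)| `^ p))).
  rewrite -expR_sum ler_expR sumrN -mulr_sumr big_split /= mulNr -opprD lerN2.
  rewrite -!mulrA -mulrDr ler_pM2l// mulrDr.
  exact: lerD S1 S2.
have hf : nc (f z) ^+ 2 <= K ^+ 2 * \prod_(j < d) gf p (Some (sigma j)) A n.+1 (z 0 j) ^+ 2.
  rewrite prodrXl -exprMn; apply: sqr_le; [exact: nc_ge0|exact: hK].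
have py0 : 0 <= polyw n t by exact/ltW/polyw_gt0.
have hpE : polyw n t * E <= polyw n t * \prod_(j < d) expR (- (2 * (A + 1) * (v j `^ p + `|Im (z 0 j)| `^ p))).
  exact: ler_wpM2l.
have E0 : 0 <= polyw n t * E by rewrite mulr_ge0// expR_ge0.
apply: (le_trans (ler_pM (sqr_ge0 _) E0 hf hpE)).
rewrite -[leLHS]mulrA -[leRHS]mulrA; apply: (ler_wpM2l (sqr_ge0 K)).
rewrite /polyw /pdec /tdec -!big_split /=; apply: ler_prod => j _; apply/andP; split.
  by rewrite mulr_ge0 ?sqr_ge0// mulr_ge0 ?expR_ge0// exprn_ge0// addr_ge0.
have h := (hc j).2 (z 0 j); rewrite [leLHS]mulrA.
by move: h; rewrite /v /z ptE /=; exact.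
Qed.

Lemma Sb0_dclass b (f : cfun R d) : 0 < b -> Sb beta N [set 0] b f -> dclass p (fun=> None) f.
Proof.
move=> b0 hf; have b1 : b < b + 1 by rewrite ltrDl.
have b2 : b + 1 < b + 2 by rewrite ltrD2l ltr1n.
have b10 : 0 < b + 1 by exact: lt_trans b1.
have B0 : 0 < b + 2 by exact: lt_trans b2.
split; first exact: Sb_entire hf.
have [k k0 hk] := N_upper hN.
have [K K0 hK] := H_point hb0 hb1 hN b10 b2 (leqnn 1).
have c0 : cone ([set 0] : set 'rV[R]_d).
  by split; [exists 0|move=> t x _ ->; rewrite scaler0].
set B := b + 2 in b2 B0 hK.
exists ((B * k) `^ p); first exact: powR_ge0.
pose Q := K * Hnorm beta N [set 0] (b + 1) 1 f ^+ 2 + 1.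
have Q1 : 1 <= Q by rewrite lerDr mulr_ge0 ?sqr_ge0// ltW.
have Q0 : 0 <= Q by exact: le_trans Q1.
move=> n; exists Q => // z.
rewrite -(unptK z); set t := unpt z.
have h := hK [set 0] f t c0 (hf _ 1%N b1).
have S (x : 'rV[R]_d) : N (B *: x) `^ p <= (B * k) `^ p * \sum_j `|x 0 j| `^ p.
  have s0 : 0 <= \sum_j `|x 0 j| `^ p by apply: sumr_ge0 => j _; exact: powR_ge0.
  have r1 : rn x <= (\sum_j `|x 0 j| `^ p) `^ p^-1.
    apply: rn_leP => [|j]; first exact: powR_ge0.
    have E : `|x 0 j| = (`|x 0 j| `^ p) `^ p^-1.
      by rewrite -powRrM mulfV ?gt_eqF ?(lt_le_trans ltr01 p1)// powRr1.
    rewrite E; apply: powR_mono; [by rewrite invr_ge0; exact: pp|exact: powR_ge0|].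
    by rewrite (bigD1 j)//= lerDl sumr_ge0// => i _; exact: powR_ge0.
  have r2 : rn x `^ p <= \sum_j `|x 0 j| `^ p.
    apply: (le_trans (powR_mono pp (rn_ge0 x) r1)).
    by rewrite -powRrM mulVf ?gt_eqF ?(lt_le_trans ltr01 p1)// powRr1.
  apply: (@le_trans _ _ ((B * k * rn x) `^ p)).
    apply: powR_mono => //; first exact: N_ge0.
    by rewrite (NZ_pos hN _ (ltW B0)) -mulrA; apply: (ler_wpM2l (ltW B0)).
  rewrite powRM ?mulr_ge0 ?rn_ge0 ?(ltW B0) ?(ltW k0)//.
  by apply: ler_wpM2l r2; exact: powR_ge0.
have G : gfp p (fun=> None) ((B * k) `^ p) n (pt t) =
    expR ((B * k) `^ p * \sum_j `|real_point t.1 0 j| `^ p + (B * k) `^ p * \sum_j `|real_point t.2 0 j| `^ p).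
  rewrite -mulrDr -big_split mulr_sumr expR_sum; apply: eq_bigr => j _.
  rewrite /gf /= -expRD -mulrDr addrC ptE; congr (expR (_ * _)).
  by rewrite !mxE.
rewrite G; apply: le_sqr; first by rewrite mulr_ge0// expR_ge0.
have W0 : 0 < expR (- 2 * N (B *: real_point t.1) `^ p - 2 * N (B *: real_point t.2) `^ p) by exact: expR_gt0.
have h2 : nc (f (pt t)) ^+ 2 * expR (- 2 * N (B *: real_point t.1) `^ p - 2 * N (B *: real_point t.2) `^ p) <= Q.
  apply: (@le_trans _ _ (nc (f (pt t)) ^+ 2 * wt beta N [set 0] B 0 t)).
    apply: (ler_wpM2l (sqr_ge0 _)); rewrite wtE (dist0 hN) -[leLHS]mul1r.
    by apply: ler_wpM2r (polyw_ge1 _ _); exact: ltW.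
  apply: (le_trans h); rewrite /Q; apply: (@le_trans _ _ (K * Hnorm beta N [set 0] (b + 1) 1 f ^+ 2)).
    rewrite ler_piMr// ?pdec_le1// mulr_ge0 ?sqr_ge0//; exact: ltW.
  by rewrite lerDl.
rewrite -ler_pdivlMr// in h2; apply: (le_trans h2); rewrite exprMn.
apply: ler_pM; rewrite ?invr_ge0 ?(ltW W0)//.
  by rewrite expr2 ler_peMl.
rewrite -expRN -expRM_natl ler_expR.
have := S (real_point t.1); have := S (real_point t.2).
move: (_ * \sum_j _) (_ * \sum_j _) (N _ `^ p) (N _ `^ p) => *; lra.
Qed.

(** Every coordinate is eventually given a sign, and each choice of signs is an
orthant. *)
Theorem splits_norm : splits beta N.
Proof.
move=> b f b0 hf; have := dclass_span p1 (Sb0_dclass b0 hf).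
case=> m [a [g [hg ->]]].
exists m, a, g; split=> // i; have [sigma hs] := hg i.
exists (orthant sigma); split; first exact: orthant_open_cone.
by apply/car_Sopen; have [b' b'0 h] := dclass_orthant hs; exists b'.
Qed.

End Orthants.

(** * The kernel theorem *)

Theorem theorem7 (R : realType) (beta : R) (hbeta0 : 0 <= beta)
    (hbeta1 : beta < 1) (d1 d2 : nat)
    (N1 : 'rV[R]_d1 -> R) (N2 : 'rV[R]_d2 -> R) (N12 : 'rV[R]_(d1 + d2) -> R)
    (hN1 : is_norm N1) (hN2 : is_norm N2) (hN12 : is_norm N12)
    (K1 : set 'rV[R]_d1) (K2 : set 'rV[R]_d2)
    (hK1 : closed_cone K1) (hK2 : closed_cone K2)
    (w : cfun R d1 -> cfun R d2 -> R[i])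
    (hw : bilinear_on (car (Scone beta N1 K1)) (car (Scone beta N2 K2)) w)
    (hwc : separately_continuous (Scone beta N1 K1) (Scone beta N2 K2) w) :
  let S := Sconepair beta N12 K1 K2 in
  let represents (v : cfun R (d1 + d2) -> R[i]) :=
    [/\ linear_on (car S) v, continuous_on S v &
        forall f g, car (Scone beta N1 K1) f -> car (Scone beta N2 K2) g ->
          car S (tensor f g) /\ w f g = v (tensor f g)] in
  exists2 v, represents v &
    forall v', represents v' -> forall h, car S h -> v' h = v h.
Proof.
have [kap [kap1 hkap]] := wt_product hbeta0 hbeta1 hN1 hN2 hN12.
exists (glued beta N1 N2 N12 kap K1 K2 w).
  split.
  - exact: (glued_linear hbeta0 hbeta1 hN1 hN2 hN12 kap1 hkap hK1 hK2 hw hwc).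
  - exact: (glued_continuous hbeta0 hbeta1 hN1 hN2 hN12 kap1 hkap hK1 hK2 hw hwc).
  - move=> f g hf hg; split.
      exact: (tensor_in_pair hbeta0 hbeta1 hN1 hN2 hN12 kap1 hkap
        (splits_norm hbeta0 hbeta1 hN1) (splits_norm hbeta0 hbeta1 hN2) hf hg).
    exact/esym/(glued_tensor hbeta0 hbeta1 hN1 hN2 hN12 kap1 hkap hK1 hK2 hw hwc hf hg).
move=> v' [lv cv tv] h hh.
apply: (glued_unique hbeta0 hbeta1 hN1 hN2 hN12 kap1 hkap hK1 hK2 hw hwc lv cv _ hh).
by move=> f g hf hg; have [] := tv f g hf hg.
Qed.
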